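(* Let $G$ be a $2$-connected partial $3$-tree. Then $\mathrm{lct}(G)=1$; that is, there is a vertex of $G$ that belongs to every longest cycle of $G$.
   Context: All graphs are finite and simple. A longest cycle of $G$ is a cycle of maximum length in $G$. $\mathrm{lct}(G)$ (the longest cycle transversal number) is the minimum size of a set of vertices of $G$ that meets every longest cycle of $G$. A $3$-tree is defined recursively: the complete graph $K_3$ is a $3$-tree, and any graph obtained from a $3$-tree by adding a new vertex adjacent to exactly the three vertices of an existing triangle is a $3$-tree. A partial $3$-tree is a subgraph of a $3$-tree; equivalently, a graph of treewidth at most $3$. *)

(* Defs.v *)
From mathcomp Require Import all_boot boolp.
Set Implicit Arguments.
Unset Strict Implicit.
Unset Printing Implicit Defensive.

Definition simple_graph (T : finType) (e : rel T) : Prop :=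
  symmetric e /\ irreflexive e.

Definition connected_off (T : finType) (e : rel T) (X : {set T}) : Prop :=
  forall x y : T, x \notin X -> y \notin X ->
    connect [rel u v | [&& u \notin X, v \notin X & e u v]] x y.

Definition k_connected (k : nat) (T : finType) (e : rel T) : Prop :=
  k < #|T| /\ forall X : {set T}, #|X| < k -> connected_off e X.

Definition triangle (T : finType) (e : rel T) (B : {set T}) : Prop :=
  #|B| = 3 /\ {in B &, forall x y, x != y -> e x y}.

(* [three_tree_on e A]: the subgraph of [e] induced on [A] is a 3-tree.
   Building up inside a fixed ambient graph avoids quotienting by isomorphism. *)
Inductive three_tree_on (T : finType) (e : rel T) : {set T} -> Prop :=
| three_tree_K3 (A : {set T}) : triangle e A -> three_tree_on e A
| three_tree_add (A B : {set T}) (v : T) :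
    three_tree_on e A -> v \notin A ->
    B \subset A -> triangle e B -> [set u in A | e v u] = B ->
    three_tree_on e (v |: A).

Definition three_tree (T : finType) (e : rel T) : Prop :=
  simple_graph e /\ three_tree_on e [set: T].

(* Up to isomorphism, [e] is a (not necessarily induced or spanning) subgraph
   of a 3-tree. *)
Definition partial_three_tree (T : finType) (e : rel T) : Prop :=
  exists (U : finType) (r : rel U) (f : T -> U),
    [/\ three_tree r, injective f & forall x y, e x y -> r (f x) (f y)].

(* A cycle is given by the cyclic sequence of its vertices. Without the bound
   on the size, [ucycle] would also accept the empty sequence and, for a
   symmetric relation, every edge. *)
Definition graph_cycle (T : finType) (e : rel T) (c : seq T) : Prop :=
  2 < size c /\ ucycle e c.

Definition longest_cycle (T : finType) (e : rel T) (c : seq T) : Prop :=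
  graph_cycle e c /\ forall d : seq T, graph_cycle e d -> size d <= size c.

Definition longest_cycle_transversal (T : finType) (e : rel T) (S : {set T}) :
    Prop :=
  forall c : seq T, longest_cycle e c -> exists2 x, x \in S & x \in c.

(* [arg min] is meaningful because the whole vertex set is a transversal. *)
Definition lct (T : finType) (e : rel T) : nat :=
  #|[arg min_(S < [set: T] | `[< longest_cycle_transversal e S >]) #|S|]|.

(* Main.v *)
(* Suppose that no vertex lies on all longest cycles, and let L be their length.
   (1) In a 2-connected graph two longest cycles share at least two vertices.
   (2) By rerouting along the longer arcs of the cycles, a set of at most three
   vertices never separates two longest cycles.
   (3) Removing the vertices of the 3-tree one by one, in the order opposite to its
   construction, until for the first time every longest cycle meets the component of the
   removed vertex v, gives a bag of four vertices such that every component outside the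
   bag misses a vertex of the bag, no longest cycle lives in the bag and a single
   component, and a component adjacent to v is avoided by some longest cycle.
   (4) The bag cuts a longest cycle into segments. Two segments in different
   components are disjoint, and two segments that intersect can be rerouted at their
   first intersection. Recombining the segments of three or four longest cycles missing
   prescribed bag vertices gives cycles whose lengths sum up to a contradiction, unless
   there are two components meeting all the chosen cycles. One of these is avoided by a
   further longest cycle, and recombining with its segments gives a contradiction too.
   The finitely many configurations are settled by certificates run through a checker
   proved sound. *)
Require Import Defs.
From mathcomp Require Import all_boot boolp zify.
Set Implicit Arguments.
Unset Strict Implicit.
Unset Printing Implicit Defensive.

(** All length arguments about segments share one shape. A recombined cycle has length at most [L].
    If the recombined cycles use each segment of the [no] chosen longest cycles [k] times and number
    at most [k * no], then all these bounds are equalities, so a single left-over piece, or one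
    cycle fewer, is absurd. The obstacle is disjointness: inside one component two segments may
    cross in any manner, and only the first vertex of one on the other is under control. Hence the
    branching on which pairs meet. Two segments that meet lie in one component, and each component
    misses a bag vertex and contains no longest cycle; this limits the patterns of meetings. The
    patterns that survive have two components used by all chosen cycles. Here the choice of the bag
    matters: if both were met by every longest cycle, neither would be adjacent to [v], which is
    impossible; so one is avoided by a further longest cycle, whose segments are then disjoint from
    those in it. The bound three in (2) comes from the 3-tree, where a component cut off during the
    removal hangs on a triangle. *)

Section Chains.
Variables (U : eqType) (e : rel U).

(** Only the inner vertices are listed, so an edge has empty [m] and the number of edges is
    [(size m).+1], the form in which lengths are counted throughout. The ends may coincide;
    [conn x m x] is by computation [cycle e (x :: m)]. *)
Definition conn (x : U) (m : seq U) (y : U) := path e x (rcons m y).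

Lemma conn_cat x m1 z m2 y :
  conn x (m1 ++ z :: m2) y = conn x m1 z && conn z m2 y.
Proof. by rewrite /conn rcons_cat -cat_rcons cat_path last_rcons. Qed.

Lemma conn_rev x m y : symmetric e -> conn x m y -> conn y (rev m) x.
Proof.
move=> es; rewrite /conn -rev_cons -[X in rev X](belast_rcons x m y).
rewrite -{2}(last_rcons x m y) rev_path.
by rewrite (@eq_path _ _ e) // => u v; rewrite es.
Qed.

Definition glue (ch : seq (U * seq U)) := flatten [seq c.1 :: c.2 | c <- ch].

(** A chain is a list of vertices, each with the inner vertices leading to the next one; [z] is
    where the last link ends. Taking for [z] the first vertex of the chain closes it, as in
    [links_cycle]. *)
Fixpoint links (z : U) (ch : seq (U * seq U)) :=
  if ch is c :: ch' then conn c.1 c.2 (head z (unzip1 ch')) && links z ch'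
  else true.

Lemma links_path x z ch :
  path e x (rcons (glue ch) z) = e x (head z (unzip1 ch)) && links z ch.
Proof.
elim: ch x => [|[y m] ch IH] x //=.
rewrite rcons_cat cat_path IH /conn rcons_path.
by case: (e _ _); rewrite //= ?andbA.
Qed.

Lemma links_cycle x m ch :
  cycle e (glue ((x, m) :: ch)) = links x ((x, m) :: ch).
Proof.
by rewrite /= rcons_cat cat_path links_path /conn rcons_path andbA.
Qed.

End Chains.

(* [Sg a] is the whole segment [a]. When [a] and [b] meet, share exactly one end and
   [x] is the first vertex of [b] on the way along [a] towards that end, [Xg a b] and
   [Kg a b] follow [a] up to [x] and then [b], to its other end and to the common end
   respectively. *)
Inductive piece := Sg of nat | Xg of nat & nat | Kg of nat & nat.

(* A refutation tree: [Br a b] branches on whether the segments [a] and [b] meet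
   (first subtree: they do not); [Cl a] closes a branch in which the component of [a]
   touches the whole bag or contains a whole cycle; [Tg i] reaches the [i]-th target;
   [Lp k rows] closes a branch by a linear combination of the inequalities saying
   that the cycles [rows] have length at most [L]. *)
Inductive cert :=
| Br of nat & nat & cert & cert
| Cl of nat
| Tg of nat
| Lp of nat & seq (nat * seq piece).

(* Pairs of segments known to be disjoint, to intersect, to lie in one component. *)
Record facts := Facts {
  apart : seq (nat * nat); meeting : seq (nat * nat); together : seq (nat * nat) }.

Definition listed (l : seq (nat * nat)) a b := ((a, b) \in l) || ((b, a) \in l).

(** * The checker, on segments known only by their end labels and their cycle *)

Section Checker.
Variable sgs : seq (nat * nat * nat).
Let n := size sgs.

Definition su a := (nth (0, 0, 0) sgs a).1.1.
Definition sv a := (nth (0, 0, 0) sgs a).1.2.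
Definition so a := (nth (0, 0, 0) sgs a).2.
Definition ends a := [:: su a; sv a].
Definition com a b := if su a \in ends b then su a else sv a.
Definition far a b := if su a \in ends b then sv a else su a.

Definition pends p :=
  match p with
  | Sg a => (su a, sv a)
  | Xg a b => (far a b, far b a)
  | Kg a b => (far a b, com a b)
  end.

Definition base p := match p with Sg a => [:: a] | Xg a b | Kg a b => [:: a; b] end.

(** [com] and [far] make sense only when exactly one end is shared. The test on [far a b] excludes
    two shared ends, and the agreement of [com a b] with [com b a] excludes that there is none. *)
Definition hitok (st : facts) a b :=
  [&& a < n, b < n, listed (meeting st) a b, far a b \notin ends b &
      com a b == com b a].

Definition pok st p :=
  match p with Sg a => a < n | Xg a b | Kg a b => hitok st a b end.

Definition grow (l : seq (nat * nat)) (s : seq nat) :=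
  undup (s ++ flatten [seq (if p.1 \in s then [:: p.2] else [::]) ++
                           (if p.2 \in s then [:: p.1] else [::]) | p <- l]).

(** Eight rounds are enough for the certificates below. Soundness holds for any number of rounds,
    since a round only adds segments of the same component. *)
Definition cls st a := iter 8 (grow (meeting st ++ together st)) [:: a].

(** Segments of one component never reach all four labels, because a component misses a bag vertex;
    so this test refutes that the segments of [s] lie together. *)
Definition spans (s : seq nat) := size (undup (flatten (map ends s))) == 4.

(* [spans]: were the two segments to meet, one component would touch the whole bag. *)
Definition isD st a b :=
  if a == b then false else if so a == so b then true else
  if listed (apart st) a b then true else spans (cls st a ++ cls st b).

Definition step x p := if x == (pends p).1 then (pends p).2 else (pends p).1.

Fixpoint follows x row :=
  if row is p :: row' then
    (x \in [:: (pends p).1; (pends p).2]) && follows (step x p) row'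
  else true.

Fixpoint stops x row :=
  if row is p :: row' then x :: stops (step x p) row' else [::].

(** A row is a closed walk whose pieces may be traversed in either direction, so its first label
    determines it. The stops are the bag vertices on the future cycle and must therefore be
    distinct. *)
Definition closed_from row x :=
  [&& follows x row, foldl step x row == x, uniq (stops x row) &
      all (gtn 4) (stops x row)].

(** Disjointness is demanded of the whole segments from which the pieces are cut, not only of the
    pieces: coarser, but it can be read off the recorded facts. *)
Definition rowok st row :=
  [&& 0 < size row, all (pok st) row,
      pairwise (fun p q => all (fun a => all (isD st a) (base q)) (base p)) row &
      has (closed_from row) (iota 0 4)].

(* Lengths occurring in a row: code 0 is the length of a segment; when [a] meets
   [b] and [x] is the first vertex of [b] met on the way along [a] towards the
   common end, codes 1, 2, 3 are the lengths of the part of [a] before [x] and of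
   the parts of [b] from [x] to the common end and to the other end. *)
Definition lens p :=
  match p with
  | Sg a => [:: (0, a, a)]
  | Xg a b => [:: (1, a, b); (3, a, b)]
  | Kg a b => [:: (1, a, b); (2, a, b)]
  end.

Fixpoint submset (s1 s2 : seq (nat * nat * nat)) :=
  if s1 is x :: s1' then (x \in s2) && submset s1' (rem x s2) else true.

(** The lengths of codes 2 and 3 for one pair [a], [b] add up to the whole length of [b]. Every
    possible such pairing is counted, each to be traded for [b] in [lpok]. *)
Definition joins (s : seq (nat * nat * nat)) :=
  flatten [seq (let: (k, a, b) := v in
    if k == 3 then
      nseq (minn (count_mem v s) (count_mem (2, a, b) s)) (a, b)
    else [::]) | v <- undup s].

(** The multiset [s] collects the lengths of all rows. Adding the joined parts to one side and the
    corresponding whole segments to the other leaves the comparison of totals unchanged, and then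
    turns [s1] inside [s2] into: the rows contain [k] copies of every segment, of total
    [k * no * L]. As at most [k * no] rows of length at most [L] are used, a spare positive length
    or a spare row is a contradiction. *)
Definition lpok st no k (rows : seq (nat * seq piece)) :=
  let s := flatten [seq flatten (nseq r.1 (flatten (map lens r.2))) | r <- rows] in
  let j := joins s in
  let s1 := flatten (nseq k [seq (0, a, a) | a <- iota 0 n]) ++
            flatten [seq [:: (2, ab.1, ab.2); (3, ab.1, ab.2)] | ab <- j] in
  let s2 := s ++ [seq (0, ab.2, ab.2) | ab <- j] in
  [&& all (fun r => rowok st r.2) rows, submset s1 s2,
      sumn (map fst rows) <= k * no &
      (size s1 < size s2) || (sumn (map fst rows) < k * no)].

Definition add_apart st a b := Facts ((a, b) :: apart st) (meeting st) (together st).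
Definition add_meeting st a b := Facts (apart st) ((a, b) :: meeting st) (together st).

Definition single st s := let s' := cls st (head 0 s) in all (mem s') s.

Fixpoint check no (targets : seq (seq (seq nat))) st t :=
  match t with
  | Br a b t1 t2 =>
      [&& a < n, b < n, check no targets (add_apart st a b) t1 &
          check no targets (add_meeting st a b) t2]
  | Cl a =>
      let s := cls st a in
      (a < n) && (spans s || all (fun c => (so c == so a) ==> (c \in s)) (iota 0 n))
  | Tg i => (i < size targets) &&
      all (fun s => all (gtn n) s && single st s) (nth [::] targets i)
  | Lp k rows => lpok st no k rows
  end.

Arguments cls : simpl never.
Arguments spans : simpl never.
Arguments single : simpl never.
Arguments lpok : simpl never.

(** * Soundness of the checker for actual paths in a graph *)

Section Soundness.
Variables (U K : eqType) (e : rel U) (vb : nat -> U) (mi : nat -> seq U).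
(** Components enter only through the labels [kap], so that a segment without inner vertices, which
    lies in no component, can be labelled as well. *)
Variables (kap : nat -> K) (L no : nat).
Hypothesis e_sym : symmetric e.
Hypothesis vb_inj : {in gtn 4 &, injective vb}.
Hypothesis seg_lab : forall a, a < n -> [/\ su a < 4, sv a < 4 & su a != sv a].
Hypothesis seg_conn : forall a, a < n -> conn e (vb (su a)) (mi a) (vb (sv a)).
Hypothesis seg_uniq : forall a, a < n -> uniq (mi a).
Hypothesis seg_off : forall a i, a < n -> i < 4 -> vb i \notin mi a.
Hypothesis seg_own : forall a c, a < n -> c < n -> a != c -> so a = so c ->
  ~~ has (mem (mi a)) (mi c).
Hypothesis kap_meet : forall a c, a < n -> c < n -> has (mem (mi a)) (mi c) ->
  kap a = kap c.
Hypothesis kap_side : forall k : K, exists2 w, w < 4 &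
  forall a, a < n -> kap a = k -> w \notin ends a.
Hypothesis kap_own : forall a, a < n -> exists c, [/\ c < n, so c = so a & kap c <> kap a].
Hypothesis L_gt1 : 1 < L.
Hypothesis L_max : forall c, ucycle e c -> 2 < size c -> size c <= L.
Hypothesis seg_sum : \sum_(a <- iota 0 n) (size (mi a)).+1 = no * L.

Definition holds (st : facts) :=
  [/\ forall a b, listed (apart st) a b -> a < n -> b < n -> ~~ has (mem (mi a)) (mi b),
       forall a b, listed (meeting st) a b ->
         [/\ a < n, b < n & has (mem (mi a)) (mi b)]
     & forall a b, listed (together st) a b -> [/\ a < n, b < n & kap a = kap b]].

Lemma has_memC (s1 s2 : seq U) : has (mem s1) s2 = has (mem s2) s1.
Proof. by apply: has_sym. Qed.

Lemma cls_kap st a : holds st -> a < n ->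
  {in cls st a, forall c, c < n /\ kap c = kap a}.
Proof.
move=> [_ h2 h3] an; rewrite /cls; elim: 8 => [|k IH] c.
  by rewrite /= inE => /eqP->.
rewrite iterS {1}/grow mem_undup mem_cat => /orP[/IH //|].
case/flattenP => s /mapP[[x y] xyl ->] /=; rewrite mem_cat.
have [xn yn xy] : [/\ x < n, y < n & kap x = kap y].
  move: xyl; rewrite mem_cat => /orP[xyl|xyl].
    have [xn yn m] := h2 x y (introT orP (or_introl xyl)).
    by split=> //; apply: kap_meet.
  by apply: h3; rewrite /listed xyl.
case/orP; case: ifP => // /IH[_ E]; rewrite inE => /eqP->; split=> //; congruence.
Qed.

Lemma spans_contra s k : spans s -> (forall c, c \in s -> c < n /\ kap c = k) -> False.
Proof.
move=> sp H; have [w w4 Hw] := kap_side k.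
rewrite /spans in sp; set t := undup _ in sp.
have tw : {subset t <= rem w (iota 0 4)}.
  move=> x; rewrite mem_undup => /flattenP[l /mapP[a /H[an ka] ->]] xa.
  rewrite (rem_filter _ (iota_uniq _ _)) mem_filter mem_iota.
  apply/andP; split; rewrite /=.
    by apply: contraNneq (Hw a an ka) => <-.
  have [h1 h2 _] := seg_lab an.
  by move: xa; rewrite !inE => /orP[] /eqP->.
have := uniq_leq_size (undup_uniq _) tw.
by rewrite size_rem ?mem_iota // (eqP sp).
Qed.

Lemma isD_sound st a b : holds st -> a < n -> b < n -> isD st a b ->
  ~~ has (mem (mi a)) (mi b).
Proof.
move=> hs an bn; rewrite /isD; case: ifP => // /negbT ab.
case: ifP => [/eqP oab _|_]; first exact: seg_own.
case: ifP => [ap _|_ sp]; first by case: hs => h _ _; apply: h.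
apply/negP => /(kap_meet an bn) kab; apply: (spans_contra (k := kap a) sp) => c.
by rewrite mem_cat => /orP[/(cls_kap hs an)|/(cls_kap hs bn)]; rewrite ?kab.
Qed.

Definition ornt a x := if su a == x then mi a else rev (mi a).

Definition hitx a b := find (mem (mi b)) (ornt a (far a b)).
Definition hity a b :=
  index (nth (vb 0) (ornt a (far a b)) (hitx a b)) (ornt b (far b a)).

(** Edges are counted, hence the successors: from an end to the inner vertex at position [i] there
    are [i.+1] edges, and from there to the opposite end [size - i]. *)
Definition len (v : nat * nat * nat) :=
  let: (k, a, b) := v in
  match k with
  | 0 => (size (mi a)).+1
  | 1 => (hitx a b).+1
  | 2 => size (mi b) - hity a b
  | _ => (hity a b).+1
  end.

Lemma size_ornt a x : size (ornt a x) = size (mi a).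
Proof. by rewrite /ornt; case: ifP; rewrite ?size_rev. Qed.

Lemma mem_ornt a x : ornt a x =i mi a.
Proof. by rewrite /ornt; case: ifP => _ y; rewrite ?mem_rev. Qed.

Lemma uniq_ornt a x : a < n -> uniq (ornt a x).
Proof. by rewrite /ornt; case: ifP => _ /seg_uniq; rewrite ?rev_uniq. Qed.

Lemma conn_ornt a b : a < n -> 
  conn e (vb (far a b)) (ornt a (far a b)) (vb (com a b)).
Proof.
move=> an; have [_ _ ne] := seg_lab an; rewrite /far /com /ornt.
case: ifP => _; last by rewrite eqxx; apply: seg_conn.
by rewrite (negbTE ne); apply: conn_rev => //; apply: seg_conn.
Qed.

Lemma hit_spec st a b : holds st -> hitok st a b -> exists x s1 s2 t1 t2,
  [/\ ornt a (far a b) = s1 ++ x :: s2, ornt b (far b a) = t1 ++ x :: t2,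
      ~~ has (mem (mi b)) s1, size s1 = hitx a b &
      size t1 = hity a b /\ size t1 + size t2 = (size (mi b)).-1].
Proof.
move=> [_ h2 _] /and5P[an bn ab _ _]; have [_ _ m] := h2 _ _ ab.
set ma := ornt a _; set mb := ornt b _.
have hm : has (mem (mi b)) ma.
  rewrite has_memC in m; apply/hasP; case/hasP: m => y y1 y2.
  by exists y => //; rewrite mem_ornt.
have xlt : hitx a b < size ma by rewrite -has_find.
set x := nth (vb 0) ma (hitx a b).
have xb : x \in mb by rewrite mem_ornt; apply: (nth_find (vb 0) hm).
have ylt : hity a b < size mb by rewrite index_mem.
exists x, (take (hitx a b) ma), (drop (hitx a b).+1 ma),
  (take (hity a b) mb), (drop (hity a b).+1 mb); split.
- by rewrite -drop_nth // cat_take_drop.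
- by rewrite -[X in X :: _](nth_index (vb 0) xb) -drop_nth // cat_take_drop.
- by rewrite has_take_leq ?(ltnW xlt) // -leqNgt leqnn.
- by rewrite size_takel // ltnW.
- rewrite size_takel ?size_drop; last exact: ltnW.
  by split=> //; rewrite -(size_ornt b (far b a)) -/mb; lia.
Qed.

Lemma lens_split st a b : holds st -> hitok st a b ->
  len (2, a, b) + len (3, a, b) = len (0, b, b).
Proof.
move=> hs hk; have [x [s1 [s2 [t1 [t2 [_ Eb _ _ [E1 E2]]]]]]] := hit_spec hs hk.
have := size_ornt b (far b a); rewrite Eb size_cat /= => E.
by rewrite -E1; lia.
Qed.

Definition sumlen s := \sum_(v <- s) len v.

Lemma piece_sound st p : holds st -> pok st p -> forall x,
  x \in [:: (pends p).1; (pends p).2] ->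
  exists m, [/\ conn e (vb x) m (vb (step x p)), uniq m,
    forall y, y \in m -> exists2 a, a \in base p & y \in mi a
    & (size m).+1 = sumlen (lens p)].
Proof.
move=> hs pk x xp.
suff [m [h1 h2 h3 h4]] : exists m,
   [/\ conn e (vb (pends p).1) m (vb (pends p).2), uniq m,
    forall y, y \in m -> exists2 a, a \in base p & y \in mi a
    & (size m).+1 = sumlen (lens p)].
  rewrite /step; move: xp; rewrite !inE; case: eqP => [-> _|_ /= /eqP->].
    by exists m.
  exists (rev m); rewrite rev_uniq size_rev; split=> //; first exact: conn_rev.
  by move=> y; rewrite mem_rev; apply: h3.
case: p pk {xp} => [a|a b|a b] /= pk.
- exists (mi a); split; [exact: seg_conn|exact: seg_uniq| |].
    by move=> y ya; exists a; rewrite ?inE.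
  by rewrite /sumlen big_seq1.
- have [x' [s1 [s2 [t1 [t2 [Ea Eb ns Es [Et Est]]]]]]] := hit_spec hs pk.
  case/and5P: pk => an bn ab fb cc.
  have ca := conn_ornt b an; have cb := conn_ornt a bn.
  have ua := uniq_ornt (far a b) an; have ub := uniq_ornt (far b a) bn.
  have ma := mem_ornt a (far a b); have mb := mem_ornt b (far b a).
  rewrite Ea in ca ua ma; rewrite Eb in cb ub mb.
  exists (s1 ++ x' :: rev t1); split.
  + move: ca cb; rewrite !conn_cat => /andP[-> _] /andP[h _] /=.
    exact: conn_rev.
  + move: ua ub; rewrite !cat_uniq /= rev_uniq mem_rev => /and4P[u1 h1 _ _].
    case/and4P=> u2 h2 _ _; rewrite u1 u2 (negbTE (_ : x' \notin t1)) /=; last first.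
      by apply/negP => xt; move: h2; rewrite xt.
    rewrite andbT; move: h1; rewrite !negb_or => /andP[-> _] /=.
    apply/negP => /hasP[y]; rewrite mem_rev => yt ys.
    case/negP: ns; apply/hasP; exists y => //=.
    by rewrite -mb mem_cat yt.
  + move=> y; rewrite mem_cat inE mem_rev => /or3P[ys|/eqP->|yt].
    * by exists a; rewrite ?inE ?eqxx // -ma mem_cat ys.
    * by exists a; rewrite ?inE ?eqxx // -ma mem_cat inE eqxx orbT.
    * by exists b; rewrite ?inE ?eqxx ?orbT // -mb mem_cat yt.
  + rewrite /sumlen big_cons big_seq1 size_cat /= size_rev Es Et; lia.
- have [x' [s1 [s2 [t1 [t2 [Ea Eb ns Es [Et Est]]]]]]] := hit_spec hs pk.
  have := size_ornt b (far b a); rewrite Eb size_cat /= => Esz.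
  case/and5P: pk => an bn ab fb /eqP cc.
  have ca := conn_ornt b an; have cb := conn_ornt a bn.
  have ua := uniq_ornt (far a b) an; have ub := uniq_ornt (far b a) bn.
  have ma := mem_ornt a (far a b); have mb := mem_ornt b (far b a).
  rewrite Ea in ca ua ma; rewrite Eb in cb ub mb.
  exists (s1 ++ x' :: t2); split.
  + by move: ca cb; rewrite !conn_cat -cc => /andP[-> _] /andP[_ ->].
  + move: ua ub; rewrite !cat_uniq /= => /and4P[u1 h1 _ _].
    case/and4P=> u2 h2 h3 h4; rewrite u1 h3 h4 /= andbT.
    move: h1; rewrite !negb_or => /andP[-> _] /=.
    apply/negP => /hasP[y yt ys].
    case/negP: ns; apply/hasP; exists y => //=.
    by rewrite -mb mem_cat inE yt !orbT.
  + move=> y; rewrite mem_cat inE => /or3P[ys|/eqP->|yt].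
    * by exists a; rewrite ?inE ?eqxx // -ma mem_cat ys.
    * by exists a; rewrite ?inE ?eqxx // -ma mem_cat inE eqxx orbT.
    * by exists b; rewrite ?inE ?eqxx ?orbT // -mb mem_cat inE yt !orbT.
  + rewrite /sumlen big_cons big_seq1 size_cat /= Es -Et; lia.
Qed.

Lemma base_lt st p a : pok st p -> a \in base p -> a < n.
Proof.
case: p => [b|b c|b c] /=; first by move=> ?; rewrite inE => /eqP->.
all: by case/and5P=> ? ? _ _ _; rewrite !inE => /orP[] /eqP->.
Qed.

Lemma bases_lt st row a : all (pok st) row -> a \in flatten (map base row) -> a < n.
Proof.
elim: row => //= p row IH /andP[pk pks]; rewrite mem_cat => /orP[|/IH->//].
exact: base_lt pk.
Qed.

Lemma bases_isD st p row a b :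
  all (fun q => all (fun a => all (isD st a) (base q)) (base p)) row ->
  a \in base p -> b \in flatten (map base row) -> isD st a b.
Proof.
move=> + ap; elim: row => //= q row IH /andP[/allP/(_ _ ap)/allP h hs].
by rewrite mem_cat => /orP[/h|/(IH hs)].
Qed.

(** Induction along the row. Nothing is repeated: pieces of the row are cut from disjoint segments,
    the stops are distinct, and bag vertices are off all interiors. The walk is kept open at [z],
    since only the entire row closes up. *)
Lemma row_sound st row x z : holds st -> all (pok st) row ->
  pairwise (fun p q => all (fun a => all (isD st a) (base q)) (base p)) row ->
  follows x row -> foldl step x row = z -> uniq (stops x row) ->
  all (gtn 4) (stops x row) ->
  exists ch, [/\ unzip1 ch = map vb (stops x row), links e (vb z) ch,
    uniq (glue ch),
    forall y, y \in glue ch -> y \in map vb (stops x row) \/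
      exists2 a, a \in flatten (map base row) & y \in mi a
    & size (glue ch) = \sum_(p <- row) sumlen (lens p)].
Proof.
move=> hs; elim: row x => [|p row IH] x.
  by move=> _ _ _ _ _ _; exists [::]; rewrite big_nil.
rewrite [all _ _]/= [pairwise _ _]/= [follows _ _]/= [foldl _ _ _]/= [stops _ _]/=.
rewrite [uniq _]/= [all (gtn 4) _]/=.
case/andP=> pk pks /andP[pD pDs] /andP[xp fl] zE /andP[xn un] /andP[x4 l4].
have [ch [h1 h2 h3 h4 h5]] := IH _ pks pDs fl zE un l4.
have [m [m1 m2 m3 m4]] := piece_sound hs pk xp.
exists ((vb x, m) :: ch); split.
- by rewrite /= h1.
- rewrite /= h2 andbT h1; case: (row) zE => /= [<-//|//].
- rewrite /glue /= -/(glue ch) mem_cat negb_or cat_uniq m2 h3 /= andbT.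
  apply/andP; split.
    apply/andP; split.
      apply/negP => /m3[a ap]; apply/negP; apply: seg_off => //.
      exact: base_lt pk ap.
    apply/negP => /h4[/mapP[i il E]|[a ab]].
      by have xi := vb_inj x4 (allP l4 _ il) E; rewrite -xi in il; rewrite il in xn.
    by apply/negP; apply: seg_off => //; apply: bases_lt pks ab.
  apply/negP => /hasP[y /h4 yc /m3[a ap ya]].
  have an := base_lt pk ap.
  case: yc => [/mapP[i il yi]|[b bb yb]].
    by move: ya; rewrite yi; apply/negP/seg_off => //; apply: (allP l4).
  have bn := bases_lt pks bb.
  case/negP: (isD_sound hs an bn (bases_isD pD ap bb)).
  by apply/hasP; exists y.
- move=> y; rewrite /glue /= -/(glue ch) inE mem_cat => /or3P[/eqP->|/m3[a ap ya]|/h4[ys|[a ab ya]]].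
  + by left; rewrite inE eqxx.
  + by right; exists a; rewrite // mem_cat ap.
  + by left; rewrite inE ys orbT.
  + by right; exists a; rewrite // mem_cat ab orbT.
- by rewrite big_cons -m4 -h5 /glue /= size_cat.
Qed.

Lemma rowok_sound st row : holds st -> rowok st row ->
  \sum_(p <- row) sumlen (lens p) <= L.
Proof.
move=> hs /and4P[r0 pks pD /hasP[x _ /and4P[fl /eqP zE un l4]]].
have [ch [h1 h2 h3 _ <-]] := row_sound hs pks pD fl zE un l4.
case: row {pks pD} r0 fl zE un l4 h1 => //= p row _ _ _ _ _.
case: ch h2 h3 => [|[y m] ch] // + + [E _]; rewrite -E => h2 h3.
(* A row may close up on fewer than three vertices, for instance two segments without inner
   vertices. A closed walk longer than [L] is not of this kind, because [1 < L], so [L_max] applies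
   to it. *)
rewrite leqNgt; apply/negP => sz.
have := L_max (c := glue ((y, m) :: ch)).
rewrite /ucycle h3 links_cycle h2 => /(_ isT (leq_ltn_trans L_gt1 sz)).
by rewrite leqNgt sz.
Qed.

Lemma submsetP s1 s2 : submset s1 s2 -> exists s3, perm_eq s2 (s1 ++ s3).
Proof.
elim: s1 s2 => [|x s1 IH] s2 /=; first by exists s2.
case/andP=> xs /IH[s3 h]; exists s3.
by rewrite (perm_trans (perm_to_rem xs)) //= perm_cons.
Qed.

Lemma len_gt0 st k a b : holds st -> hitok st a b -> 0 < len (k, a, b).
Proof.
move=> hs hk; have [x [s1 [s2 [t1 [t2 [_ Eb _ _ [E1 E2]]]]]]] := hit_spec hs hk.
case: k => [|[|[|k]]] //=; have := size_ornt b (far b a).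
by rewrite Eb size_cat /= -E1; lia.
Qed.

Lemma lens_gt0 st p v : holds st -> pok st p -> v \in lens p -> 0 < len v.
Proof.
move=> hs; case: p => [a|a b|a b] /= pk; rewrite !inE; first by move/eqP->.
all: by case/orP=> /eqP->; apply: len_gt0 hs pk.
Qed.

Lemma sumlen_cat s1 s2 : sumlen (s1 ++ s2) = sumlen s1 + sumlen s2.
Proof. exact: big_cat. Qed.

Lemma sumlen_nseq k s : sumlen (flatten (nseq k s)) = k * sumlen s.
Proof.
elim: k => [|k IH] /=; first by rewrite /sumlen big_nil.
by rewrite sumlen_cat IH mulSn.
Qed.

Lemma sumlen_lens row :
  sumlen (flatten (map lens row)) = \sum_(p <- row) sumlen (lens p).
Proof.
elim: row => [|p row IH] /=; first by rewrite /sumlen !big_nil.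
by rewrite sumlen_cat IH big_cons.
Qed.

Lemma lens_hit st row k a b : all (pok st) row -> 0 < k ->
  (k, a, b) \in flatten (map lens row) -> hitok st a b.
Proof.
move=> + k0; elim: row => //= p row IH /andP[pk pks].
rewrite mem_cat => /orP[|/IH->//].
case: p pk => [c|c d|c d] /=; rewrite !inE => pk.
- by case/eqP=> E; rewrite E in k0.
- by case/orP=> /eqP[_ -> ->].
- by case/orP=> /eqP[_ -> ->].
Qed.

Let rowlens (rows : seq (nat * seq piece)) :=
  flatten [seq flatten (nseq r.1 (flatten (map lens r.2))) | r <- rows].

Lemma mem_flatten_nseq (T : eqType) k (s : seq T) x :
  x \in flatten (nseq k s) -> x \in s.
Proof. by elim: k => //= k IH; rewrite mem_cat => /orP[|/IH]. Qed.

Lemma rowlens_mem st rows v : all (fun r => rowok st r.2) rows ->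
  v \in rowlens rows ->
  exists2 row, all (pok st) row & v \in flatten (map lens row).
Proof.
elim: rows => //= r rows IH /andP[/and4P[_ pks _ _] ok].
rewrite /rowlens /= mem_cat => /orP[/mem_flatten_nseq vr|/(IH ok)//].
by exists r.2.
Qed.

Lemma rowlens_sum st rows : holds st -> all (fun r => rowok st r.2) rows ->
  sumlen (rowlens rows) <= sumn (map fst rows) * L.
Proof.
move=> hs; elim: rows => [|r rows IH] /=; first by rewrite /sumlen big_nil.
case/andP=> rk ok; rewrite /rowlens /= sumlen_cat sumlen_nseq sumlen_lens mulnDl.
by apply: leq_add; [apply: leq_mul => //; apply: rowok_sound hs rk|apply: IH].
Qed.

Lemma pieces_gt0 st row v : holds st -> all (pok st) row ->
  v \in flatten (map lens row) -> 0 < len v.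
Proof.
move=> hs; elim: row => //= p row IH /andP[pk pks].
by rewrite mem_cat => /orP[|/IH->//]; apply: lens_gt0 hs pk.
Qed.

Lemma lpok_sound st k rows : holds st -> lpok st no k rows -> False.
Proof.
rewrite /lpok -/(rowlens rows); set s := rowlens rows; set j := joins s.
set s1 := _ ++ _; set s2 := s ++ _.
move=> hs /and4P[ok /submsetP[s3 pm] le_no slack].
have s_le : sumlen s <= sumn (map fst rows) * L := rowlens_sum hs ok.
have s_gt0 v : v \in s -> 0 < len v.
  by case/(rowlens_mem ok) => row pks; apply: pieces_gt0 hs pks.
have jhit a b : (a, b) \in j -> hitok st a b.
  case/flattenP => t /mapP[[[[|[|[|[|c]]]] x] y] vs ->] //=.
  rewrite mem_undup in vs => /nseqP[[-> ->] _].
  by have [row pks /(lens_hit pks)->] := rowlens_mem ok vs.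
have E1 : sumlen s1 = k * (no * L) + sumlen [seq (0, ab.2, ab.2) | ab <- j].
  rewrite /s1 sumlen_cat sumlen_nseq /sumlen big_map -seg_sum; congr (_ + _).
  elim: (j) jhit => [|[a b] l IH] h /=; first by rewrite !big_nil.
  rewrite !big_cons addnA -(lens_split hs (h a b (mem_head _ _))) IH //.
  by move=> a' b' ab; apply: h; rewrite inE ab orbT.
have E2 : sumlen s2 = sumlen s + sumlen [seq (0, ab.2, ab.2) | ab <- j].
  by rewrite /s2 sumlen_cat.
have E3 : sumlen s2 = sumlen s1 + sumlen s3.
  by rewrite -sumlen_cat /sumlen (perm_big _ pm).
(* The traded segments cancel, and [s3] is what the rows use beyond [k] copies of every segment. It
   remains to make one of the two estimates strict. *)
have E : sumlen s = k * (no * L) + sumlen s3 by lia.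
case/orP: slack => [lt|lt].
  have : 0 < sumlen s3.
    have := perm_size pm; rewrite (size_cat s1); case: (s3) pm => [_|v s4 pm _].
      by rewrite addn0 => Es; rewrite Es ltnn in lt.
    rewrite /sumlen big_cons addn_gt0.
    suff -> : 0 < len v by [].
    have : v \in s2 by rewrite (perm_mem pm) mem_cat inE eqxx orbT.
    by rewrite mem_cat => /orP[/s_gt0//|/mapP[ab _ ->]].
  have : sumn (map fst rows) * L <= k * no * L by rewrite leq_mul2r le_no orbT.
  by move: s_le; rewrite E mulnA; lia.
have : sumn (map fst rows) * L < k * no * L.
  by rewrite ltn_mul2r lt andbT; lia.
by move: s_le; rewrite E mulnA; lia.
Qed.

Lemma single_kap st s : holds st -> all (gtn n) s -> single st s ->
  {in s &, forall a b, kap a = kap b}.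
Proof.
move=> hs; case: s => [//|c s] /andP[cn _] /allP sg a b /sg ac /sg bc.
by rewrite (cls_kap hs cn ac).2 (cls_kap hs cn bc).2.
Qed.

(** Following at each [Br] the alternative that is true for the given paths ends at a leaf. Leaves
    [Cl] and [Lp] are contradictory, so the leaf is a target; with no targets the configuration does
    not exist. *)
Theorem check_sound targets st t : holds st -> check no targets st t ->
  exists2 tg, tg \in targets &
    forall s, s \in tg -> {in s &, forall a b, kap a = kap b}.
Proof.
elim: t st => [a b t1 IH1 t2 IH2|a|i|k rows] st hs.
- case/and4P=> an bn c1 c2; have [h1 h2 h3] := hs.
  case: (boolP (has (mem (mi a)) (mi b))) => m; [apply: (IH2 _ _ c2)|apply: (IH1 _ _ c1)].
    split=> //= x y; rewrite /listed !inE.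
    case: eqP => [[-> ->] _|_ /=]; first by split.
    case/or3P=> [xy|/eqP[-> ->]|xy].
    + by apply: h2; rewrite /listed xy.
    + by split=> //; rewrite has_memC.
    + by apply: h2; rewrite /listed xy orbT.
  split=> //= x y; rewrite /listed !inE.
  case: eqP => [[-> ->] _ _ _ //|_ /=].
  case/or3P=> [xy|/eqP[-> ->] _ _|xy].
  + by apply: h1; rewrite /listed xy.
  + by rewrite has_memC.
  + by apply: h1; rewrite /listed xy orbT.
- case/andP=> an /orP[sp|/allP al]; exfalso.
    by apply: (spans_contra sp) => c; apply: cls_kap hs an c.
  have [c [cn oc]] := kap_own an; apply.
  by have := al c; rewrite mem_iota /= cn oc eqxx => /(_ isT)/(cls_kap hs an)[].
- case/andP=> it /allP al; exists (nth [::] targets i); first exact: mem_nth.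
  by move=> s /al/andP[]; apply: single_kap.
- by move/(lpok_sound hs).
Qed.

End Soundness.
End Checker.

(* The cyclic orders, up to rotation and reversal, in which a cycle can visit at least
   two of the bag vertices 0, 1, 2, 3. *)
Definition all_traces : seq (seq nat) :=
  [:: [:: 0; 1]; [:: 0; 2]; [:: 0; 3]; [:: 1; 2]; [:: 1; 3]; [:: 2; 3];
      [:: 0; 1; 2]; [:: 0; 1; 3]; [:: 0; 2; 3]; [:: 1; 2; 3];
      [:: 0; 1; 2; 3]; [:: 0; 1; 3; 2]; [:: 0; 2; 1; 3]].

(** * Cutting a cycle at the bag, up to rotation and reversal *)

Definition flip (T : Type) (s : seq T) := if s is x :: s' then x :: rev s' else [::].

(** A duplicate-free word in four labels has length at most four, so all words can be tried. A cycle
    has neither start nor direction, hence certificates are needed only for words up to these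
    symmetries. *)
Lemma normal_trace tr : all (gtn 4) tr -> uniq tr -> 1 < size tr ->
  has (fun k => (rot k tr \in all_traces) || (rot k (flip tr) \in all_traces)) (iota 0 4).
Proof.
case: tr => [|a [|b [|c [|d [|z tr]]]]] //.
- by case: a => [|[|[|[|a]]]] //; case: b => [|[|[|[|b]]]].
- by case: a => [|[|[|[|a]]]] //; case: b => [|[|[|[|b]]]] //; case: c => [|[|[|[|c]]]].
- by case: a => [|[|[|[|a]]]] //; case: b => [|[|[|[|b]]]] //;
    case: c => [|[|[|[|c]]]] //; case: d => [|[|[|[|d]]]].
move=> /allP h /uniq_leq_size u _.
by have : size [:: a, b, c, d, z & tr] <= size (iota 0 4) by apply: u => x /h; rewrite mem_iota.
Qed.

Section Glue.
Variable U : eqType.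
Implicit Types (tr : seq U) (ms : seq (seq U)).

Lemma glue_cat (s1 s2 : seq (U * seq U)) : glue (s1 ++ s2) = glue s1 ++ glue s2.
Proof. by rewrite /glue map_cat flatten_cat. Qed.

Lemma glue1 (x : U) m : glue [:: (x, m)] = x :: m.
Proof. by rewrite /glue /= cats0. Qed.

(** Reversal makes each interior follow the vertex at its other end, so vertices and interiors shift
    against each other by one place. The extra [y] in front and the [x] left at the back absorb the
    shift; for a cycle, [y] is [x]. *)
Lemma glue_flip x y m tr ms : size tr = size ms ->
  y :: rev (glue (zip (x :: tr) (m :: ms))) =
  rcons (glue (zip (y :: rev tr) (map rev (rev (m :: ms))))) x.
Proof.
elim: tr x m ms => [|z tr IH] x m [|m' ms] //= => [_|[sz]].
  by rewrite /glue /= !cats0 rev_cons.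
have -> : glue (zip [:: x, z & tr] [:: m, m' & ms]) =
    (x :: m) ++ glue (zip (z :: tr) (m' :: ms)) by [].
rewrite rev_cat -cat_cons IH // [rev (z :: tr)]rev_cons [rev (m :: _)]rev_cons.
rewrite map_rcons -rcons_cons zip_rcons; last first.
  by rewrite size_map size_rev /= size_rev sz.
by rewrite -[rcons (zip _ _) _]cats1 glue_cat glue1 rcons_cat rcons_cons [rev (x :: m)]rev_cons cat_rcons.
Qed.

Lemma glue_rot tr ms : size tr = size ms ->
  exists k, glue (zip (rot 1 tr) (rot 1 ms)) = rot k (glue (zip tr ms)).
Proof.
case: tr ms => [|x tr] [|m ms] //= => [_|[sz]]; first by exists 0.
exists (size (x :: m)); rewrite !rot1_cons zip_rcons // -cats1 glue_cat glue1.
by rewrite -(rot_size_cat (x :: m)).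
Qed.
End Glue.

Section Decomposition.
Variables (U : eqType) (e : rel U) (vb : nat -> U).
Hypothesis e_sym : symmetric e.

(** The glued cycle is compared with [c] by [perm_eq] only, because nothing but its vertices and its
    length matters. This lets a rotated or reversed decomposition still be one of the same [c]. *)
Definition dec c (tr : seq nat) (ms : seq (seq U)) :=
  [/\ size tr = size ms, cycle e (glue (zip (map vb tr) ms)),
      perm_eq (glue (zip (map vb tr) ms)) c
    & forall i m, i < 4 -> m \in ms -> vb i \notin m].

Lemma dec_rot1 c tr ms : dec c tr ms -> dec c (rot 1 tr) (rot 1 ms).
Proof.
case=> sz cy pe off; have sz' : size (map vb tr) = size ms by rewrite size_map.
have [k E] := glue_rot sz'.
split; rewrite ?size_rot // ?map_rot ?E ?rot_cycle //.
- by rewrite perm_rot.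
- by move=> i m i4; rewrite mem_rot; apply: off.
Qed.

Lemma dec_rot k c tr ms : dec c tr ms -> exists ms', dec c (rot k tr) ms'.
Proof.
move=> d; case: (leqP k (size tr)) => kn; last first.
  by exists ms; rewrite rot_oversize // ltnW.
elim: k kn => [|k IH] kn; first by exists ms; rewrite rot0.
have [ms' d'] := IH (ltnW kn); exists (rot 1 ms').
by rewrite -add1n rotD ?add1n //; apply: dec_rot1.
Qed.

Lemma dec_flip c tr ms : dec c tr ms -> exists ms', dec c (flip tr) ms'.
Proof.
case: tr ms => [|x tr] [|m ms] [] // sz cy pe off.
  by exists [::]; split.
exists (map rev (rev (m :: ms))).
have [sz'] : size (x :: tr) = size (m :: ms) := sz.
have := @glue_flip _ (vb x) (vb x) m (map vb tr) ms; rewrite size_map => /(_ sz').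
set G := glue _ in cy pe *; set F := glue _.
have EG : G = vb x :: behead G by [].
have EF : F = vb x :: behead F.
  by rewrite /F rev_cons map_rcons; case: (map rev (rev ms)).
rewrite EF EG rev_cons rcons_cons -!rcons_cons => - [/rcons_inj[E]].
have EF' : F = vb x :: rev (behead G) by rewrite EF E.
have EFF : glue (zip (map vb (flip (x :: tr))) (map rev (rev (m :: ms)))) = F.
  by rewrite /= map_rev.
split; rewrite ?EFF.
- by rewrite size_map [in RHS]size_rev /= size_rev sz'.
- rewrite EF' -(rot_cycle 1) rot1_cons -rev_cons -EG rev_cycle.
  by rewrite (@eq_cycle _ _ e) // => u v; rewrite e_sym.
- apply: perm_trans pe; rewrite EF' EG perm_cons perm_sym.
  by rewrite perm_sym perm_rev.
- move=> i m' i4 /mapP[m'']; rewrite mem_rev => mm ->; rewrite mem_rev.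
  exact: off.
Qed.

Lemma dec_normal c tr ms : dec c tr ms -> all (gtn 4) tr -> uniq tr ->
  1 < size tr -> exists tr' ms', tr' \in all_traces /\ dec c tr' ms'.
Proof.
move=> d a u s; case/hasP: (normal_trace a u s) => k _ /orP[h|h].
  by have [ms' d'] := dec_rot k d; exists (rot k tr), ms'.
have [ms1 d1] := dec_flip d; have [ms' d'] := dec_rot k d1.
by exists (rot k (flip tr)), ms'.
Qed.

Lemma mem_glue (ch : seq (U * seq U)) y :
  (y \in glue ch) = (y \in unzip1 ch) || (y \in flatten (unzip2 ch)).
Proof.
elim: ch => [|[x m] ch IH] //=; rewrite /glue /= -/(glue ch) !inE !mem_cat IH.
by case: (y == x); case: (y \in m); case: (y \in unzip1 ch).
Qed.

Lemma dec_mem c tr ms i : {in gtn 4 &, injective vb} -> all (gtn 4) tr -> i < 4 ->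
  dec c tr ms -> (vb i \in c) = (i \in tr).
Proof.
move=> vi a i4 [sz _ pe off]; rewrite -(perm_mem pe) mem_glue.
rewrite unzip1_zip ?unzip2_zip ?size_map ?sz //.
have -> : vb i \in flatten ms = false.
  by apply/negP => /flattenP[m mm im]; case/negP: (off _ _ i4 mm).
rewrite orbF; apply/mapP/idP => [[j jt /vi E]|it]; last by exists i.
by rewrite (E i4 (allP a _ jt)).
Qed.

Lemma split_glue (B : {pred U}) s : exists m ch, [/\ s = m ++ glue ch,
  {in m, forall y, y \notin B}, {subset unzip1 ch <= B} &
  {in unzip2 ch, forall m', {in m', forall y, y \notin B}}].
Proof.
elim: s => [|y s [m [ch [-> h1 h2 h3]]]]; first by exists [::], [::].
case: (boolP (y \in B)) => yB.
  exists [::], ((y, m) :: ch); split=> //= [z|z].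
    by rewrite inE => /predU1P[->|/h2].
  by rewrite inE => /predU1P[->|/h3].
exists (y :: m), ch; split=> // z; rewrite inE => /predU1P[->//|]; exact: h1.
Qed.

End Decomposition.

(** * Segments of longest cycles at a fixed bag, and the hypotheses of the checker *)

Section Problem.
Variables (U : finType) (e : rel U) (L : nat) (bs : seq U) (x0 : U).
Hypothesis e_sym : symmetric e.

Definition off_bag : rel U := [rel u v | [&& u \notin bs, v \notin bs & e u v]].

Definition bag_label i := nth x0 bs i.

(* A segment with empty interior gets a label of its own. *)
Definition comp_label (sg : nat) (m : seq U) : nat + U :=
  if m is x :: _ then inr (root off_bag x) else inl sg.

Lemma off_bag_sym : connect_sym off_bag.
Proof.
by apply: sym_connect_sym => u v; rewrite /off_bag /= e_sym andbCA.
Qed.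

Lemma conn_interior x m y : conn e x m y -> {in m, forall z, z \notin bs} ->
  {in m &, forall u v, connect off_bag u v}.
Proof.
elim: m x => //= z m IH x /andP[_ zm] off.
have off' : {in m, forall z, z \notin bs} by move=> u um; apply: off; rewrite inE um orbT.
have zc u : u \in m -> connect off_bag z u.
  case: m IH zm off off' => // w m IH zm off off' um.
  have zw : connect off_bag z w.
    by apply: connect1; rewrite /off_bag /= !off ?inE ?eqxx ?orbT //; case/andP: zm.
  by apply: connect_trans zw (IH z zm off' _ _ (mem_head _ _) um).
move=> u v; rewrite !inE => /predU1P[->|um] /predU1P[->|vm] //; first exact: zc.
  by rewrite off_bag_sym; apply: zc.
exact: IH zm off' _ _ um vm.
Qed.

Definition positions (trs : seq (seq nat)) :=
  [seq (o, i) | o <- iota 0 (size trs), i <- iota 0 (size (nth [::] trs o))].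

(** Second ends come from [rot 1], which lists the cyclic successors; the third entry is the cycle.
    Numbers run through the cycles in order, so adding a cycle at the end keeps the earlier
    numbers. *)
Definition segments (trs : seq (seq nat)) :=
  [seq (nth 0 (nth [::] trs oi.1) oi.2, nth 0 (rot 1 (nth [::] trs oi.1)) oi.2, oi.1)
   | oi <- positions trs].

Definition interior (trs : seq (seq nat)) (mss : seq (seq (seq U))) a :=
  let oi := nth (0, 0) (positions trs) a in nth [::] (nth [::] mss oi.1) oi.2.

Hypothesis bs_uniq : uniq bs.
Hypothesis bs_size : size bs = 4.
Hypothesis L_gt2 : 2 < L.
Hypothesis L_max : forall c, ucycle e c -> 2 < size c -> size c <= L.
Hypothesis side : forall x, x \notin bs -> exists2 w, w \in bs &
  forall y, connect off_bag x y -> ~~ e y w.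
Hypothesis unfenced : forall x c, x \notin bs -> ucycle e c -> size c = L ->
  exists2 y, y \in c & ~~ connect off_bag x y /\
    (y \in bs -> forall z, connect off_bag x z -> ~~ e z y).

Lemma bag_label_inj : {in gtn 4 &, injective bag_label}.
Proof.
by move=> i j i4 j4 /eqP; rewrite /bag_label nth_uniq ?bs_size // => /eqP.
Qed.

Lemma bag_label_in i : i < 4 -> bag_label i \in bs.
Proof. by move=> i4; rewrite mem_nth ?bs_size. Qed.

Lemma bag_labelP y : y \in bs -> exists2 i, i < 4 & y = bag_label i.
Proof.
by move=> yb; exists (index y bs); [rewrite -bs_size index_mem|rewrite /bag_label nth_index].
Qed.

(** The vertices of [m] lie in one component, and [x] is in this component or a bag vertex adjacent
    to it, which [unfenced] forbids. So a longest cycle has at least two bag vertices and is cut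
    into segments with distinct ends. *)
Lemma not_conn_all x m c : ucycle e c -> size c = L -> perm_eq c (x :: m) ->
  conn e x m x -> {in m, forall z, z \notin bs} -> False.
Proof.
move=> uc sc pe xm off.
case: m pe xm off => [|z m] pe xm off.
  by have := perm_size pe; rewrite sc /=; lia.
have zn : z \notin bs by apply: off; rewrite mem_head.
have [y yc [ny ay]] := unfenced zn uc sc.
have cz := conn_interior xm off.
move: yc; rewrite (perm_mem pe) inE => /predU1P[yx|ym]; last first.
  by case/negP: ny; apply: cz; rewrite ?mem_head.
case: (boolP (x \in bs)) => xb.
  have := ay; rewrite yx => /(_ xb z (connect0 _ _)).
  by case/andP: xm => xz _; rewrite e_sym xz.
case/negP: ny; rewrite yx; apply: connect1; rewrite /off_bag /= zn xb /=.
by case/andP: xm => xz _; rewrite e_sym.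
Qed.

Lemma decomposition c : ucycle e c -> size c = L ->
  exists tr ms, tr \in all_traces /\ dec e bag_label c tr ms.
Proof.
move=> uc sc; have /andP[cc cu] := uc.
have [hb|nb] := boolP (has (mem bs) c); last first.
  exfalso; case: c uc sc cc cu nb => [|x c] uc sc cc cu nb; first by move: L_gt2; rewrite -sc.
  apply: (not_conn_all uc sc (perm_refl _) cc) => z zc.
  by move/hasPn: nb; apply; rewrite inE zc orbT.
have [x xc xb] := hasP hb.
have [k c' Ec] := rot_to xc.
have pe : perm_eq (x :: c') c by rewrite -Ec perm_rot.
have cy : cycle e (x :: c') by rewrite -Ec rot_cycle.
have un : uniq (x :: c') by rewrite -Ec rot_uniq.
have [m [ch [E h1 h2 h3]]] := split_glue (mem bs) c'.
set ch' := (x, m) :: ch.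
have E' : x :: c' = glue ch' by rewrite E.
have b1 : {subset unzip1 ch' <= bs} by move=> z; rewrite inE => /predU1P[->|/h2].
have b2 : {in unzip2 ch', forall m', {in m', forall y, y \notin bs}}.
  by move=> z; rewrite inE => /predU1P[->|/h3].
have Et : map bag_label (map (index^~ bs) (unzip1 ch')) = unzip1 ch'.
  rewrite -map_comp -[RHS]map_id; apply/eq_in_map => z /b1 zb.
  by rewrite /= /bag_label nth_index.
have d : dec e bag_label c (map (index^~ bs) (unzip1 ch')) (unzip2 ch').
  split; rewrite ?Et ?zip_unzip -?E' //; first by rewrite !size_map.
  by move=> i m' i4 /b2 mo; apply/negP => /mo; rewrite bag_label_in.
apply: (dec_normal e_sym d).
- by apply/allP => i /mapP[z /b1 zb ->]; rewrite /= -bs_size index_mem.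
- apply: (@map_uniq _ _ bag_label); rewrite Et.
  by move: un; rewrite E'; apply: subseq_uniq; elim: (ch') => //= p s IH;
    rewrite /glue /= eqxx; apply: subseq_trans IH _; apply: suffix_subseq.
- rewrite !size_map /=; case: (ch) E E' => [|//] Em _.
  exfalso; rewrite cats0 in Em; apply: (not_conn_all uc sc (x := x) (m := m)).
  + by rewrite perm_sym -Em.
  + by rewrite -Em.
  + by move=> z /h1.
Qed.

Lemma traces_ok tr i : tr \in all_traces -> i < size tr ->
  [/\ nth 0 tr i < 4, nth 0 (rot 1 tr) i < 4 & nth 0 tr i != nth 0 (rot 1 tr) i].
Proof.
move=> ta it; apply/and3P.
have : all (fun tr => all (fun i => [&& nth 0 tr i < 4, nth 0 (rot 1 tr) i < 4 &
  nth 0 tr i != nth 0 (rot 1 tr) i]) (iota 0 (size tr))) all_traces by [].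
by move/allP/(_ _ ta)/allP; apply; rewrite mem_iota.
Qed.

Lemma traces_size tr : tr \in all_traces -> 1 < size tr.
Proof. by move: tr; apply/allP. Qed.

Lemma dec_conn c tr ms i : dec e bag_label c tr ms -> i < size tr ->
  conn e (bag_label (nth 0 tr i)) (nth [::] ms i) (bag_label (nth 0 (rot 1 tr) i)).
Proof.
case=> sz cy _ _ it; have i0 : i < size ms by rewrite -sz.
have gen z s ts j : size s = size ts -> j < size s -> links e z (zip s ts) ->
    conn e (nth z s j) (nth [::] ts j) (nth z (rcons (behead s) z) j).
  elim: s ts j => [|x s IH] [|m ts] [|j] //= [sts] js /andP[h1 h2].
    by move: h1; rewrite unzip1_zip ?sts //; case: (s).
  by have := IH ts j sts js h2; case: (s) js.
case: tr sz cy it => [|t tr] // sz cy it; case: ms sz cy i0 => [|m ms] // sz cy i0.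
rewrite [zip _ _]/= links_cycle in cy.
have := gen (bag_label t) (map bag_label (t :: tr)) (m :: ms) i.
rewrite size_map => /(_ sz it cy); rewrite [behead _]/= -map_rcons -rot1_cons.
by rewrite !(nth_map 0) ?size_rot.
Qed.

Lemma uniq_glue (ch : seq (U * seq U)) : uniq (glue ch) -> uniq (flatten (unzip2 ch)).
Proof.
apply: subseq_uniq; elim: ch => //= c ch IH; rewrite /glue /=.
apply: subseq_trans (subseq_cons _ _); exact: cat_subseq.
Qed.

Lemma dec_uniq c tr ms : uniq c -> dec e bag_label c tr ms -> uniq (flatten ms).
Proof.
move=> uc [sz _ pe _]; rewrite -(perm_uniq pe) in uc.
by have := uniq_glue uc; rewrite unzip2_zip // size_map sz.
Qed.

Lemma flatten_uniq_nth (ms : seq (seq U)) : uniq (flatten ms) ->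
  (forall i, uniq (nth [::] ms i)) /\
  (forall i j, i != j -> ~~ has (mem (nth [::] ms i)) (nth [::] ms j)).
Proof.
elim: ms => [|m ms IH] /=; first by move=> _; split=> [i|i j _]; rewrite !nth_nil.
rewrite cat_uniq => /and3P[um hm /IH[u1 u2]]; split=> [[|i]|[|i] [|j]] //= ij.
- apply/hasPn => y ym; apply: contra hm => /= yn; apply/hasP; exists y => //.
  case: (ltnP j (size ms)) => js; last by rewrite nth_default in ym.
  by apply/flattenP; exists (nth [::] ms j); rewrite ?mem_nth.
- apply/hasPn => y ym; apply: contra hm => /= yn; apply/hasP; exists y => //.
  case: (ltnP i (size ms)) => js; last by rewrite nth_default in yn.
  by apply/flattenP; exists (nth [::] ms i); rewrite ?mem_nth.
- exact: u2.
Qed.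

Lemma size_glue (ch : seq (U * seq U)) :
  size (glue ch) = \sum_(c <- ch) (size c.2).+1.
Proof.
elim: ch => [|c ch IH]; first by rewrite big_nil.
by rewrite big_cons -IH /glue /= size_cat addSn.
Qed.

Section Sound.
Variables (trs : seq (seq nat)) (cs : seq (seq U)) (mss : seq (seq (seq U))).
Hypothesis decs : forall o, o < size trs ->
  [/\ nth [::] trs o \in all_traces, ucycle e (nth [::] cs o),
      size (nth [::] cs o) = L
    & dec e bag_label (nth [::] cs o) (nth [::] trs o) (nth [::] mss o)].

Let sgs := segments trs.
Let n := size sgs.
Let mi := interior trs mss.
Definition seg_label a := comp_label a (mi a).

Lemma positionsP o i :
  ((o, i) \in positions trs) = (o < size trs) && (i < size (nth [::] trs o)).
Proof.
apply/allpairsPdep/andP => [[o' [i']]|[oi ii]].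
  by rewrite !mem_iota => -[/= h1 h2 [-> ->]].
by exists o, i; rewrite !mem_iota.
Qed.

Lemma positions_uniq : uniq (positions trs).
Proof.
apply: allpairs_uniq_dep; rewrite ?iota_uniq //.
  by move=> o _; apply: iota_uniq.
by move=> [x1 x2] [y1 y2] _ _ /= [-> ->].
Qed.

Lemma seg_at a : a < n -> exists o i,
  [/\ o < size trs, i < size (nth [::] trs o), nth (0, 0) (positions trs) a = (o, i),
      [/\ su sgs a = nth 0 (nth [::] trs o) i,
          sv sgs a = nth 0 (rot 1 (nth [::] trs o)) i & so sgs a = o]
    & mi a = nth [::] (nth [::] mss o) i].
Proof.
rewrite /n /sgs size_map => an; have := mem_nth (0, 0) an.
case E : (nth _ _ _) => [o i]; rewrite positionsP => /andP[ot it].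
exists o, i; split=> //; last by rewrite /mi /interior E.
by rewrite /su /sv /so (nth_map (0, 0)) // E.
Qed.

Lemma seg_of o i : o < size trs -> i < size (nth [::] trs o) ->
  exists2 a, a < n & nth (0, 0) (positions trs) a = (o, i).
Proof.
move=> ot it; have h : (o, i) \in positions trs by rewrite positionsP ot it.
by exists (index (o, i) (positions trs)); rewrite ?nth_index // /n size_map index_mem.
Qed.

Lemma glue_size o : o < size trs ->
  \sum_(i <- iota 0 (size (nth [::] trs o))) (size (nth [::] (nth [::] mss o) i)).+1 = L.
Proof.
case/decs=> _ _ sc [sz _ pe _]; rewrite -sc -(perm_size pe) size_glue.
rewrite -(big_map snd xpredT (fun m => (size m).+1)) -/(unzip2 _).
rewrite unzip2_zip ?size_map ?sz // [in RHS](big_nth [::]).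
by rewrite big_mkord -(big_mkord xpredT (fun i => (size (nth [::] (nth [::] mss o) i)).+1)) /index_iota subn0.
Qed.

Lemma mi_off a y : a < n -> y \in mi a -> y \notin bs.
Proof.
move=> an ya; have [o [i [ot it _ _ Em]]] := seg_at an.
have [_ _ _ [sz _ _ off]] := decs ot.
apply/negP => /bag_labelP[j j4 yj]; move: ya; rewrite yj Em; apply/negP/off => //.
by rewrite mem_nth // -sz.
Qed.

Lemma mi_conn a : a < n ->
  conn e (bag_label (su sgs a)) (mi a) (bag_label (sv sgs a)).
Proof.
move=> an; have [o [i [ot it _ [-> -> _] ->]]] := seg_at an.
by have [_ _ _ d] := decs ot; apply: dec_conn d it.
Qed.

Lemma seg_label_root a y : a < n -> y \in mi a -> seg_label a = inr (root off_bag y).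
Proof.
move=> an ya; rewrite /seg_label /comp_label.
have cn := conn_interior (mi_conn an) (fun z => @mi_off a z an).
case: (mi a) ya cn => [//|x m] ya cn; congr inr.
by apply/eqP; rewrite root_connect; [apply: cn; rewrite ?mem_head|exact: off_bag_sym].
Qed.

Lemma seg_ends_adj a y : a < n -> y \in mi a ->
  exists z1 z2, [/\ connect off_bag y z1, e z1 (bag_label (su sgs a)),
    connect off_bag y z2 & e z2 (bag_label (sv sgs a))].
Proof.
move=> an ya; have cn := conn_interior (mi_conn an) (fun z => @mi_off a z an).
have := mi_conn an; case: (lastP (mi a)) ya cn => [//|m x] ya cn.
rewrite /conn rcons_path last_rcons => /andP[h1 h2].
case E : (rcons m x) h1 ya cn => [|z m'] // h1 ya cn.
exists z, x; split=> //.
- by apply: cn => //; rewrite mem_head.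
- by rewrite e_sym; case/andP: h1.
- by apply: cn => //; rewrite -E mem_rcons mem_head.
Qed.

(** If all segments of the cycle had the label of a genuine component, each bag vertex on the cycle
    would be the end of a segment with inner vertices there, hence adjacent to that component. The
    cycle would then lie in a component and its neighbours in the bag, against [unfenced]. *)
Lemma seg_label_own a : a < n -> exists c,
  [/\ c < n, so sgs c = so sgs a & seg_label c <> seg_label a].
Proof.
move=> an; have [o [i [ot it Ea [_ _ so1] _]]] := seg_at an.
  have [ta uc sc d] := decs ot.
  case: (boolP (has (fun c => (so sgs c == o) && (seg_label c != seg_label a)) (iota 0 n))).
    case/hasP=> c; rewrite mem_iota /= add0n => cn /andP[/eqP oc /eqP kc].
    by exists c; rewrite so1.
  move/hasPn => same; exfalso.
  have lab j b : j < size (nth [::] trs o) -> b < n ->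
      nth (0, 0) (positions trs) b = (o, j) -> seg_label b = seg_label a.
    move=> jt bn Eb; have := same b; rewrite mem_iota /= bn.
    have [o' [j' [_ _ Eb' [_ _ ->] _]]] := seg_at bn.
    move: Eb'; rewrite Eb => -[<- _]; rewrite eqxx /= negbK => /(_ isT)/eqP //.
  (* A segment without inner vertices is labelled by its own number, so any second segment of the
     cycle has another label; a trace has length at least two. *)
  case Em : (mi a) => [|x m].
    have [j [jt ji]] : exists j, j < size (nth [::] trs o) /\ j != i.
      have := traces_size ta; case: (i) it => [|i'] it s2; first by exists 1.
      by exists 0; split=> //; apply: leq_trans s2.
    have [b bn Eb] := seg_of ot jt.
    have := lab j b jt bn Eb; rewrite /seg_label Em /=.
    case: (mi b) => [|//] [ba]; move: ji.
    by have := Eb; rewrite ba Ea => -[->]; rewrite eqxx.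
  have xa : x \in mi a by rewrite Em mem_head.
  have [y yc [ny ay]] := unfenced (mi_off an xa) uc sc.
  have inner j b z : j < size (nth [::] trs o) -> b < n ->
      nth (0, 0) (positions trs) b = (o, j) -> z \in mi b -> connect off_bag x z.
    move=> jt bn Eb zb; rewrite -root_connect; last exact: off_bag_sym.
    have := lab j b jt bn Eb; rewrite (seg_label_root an xa) (seg_label_root bn zb).
    by case=> ->.
  have [sz _ pe _] := d; move: yc; rewrite -(perm_mem pe) mem_glue.
  rewrite unzip1_zip ?unzip2_zip ?size_map ?sz // => /orP[|].
    case/mapP=> l /(nthP 0)[j jt lj] yl.
    have [b bn Eb] := seg_of ot jt.
    have [o' [j' [_ _ Eb' [sb _ _] _]]] := seg_at bn.
    move: Eb'; rewrite Eb => -[oo jj]; rewrite -oo -jj lj in sb.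
    have l4 : l < 4 by rewrite -lj; case: (traces_ok ta jt).
    case Eb2 : (mi b) => [|z m'].
      have := lab j b jt bn Eb; rewrite (seg_label_root an xa).
      by rewrite /seg_label Eb2.
    have zb : z \in mi b by rewrite Eb2 mem_head.
    have [z1 [z2 [c1 e1 _ _]]] := seg_ends_adj bn zb.
    have xz := connect_trans (inner j b z jt bn Eb zb) c1.
    have yb : y \in bs by rewrite yl bag_label_in.
    by move: e1; rewrite sb -yl (negbTE (ay yb _ xz)).
  case/flattenP=> m' /(nthP [::])[j jt mj] ym; rewrite -sz in jt.
  have [b bn Eb] := seg_of ot jt; case/negP: ny; apply: (inner j b y jt bn Eb).
  by rewrite /mi /interior Eb /= mj.
Qed.

Theorem problem targets st t :
  holds sgs mi seg_label st -> check sgs (size trs) targets st t ->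
  exists2 tg, tg \in targets &
    forall s, s \in tg -> {in s &, forall a b, seg_label a = seg_label b}.
Proof.
apply: (@check_sound sgs U _ e bag_label mi seg_label L (size trs)) => //.
- exact: bag_label_inj.
- move=> a an; have [o [i [ot it _ [-> -> _] _]]] := seg_at an.
  by have [ta _ _ _] := decs ot; apply: traces_ok.
- exact: mi_conn.
- move=> a an; have [o [i [ot it _ _ ->]]] := seg_at an.
  have [_ /andP[_ uc] _ d] := decs ot.
  by have [u _] := flatten_uniq_nth (dec_uniq uc d); apply: u.
- by move=> a i an i4; apply/negP => /(mi_off an); rewrite bag_label_in.
- move=> a c an cn ac soE.
  have [o [i [ot it Ea [_ _ so1] ->]]] := seg_at an.
  have [o' [j [ot' jt Ec [_ _ so2] ->]]] := seg_at cn.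
  move: soE; rewrite so1 so2 => oE; rewrite -oE in Ec *.
  have [_ /andP[_ uc] _ d] := decs ot.
  have [_ u] := flatten_uniq_nth (dec_uniq uc d); apply: u.
  apply: contra ac => /eqP ij; rewrite -(nth_uniq (0, 0) _ _ positions_uniq) ?Ea ?Ec ?ij //.
    by move: an; rewrite /n size_map.
  by move: cn; rewrite /n size_map.
- move=> a c an cn /hasP[y yc ya].
  by rewrite (seg_label_root an ya) (seg_label_root cn yc).
(* The label of a component with a genuine segment misses a bag vertex by [side]. A label of an
   empty segment belongs to it alone, and its two ends leave labels over. For a label that does not
   occur any [w] will do. *)
- move=> k; case: (boolP (has (fun a => (seg_label a == k) && (mi a != [::])) (iota 0 n))).
    case/hasP=> a; rewrite mem_iota /= add0n => an /andP[/eqP ka].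
    case Em : (mi a) => [//|x m] _; have xa : x \in mi a by rewrite Em mem_head.
    have [w wb Hw] := side (mi_off an xa); have [i i4 wi] := bag_labelP wb.
    exists i => // c cn kc; case Ec : (mi c) => [|y m'].
      move: kc; rewrite -ka (seg_label_root an xa) /seg_label /comp_label.
      by rewrite Ec.
    have yc : y \in mi c by rewrite Ec mem_head.
    have xy : connect off_bag x y.
      rewrite -root_connect; last exact: off_bag_sym.
      move: kc; rewrite -ka (seg_label_root an xa) (seg_label_root cn yc).
      by case=> ->.
    have [z1 [z2 [c1 e1 c2 e2]]] := seg_ends_adj cn yc.
    rewrite !inE; apply/norP; split; apply/eqP => E.
      by case/negP: (Hw z1 (connect_trans xy c1)); rewrite wi E.
    by case/negP: (Hw z2 (connect_trans xy c2)); rewrite wi E.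
  move=> /hasPn nk.
  have empt c : c < n -> seg_label c = k -> mi c = [::] /\ k = inl c.
    move=> cn kc; have := nk c; rewrite mem_iota /= cn kc eqxx /= negbK => /(_ isT)/eqP Ec.
    by split=> //; rewrite -kc /seg_label Ec.
  case: (boolP (has (fun a => seg_label a == k) (iota 0 n))) => [|/hasPn no].
    case/hasP=> a; rewrite mem_iota /= add0n => an /eqP ka.
    have [_ ka'] := empt a an ka.
    have /allPn[w] : ~~ all (mem (ends sgs a)) (iota 0 4).
      apply/negP => /allP h; have := uniq_leq_size (iota_uniq 0 4) h.
      by rewrite size_iota.
    rewrite mem_iota /= add0n => w4 wa; exists w => // c cn kc.
    have [_] := empt c cn kc; rewrite ka' => -[E]; by rewrite -E.
  exists 0 => // c cn kc; have := no c; rewrite mem_iota /= cn kc eqxx.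
  by move/(_ isT).
- exact: seg_label_own.
- by apply: ltnW.
- rewrite /n /sgs /segments size_map.
  transitivity (\sum_(oi <- positions trs) (size (nth [::] (nth [::] mss oi.1) oi.2)).+1).
    by rewrite [RHS](big_nth (0, 0)) /index_iota subn0.
  rewrite /positions big_allpairs_dep /=.
  rewrite (eq_big_seq (fun=> L)) => [|o].
    by rewrite big_const_seq count_predT size_iota iter_addn_0 mulnC.
  by rewrite mem_iota /= => ot; apply: glue_size.
Qed.

End Sound.
End Problem.

(* The refutation trees were found by a computer search, with a linear programming
   solver providing the multipliers at the leaves. *)
Definition cert_01_12_02 :=
Br 0 2 (Br 2 4 (Br 0 4 (Br 3 4 (Br 0 3 (Br 1 4 (Br 1 2 (Lp 1 [:: (1, [:: Sg 4;Sg 5]); (1, [:: Sg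
0;Sg 3;Sg 4]); (1, [:: Sg 1;Sg 2;Sg 4])]) (Br 1 3 (Lp 1 [:: (1, [:: Sg 4;Sg 5]); (1, [:: Sg 0;Sg
2;Sg 4]); (1, [:: Sg 1;Sg 3;Sg 4])]) (Cl 2))) (Br 1 5 (Br 0 5 (Lp 2 [:: (1, [:: Sg 0;Sg 1]); (1,
[:: Sg 2;Sg 3]); (1, [:: Sg 0;Sg 2;Sg 4]); (1, [:: Sg 0;Sg 3;Sg 4]); (1, [:: Sg 0;Xg 4 1;Sg 5]);
(1, [:: Sg 5;Kg 4 1])]) (Lp 2 [:: (1, [:: Sg 2;Sg 3]); (1, [:: Sg 0;Sg 2;Sg 4]); (1, [:: Sg 0;Sg
3;Sg 4]); (1, [:: Xg 0 5;Xg 4 1]); (1, [:: Sg 1;Kg 0 5]); (1, [:: Sg 5;Kg 4 1])])) (Cl 4))) (Br 1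
3 (Br 1 4 (Lp 1 [:: (1, [:: Sg 4;Sg 5]); (1, [:: Sg 0;Sg 2;Sg 4]); (1, [:: Sg 1;Sg 3;Sg 4])]) (Br
1 5 (Lp 1 [:: (1, [:: Sg 3;Xg 4 1]); (1, [:: Sg 0;Sg 2;Sg 4]); (1, [:: Sg 5;Kg 4 1])]) (Cl 4)))
(Cl 0))) (Br 3 5 (Br 1 3 (Br 1 4 (Lp 1 [:: (1, [:: Sg 0;Sg 2;Sg 4]); (1, [:: Sg 1;Xg 4 3]); (1,
[:: Sg 5;Kg 4 3])]) (Br 1 5 (Lp 1 [:: (1, [:: Sg 0;Sg 2;Sg 4]); (1, [:: Sg 1;Sg 3;Sg 5])]) (Cl
4))) (Br 1 2 (Br 1 5 (Br 2 5 (Lp 1 [:: (1, [:: Sg 2;Sg 3]); (1, [:: Sg 0;Sg 2;Sg 4]); (1, [:: Sg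
1;Sg 2;Sg 5])]) (Lp 1 [:: (1, [:: Sg 0;Sg 2;Sg 4]); (1, [:: Sg 1;Xg 2 5]); (1, [:: Sg 3;Kg 2
5])])) (Cl 4)) (Cl 2))) (Cl 4))) (Br 0 5 (Br 1 4 (Br 0 3 (Br 3 5 (Lp 1 [:: (1, [:: Sg 2;Xg 0 4]);
(1, [:: Sg 0;Sg 3;Sg 5]); (1, [:: Sg 1;Kg 0 4])]) (Br 2 5 (Br 3 4 (Lp 1 [:: (1, [:: Sg 0;Sg 1]);
(1, [:: Kg 0 4;Sg 2;Sg 5]); (1, [:: Sg 3;Xg 0 4])]) (Cl 4)) (Cl 2))) (Br 1 3 (Br 3 4 (Lp 1 [:: (1,
[:: Sg 2;Xg 4 0]); (1, [:: Sg 1;Sg 3;Sg 4]); (1, [:: Sg 5;Kg 4 0])]) (Br 3 5 (Br 2 5 (Br 1 2 (Lp 1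
[:: (1, [:: Sg 2;Sg 3]); (1, [:: Sg 0;Sg 2;Sg 5]); (1, [:: Sg 1;Sg 2;Sg 4])]) (Lp 1 [:: (1, [:: Sg
0;Sg 2;Sg 5]); (1, [:: Sg 4;Xg 2 1]); (1, [:: Sg 3;Kg 2 1])])) (Br 1 2 (Lp 1 [:: (1, [:: Sg 1;Sg
2;Sg 4]); (1, [:: Sg 0;Xg 2 5]); (1, [:: Sg 3;Kg 2 5])]) (Tg 2))) (Cl 4))) (Cl 0))) (Cl 0)) (Cl
4))) (Br 2 5 (Br 3 4 (Br 0 4 (Br 1 2 (Br 1 5 (Lp 1 [:: (1, [:: Sg 0;Xg 2 4]); (1, [:: Sg 1;Sg 2;Sg
5]); (1, [:: Sg 3;Kg 2 4])]) (Br 0 5 (Br 1 4 (Lp 1 [:: (1, [:: Sg 2;Sg 3]); (1, [:: Sg 0;Kg 2 4;Sg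
5]); (1, [:: Sg 1;Xg 2 4])]) (Cl 4)) (Cl 0))) (Br 1 3 (Br 1 4 (Lp 1 [:: (1, [:: Sg 0;Xg 4 2]); (1,
[:: Sg 1;Sg 3;Sg 4]); (1, [:: Sg 5;Kg 4 2])]) (Br 1 5 (Br 0 5 (Br 0 3 (Lp 1 [:: (1, [:: Sg 0;Sg
1]); (1, [:: Sg 0;Sg 2;Sg 5]); (1, [:: Sg 0;Sg 3;Sg 4])]) (Lp 1 [:: (1, [:: Sg 0;Sg 2;Sg 5]); (1,
[:: Sg 4;Xg 0 3]); (1, [:: Sg 1;Kg 0 3])])) (Br 0 3 (Lp 1 [:: (1, [:: Sg 0;Sg 3;Sg 4]); (1, [:: Sg
2;Xg 0 5]); (1, [:: Sg 1;Kg 0 5])]) (Tg 3))) (Cl 4))) (Cl 2))) (Br 0 5 (Br 1 4 (Br 1 2 (Lp 1 [::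
(1, [:: Sg 0;Sg 2;Sg 5]); (1, [:: Sg 1;Xg 2 4]); (1, [:: Sg 3;Kg 2 4])]) (Cl 0)) (Cl 0)) (Cl 4)))
(Cl 2)) (Cl 4))) (Br 0 3 (Br 1 2 (Br 2 4 (Br 0 4 (Br 1 3 (Br 2 5 (Br 1 5 (Lp 1 [:: (1, [:: Sg 4;Xg
2 0]); (1, [:: Sg 1;Sg 2;Sg 5]); (1, [:: Sg 3;Kg 2 0])]) (Br 1 4 (Lp 2 [:: (1, [:: Sg 0;Sg 1]);
(1, [:: Sg 4;Sg 5]); (1, [:: Sg 2;Xg 1 5]); (1, [:: Sg 1;Sg 3;Xg 2 0]); (1, [:: Kg 1 5;Sg 2;Sg
4]); (1, [:: Sg 3;Kg 2 0])]) (Cl 4))) (Br 3 5 (Br 0 5 (Lp 1 [:: (1, [:: Sg 4;Xg 0 2]); (1, [:: Sg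
0;Sg 3;Sg 5]); (1, [:: Sg 1;Kg 0 2])]) (Br 1 5 (Br 3 4 (Lp 1 [:: (1, [:: Sg 2;Sg 3]); (1, [:: Sg
0;Sg 3;Sg 4]); (1, [:: Sg 1;Sg 3;Sg 5])]) (Lp 1 [:: (1, [:: Sg 0;Xg 3 4]); (1, [:: Sg 2;Kg 3 4]);
(1, [:: Sg 1;Sg 3;Sg 5])])) (Cl 0))) (Cl 2))) (Br 3 4 (Br 1 4 (Lp 1 [:: (1, [:: Sg 4;Sg 5]); (1,
[:: Sg 0;Sg 3;Sg 4]); (1, [:: Sg 1;Sg 2;Sg 4])]) (Br 1 5 (Lp 1 [:: (1, [:: Sg 2;Xg 4 1]); (1, [::
Sg 0;Sg 3;Sg 4]); (1, [:: Sg 5;Kg 4 1])]) (Cl 4))) (Br 2 5 (Br 1 5 (Lp 1 [:: (1, [:: Sg 4;Xg 2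
0]); (1, [:: Sg 1;Sg 2;Sg 5]); (1, [:: Sg 3;Kg 2 0])]) (Cl 4)) (Tg 1)))) (Br 1 4 (Br 3 4 (Br 0 5
(Lp 1 [:: (1, [:: Sg 3;Xg 4 0]); (1, [:: Sg 1;Sg 2;Sg 4]); (1, [:: Sg 5;Kg 4 0])]) (Cl 4)) (Cl 2))
(Cl 0))) (Br 3 4 (Br 2 5 (Br 0 5 (Br 0 4 (Lp 1 [:: (1, [:: Sg 0;Sg 3;Sg 4]); (1, [:: Sg 5;Xg 0
2]); (1, [:: Sg 1;Kg 0 2])]) (Br 1 4 (Br 3 5 (Br 1 5 (Lp 1 [:: (1, [:: Sg 4;Sg 5]); (1, [:: Sg
0;Sg 3;Sg 5]); (1, [:: Sg 1;Sg 2;Sg 5])]) (Lp 1 [:: (1, [:: Sg 0;Sg 3;Sg 5]); (1, [:: Sg 2;Xg 5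
1]); (1, [:: Sg 4;Kg 5 1])])) (Br 1 3 (Lp 1 [:: (1, [:: Sg 1;Sg 3;Sg 4]); (1, [:: Sg 0;Xg 3 5]);
(1, [:: Sg 2;Kg 3 5])]) (Tg 0))) (Cl 0))) (Cl 4)) (Cl 4)) (Cl 2))) (Cl 0)) (Cl 2)).

Definition cert_01_12_023 :=
Br 0 2 (Br 2 4 (Br 0 4 (Br 3 4 (Br 0 3 (Br 1 6 (Br 2 5 (Br 0 6 (Lp 1 [:: (1, [:: Sg 0;Sg 1]); (1,
[:: Sg 0;Sg 3;Sg 4]); (1, [:: Sg 0;Sg 2;Sg 5;Sg 6])]) (Lp 1 [:: (1, [:: Sg 0;Sg 3;Sg 4]); (1, [::
Sg 2;Sg 5;Xg 0 6]); (1, [:: Sg 1;Kg 0 6])])) (Lp 1 [:: (1, [:: Sg 2;Sg 3]); (1, [:: Sg 1;Xg 2 5;Sg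
6]); (1, [:: Sg 0;Kg 2 5;Sg 4])])) (Lp 1 [:: (1, [:: Sg 0;Sg 3;Sg 4]); (1, [:: Sg 4;Sg 5;Sg 6]);
(1, [:: Sg 1;Sg 2;Sg 4])])) (Lp 1 [:: (1, [:: Sg 0;Sg 1]); (1, [:: Xg 0 3;Sg 5;Sg 6]); (1, [:: Kg
0 3;Sg 2;Sg 4])])) (Br 1 6 (Br 1 3 (Lp 1 [:: (1, [:: Sg 0;Sg 2;Sg 4]); (1, [:: Sg 1;Sg 3;Sg 5;Sg
6])]) (Br 1 2 (Br 2 5 (Lp 1 [:: (1, [:: Sg 2;Sg 3]); (1, [:: Sg 0;Sg 2;Sg 4]); (1, [:: Sg 1;Sg
2;Sg 5;Sg 6])]) (Lp 1 [:: (1, [:: Sg 2;Sg 3]); (1, [:: Sg 1;Xg 2 5;Sg 6]); (1, [:: Sg 0;Kg 2 5;Sg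
4])])) (Cl 2))) (Lp 2 [:: (1, [:: Sg 0;Sg 1]); (1, [:: Sg 0;Sg 2;Sg 4]); (1, [:: Sg 4;Sg 5;Sg 6]);
(1, [:: Sg 1;Sg 2;Kg 4 3]); (1, [:: Sg 3;Sg 5;Xg 1 6]); (1, [:: Kg 1 6;Xg 4 3])]))) (Br 1 4 (Br 3
5 (Br 0 3 (Lp 1 [:: (1, [:: Sg 2;Xg 0 4]); (1, [:: Sg 0;Sg 3;Sg 5;Sg 6]); (1, [:: Sg 1;Kg 0 4])])
(Br 1 3 (Br 3 4 (Lp 1 [:: (1, [:: Sg 2;Xg 4 0]); (1, [:: Sg 1;Sg 3;Sg 4]); (1, [:: Kg 4 0;Sg 5;Sg
6])]) (Br 1 2 (Br 2 5 (Lp 1 [:: (1, [:: Sg 2;Sg 3]); (1, [:: Sg 1;Sg 2;Sg 4]); (1, [:: Sg 0;Sg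
2;Sg 5;Sg 6])]) (Lp 1 [:: (1, [:: Sg 2;Sg 3]); (1, [:: Sg 0;Xg 2 5;Sg 6]); (1, [:: Sg 1;Kg 2 5;Sg
4])])) (Lp 1 [:: (1, [:: Sg 4;Sg 5;Sg 6]); (1, [:: Sg 0;Sg 2;Sg 5;Sg 6]); (1, [:: Sg 1;Sg 3;Sg
5;Sg 6])]))) (Cl 0))) (Lp 1 [:: (1, [:: Sg 2;Xg 4 0]); (1, [:: Sg 4;Sg 5;Sg 6]); (1, [:: Sg 1;Sg
3;Kg 4 0])])) (Cl 0))) (Br 3 4 (Br 0 6 (Br 1 6 (Br 3 5 (Br 1 2 (Lp 2 [:: (1, [:: Sg 0;Sg 1]); (1,
[:: Sg 4;Sg 5;Sg 6]); (1, [:: Sg 0;Sg 2;Sg 5;Sg 6]); (1, [:: Xg 2 4;Sg 3;Sg 5;Sg 6]); (1, [:: Sg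
1;Sg 2;Sg 5;Sg 6]); (1, [:: Sg 3;Kg 2 4])]) (Br 1 3 (Lp 1 [:: (1, [:: Sg 4;Sg 5;Sg 6]); (1, [:: Sg
0;Sg 2;Sg 5;Sg 6]); (1, [:: Sg 1;Sg 3;Sg 5;Sg 6])]) (Cl 2))) (Lp 1 [:: (1, [:: Sg 0;Sg 2;Sg 5;Sg
6]); (1, [:: Sg 1;Xg 5 3;Sg 6]); (1, [:: Sg 4;Kg 5 3;Sg 6])])) (Lp 1 [:: (1, [:: Sg 0;Sg 2;Sg 5;Sg
6]); (1, [:: Sg 1;Sg 3;Sg 4])])) (Lp 1 [:: (1, [:: Sg 0;Sg 1]); (1, [:: Sg 2;Sg 5;Xg 0 6]); (1,
[:: Kg 0 6;Sg 3;Sg 4])])) (Cl 2))) (Br 0 3 (Br 1 2 (Br 1 3 (Br 2 4 (Br 1 4 (Lp 1 [:: (1, [:: Xg 2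
0;Sg 5;Sg 6]); (1, [:: Sg 1;Sg 2;Sg 4]); (1, [:: Sg 3;Kg 2 0])]) (Lp 2 [:: (1, [:: Sg 0;Sg 1]);
(1, [:: Sg 1;Sg 3;Xg 2 0]); (1, [:: Sg 4;Sg 5;Sg 6]); (1, [:: Sg 2;Xg 1 4]); (1, [:: Kg 1 4;Sg
2;Sg 5;Sg 6]); (1, [:: Sg 3;Kg 2 0])])) (Br 3 4 (Br 0 4 (Lp 1 [:: (1, [:: Xg 0 2;Sg 5;Sg 6]); (1,
[:: Sg 0;Sg 3;Sg 4]); (1, [:: Sg 1;Kg 0 2])]) (Br 1 6 (Br 3 5 (Lp 1 [:: (1, [:: Sg 4;Sg 5;Sg 6]);
(1, [:: Sg 1;Sg 2;Sg 5;Sg 6]); (1, [:: Sg 0;Sg 3;Sg 5;Sg 6])]) (Lp 1 [:: (1, [:: Sg 1;Sg 2;Sg 5;Sg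
6]); (1, [:: Sg 0;Xg 5 3;Sg 6]); (1, [:: Sg 4;Kg 5 3;Sg 6])])) (Lp 1 [:: (1, [:: Sg 0;Sg 1]); (1,
[:: Sg 2;Sg 5;Xg 1 6]); (1, [:: Kg 1 6;Sg 3;Sg 4])]))) (Cl 2))) (Lp 1 [:: (1, [:: Sg 4;Sg 5;Sg
6]); (1, [:: Sg 0;Sg 3;Sg 5;Sg 6]); (1, [:: Sg 1;Sg 2;Sg 5;Sg 6])])) (Cl 0)) (Cl 2)).

Definition cert_01_123_023 :=
Br 2 5 (Br 4 7 (Br 0 5 (Br 0 2 (Br 1 5 (Br 1 2 (Br 3 5 (Br 0 4 (Lp 1 [:: (1, [:: Sg 1;Sg 2;Sg 5]);
(1, [:: Sg 5;Sg 6;Sg 7]); (1, [:: Sg 0;Sg 4;Sg 3;Sg 5])]) (Br 1 4 (Lp 1 [:: (1, [:: Sg 5;Sg 2;Sg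
4;Sg 7]); (1, [:: Sg 1;Sg 2;Sg 3;Xg 4 0]); (1, [:: Sg 1;Kg 4 0;Sg 6;Sg 5])]) (Cl 0))) (Br 2 6 (Br
3 6 (Lp 1 [:: (1, [:: Sg 5;Sg 2;Sg 4;Sg 7]); (1, [:: Sg 1;Sg 2;Sg 6;Xg 5 3]); (1, [:: Sg 0;Sg 2;Kg
5 3])]) (Br 0 4 (Lp 1 [:: (1, [:: Sg 5;Sg 6;Sg 7]); (1, [:: Sg 0;Sg 4;Xg 5 3]); (1, [:: Sg 1;Sg
2;Kg 5 3])]) (Br 1 4 (Lp 1 [:: (1, [:: Sg 5;Sg 2;Sg 4;Sg 7]); (1, [:: Sg 1;Sg 2;Sg 3;Xg 4 0]); (1,
[:: Sg 1;Kg 4 0;Sg 6;Sg 5])]) (Cl 0)))) (Lp 1 [:: (1, [:: Sg 5;Sg 2;Sg 4;Sg 7]); (1, [:: Sg 1;Xg 2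
6;Xg 5 3]); (1, [:: Sg 0;Kg 2 6;Kg 5 3])]))) (Lp 1 [:: (1, [:: Sg 2;Sg 3;Sg 4]); (1, [:: Xg 2 1;Sg
6;Sg 7]); (1, [:: Sg 0;Kg 2 1;Sg 5])])) (Lp 1 [:: (1, [:: Sg 0;Sg 2;Sg 5]); (1, [:: Xg 5 1;Sg 3;Sg
4]); (1, [:: Kg 5 1;Sg 6;Sg 7])])) (Br 1 2 (Br 3 5 (Lp 1 [:: (1, [:: Sg 0;Sg 1]); (1, [:: Kg 0
2;Sg 4;Sg 3;Sg 5]); (1, [:: Xg 0 2;Sg 6;Sg 7])]) (Lp 1 [:: (1, [:: Xg 2 0;Sg 6;Sg 7]); (1, [:: Kg
2 0;Sg 3;Sg 4]); (1, [:: Sg 1;Sg 2;Sg 5])])) (Cl 0))) (Br 1 5 (Br 1 2 (Lp 1 [:: (1, [:: Kg 5 0;Sg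
6;Sg 7]); (1, [:: Xg 5 0;Sg 3;Sg 4]); (1, [:: Sg 1;Sg 2;Sg 5])]) (Lp 1 [:: (1, [:: Sg 5;Sg 2;Sg
4;Sg 7]); (1, [:: Sg 1;Xg 5 0;Sg 6;Sg 7]); (1, [:: Sg 1;Sg 4;Sg 3;Kg 5 0])])) (Cl 0))) (Br 3 5 (Br
0 5 (Br 0 2 (Br 1 5 (Br 1 4 (Lp 1 [:: (1, [:: Sg 0;Sg 2;Sg 5]); (1, [:: Sg 5;Sg 3;Sg 7]); (1, [::
Sg 1;Sg 4;Sg 6;Sg 5])]) (Br 0 4 (Lp 1 [:: (1, [:: Sg 1;Sg 2;Sg 5]); (1, [:: Sg 5;Sg 3;Sg 7]); (1,
[:: Sg 0;Sg 4;Sg 6;Sg 5])]) (Cl 0))) (Lp 1 [:: (1, [:: Sg 0;Sg 2;Sg 5]); (1, [:: Xg 5 1;Sg 6;Sg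
4]); (1, [:: Kg 5 1;Sg 3;Sg 7])])) (Lp 1 [:: (1, [:: Sg 0;Sg 1]); (1, [:: Xg 0 2;Sg 6;Sg 7]); (1,
[:: Kg 0 2;Sg 4;Sg 3;Sg 5])])) (Br 1 5 (Br 1 7 (Lp 1 [:: (1, [:: Xg 7 4;Sg 2;Sg 5]); (1, [:: Sg
1;Xg 5 0;Sg 6;Sg 7]); (1, [:: Kg 5 0;Sg 3;Kg 7 4])]) (Lp 1 [:: (1, [:: Xg 5 0;Sg 6;Sg 4]); (1, [::
Sg 1;Sg 2;Sg 5]); (1, [:: Kg 5 0;Sg 3;Sg 7])])) (Cl 0))) (Br 0 2 (Br 1 4 (Lp 1 [:: (1, [:: Sg 0;Sg
2;Kg 5 3]); (1, [:: Sg 5;Sg 6;Sg 7]); (1, [:: Sg 1;Sg 4;Xg 5 3])]) (Br 0 4 (Lp 1 [:: (1, [:: Sg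
1;Sg 2;Kg 5 3]); (1, [:: Sg 5;Sg 6;Sg 7]); (1, [:: Sg 0;Sg 4;Xg 5 3])]) (Cl 0))) (Lp 1 [:: (1, [::
Sg 0;Sg 1]); (1, [:: Xg 0 2;Sg 3;Sg 7]); (1, [:: Kg 0 2;Sg 4;Sg 6;Sg 5])])))) (Br 0 2 (Br 0 5 (Br
1 5 (Br 1 2 (Br 0 7 (Lp 1 [:: (1, [:: Sg 1;Xg 2 5]); (1, [:: Sg 2;Sg 3;Sg 4]); (1, [:: Sg 0;Kg 2
5;Sg 6;Sg 7])]) (Br 1 7 (Lp 1 [:: (1, [:: Sg 0;Xg 2 5]); (1, [:: Sg 1;Sg 2;Sg 6;Sg 7]); (1, [:: Kg
2 5;Sg 3;Sg 4])]) (Cl 0))) (Lp 1 [:: (1, [:: Sg 0;Xg 5 2]); (1, [:: Sg 1;Sg 4;Sg 3;Sg 5]); (1, [::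
Kg 5 2;Sg 6;Sg 7])])) (Br 1 2 (Lp 1 [:: (1, [:: Sg 0;Xg 2 5]); (1, [:: Sg 1;Sg 2;Sg 6;Sg 7]); (1,
[:: Kg 2 5;Sg 3;Sg 4])]) (Br 3 7 (Br 4 6 (Br 0 7 (Br 0 4 (Lp 1 [:: (1, [:: Sg 0;Sg 1]); (1, [:: Sg
0;Sg 2;Sg 6;Sg 7]); (1, [:: Sg 0;Sg 4;Sg 3;Sg 5])]) (Lp 1 [:: (1, [:: Sg 0;Sg 2;Sg 6;Sg 7]); (1,
[:: Sg 5;Sg 3;Xg 0 4]); (1, [:: Sg 1;Kg 0 4])])) (Br 0 4 (Lp 1 [:: (1, [:: Sg 0;Sg 4;Sg 6;Sg 5]);
(1, [:: Sg 2;Sg 3;Xg 0 7]); (1, [:: Sg 1;Kg 0 7])]) (Tg 1))) (Lp 1 [:: (1, [:: Sg 2;Sg 3;Sg 4]);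
(1, [:: Sg 0;Xg 4 6;Sg 5]); (1, [:: Sg 1;Kg 4 6;Sg 7])])) (Lp 1 [:: (1, [:: Sg 5;Sg 6;Sg 7]); (1,
[:: Sg 0;Sg 2;Xg 7 3]); (1, [:: Sg 1;Sg 4;Kg 7 3])])))) (Br 1 5 (Lp 1 [:: (1, [:: Xg 0 5;Sg 3;Sg
4]); (1, [:: Sg 0;Sg 2;Sg 6;Sg 7]); (1, [:: Sg 1;Kg 0 5])]) (Cl 0))) (Br 1 2 (Br 0 5 (Lp 1 [:: (1,
[:: Sg 0;Sg 4;Sg 3;Sg 5]); (1, [:: Xg 0 2;Sg 6;Sg 7]); (1, [:: Sg 1;Kg 0 2])]) (Br 1 5 (Br 3 7 (Br
4 6 (Br 1 7 (Br 1 4 (Lp 1 [:: (1, [:: Sg 0;Sg 1]); (1, [:: Sg 1;Sg 2;Sg 6;Sg 7]); (1, [:: Sg 1;Sg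
4;Sg 3;Sg 5])]) (Lp 1 [:: (1, [:: Sg 1;Sg 2;Sg 6;Sg 7]); (1, [:: Sg 5;Sg 3;Xg 1 4]); (1, [:: Sg
0;Kg 1 4])])) (Br 1 4 (Lp 1 [:: (1, [:: Sg 1;Sg 4;Sg 6;Sg 5]); (1, [:: Sg 2;Sg 3;Xg 1 7]); (1, [::
Sg 0;Kg 1 7])]) (Tg 0))) (Lp 1 [:: (1, [:: Sg 2;Sg 3;Sg 4]); (1, [:: Sg 1;Xg 4 6;Sg 5]); (1, [::
Sg 0;Kg 4 6;Sg 7])])) (Lp 1 [:: (1, [:: Sg 5;Sg 6;Sg 7]); (1, [:: Sg 1;Sg 2;Xg 7 3]); (1, [:: Sg
0;Sg 4;Kg 7 3])])) (Cl 0))) (Cl 0))).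

Definition cert_trios :=
Br 0 3 (Br 3 6 (Br 0 6 (Br 1 8 (Br 3 8 (Br 2 8 (Br 1 3 (Br 1 11 (Br 7 9 (Br 1 7 (Lp 1 [:: (1, [::
Sg 9;Sg 10;Sg 11]); (1, [:: Sg 3;Sg 4;Sg 5]); (1, [:: Sg 3;Sg 0;Sg 2;Sg 8]); (1, [:: Sg 6;Sg 7;Sg
1;Sg 3])]) (Br 4 7 (Lp 1 [:: (1, [:: Sg 9;Sg 10;Sg 11]); (1, [:: Sg 3;Sg 0;Sg 2;Sg 8]); (1, [:: Sg
6;Sg 7;Sg 4;Sg 3]); (1, [:: Sg 3;Sg 1;Sg 5])]) (Br 0 9 (Br 0 11 (Br 6 10 (Br 4 10 (Lp 1 [:: (1,
[:: Sg 9;Xg 1 7;Sg 11]); (1, [:: Sg 0;Sg 1;Sg 2]); (1, [:: Sg 6;Sg 10;Sg 4;Sg 8]); (1, [:: Sg 3;Kg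
1 7;Sg 5])]) (Br 7 10 (Lp 1 [:: (1, [:: Sg 9;Xg 7 4;Sg 11]); (1, [:: Sg 0;Sg 1;Sg 2]); (1, [:: Sg
3;Sg 10;Sg 7;Sg 5]); (1, [:: Sg 6;Kg 7 4;Sg 8])]) (Br 5 6 (Br 2 9 (Br 0 4 (Lp 1 [:: (1, [:: Sg
6;Sg 7;Sg 8]); (1, [:: Sg 9;Sg 2;Sg 1;Sg 11]); (1, [:: Sg 6;Sg 0;Sg 4;Sg 5]); (1, [:: Sg 6;Sg
10;Sg 3])]) (Br 2 4 (Lp 1 [:: (1, [:: Sg 6;Sg 7;Sg 5]); (1, [:: Sg 6;Sg 0;Sg 1;Sg 8]); (1, [:: Sg
9;Sg 2;Sg 4;Sg 11]); (1, [:: Sg 6;Sg 10;Sg 3])]) (Cl 0))) (Lp 1 [:: (1, [:: Sg 6;Sg 7;Sg 5]); (1,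
[:: Sg 3;Sg 10;Sg 2;Sg 8]); (1, [:: Sg 0;Sg 1;Kg 2 9]); (1, [:: Sg 11;Sg 4;Xg 2 9])])) (Br 3 9 (Br
5 9 (Br 6 9 (Lp 1 [:: (1, [:: Sg 6;Sg 7;Sg 8]); (1, [:: Sg 0;Sg 1;Sg 2]); (1, [:: Sg 9;Xg 6 5;Sg
4;Sg 11]); (1, [:: Kg 6 5;Sg 10;Sg 3])]) (Br 1 10 (Lp 1 [:: (1, [:: Sg 9;Sg 7;Sg 5]); (1, [:: Sg
3;Sg 0;Sg 2;Sg 8]); (1, [:: Sg 6;Sg 10;Sg 1;Sg 8]); (1, [:: Sg 11;Sg 4;Sg 5])]) (Br 5 8 (Lp 1 [::
(1, [:: Sg 9;Sg 7;Sg 5]); (1, [:: Sg 0;Sg 1;Sg 2]); (1, [:: Sg 3;Sg 10;Xg 5 6;Sg 8]); (1, [:: Sg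
11;Sg 4;Kg 5 6])]) (Br 2 6 (Br 0 7 (Lp 1 [:: (1, [:: Sg 9;Sg 10;Sg 11]); (1, [:: Sg 3;Sg 4;Sg 8]);
(1, [:: Sg 6;Sg 2;Sg 1;Sg 3]); (1, [:: Sg 3;Sg 0;Sg 7;Sg 5])]) (Br 2 4 (Lp 1 [:: (1, [:: Sg 6;Sg
10;Sg 11]); (1, [:: Sg 6;Sg 7;Sg 8]); (1, [:: Sg 9;Sg 0;Sg 1;Sg 5]); (1, [:: Sg 6;Sg 2;Sg 4;Sg
3])]) (Cl 0))) (Tg 1))))) (Br 2 5 (Br 2 6 (Br 1 10 (Lp 1 [:: (1, [:: Sg 6;Sg 7;Sg 8]); (1, [:: Sg
11;Sg 0;Sg 2;Sg 5]); (1, [:: Sg 10;Sg 1;Xg 5 9]); (1, [:: Sg 3;Sg 4;Kg 5 9])]) (Br 0 4 (Lp 1 [::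
(1, [:: Sg 9;Sg 10;Sg 11]); (1, [:: Sg 6;Sg 7;Sg 8]); (1, [:: Kg 6 5;Sg 2;Sg 1;Sg 3]); (1, [:: Sg
0;Sg 4;Xg 6 5])]) (Br 2 4 (Lp 1 [:: (1, [:: Sg 9;Sg 10;Sg 11]); (1, [:: Sg 6;Sg 0;Sg 1;Sg 8]); (1,
[:: Kg 6 5;Sg 2;Sg 4;Sg 3]); (1, [:: Sg 7;Xg 6 5])]) (Cl 0)))) (Tg 1)) (Tg 1))) (Lp 1 [:: (1, [::
Sg 9;Sg 10;Sg 11]); (1, [:: Sg 0;Sg 1;Sg 2]); (1, [:: Sg 6;Xg 9 3;Sg 4;Sg 8]); (1, [:: Kg 9 3;Sg
7;Sg 5])]))))) (Lp 1 [:: (1, [:: Sg 6;Sg 2;Sg 1;Sg 3]); (1, [:: Xg 6 10;Sg 4;Sg 8]); (1, [:: Kg 6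
10;Sg 7;Sg 5]); (1, [:: Sg 9;Sg 0;Sg 11])])) (Lp 1 [:: (1, [:: Sg 9;Sg 10;Sg 11]); (1, [:: Sg 0;Sg
1;Sg 2]); (1, [:: Sg 6;Sg 0;Sg 4;Sg 8]); (1, [:: Sg 3;Sg 0;Sg 7;Sg 5])])) (Lp 1 [:: (1, [:: Sg
9;Sg 10;Sg 11]); (1, [:: Sg 9;Sg 2;Sg 1;Sg 11]); (1, [:: Sg 6;Sg 0;Sg 4;Sg 8]); (1, [:: Sg 3;Sg
0;Sg 7;Sg 5])])))) (Lp 1 [:: (1, [:: Sg 9;Sg 10;Sg 11]); (1, [:: Sg 3;Sg 4;Sg 5]); (1, [:: Sg 3;Sg
0;Sg 2;Sg 8]); (1, [:: Sg 6;Sg 7;Sg 1;Sg 3])])) (Lp 1 [:: (1, [:: Sg 9;Sg 10;Sg 11]); (1, [:: Sg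
3;Sg 4;Sg 5]); (1, [:: Sg 3;Sg 0;Sg 2;Sg 8]); (1, [:: Sg 6;Sg 7;Sg 1;Sg 3])])) (Lp 1 [:: (1, [::
Sg 9;Sg 10;Sg 11]); (1, [:: Sg 3;Sg 4;Sg 5]); (1, [:: Sg 6;Sg 7;Xg 3 1]); (1, [:: Kg 3 1;Sg 0;Sg
2;Sg 8])])) (Br 2 6 (Br 0 9 (Br 1 5 (Br 5 9 (Lp 1 [:: (1, [:: Sg 9;Sg 10;Sg 11]); (1, [:: Sg 6;Sg
7;Sg 8]); (1, [:: Sg 6;Sg 2;Sg 4;Sg 3]); (1, [:: Sg 9;Sg 0;Sg 1;Sg 5])]) (Br 2 5 (Lp 1 [:: (1, [::
Sg 6;Sg 7;Sg 8]); (1, [:: Sg 0;Sg 1;Xg 5 9]); (1, [:: Sg 11;Sg 10;Sg 2;Sg 5]); (1, [:: Sg 3;Sg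
4;Kg 5 9])]) (Br 2 9 (Lp 1 [:: (1, [:: Sg 6;Sg 7;Sg 8]); (1, [:: Sg 0;Sg 1;Xg 9 5]); (1, [:: Sg
9;Sg 2;Sg 4;Sg 3]); (1, [:: Kg 9 5;Sg 10;Sg 11])]) (Br 3 10 (Br 5 6 (Lp 1 [:: (1, [:: Sg 9;Sg
10;Sg 11]); (1, [:: Sg 6;Sg 7;Sg 8]); (1, [:: Sg 6;Sg 2;Sg 4;Sg 3]); (1, [:: Sg 6;Sg 0;Sg 1;Sg
5])]) (Br 2 7 (Br 7 9 (Br 8 9 (Lp 1 [:: (1, [:: Sg 3;Sg 4;Sg 5]); (1, [:: Sg 6;Sg 0;Sg 1;Kg 8 2]);
(1, [:: Sg 9;Sg 7;Sg 8]); (1, [:: Xg 8 2;Sg 10;Sg 11])]) (Br 5 7 (Br 5 8 (Lp 1 [:: (1, [:: Sg 9;Sg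
10;Sg 11]); (1, [:: Sg 0;Sg 1;Xg 6 5]); (1, [:: Sg 6;Sg 2;Sg 4;Sg 3]); (1, [:: Kg 6 5;Sg 7;Sg
8])]) (Br 7 10 (Lp 1 [:: (1, [:: Sg 9;Sg 0;Sg 3]); (1, [:: Sg 6;Sg 0;Sg 1;Sg 8]); (1, [:: Sg 6;Sg
2;Sg 4;Sg 3]); (1, [:: Sg 11;Sg 10;Sg 7;Sg 5])]) (Br 4 7 (Lp 1 [:: (1, [:: Sg 11;Xg 7 10;Sg 5]);
(1, [:: Sg 6;Sg 0;Sg 1;Sg 8]); (1, [:: Sg 9;Sg 7;Sg 4;Sg 3]); (1, [:: Sg 2;Kg 7 10])]) (Tg 1))))
(Cl 6))) (Cl 6)) (Cl 6))) (Lp 1 [:: (1, [:: Sg 9;Sg 0;Sg 3]); (1, [:: Sg 3;Sg 4;Sg 5]); (1, [:: Sg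
6;Sg 2;Sg 1;Sg 3]); (1, [:: Sg 11;Sg 10;Sg 7;Sg 8])]))))) (Lp 1 [:: (1, [:: Sg 9;Sg 10;Sg 11]);
(1, [:: Sg 6;Sg 0;Sg 1;Sg 8]); (1, [:: Sg 6;Sg 2;Sg 4;Sg 3]); (1, [:: Sg 6;Sg 7;Sg 5])])) (Lp 1
[:: (1, [:: Sg 3;Sg 4;Sg 5]); (1, [:: Sg 9;Sg 7;Sg 8]); (1, [:: Xg 8 2;Sg 10;Sg 11]); (1, [:: Sg
6;Sg 0;Sg 1;Kg 8 2])])) (Br 0 9 (Br 3 9 (Br 2 7 (Br 1 5 (Br 5 9 (Lp 1 [:: (1, [:: Sg 6;Sg 7;Sg
8]); (1, [:: Sg 3;Sg 4;Xg 6 2]); (1, [:: Sg 9;Sg 0;Sg 1;Sg 5]); (1, [:: Kg 6 2;Sg 10;Sg 11])]) (Br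
2 5 (Lp 1 [:: (1, [:: Sg 6;Sg 7;Sg 8]); (1, [:: Sg 11;Sg 10;Sg 2;Sg 5]); (1, [:: Sg 0;Sg 1;Xg 5
9]); (1, [:: Sg 3;Sg 4;Kg 5 9])]) (Br 2 9 (Lp 1 [:: (1, [:: Sg 6;Sg 7;Sg 8]); (1, [:: Sg 9;Sg 2;Sg
4;Sg 3]); (1, [:: Sg 0;Sg 1;Xg 9 5]); (1, [:: Kg 9 5;Sg 10;Sg 11])]) (Br 5 7 (Br 7 9 (Br 1 11 (Br
1 3 (Br 4 11 (Br 3 10 (Br 0 11 (Br 5 6 (Br 8 9 (Lp 1 [:: (1, [:: Sg 3;Sg 4;Xg 6 2]); (1, [:: Sg
6;Sg 0;Sg 1;Sg 5]); (1, [:: Sg 9;Sg 7;Sg 8]); (1, [:: Kg 6 2;Sg 10;Sg 11])]) (Br 5 8 (Br 4 7 (Lp 2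
[:: (1, [:: Sg 5;Sg 8]); (1, [:: Sg 9;Sg 10;Sg 11]); (1, [:: Sg 6;Sg 7;Sg 5]); (1, [:: Sg 3;Sg
4;Xg 6 2]); (1, [:: Sg 0;Sg 1;Sg 2]); (1, [:: Sg 6;Sg 0;Sg 1;Sg 8]); (1, [:: Sg 9;Sg 7;Sg 4;Sg
11]); (1, [:: Kg 6 2;Sg 10;Sg 3])]) (Br 7 10 (Lp 1 [:: (1, [:: Sg 9;Xg 7 4;Sg 11]); (1, [:: Sg
6;Sg 0;Sg 1;Sg 8]); (1, [:: Sg 3;Sg 10;Sg 7;Sg 5]); (1, [:: Sg 2;Kg 7 4])]) (Tg 1))) (Br 1 7 (Br 4
10 (Lp 1 [:: (1, [:: Sg 3;Sg 4;Sg 5]); (1, [:: Sg 6;Sg 0;Sg 1;Sg 8]); (1, [:: Sg 9;Sg 7;Sg 1;Sg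
11]); (1, [:: Sg 10;Sg 4;Sg 2])]) (Br 7 10 (Lp 1 [:: (1, [:: Sg 2;Xg 10 4]); (1, [:: Sg 6;Sg 0;Sg
1;Sg 8]); (1, [:: Sg 11;Sg 10;Sg 7;Sg 5]); (1, [:: Sg 9;Kg 10 4;Sg 3])]) (Tg 1))) (Br 4 10 (Lp 1
[:: (1, [:: Sg 9;Xg 1 7;Sg 11]); (1, [:: Sg 3;Kg 1 7;Sg 5]); (1, [:: Sg 6;Sg 0;Sg 1;Sg 8]); (1,
[:: Sg 10;Sg 4;Sg 2])]) (Br 4 7 (Lp 1 [:: (1, [:: Sg 6;Sg 0;Sg 1;Sg 8]); (1, [:: Sg 9;Sg 7;Sg 4;Sg
11]); (1, [:: Sg 2;Xg 4 10]); (1, [:: Sg 3;Kg 4 10;Sg 5])]) (Tg 1)))))) (Br 6 9 (Br 4 7 (Br 1 10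
(Lp 1 [:: (1, [:: Sg 3;Sg 4;Sg 5]); (1, [:: Sg 6;Sg 0;Sg 1;Sg 8]); (1, [:: Sg 9;Sg 7;Sg 4;Sg 11]);
(1, [:: Sg 10;Sg 1;Sg 2])]) (Lp 1 [:: (1, [:: Sg 6;Sg 0;Sg 1;Sg 8]); (1, [:: Sg 9;Sg 7;Sg 4;Sg
11]); (1, [:: Sg 2;Xg 1 10]); (1, [:: Sg 3;Kg 1 10;Sg 5])])) (Br 7 10 (Lp 1 [:: (1, [:: Sg 6;Sg
0;Sg 1;Sg 8]); (1, [:: Sg 11;Sg 10;Sg 7;Sg 5]); (1, [:: Sg 9;Xg 7 4;Sg 3]); (1, [:: Sg 2;Kg 7
4])]) (Tg 1))) (Br 0 7 (Br 4 10 (Lp 1 [:: (1, [:: Sg 9;Sg 10;Sg 11]); (1, [:: Sg 6;Sg 0;Sg 1;Sg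
8]); (1, [:: Sg 3;Sg 0;Sg 7;Sg 5]); (1, [:: Sg 10;Sg 4;Sg 2])]) (Br 4 7 (Lp 1 [:: (1, [:: Sg 2;Xg
4 10]); (1, [:: Sg 6;Sg 0;Sg 1;Sg 8]); (1, [:: Sg 9;Sg 7;Sg 4;Sg 11]); (1, [:: Sg 3;Kg 4 10;Sg
5])]) (Tg 1))) (Br 4 10 (Lp 1 [:: (1, [:: Sg 9;Kg 0 7;Sg 11]); (1, [:: Sg 3;Xg 0 7;Sg 5]); (1, [::
Sg 6;Sg 0;Sg 1;Sg 8]); (1, [:: Sg 10;Sg 4;Sg 2])]) (Br 7 10 (Lp 1 [:: (1, [:: Sg 6;Sg 0;Sg 1;Sg
8]); (1, [:: Sg 11;Sg 10;Sg 7;Sg 5]); (1, [:: Sg 2;Xg 10 4]); (1, [:: Sg 9;Kg 10 4;Sg 3])]) (Tg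
1)))))) (Lp 1 [:: (1, [:: Sg 9;Sg 10;Sg 11]); (1, [:: Sg 6;Sg 0;Sg 1;Sg 8]); (1, [:: Sg 3;Sg 0;Sg
7;Sg 5]); (1, [:: Sg 0;Sg 4;Sg 2])])) (Lp 1 [:: (1, [:: Sg 6;Sg 0;Sg 1;Sg 8]); (1, [:: Sg 11;Sg
10;Sg 7;Sg 5]); (1, [:: Sg 10;Sg 4;Sg 2]); (1, [:: Sg 9;Sg 0;Sg 3])])) (Lp 1 [:: (1, [:: Sg 3;Sg
4;Sg 5]); (1, [:: Sg 6;Sg 0;Sg 1;Sg 8]); (1, [:: Sg 9;Sg 7;Xg 4 11]); (1, [:: Sg 10;Kg 4 11;Sg
2])])) (Lp 1 [:: (1, [:: Sg 3;Sg 4;Sg 5]); (1, [:: Sg 6;Sg 0;Sg 1;Sg 8]); (1, [:: Sg 9;Sg 7;Sg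
1;Sg 11]); (1, [:: Sg 10;Kg 1 3;Sg 2])])) (Lp 1 [:: (1, [:: Sg 3;Sg 4;Sg 5]); (1, [:: Sg 6;Sg 0;Sg
1;Sg 8]); (1, [:: Sg 9;Sg 7;Xg 1 11]); (1, [:: Sg 10;Kg 1 11;Sg 2])])) (Cl 6)) (Cl 6))))) (Lp 1
[:: (1, [:: Sg 9;Sg 10;Sg 11]); (1, [:: Sg 3;Sg 4;Xg 6 2]); (1, [:: Sg 6;Sg 0;Sg 1;Sg 8]); (1, [::
Kg 6 2;Sg 7;Sg 5])])) (Cl 6)) (Lp 1 [:: (1, [:: Sg 6;Sg 7;Sg 8]); (1, [:: Sg 3;Sg 4;Sg 5]); (1,
[:: Sg 9;Sg 0;Sg 1;Xg 6 2]); (1, [:: Kg 6 2;Sg 10;Sg 11])])) (Lp 1 [:: (1, [:: Xg 0 9;Sg 4;Sg 5]);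
(1, [:: Sg 3;Sg 0;Sg 7;Sg 8]); (1, [:: Kg 0 9;Sg 1;Sg 2]); (1, [:: Sg 6;Sg 10;Sg 11])])))) (Br 1
11 (Br 5 7 (Br 2 9 (Br 7 9 (Br 6 10 (Br 0 9 (Br 7 10 (Lp 1 [:: (1, [:: Sg 3;Sg 4;Sg 5]); (1, [::
Sg 6;Sg 0;Sg 1;Sg 8]); (1, [:: Sg 9;Sg 2;Sg 1;Sg 11]); (1, [:: Sg 3;Sg 10;Sg 7;Sg 5])]) (Br 0 7
(Lp 1 [:: (1, [:: Sg 3;Sg 4;Sg 5]); (1, [:: Sg 9;Sg 2;Sg 1;Sg 11]); (1, [:: Sg 0;Xg 3 8;Sg 7]);
(1, [:: Sg 6;Sg 10;Kg 3 8])]) (Br 6 11 (Br 1 7 (Lp 1 [:: (1, [:: Sg 3;Sg 4;Sg 5]); (1, [:: Sg 0;Xg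
3 8;Sg 2]); (1, [:: Sg 9;Sg 7;Sg 1;Sg 11]); (1, [:: Sg 6;Sg 10;Kg 3 8])]) (Br 2 7 (Br 4 8 (Br 4 7
(Lp 1 [:: (1, [:: Sg 9;Sg 10;Sg 11]); (1, [:: Sg 0;Xg 3 8;Sg 2]); (1, [:: Sg 6;Sg 7;Sg 4;Kg 3 8]);
(1, [:: Sg 3;Sg 1;Sg 5])]) (Br 4 10 (Lp 1 [:: (1, [:: Sg 0;Sg 1;Sg 2]); (1, [:: Sg 9;Sg 10;Sg 4;Sg
8]); (1, [:: Sg 3;Kg 1 7;Sg 5]); (1, [:: Sg 6;Xg 1 7;Sg 11])]) (Br 2 10 (Br 5 11 (Lp 1 [:: (1, [::
Sg 9;Sg 7;Kg 8 3]); (1, [:: Sg 10;Xg 8 3;Sg 2]); (1, [:: Sg 6;Sg 0;Sg 1;Sg 8]); (1, [:: Sg 11;Sg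
4;Sg 5])]) (Lp 1 [:: (1, [:: Sg 6;Sg 0;Sg 1;Sg 8]); (1, [:: Sg 3;Sg 10;Sg 2;Sg 5]); (1, [:: Sg
4;Xg 5 11]); (1, [:: Sg 9;Sg 7;Kg 5 11])])) (Cl 0)))) (Lp 1 [:: (1, [:: Sg 9;Sg 10;Sg 11]); (1,
[:: Sg 6;Sg 0;Sg 1;Sg 8]); (1, [:: Xg 1 7;Sg 4;Sg 2]); (1, [:: Sg 3;Kg 1 7;Sg 5])])) (Cl 0))) (Lp
1 [:: (1, [:: Sg 3;Sg 4;Sg 5]); (1, [:: Sg 0;Sg 1;Sg 2]); (1, [:: Sg 9;Sg 7;Xg 3 8;Sg 11]); (1,
[:: Sg 6;Sg 10;Kg 3 8])])))) (Lp 1 [:: (1, [:: Sg 3;Sg 4;Sg 5]); (1, [:: Sg 9;Sg 2;Sg 1;Sg 11]);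
(1, [:: Sg 0;Xg 3 8;Sg 7]); (1, [:: Sg 6;Sg 10;Kg 3 8])])) (Lp 1 [:: (1, [:: Sg 3;Sg 4;Sg 5]); (1,
[:: Sg 6;Sg 0;Sg 1;Sg 8]); (1, [:: Sg 9;Sg 2;Sg 1;Sg 11]); (1, [:: Sg 3;Sg 10;Sg 7;Sg 5])])) (Lp 2
[:: (1, [:: Sg 9;Sg 10;Sg 3]); (1, [:: Sg 9;Sg 10;Sg 11]); (1, [:: Sg 9;Sg 2;Sg 8]); (1, [:: Sg
3;Sg 4;Sg 5]); (1, [:: Sg 6;Sg 0;Sg 1;Sg 8]); (1, [:: Sg 9;Sg 2;Sg 1;Sg 11]); (1, [:: Sg 6;Sg 7;Sg
4;Sg 3]); (1, [:: Sg 3;Sg 0;Sg 7;Sg 5])])) (Br 8 11 (Lp 1 [:: (1, [:: Sg 6;Sg 7;Sg 8]); (1, [:: Sg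
3;Sg 4;Sg 5]); (1, [:: Sg 9;Sg 0;Sg 1;Sg 8]); (1, [:: Sg 11;Sg 10;Sg 2;Sg 8])]) (Lp 1 [:: (1, [::
Sg 3;Sg 4;Sg 5]); (1, [:: Sg 9;Sg 0;Sg 1;Sg 8]); (1, [:: Sg 10;Xg 8 11;Sg 2]); (1, [:: Sg 6;Sg
7;Kg 8 11])]))) (Lp 1 [:: (1, [:: Sg 0;Xg 3 8;Sg 2]); (1, [:: Sg 6;Sg 7;Sg 4;Sg 3]); (1, [:: Sg
11;Sg 1;Sg 5]); (1, [:: Sg 9;Sg 10;Kg 3 8])])) (Lp 1 [:: (1, [:: Sg 3;Sg 4;Sg 5]); (1, [:: Sg 9;Sg
10;Sg 1;Sg 8]); (1, [:: Sg 6;Sg 7;Xg 1 11]); (1, [:: Sg 0;Kg 1 11;Sg 2])]))) (Br 3 9 (Br 3 10 (Br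
2 9 (Br 5 7 (Br 2 5 (Br 7 9 (Br 4 7 (Br 5 9 (Br 4 10 (Br 1 11 (Lp 1 [:: (1, [:: Sg 6;Sg 7;Sg 8]);
(1, [:: Sg 9;Sg 10;Sg 4;Sg 5]); (1, [:: Sg 3;Sg 0;Sg 2;Sg 5]); (1, [:: Sg 9;Sg 2;Sg 1;Sg 11])])
(Br 1 3 (Lp 1 [:: (1, [:: Sg 6;Sg 7;Sg 8]); (1, [:: Sg 9;Sg 10;Sg 4;Sg 5]); (1, [:: Sg 9;Sg 2;Sg
1;Sg 3]); (1, [:: Sg 6;Sg 0;Sg 11])]) (Br 8 11 (Lp 1 [:: (1, [:: Sg 0;Sg 1;Sg 2]); (1, [:: Sg 9;Sg
10;Sg 4;Sg 5]); (1, [:: Sg 6;Sg 7;Sg 4;Sg 3]); (1, [:: Sg 11;Sg 0;Sg 2;Sg 8])]) (Br 1 5 (Lp 1 [::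
(1, [:: Sg 9;Sg 2;Sg 8]); (1, [:: Sg 6;Sg 7;Sg 4;Sg 3]); (1, [:: Sg 9;Sg 10;Sg 1;Sg 5]); (1, [::
Sg 6;Sg 0;Sg 11])]) (Br 1 4 (Br 4 8 (Br 0 7 (Lp 1 [:: (1, [:: Sg 6;Sg 0;Sg 11]); (1, [:: Sg 9;Sg
10;Sg 4;Sg 8]); (1, [:: Sg 3;Sg 0;Sg 2;Sg 5]); (1, [:: Sg 0;Sg 1;Sg 7])]) (Lp 1 [:: (1, [:: Sg
9;Sg 10;Sg 4;Sg 8]); (1, [:: Sg 3;Sg 0;Sg 2;Sg 5]); (1, [:: Sg 1;Xg 0 7]); (1, [:: Sg 6;Kg 0 7;Sg
11])])) (Cl 3)) (Cl 3)))))) (Lp 1 [:: (1, [:: Sg 3;Sg 0;Sg 2;Sg 5]); (1, [:: Sg 9;Sg 7;Sg 4;Sg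
11]); (1, [:: Sg 6;Xg 4 10;Sg 8]); (1, [:: Sg 1;Kg 4 10])])) (Lp 1 [:: (1, [:: Sg 9;Sg 2;Sg 8]);
(1, [:: Sg 6;Sg 7;Sg 4;Sg 3]); (1, [:: Sg 0;Sg 1;Xg 9 5]); (1, [:: Kg 9 5;Sg 10;Sg 11])])) (Br 7
10 (Lp 1 [:: (1, [:: Sg 9;Xg 7 4;Sg 11]); (1, [:: Sg 3;Sg 0;Sg 2;Sg 5]); (1, [:: Sg 10;Sg 1;Sg
7]); (1, [:: Sg 6;Kg 7 4;Sg 8])]) (Br 8 11 (Lp 1 [:: (1, [:: Sg 9;Sg 7;Kg 8 1]); (1, [:: Sg 3;Sg
0;Sg 2;Sg 5]); (1, [:: Sg 11;Sg 4;Sg 8]); (1, [:: Sg 6;Sg 10;Xg 8 1])]) (Tg 0)))) (Br 1 11 (Lp 1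
[:: (1, [:: Sg 3;Sg 4;Sg 5]); (1, [:: Sg 9;Sg 2;Sg 1;Sg 11]); (1, [:: Sg 6;Sg 0;Xg 1 8]); (1, [::
Sg 10;Kg 1 8;Sg 7])]) (Br 8 11 (Lp 1 [:: (1, [:: Sg 6;Sg 0;Xg 8 1]); (1, [:: Sg 9;Sg 2;Kg 8 1]);
(1, [:: Sg 3;Sg 4;Sg 5]); (1, [:: Sg 11;Sg 10;Sg 7;Sg 8])]) (Br 5 11 (Lp 1 [:: (1, [:: Sg 9;Sg
2;Sg 8]); (1, [:: Sg 0;Sg 1;Sg 2]); (1, [:: Sg 6;Sg 7;Sg 4;Sg 3]); (1, [:: Sg 11;Sg 10;Sg 7;Sg
5])]) (Br 1 5 (Lp 1 [:: (1, [:: Sg 9;Sg 10;Sg 11]); (1, [:: Sg 9;Sg 2;Sg 8]); (1, [:: Sg 6;Sg 7;Sg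
4;Sg 3]); (1, [:: Sg 6;Sg 0;Sg 1;Sg 5])]) (Br 6 9 (Lp 1 [:: (1, [:: Sg 9;Sg 2;Sg 8]); (1, [:: Sg
3;Sg 4;Sg 5]); (1, [:: Sg 6;Sg 0;Sg 1;Xg 9 7]); (1, [:: Kg 9 7;Sg 10;Sg 11])]) (Br 2 7 (Lp 1 [::
(1, [:: Sg 6;Sg 7;Sg 8]); (1, [:: Sg 3;Sg 4;Sg 5]); (1, [:: Sg 11;Sg 0;Sg 2;Xg 7 9]); (1, [:: Sg
10;Sg 1;Kg 7 9])]) (Br 4 11 (Lp 1 [:: (1, [:: Sg 9;Sg 2;Sg 8]); (1, [:: Sg 3;Sg 0;Sg 2;Sg 5]); (1,
[:: Sg 6;Sg 7;Sg 4;Sg 11]); (1, [:: Sg 10;Sg 1;Sg 2])]) (Br 3 8 (Lp 1 [:: (1, [:: Sg 9;Sg 10;Sg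
11]); (1, [:: Sg 0;Sg 1;Sg 7]); (1, [:: Sg 6;Sg 0;Sg 4;Sg 5]); (1, [:: Sg 3;Sg 0;Sg 2;Sg 8])]) (Cl
3)))))))))) (Lp 1 [:: (1, [:: Sg 6;Sg 7;Sg 8]); (1, [:: Sg 9;Sg 2;Sg 4;Sg 3]); (1, [:: Xg 2 5;Sg
10;Sg 11]); (1, [:: Sg 0;Sg 1;Kg 2 5])])) (Lp 1 [:: (1, [:: Sg 9;Sg 2;Sg 8]); (1, [:: Sg 6;Sg 7;Sg
4;Sg 3]); (1, [:: Xg 7 5;Sg 10;Sg 11]); (1, [:: Sg 0;Sg 1;Kg 7 5])])) (Br 6 11 (Br 1 11 (Lp 1 [::
(1, [:: Sg 3;Sg 4;Sg 5]); (1, [:: Sg 6;Sg 7;Sg 1;Sg 11]); (1, [:: Sg 9;Sg 10;Xg 1 8]); (1, [:: Sg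
0;Kg 1 8;Sg 2])]) (Br 2 5 (Br 4 11 (Lp 1 [:: (1, [:: Sg 6;Sg 7;Sg 8]); (1, [:: Sg 3;Sg 10;Sg 2;Sg
5]); (1, [:: Sg 11;Sg 4;Xg 2 9]); (1, [:: Sg 0;Sg 1;Kg 2 9])]) (Br 5 9 (Br 8 11 (Lp 1 [:: (1, [::
Sg 0;Sg 1;Sg 2]); (1, [:: Sg 9;Sg 10;Sg 4;Sg 5]); (1, [:: Sg 6;Sg 7;Sg 4;Sg 3]); (1, [:: Sg 11;Sg
0;Sg 2;Sg 8])]) (Br 1 3 (Lp 1 [:: (1, [:: Sg 9;Sg 10;Sg 11]); (1, [:: Sg 6;Sg 7;Sg 8]); (1, [:: Kg
9 2;Sg 0;Sg 4;Sg 5]); (1, [:: Sg 3;Sg 1;Xg 9 2])]) (Br 1 5 (Lp 1 [:: (1, [:: Sg 9;Sg 10;Sg 11]);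
(1, [:: Sg 6;Sg 7;Sg 8]); (1, [:: Sg 3;Sg 4;Xg 9 2]); (1, [:: Kg 9 2;Sg 0;Sg 1;Sg 5])]) (Cl 3))))
(Tg 3))) (Tg 3))) (Lp 1 [:: (1, [:: Sg 6;Sg 7;Sg 8]); (1, [:: Sg 3;Sg 4;Sg 5]); (1, [:: Sg 11;Sg
10;Sg 2;Kg 8 1]); (1, [:: Sg 9;Sg 0;Xg 8 1])]))) (Lp 1 [:: (1, [:: Sg 9;Sg 10;Sg 11]); (1, [:: Sg
3;Sg 4;Sg 5]); (1, [:: Sg 6;Sg 7;Sg 1;Sg 3]); (1, [:: Sg 3;Sg 0;Sg 2;Sg 8])])) (Lp 1 [:: (1, [::
Sg 9;Sg 10;Sg 11]); (1, [:: Sg 3;Sg 4;Sg 5]); (1, [:: Sg 6;Sg 7;Sg 1;Sg 3]); (1, [:: Sg 3;Sg 0;Sg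
2;Sg 8])]))) (Br 4 7 (Br 1 3 (Lp 1 [:: (1, [:: Sg 9;Sg 10;Sg 11]); (1, [:: Sg 6;Sg 7;Sg 8]); (1,
[:: Xg 6 0;Sg 4;Sg 5]); (1, [:: Kg 6 0;Sg 2;Sg 1;Sg 3])]) (Br 3 8 (Lp 1 [:: (1, [:: Sg 9;Sg 10;Sg
11]); (1, [:: Xg 0 6;Sg 4;Sg 5]); (1, [:: Sg 0;Sg 1;Sg 2]); (1, [:: Sg 3;Kg 0 6;Sg 7;Sg 8])]) (Br
1 5 (Lp 1 [:: (1, [:: Sg 9;Sg 10;Sg 11]); (1, [:: Kg 6 0;Sg 7;Sg 4;Sg 3]); (1, [:: Xg 6 0;Sg 1;Sg
5]); (1, [:: Sg 6;Sg 2;Sg 8])]) (Br 4 8 (Lp 1 [:: (1, [:: Sg 9;Sg 10;Sg 11]); (1, [:: Sg 0;Sg 1;Sg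
2]); (1, [:: Sg 3;Kg 0 6;Sg 7;Sg 5]); (1, [:: Xg 0 6;Sg 4;Sg 8])]) (Cl 3))))) (Lp 1 [:: (1, [:: Sg
9;Sg 10;Sg 11]); (1, [:: Sg 0;Sg 1;Sg 2]); (1, [:: Sg 3;Kg 0 6;Sg 7;Sg 5]); (1, [:: Xg 0 6;Sg 4;Sg
8])]))) (Br 0 6 (Br 0 9 (Br 0 4 (Lp 1 [:: (1, [:: Sg 9;Sg 10;Sg 11]); (1, [:: Sg 6;Sg 7;Sg 8]);
(1, [:: Xg 6 3;Sg 1;Sg 2]); (1, [:: Kg 6 3;Sg 0;Sg 4;Sg 5])]) (Br 0 7 (Lp 1 [:: (1, [:: Sg 9;Sg
10;Sg 11]); (1, [:: Sg 3;Sg 4;Sg 5]); (1, [:: Xg 3 6;Sg 1;Sg 2]); (1, [:: Kg 3 6;Sg 0;Sg 7;Sg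
8])]) (Br 1 5 (Br 2 4 (Lp 1 [:: (1, [:: Sg 9;Sg 10;Sg 11]); (1, [:: Sg 6;Sg 7;Sg 8]); (1, [:: Kg 6
3;Sg 0;Sg 1;Sg 5]); (1, [:: Xg 6 3;Sg 4;Sg 2])]) (Br 1 7 (Lp 1 [:: (1, [:: Sg 9;Sg 10;Sg 11]); (1,
[:: Sg 3;Sg 4;Sg 5]); (1, [:: Kg 3 6;Sg 0;Sg 2;Sg 8]); (1, [:: Xg 3 6;Sg 1;Sg 7])]) (Cl 0))) (Lp 1
[:: (1, [:: Sg 9;Sg 10;Sg 11]); (1, [:: Xg 3 6;Sg 1;Sg 7]); (1, [:: Kg 3 6;Sg 0;Sg 2;Sg 5]); (1,
[:: Sg 3;Sg 4;Sg 8])])))) (Lp 1 [:: (1, [:: Sg 9;Sg 10;Sg 11]); (1, [:: Sg 0;Sg 1;Sg 2]); (1, [::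
Sg 6;Sg 0;Sg 4;Sg 5]); (1, [:: Sg 3;Sg 0;Sg 7;Sg 8])])) (Lp 1 [:: (1, [:: Sg 9;Sg 10;Sg 11]); (1,
[:: Sg 3;Sg 0;Sg 7;Sg 8]); (1, [:: Xg 3 6;Sg 1;Sg 2]); (1, [:: Kg 3 6;Sg 4;Sg 5])]))) (Br 0 6 (Br
3 6 (Br 5 6 (Lp 1 [:: (1, [:: Sg 9;Sg 10;Sg 11]); (1, [:: Sg 0;Sg 1;Sg 2]); (1, [:: Sg 6;Kg 0 3;Sg
4;Sg 5]); (1, [:: Xg 0 3;Sg 7;Sg 8])]) (Br 2 6 (Lp 1 [:: (1, [:: Sg 9;Sg 10;Sg 11]); (1, [:: Sg
3;Sg 4;Sg 5]); (1, [:: Sg 6;Sg 2;Sg 1;Kg 3 0]); (1, [:: Xg 3 0;Sg 7;Sg 8])]) (Br 1 8 (Br 5 7 (Lp 1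
[:: (1, [:: Sg 9;Sg 10;Sg 11]); (1, [:: Sg 6;Kg 0 3;Sg 1;Sg 8]); (1, [:: Xg 0 3;Sg 7;Sg 5]); (1,
[:: Sg 0;Sg 4;Sg 2])]) (Br 2 8 (Lp 1 [:: (1, [:: Sg 9;Sg 10;Sg 11]); (1, [:: Sg 3;Sg 4;Sg 5]); (1,
[:: Sg 6;Sg 7;Sg 1;Kg 3 0]); (1, [:: Xg 3 0;Sg 2;Sg 8])]) (Cl 6))) (Lp 1 [:: (1, [:: Sg 9;Sg 10;Sg
11]); (1, [:: Sg 3;Sg 4;Sg 5]); (1, [:: Sg 6;Sg 7;Sg 1;Kg 3 0]); (1, [:: Xg 3 0;Sg 2;Sg 8])]))))
(Lp 1 [:: (1, [:: Sg 9;Sg 10;Sg 11]); (1, [:: Sg 6;Sg 0;Sg 4;Sg 5]); (1, [:: Xg 6 3;Sg 1;Sg 2]);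
(1, [:: Kg 6 3;Sg 7;Sg 8])])) (Br 3 6 (Lp 1 [:: (1, [:: Sg 9;Sg 10;Sg 11]); (1, [:: Sg 6;Sg 2;Sg
1;Sg 3]); (1, [:: Xg 6 0;Sg 4;Sg 5]); (1, [:: Kg 6 0;Sg 7;Sg 8])]) (Br 3 9 (Br 0 9 (Br 6 9 (Br 1 7
(Br 7 9 (Br 2 9 (Br 5 9 (Lp 1 [:: (1, [:: Sg 9;Sg 10;Sg 11]); (1, [:: Sg 6;Sg 7;Sg 8]); (1, [:: Sg
9;Sg 2;Sg 1;Sg 3]); (1, [:: Sg 9;Sg 0;Sg 4;Sg 5])]) (Lp 1 [:: (1, [:: Sg 6;Sg 7;Sg 8]); (1, [:: Sg
9;Sg 2;Sg 1;Sg 3]); (1, [:: Sg 0;Sg 4;Xg 9 5]); (1, [:: Kg 9 5;Sg 10;Sg 11])])) (Br 5 9 (Lp 1 [::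
(1, [:: Sg 6;Sg 7;Sg 8]); (1, [:: Sg 9;Sg 0;Sg 4;Sg 5]); (1, [:: Sg 3;Sg 1;Xg 9 2]); (1, [:: Kg 9
2;Sg 10;Sg 11])]) (Tg 5))) (Br 2 4 (Br 4 10 (Br 2 10 (Br 1 10 (Br 2 9 (Br 5 9 (Lp 1 [:: (1, [:: Sg
9;Sg 10;Sg 11]); (1, [:: Sg 6;Sg 7;Sg 8]); (1, [:: Sg 9;Sg 2;Sg 1;Sg 3]); (1, [:: Sg 9;Sg 0;Sg
4;Sg 5])]) (Lp 1 [:: (1, [:: Sg 6;Sg 7;Sg 8]); (1, [:: Sg 9;Sg 2;Sg 4;Sg 3]); (1, [:: Sg 0;Sg 1;Xg
9 5]); (1, [:: Kg 9 5;Sg 10;Sg 11])])) (Br 5 9 (Lp 1 [:: (1, [:: Sg 6;Sg 7;Sg 8]); (1, [:: Sg 9;Sg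
0;Sg 4;Sg 5]); (1, [:: Sg 3;Sg 1;Xg 9 2]); (1, [:: Kg 9 2;Sg 10;Sg 11])]) (Tg 5))) (Lp 1 [:: (1,
[:: Sg 9;Sg 10;Sg 11]); (1, [:: Sg 0;Sg 1;Sg 2]); (1, [:: Sg 6;Sg 10;Sg 4;Sg 5]); (1, [:: Sg 3;Sg
10;Sg 7;Sg 8])])) (Lp 1 [:: (1, [:: Sg 9;Sg 10;Sg 11]); (1, [:: Sg 0;Sg 1;Sg 2]); (1, [:: Sg 6;Sg
10;Sg 4;Sg 5]); (1, [:: Sg 3;Sg 10;Sg 7;Sg 8])])) (Lp 1 [:: (1, [:: Sg 9;Sg 10;Sg 11]); (1, [:: Sg
0;Sg 1;Sg 2]); (1, [:: Sg 3;Kg 10 4;Sg 7;Sg 8]); (1, [:: Sg 6;Xg 10 4;Sg 5])])) (Lp 1 [:: (1, [::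
Sg 9;Sg 10;Sg 11]); (1, [:: Sg 0;Sg 1;Sg 2]); (1, [:: Sg 3;Xg 2 4;Sg 7;Sg 8]); (1, [:: Sg 6;Kg 2
4;Sg 5])]))) (Br 4 8 (Br 5 11 (Br 8 11 (Br 4 11 (Br 5 9 (Br 2 9 (Lp 1 [:: (1, [:: Sg 9;Sg 10;Sg
11]); (1, [:: Sg 6;Sg 7;Sg 8]); (1, [:: Sg 9;Sg 0;Sg 4;Sg 5]); (1, [:: Sg 9;Sg 2;Sg 1;Sg 3])]) (Lp
1 [:: (1, [:: Sg 3;Sg 4;Sg 8]); (1, [:: Sg 9;Sg 0;Sg 1;Sg 5]); (1, [:: Sg 6;Sg 7;Xg 9 2]); (1, [::
Kg 9 2;Sg 10;Sg 11])])) (Br 2 9 (Lp 1 [:: (1, [:: Sg 6;Sg 7;Sg 8]); (1, [:: Sg 9;Sg 2;Sg 1;Sg 3]);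
(1, [:: Sg 0;Sg 4;Xg 9 5]); (1, [:: Kg 9 5;Sg 10;Sg 11])]) (Tg 5))) (Lp 1 [:: (1, [:: Sg 9;Sg
10;Sg 11]); (1, [:: Sg 0;Sg 1;Sg 2]); (1, [:: Sg 6;Xg 1 7;Sg 4;Sg 8]); (1, [:: Sg 3;Kg 1 7;Sg
5])])) (Lp 1 [:: (1, [:: Sg 9;Sg 10;Sg 11]); (1, [:: Sg 3;Sg 4;Sg 8]); (1, [:: Sg 11;Sg 0;Sg 7;Sg
5]); (1, [:: Sg 6;Sg 2;Sg 1;Sg 11])])) (Lp 2 [:: (2, [:: Sg 9;Sg 10;Sg 11]); (1, [:: Sg 6;Sg 7;Sg
8]); (1, [:: Sg 3;Sg 4;Sg 8]); (1, [:: Sg 0;Sg 1;Sg 2]); (1, [:: Sg 9;Sg 0;Sg 4;Sg 5]); (1, [:: Sg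
9;Sg 7;Xg 11 5;Sg 3]); (1, [:: Sg 6;Sg 2;Sg 1;Kg 11 5])])) (Lp 2 [:: (2, [:: Sg 9;Sg 10;Sg 11]);
(1, [:: Sg 3;Sg 4;Sg 5]); (1, [:: Sg 0;Sg 1;Sg 2]); (1, [:: Sg 9;Sg 0;Kg 1 7;Sg 8]); (1, [:: Sg
6;Xg 1 7;Sg 4;Sg 5]); (1, [:: Sg 6;Sg 2;Sg 1;Xg 4 8]); (1, [:: Sg 9;Sg 7;Kg 4 8;Sg 3])]))) (Lp 1
[:: (1, [:: Sg 9;Sg 10;Sg 11]); (1, [:: Sg 6;Sg 7;Sg 8]); (1, [:: Sg 9;Sg 0;Sg 4;Sg 5]); (1, [::
Sg 9;Sg 2;Sg 1;Sg 3])])) (Br 5 7 (Br 2 5 (Br 2 8 (Br 0 10 (Br 4 11 (Br 0 11 (Lp 1 [:: (1, [:: Sg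
6;Sg 7;Sg 8]); (1, [:: Xg 9 0;Sg 4;Sg 5]); (1, [:: Sg 9;Sg 2;Sg 1;Sg 3]); (1, [:: Kg 9 0;Sg 10;Sg
11])]) (Br 6 10 (Br 3 10 (Br 4 8 (Br 1 5 (Br 1 8 (Br 6 11 (Lp 1 [:: (1, [:: Kg 6 0;Sg 7;Sg 8]);
(1, [:: Xg 6 0;Sg 4;Sg 5]); (1, [:: Sg 9;Sg 2;Sg 1;Sg 3]); (1, [:: Sg 6;Sg 10;Sg 11])]) (Br 1 10
(Br 4 7 (Lp 1 [:: (1, [:: Sg 3;Sg 4;Sg 5]); (1, [:: Sg 6;Sg 10;Sg 1;Sg 8]); (1, [:: Sg 9;Sg 2;Sg
1;Sg 11]); (1, [:: Sg 0;Sg 4;Sg 7])]) (Br 7 10 (Lp 1 [:: (1, [:: Sg 9;Xg 7 4;Sg 11]); (1, [:: Sg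
0;Sg 1;Sg 2]); (1, [:: Sg 3;Sg 10;Sg 7;Sg 8]); (1, [:: Sg 6;Kg 7 4;Sg 5])]) (Tg 2))) (Br 4 7 (Lp 1
[:: (1, [:: Sg 6;Xg 1 10;Sg 8]); (1, [:: Sg 9;Sg 2;Sg 1;Sg 11]); (1, [:: Sg 0;Sg 4;Sg 7]); (1, [::
Sg 3;Kg 1 10;Sg 5])]) (Br 4 10 (Lp 1 [:: (1, [:: Sg 9;Sg 2;Sg 1;Sg 11]); (1, [:: Sg 6;Sg 10;Sg
4;Sg 8]); (1, [:: Sg 0;Xg 4 7]); (1, [:: Sg 3;Kg 4 7;Sg 5])]) (Tg 2))))) (Lp 2 [:: (1, [:: Sg 0;Sg
10]); (1, [:: Sg 6;Sg 7;Sg 8]); (1, [:: Sg 3;Sg 4;Sg 5]); (1, [:: Sg 0;Sg 1;Sg 2]); (1, [:: Sg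
9;Sg 2;Sg 1;Sg 3]); (1, [:: Sg 6;Sg 10;Sg 1;Sg 5]); (1, [:: Sg 11;Sg 4;Sg 8]); (1, [:: Sg 9;Sg
7;Sg 1;Sg 11])])) (Lp 2 [:: (1, [:: Sg 0;Sg 10]); (1, [:: Sg 6;Sg 7;Sg 8]); (1, [:: Sg 3;Sg 4;Sg
5]); (1, [:: Sg 0;Sg 1;Sg 2]); (1, [:: Sg 9;Sg 2;Sg 1;Sg 3]); (1, [:: Sg 11;Sg 4;Sg 8]); (1, [::
Sg 9;Sg 7;Kg 1 5;Sg 11]); (1, [:: Sg 6;Sg 10;Xg 1 5])])) (Lp 1 [:: (1, [:: Sg 0;Sg 1;Sg 2]); (1,
[:: Sg 6;Sg 10;Sg 4;Sg 5]); (1, [:: Sg 9;Sg 7;Kg 4 8;Sg 11]); (1, [:: Sg 3;Xg 4 8])])) (Cl 9)) (Cl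
9))) (Lp 1 [:: (1, [:: Sg 6;Sg 7;Sg 8]); (1, [:: Sg 9;Sg 2;Sg 1;Sg 3]); (1, [:: Kg 9 0;Sg 10;Sg
4;Sg 5]); (1, [:: Sg 11;Xg 9 0])])) (Br 6 11 (Br 6 10 (Lp 1 [:: (1, [:: Xg 6 0;Sg 4;Sg 5]); (1,
[:: Sg 9;Sg 2;Sg 1;Sg 3]); (1, [:: Sg 6;Sg 10;Sg 11]); (1, [:: Kg 6 0;Sg 7;Sg 8])]) (Br 4 7 (Br 5
11 (Lp 1 [:: (1, [:: Sg 6;Sg 7;Sg 8]); (1, [:: Sg 0;Sg 4;Sg 7]); (1, [:: Sg 9;Sg 2;Sg 1;Sg 3]);
(1, [:: Sg 11;Sg 10;Sg 2;Sg 5])]) (Br 8 11 (Lp 1 [:: (1, [:: Sg 6;Sg 7;Sg 8]); (1, [:: Sg 9;Sg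
10;Sg 4;Sg 5]); (1, [:: Sg 9;Sg 2;Sg 1;Sg 3]); (1, [:: Sg 11;Sg 0;Sg 2;Sg 8])]) (Br 1 11 (Lp 1 [::
(1, [:: Sg 0;Xg 11 8;Sg 7]); (1, [:: Sg 9;Sg 10;Sg 4;Sg 5]); (1, [:: Sg 6;Sg 2;Sg 1;Sg 11]); (1,
[:: Sg 3;Kg 11 8])]) (Tg 4)))) (Lp 1 [:: (1, [:: Sg 0;Sg 1;Sg 2]); (1, [:: Sg 9;Sg 10;Sg 4;Sg 5]);
(1, [:: Sg 6;Xg 4 7;Sg 11]); (1, [:: Sg 3;Kg 4 7;Sg 8])]))) (Cl 9))) (Lp 1 [:: (1, [:: Sg 9;Sg
2;Sg 1;Sg 3]); (1, [:: Sg 0;Sg 4;Kg 2 8]); (1, [:: Sg 6;Sg 7;Sg 5]); (1, [:: Xg 2 8;Sg 10;Sg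
11])])) (Lp 1 [:: (1, [:: Sg 6;Sg 7;Sg 8]); (1, [:: Sg 9;Sg 2;Sg 1;Sg 3]); (1, [:: Sg 0;Sg 4;Kg 2
5]); (1, [:: Xg 2 5;Sg 10;Sg 11])])) (Lp 1 [:: (1, [:: Sg 6;Sg 7;Sg 8]); (1, [:: Sg 9;Sg 2;Sg 1;Sg
3]); (1, [:: Sg 0;Sg 4;Kg 7 5]); (1, [:: Xg 7 5;Sg 10;Sg 11])]))) (Br 0 9 (Br 2 5 (Br 2 8 (Br 5 7
(Br 3 10 (Br 1 11 (Br 7 10 (Lp 1 [:: (1, [:: Sg 6;Sg 7;Sg 8]); (1, [:: Sg 9;Sg 0;Sg 4;Sg 5]); (1,
[:: Sg 3;Sg 10;Sg 7;Sg 5]); (1, [:: Sg 9;Sg 2;Sg 1;Sg 11])]) (Br 4 10 (Lp 1 [:: (1, [:: Sg 3;Xg 10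
7;Sg 8]); (1, [:: Sg 0;Sg 1;Sg 2]); (1, [:: Sg 6;Sg 10;Sg 4;Sg 5]); (1, [:: Sg 9;Kg 10 7;Sg 11])])
(Tg 2))) (Lp 1 [:: (1, [:: Sg 6;Sg 7;Sg 8]); (1, [:: Xg 9 3;Sg 1;Sg 2]); (1, [:: Sg 9;Sg 0;Sg 4;Sg
5]); (1, [:: Kg 9 3;Sg 10;Sg 11])])) (Br 6 11 (Br 6 10 (Lp 1 [:: (1, [:: Xg 6 3;Sg 1;Sg 2]); (1,
[:: Sg 9;Sg 0;Sg 4;Sg 5]); (1, [:: Sg 6;Sg 10;Sg 11]); (1, [:: Kg 6 3;Sg 7;Sg 8])]) (Br 3 11 (Br 1
7 (Br 0 11 (Br 2 4 (Br 4 7 (Br 0 10 (Br 1 11 (Lp 2 [:: (1, [:: Sg 0;Sg 10]); (1, [:: Sg 9;Sg 10;Sg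
11]); (1, [:: Sg 6;Sg 7;Sg 8]); (1, [:: Sg 3;Sg 4;Sg 5]); (1, [:: Xg 6 3;Sg 1;Sg 2]); (1, [:: Sg
9;Sg 0;Sg 4;Sg 5]); (1, [:: Sg 6;Sg 7;Sg 1;Sg 11]); (1, [:: Kg 6 3;Sg 2;Sg 8])]) (Br 8 11 (Lp 1
[:: (1, [:: Sg 6;Sg 7;Xg 11 1]); (1, [:: Sg 9;Sg 10;Sg 4;Sg 5]); (1, [:: Sg 3;Kg 11 1]); (1, [::
Sg 11;Sg 0;Sg 2;Sg 8])]) (Tg 4))) (Br 1 11 (Br 8 11 (Lp 1 [:: (1, [:: Sg 3;Sg 4;Sg 5]); (1, [:: Sg
9;Sg 10;Sg 4;Sg 5]); (1, [:: Sg 6;Sg 7;Sg 1;Sg 11]); (1, [:: Sg 11;Sg 0;Sg 2;Sg 8])]) (Lp 1 [::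
(1, [:: Sg 9;Sg 10;Sg 4;Sg 5]); (1, [:: Sg 6;Sg 7;Sg 1;Sg 11]); (1, [:: Sg 0;Xg 11 8;Sg 2]); (1,
[:: Sg 3;Kg 11 8])])) (Br 8 11 (Lp 1 [:: (1, [:: Sg 6;Sg 7;Xg 11 1]); (1, [:: Sg 9;Sg 10;Sg 4;Sg
5]); (1, [:: Sg 3;Kg 11 1]); (1, [:: Sg 11;Sg 0;Sg 2;Sg 8])]) (Tg 4)))) (Lp 1 [:: (1, [:: Sg 9;Sg
10;Sg 4;Sg 5]); (1, [:: Sg 6;Sg 2;Sg 4;Sg 11]); (1, [:: Sg 0;Sg 1;Sg 7]); (1, [:: Sg 3;Kg 4 7;Sg
8])])) (Lp 1 [:: (1, [:: Sg 9;Sg 10;Sg 4;Sg 5]); (1, [:: Sg 6;Xg 4 2;Sg 11]); (1, [:: Sg 3;Kg 4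
2;Sg 8]); (1, [:: Sg 0;Sg 1;Sg 7])])) (Cl 9)) (Lp 1 [:: (1, [:: Sg 0;Sg 1;Sg 2]); (1, [:: Sg 9;Sg
10;Sg 4;Sg 5]); (1, [:: Sg 6;Xg 1 7;Sg 11]); (1, [:: Sg 3;Kg 1 7;Sg 8])])) (Cl 9))) (Cl 9))) (Lp 1
[:: (1, [:: Sg 9;Sg 0;Sg 4;Sg 5]); (1, [:: Xg 5 7;Sg 10;Sg 11]); (1, [:: Sg 3;Sg 1;Kg 5 7]); (1,
[:: Sg 6;Sg 2;Sg 8])])) (Lp 1 [:: (1, [:: Sg 6;Sg 7;Sg 8]); (1, [:: Sg 3;Sg 4;Sg 5]); (1, [:: Sg
9;Sg 0;Sg 1;Kg 8 2]); (1, [:: Xg 8 2;Sg 10;Sg 11])])) (Lp 1 [:: (1, [:: Sg 6;Sg 7;Sg 8]); (1, [::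
Sg 3;Sg 4;Sg 5]); (1, [:: Sg 9;Sg 0;Sg 1;Kg 5 2]); (1, [:: Xg 5 2;Sg 10;Sg 11])])) (Br 6 9 (Br 1 7
(Br 2 4 (Br 4 10 (Br 7 10 (Br 2 10 (Br 1 10 (Br 2 5 (Br 3 11 (Br 5 11 (Br 0 10 (Br 1 11 (Lp 2 [::
(1, [:: Sg 6;Sg 9]); (1, [:: Sg 6;Sg 7;Sg 8]); (1, [:: Sg 3;Sg 4;Sg 5]); (1, [:: Sg 0;Sg 1;Sg 2]);
(1, [:: Xg 9 0;Sg 10;Sg 7;Sg 8]); (1, [:: Sg 9;Sg 2;Sg 1;Sg 11]); (1, [:: Kg 9 0;Sg 10;Sg 4;Sg
5]); (1, [:: Sg 3;Sg 11])]) (Br 1 8 (Lp 1 [:: (1, [:: Sg 6;Sg 7;Sg 8]); (1, [:: Sg 9;Sg 10;Sg 4;Sg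
5]); (1, [:: Sg 11;Sg 0;Sg 2;Sg 5]); (1, [:: Sg 3;Sg 1;Sg 8])]) (Tg 4))) (Br 6 11 (Br 0 11 (Br 1 8
(Lp 1 [:: (1, [:: Sg 6;Sg 7;Sg 8]); (1, [:: Sg 9;Sg 10;Sg 4;Sg 5]); (1, [:: Sg 11;Sg 0;Sg 2;Sg
5]); (1, [:: Sg 3;Sg 1;Sg 8])]) (Br 8 11 (Lp 1 [:: (1, [:: Sg 3;Xg 8 1]); (1, [:: Sg 9;Sg 10;Sg
4;Sg 5]); (1, [:: Sg 11;Sg 0;Sg 7;Sg 8]); (1, [:: Sg 6;Sg 2;Kg 8 1])]) (Tg 4))) (Cl 9)) (Cl 9)))
(Br 2 8 (Br 4 7 (Br 1 8 (Lp 1 [:: (1, [:: Sg 6;Sg 7;Kg 5 11]); (1, [:: Sg 0;Xg 5 11;Sg 2]); (1,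
[:: Sg 9;Sg 10;Sg 4;Sg 5]); (1, [:: Sg 3;Sg 1;Sg 8])]) (Br 8 11 (Lp 1 [:: (1, [:: Sg 9;Sg 10;Sg
4;Sg 5]); (1, [:: Sg 11;Sg 0;Sg 7;Sg 8]); (1, [:: Sg 3;Xg 8 1]); (1, [:: Sg 6;Sg 2;Kg 8 1])]) (Tg
4))) (Lp 1 [:: (1, [:: Sg 0;Sg 1;Sg 7]); (1, [:: Sg 9;Sg 10;Sg 4;Sg 5]); (1, [:: Sg 6;Sg 2;Sg 4;Sg
11]); (1, [:: Sg 3;Sg 4;Sg 8])])) (Lp 1 [:: (1, [:: Sg 6;Sg 2;Sg 5]); (1, [:: Sg 9;Sg 10;Sg 4;Sg
5]); (1, [:: Sg 11;Sg 0;Sg 7;Sg 8]); (1, [:: Sg 3;Sg 1;Sg 8])]))) (Br 3 10 (Lp 1 [:: (1, [:: Sg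
6;Sg 7;Sg 8]); (1, [:: Sg 0;Sg 4;Sg 2]); (1, [:: Sg 9;Sg 2;Sg 1;Sg 11]); (1, [:: Sg 3;Sg 10;Sg
2;Sg 5])]) (Cl 9))) (Br 0 11 (Lp 1 [:: (1, [:: Sg 6;Sg 7;Sg 8]); (1, [:: Sg 9;Sg 10;Sg 4;Sg 5]);
(1, [:: Xg 5 2;Sg 0;Sg 11]); (1, [:: Sg 3;Sg 1;Kg 5 2])]) (Br 3 10 (Lp 1 [:: (1, [:: Sg 6;Sg 7;Sg
8]); (1, [:: Sg 0;Sg 4;Sg 2]); (1, [:: Sg 9;Kg 2 5;Sg 1;Sg 11]); (1, [:: Xg 2 5;Sg 10;Sg 3])]) (Cl
9)))) (Lp 1 [:: (1, [:: Sg 0;Sg 1;Sg 2]); (1, [:: Sg 9;Sg 2;Sg 1;Sg 11]); (1, [:: Sg 6;Sg 10;Sg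
4;Sg 5]); (1, [:: Sg 3;Sg 10;Sg 7;Sg 8])])) (Lp 1 [:: (1, [:: Sg 9;Sg 10;Sg 11]); (1, [:: Sg 0;Sg
1;Sg 2]); (1, [:: Sg 6;Sg 10;Sg 4;Sg 5]); (1, [:: Sg 3;Sg 10;Sg 7;Sg 8])])) (Lp 1 [:: (1, [:: Sg
0;Sg 1;Sg 2]); (1, [:: Sg 6;Sg 10;Sg 4;Sg 5]); (1, [:: Sg 3;Xg 10 7;Sg 8]); (1, [:: Sg 9;Kg 10
7;Sg 11])])) (Lp 1 [:: (1, [:: Sg 0;Sg 1;Sg 7]); (1, [:: Sg 9;Sg 2;Sg 4;Sg 11]); (1, [:: Sg 6;Xg 4
10;Sg 8]); (1, [:: Sg 3;Kg 4 10;Sg 5])])) (Br 5 7 (Br 4 7 (Br 2 7 (Lp 1 [:: (1, [:: Sg 9;Sg 10;Sg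
11]); (1, [:: Sg 0;Sg 1;Sg 2]); (1, [:: Sg 3;Xg 2 4;Sg 7;Sg 8]); (1, [:: Sg 6;Kg 2 4;Sg 5])]) (Br
4 10 (Br 6 11 (Lp 1 [:: (1, [:: Sg 3;Sg 4;Sg 5]); (1, [:: Sg 0;Sg 1;Sg 2]); (1, [:: Sg 9;Sg 10;Sg
4;Sg 8]); (1, [:: Sg 6;Sg 7;Sg 4;Sg 11])]) (Br 6 10 (Lp 1 [:: (1, [:: Sg 3;Sg 4;Sg 5]); (1, [:: Sg
0;Sg 1;Sg 2]); (1, [:: Sg 9;Sg 7;Sg 4;Sg 11]); (1, [:: Sg 6;Sg 10;Sg 4;Sg 8])]) (Cl 9))) (Tg 2)))
(Br 4 10 (Br 6 11 (Lp 1 [:: (1, [:: Sg 0;Sg 1;Sg 7]); (1, [:: Sg 9;Sg 10;Sg 4;Sg 8]); (1, [:: Sg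
6;Xg 4 2;Sg 11]); (1, [:: Sg 3;Kg 4 2;Sg 5])]) (Br 6 10 (Lp 1 [:: (1, [:: Sg 3;Sg 4;Sg 5]); (1,
[:: Sg 0;Sg 1;Sg 7]); (1, [:: Sg 9;Sg 2;Sg 1;Sg 11]); (1, [:: Sg 6;Sg 10;Sg 4;Sg 8])]) (Cl 9)))
(Tg 2))) (Lp 1 [:: (1, [:: Sg 9;Sg 10;Sg 11]); (1, [:: Sg 0;Sg 1;Sg 2]); (1, [:: Sg 3;Xg 2 4;Sg
7;Sg 8]); (1, [:: Sg 6;Kg 2 4;Sg 5])]))) (Br 4 8 (Br 4 11 (Br 5 11 (Br 8 11 (Br 4 7 (Br 1 4 (Lp 1
[:: (1, [:: Sg 9;Sg 10;Sg 11]); (1, [:: Sg 0;Sg 1;Sg 2]); (1, [:: Sg 6;Xg 1 7;Sg 4;Sg 8]); (1, [::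
Sg 3;Kg 1 7;Sg 5])]) (Br 1 10 (Br 6 11 (Lp 1 [:: (1, [:: Sg 3;Sg 4;Sg 5]); (1, [:: Sg 0;Sg 4;Sg
7]); (1, [:: Sg 9;Sg 10;Sg 1;Sg 8]); (1, [:: Sg 6;Sg 2;Sg 1;Sg 11])]) (Br 6 10 (Lp 1 [:: (1, [::
Sg 3;Sg 4;Sg 5]); (1, [:: Sg 0;Sg 4;Sg 7]); (1, [:: Sg 9;Sg 2;Sg 1;Sg 11]); (1, [:: Sg 6;Sg 10;Sg
1;Sg 8])]) (Cl 9))) (Tg 2))) (Br 1 10 (Br 7 10 (Br 6 11 (Lp 1 [:: (1, [:: Sg 3;Sg 4;Sg 5]); (1,
[:: Sg 0;Sg 1;Sg 2]); (1, [:: Sg 6;Xg 1 7;Sg 11]); (1, [:: Sg 9;Sg 10;Kg 1 7;Sg 8])]) (Br 6 10 (Lp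
1 [:: (1, [:: Sg 3;Sg 4;Sg 5]); (1, [:: Sg 9;Sg 2;Sg 1;Sg 11]); (1, [:: Sg 6;Sg 10;Kg 1 7;Sg 8]);
(1, [:: Sg 0;Xg 1 7])]) (Cl 9))) (Tg 2)) (Tg 2))) (Lp 1 [:: (1, [:: Sg 9;Sg 10;Sg 11]); (1, [:: Sg
6;Sg 2;Sg 1;Sg 11]); (1, [:: Sg 11;Sg 0;Sg 7;Sg 5]); (1, [:: Sg 3;Sg 4;Sg 8])])) (Lp 1 [:: (1, [::
Sg 9;Sg 10;Sg 11]); (1, [:: Sg 6;Sg 2;Sg 1;Kg 11 5]); (1, [:: Sg 0;Xg 11 5;Sg 7]); (1, [:: Sg 3;Sg
4;Sg 8])])) (Lp 2 [:: (1, [:: Sg 0;Sg 1;Sg 2]); (1, [:: Sg 6;Xg 1 7;Sg 4;Sg 8]); (1, [:: Sg 9;Sg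
10;Sg 4;Sg 5]); (1, [:: Sg 9;Sg 10;Sg 4;Sg 8]); (1, [:: Sg 3;Kg 1 7;Xg 4 11]); (1, [:: Sg 6;Sg
2;Sg 1;Sg 11]); (1, [:: Sg 0;Kg 4 11;Sg 7]); (1, [:: Sg 3;Sg 1;Sg 5])])) (Lp 1 [:: (1, [:: Sg 9;Sg
10;Sg 11]); (1, [:: Sg 0;Sg 1;Sg 2]); (1, [:: Sg 6;Xg 1 7;Sg 4;Sg 5]); (1, [:: Sg 3;Kg 1 7;Sg
8])]))) (Br 0 10 (Br 7 10 (Br 4 10 (Br 1 10 (Br 2 10 (Br 6 10 (Br 1 7 (Br 3 10 (Lp 1 [:: (1, [::
Sg 9;Sg 10;Sg 11]); (1, [:: Sg 0;Sg 1;Sg 2]); (1, [:: Sg 6;Sg 10;Sg 4;Sg 5]); (1, [:: Sg 3;Sg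
10;Sg 7;Sg 8])]) (Br 3 11 (Br 6 11 (Br 0 11 (Br 2 8 (Br 2 5 (Br 5 7 (Br 2 4 (Br 4 7 (Br 8 11 (Br 1
11 (Lp 1 [:: (1, [:: Sg 3;Sg 4;Sg 5]); (1, [:: Sg 6;Sg 10;Sg 4;Sg 5]); (1, [:: Sg 11;Sg 0;Sg 7;Sg
8]); (1, [:: Sg 9;Sg 2;Sg 1;Sg 11])]) (Lp 1 [:: (1, [:: Sg 3;Sg 4;Sg 5]); (1, [:: Sg 11;Sg 0;Sg
7;Sg 8]); (1, [:: Sg 6;Sg 2;Xg 11 1]); (1, [:: Sg 9;Sg 10;Kg 11 1])])) (Br 1 11 (Lp 1 [:: (1, [::
Sg 0;Xg 11 8;Sg 7]); (1, [:: Sg 6;Sg 10;Sg 4;Sg 5]); (1, [:: Sg 9;Sg 2;Sg 1;Sg 11]); (1, [:: Sg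
3;Kg 11 8])]) (Tg 4))) (Lp 1 [:: (1, [:: Sg 3;Sg 4;Sg 5]); (1, [:: Sg 0;Sg 1;Sg 7]); (1, [:: Sg
9;Sg 10;Sg 4;Sg 8]); (1, [:: Sg 6;Sg 2;Sg 4;Sg 11])])) (Lp 1 [:: (1, [:: Sg 3;Sg 4;Sg 5]); (1, [::
Sg 0;Sg 1;Sg 7]); (1, [:: Sg 9;Sg 10;Kg 4 2;Sg 8]); (1, [:: Sg 6;Xg 4 2;Sg 11])])) (Lp 1 [:: (1,
[:: Sg 6;Sg 7;Sg 8]); (1, [:: Sg 3;Sg 4;Sg 5]); (1, [:: Sg 11;Sg 0;Sg 2;Sg 5]); (1, [:: Sg 9;Sg
10;Sg 1;Sg 5])])) (Lp 1 [:: (1, [:: Sg 6;Sg 7;Sg 8]); (1, [:: Sg 3;Sg 4;Sg 5]); (1, [:: Xg 5 2;Sg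
0;Sg 11]); (1, [:: Sg 9;Sg 10;Sg 1;Kg 5 2])])) (Lp 1 [:: (1, [:: Sg 3;Sg 4;Sg 5]); (1, [:: Sg
11;Sg 0;Sg 7;Sg 8]); (1, [:: Sg 9;Sg 10;Sg 1;Kg 8 2]); (1, [:: Sg 6;Xg 8 2])])) (Cl 9)) (Cl 9))
(Cl 9))) (Lp 1 [:: (1, [:: Sg 0;Sg 1;Sg 2]); (1, [:: Sg 6;Sg 10;Sg 4;Sg 5]); (1, [:: Sg 9;Xg 1
7;Sg 11]); (1, [:: Sg 3;Kg 1 7;Sg 8])])) (Br 3 11 (Br 0 11 (Br 6 11 (Br 2 5 (Br 2 8 (Br 5 7 (Br 1
7 (Br 2 4 (Br 4 7 (Br 5 11 (Br 1 8 (Lp 1 [:: (1, [:: Sg 6;Sg 7;Sg 8]); (1, [:: Sg 9;Sg 10;Sg 4;Sg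
5]); (1, [:: Sg 11;Sg 0;Sg 2;Sg 5]); (1, [:: Sg 3;Sg 1;Sg 8])]) (Br 8 11 (Lp 1 [:: (1, [:: Sg 3;Xg
8 1]); (1, [:: Sg 9;Sg 10;Sg 4;Sg 5]); (1, [:: Sg 11;Sg 0;Sg 7;Sg 8]); (1, [:: Sg 6;Sg 2;Kg 8
1])]) (Tg 4))) (Br 1 8 (Lp 1 [:: (1, [:: Sg 0;Xg 5 11;Sg 7]); (1, [:: Sg 9;Sg 10;Sg 4;Sg 5]); (1,
[:: Sg 3;Sg 1;Sg 8]); (1, [:: Sg 6;Sg 2;Kg 5 11])]) (Br 8 11 (Lp 1 [:: (1, [:: Sg 9;Sg 10;Sg 4;Sg
5]); (1, [:: Sg 11;Sg 0;Sg 7;Sg 8]); (1, [:: Sg 3;Xg 8 1]); (1, [:: Sg 6;Sg 2;Kg 8 1])]) (Tg 4))))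
(Lp 1 [:: (1, [:: Sg 6;Sg 2;Sg 4;Sg 11]); (1, [:: Sg 9;Sg 10;Sg 4;Sg 5]); (1, [:: Sg 3;Sg 4;Sg
8]); (1, [:: Sg 0;Sg 1;Sg 7])])) (Lp 1 [:: (1, [:: Sg 3;Sg 4;Sg 5]); (1, [:: Sg 6;Xg 4 2;Sg 11]);
(1, [:: Sg 9;Sg 10;Kg 4 2;Sg 8]); (1, [:: Sg 0;Sg 1;Sg 7])])) (Lp 1 [:: (1, [:: Sg 0;Sg 1;Sg 2]);
(1, [:: Sg 6;Xg 1 7;Sg 11]); (1, [:: Sg 9;Sg 10;Sg 4;Sg 5]); (1, [:: Sg 3;Kg 1 7;Sg 8])])) (Lp 1
[:: (1, [:: Sg 6;Sg 7;Sg 8]); (1, [:: Sg 3;Sg 4;Sg 5]); (1, [:: Sg 11;Sg 0;Sg 2;Sg 5]); (1, [:: Sg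
9;Sg 10;Sg 1;Sg 5])])) (Lp 1 [:: (1, [:: Sg 3;Sg 4;Sg 5]); (1, [:: Sg 11;Sg 0;Sg 7;Sg 8]); (1, [::
Sg 9;Sg 10;Sg 1;Sg 8]); (1, [:: Sg 6;Sg 2;Sg 5])])) (Lp 1 [:: (1, [:: Sg 6;Sg 7;Sg 8]); (1, [:: Sg
3;Sg 4;Sg 5]); (1, [:: Xg 5 2;Sg 0;Sg 11]); (1, [:: Sg 9;Sg 10;Sg 1;Kg 5 2])])) (Cl 9)) (Cl 9))
(Cl 9))) (Lp 1 [:: (1, [:: Sg 9;Sg 10;Sg 11]); (1, [:: Sg 0;Sg 1;Sg 2]); (1, [:: Sg 6;Sg 10;Sg
4;Sg 5]); (1, [:: Sg 3;Sg 10;Sg 7;Sg 8])])) (Lp 1 [:: (1, [:: Sg 0;Sg 1;Sg 2]); (1, [:: Sg 6;Sg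
10;Sg 4;Sg 5]); (1, [:: Sg 9;Sg 2;Sg 1;Sg 11]); (1, [:: Sg 3;Sg 10;Sg 7;Sg 8])])) (Lp 1 [:: (1,
[:: Sg 0;Sg 1;Sg 2]); (1, [:: Sg 3;Sg 10;Sg 7;Sg 8]); (1, [:: Sg 6;Xg 10 4;Sg 5]); (1, [:: Sg 9;Kg
10 4;Sg 11])])) (Br 4 10 (Lp 1 [:: (1, [:: Sg 0;Sg 1;Sg 2]); (1, [:: Sg 6;Sg 10;Sg 4;Sg 5]); (1,
[:: Sg 3;Xg 10 7;Sg 8]); (1, [:: Sg 9;Kg 10 7;Sg 11])]) (Tg 2))) (Br 3 11 (Br 6 11 (Br 0 11 (Br 2
5 (Br 2 8 (Br 5 7 (Br 1 7 (Br 2 4 (Br 4 7 (Br 5 11 (Br 1 8 (Lp 1 [:: (1, [:: Sg 6;Sg 7;Sg 8]); (1,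
[:: Sg 9;Sg 10;Sg 4;Sg 5]); (1, [:: Sg 11;Sg 0;Sg 2;Sg 5]); (1, [:: Sg 3;Sg 1;Sg 8])]) (Br 8 11
(Lp 1 [:: (1, [:: Sg 3;Xg 8 1]); (1, [:: Sg 9;Sg 10;Sg 4;Sg 5]); (1, [:: Sg 11;Sg 0;Sg 7;Sg 8]);
(1, [:: Sg 6;Sg 2;Kg 8 1])]) (Tg 4))) (Br 1 8 (Lp 1 [:: (1, [:: Sg 0;Xg 5 11;Sg 7]); (1, [:: Sg
9;Sg 10;Sg 4;Sg 5]); (1, [:: Sg 3;Sg 1;Sg 8]); (1, [:: Sg 6;Sg 2;Kg 5 11])]) (Br 8 11 (Lp 1 [::
(1, [:: Sg 9;Sg 10;Sg 4;Sg 5]); (1, [:: Sg 11;Sg 0;Sg 7;Sg 8]); (1, [:: Sg 3;Xg 8 1]); (1, [:: Sg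
6;Sg 2;Kg 8 1])]) (Tg 4)))) (Lp 1 [:: (1, [:: Sg 9;Sg 10;Sg 4;Sg 5]); (1, [:: Sg 6;Sg 2;Sg 4;Sg
11]); (1, [:: Sg 3;Sg 4;Sg 8]); (1, [:: Sg 0;Sg 1;Sg 7])])) (Lp 1 [:: (1, [:: Sg 9;Sg 10;Sg 4;Sg
5]); (1, [:: Sg 6;Xg 4 2;Sg 11]); (1, [:: Sg 0;Sg 1;Sg 7]); (1, [:: Sg 3;Kg 4 2;Sg 8])])) (Lp 1
[:: (1, [:: Sg 0;Sg 1;Sg 2]); (1, [:: Sg 9;Sg 10;Sg 4;Sg 5]); (1, [:: Sg 6;Xg 1 7;Sg 11]); (1, [::
Sg 3;Kg 1 7;Sg 8])])) (Lp 1 [:: (1, [:: Sg 6;Sg 7;Sg 8]); (1, [:: Sg 9;Sg 10;Sg 4;Sg 5]); (1, [::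
Sg 11;Sg 0;Sg 2;Sg 5]); (1, [:: Sg 3;Sg 1;Sg 5])])) (Lp 1 [:: (1, [:: Sg 9;Sg 10;Sg 4;Sg 5]); (1,
[:: Sg 11;Sg 0;Sg 7;Sg 8]); (1, [:: Sg 3;Sg 1;Sg 8]); (1, [:: Sg 6;Sg 2;Sg 5])])) (Lp 1 [:: (1,
[:: Sg 6;Sg 7;Sg 8]); (1, [:: Sg 9;Sg 10;Sg 4;Sg 5]); (1, [:: Xg 5 2;Sg 0;Sg 11]); (1, [:: Sg 3;Sg
1;Kg 5 2])])) (Cl 9)) (Cl 9)) (Cl 9)))))))).

(** Keyed by the trace of a further longest cycle, whose segments are numbered from 6. In this
    normal position the component that it avoids contains 0, 2, 4 and the other component 1, 3,
    5. *)
Definition avoid_certs_01_12_02 : seq (seq nat * cert) := [::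
([:: 0; 1],
Br 1 5 (Br 1 3 (Lp 1 [:: (1, [:: Sg 0;Sg 1]); (1, [:: Sg 6;Sg 7]); (1, [:: Sg 1;Sg 2;Sg 5]); (1,
[:: Sg 1;Sg 3;Sg 4])]) (Lp 1 [:: (1, [:: Sg 6;Sg 7]); (1, [:: Sg 1;Sg 2;Sg 5]); (1, [:: Sg 4;Xg 1
3]); (1, [:: Sg 0;Kg 1 3])])) (Br 1 3 (Lp 1 [:: (1, [:: Sg 6;Sg 7]); (1, [:: Sg 1;Sg 3;Sg 4]); (1,
[:: Sg 2;Xg 1 5]); (1, [:: Sg 0;Kg 1 5])]) (Br 3 5 (Lp 1 [:: (1, [:: Sg 6;Sg 7]); (1, [:: Sg 2;Xg
5 1]); (1, [:: Sg 0;Sg 3;Sg 5]); (1, [:: Sg 4;Kg 5 1])]) (Br 5 6 (Br 0 4 (Lp 1 [:: (1, [:: Sg 0;Sg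
1]); (1, [:: Sg 0;Sg 7]); (1, [:: Sg 6;Sg 2;Sg 5]); (1, [:: Sg 0;Sg 3;Sg 4])]) (Lp 1 [:: (1, [::
Sg 0;Sg 7]); (1, [:: Sg 6;Sg 2;Sg 5]); (1, [:: Sg 3;Xg 0 4]); (1, [:: Sg 1;Kg 0 4])])) (Br 5 7 (Br
0 4 (Lp 1 [:: (1, [:: Sg 0;Sg 1]); (1, [:: Sg 0;Sg 6]); (1, [:: Sg 7;Sg 2;Sg 5]); (1, [:: Sg 0;Sg
3;Sg 4])]) (Lp 1 [:: (1, [:: Sg 0;Sg 6]); (1, [:: Sg 7;Sg 2;Sg 5]); (1, [:: Sg 3;Xg 0 4]); (1, [::
Sg 1;Kg 0 4])])) (Cl 6))))));
([:: 0; 2],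
Br 3 5 (Br 1 5 (Lp 1 [:: (1, [:: Sg 4;Sg 5]); (1, [:: Sg 6;Sg 7]); (1, [:: Sg 0;Sg 3;Sg 5]); (1,
[:: Sg 1;Sg 2;Sg 5])]) (Lp 1 [:: (1, [:: Sg 6;Sg 7]); (1, [:: Sg 0;Sg 3;Sg 5]); (1, [:: Sg 2;Xg 5
1]); (1, [:: Sg 4;Kg 5 1])])) (Br 1 5 (Lp 1 [:: (1, [:: Sg 6;Sg 7]); (1, [:: Sg 1;Sg 2;Sg 5]); (1,
[:: Sg 0;Xg 5 3]); (1, [:: Sg 4;Kg 5 3])]) (Br 1 3 (Lp 1 [:: (1, [:: Sg 6;Sg 7]); (1, [:: Sg 2;Xg
1 5]); (1, [:: Sg 1;Sg 3;Sg 4]); (1, [:: Sg 0;Kg 1 5])]) (Br 3 6 (Br 1 7 (Lp 1 [:: (1, [:: Sg 4;Sg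
5]); (1, [:: Sg 0;Sg 3;Sg 6]); (1, [:: Sg 1;Sg 2;Sg 7])]) (Br 1 6 (Lp 1 [:: (1, [:: Sg 4;Sg 5]);
(1, [:: Sg 4;Sg 7]); (1, [:: Sg 0;Sg 3;Sg 6]); (1, [:: Sg 1;Sg 2;Sg 6])]) (Cl 6))) (Br 3 7 (Br 1 7
(Lp 1 [:: (1, [:: Sg 4;Sg 5]); (1, [:: Sg 4;Sg 6]); (1, [:: Sg 0;Sg 3;Sg 7]); (1, [:: Sg 1;Sg 2;Sg
7])]) (Cl 6)) (Cl 6))))));
([:: 1; 2],
Br 0 4 (Br 1 5 (Lp 1 [:: (1, [:: Sg 6;Sg 7]); (1, [:: Sg 0;Sg 3;Sg 4]); (1, [:: Sg 1;Sg 2;Sg 5])])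
(Br 1 3 (Lp 1 [:: (1, [:: Sg 4;Sg 5]); (1, [:: Sg 2;Sg 6]); (1, [:: Sg 0;Sg 7;Sg 4]); (1, [:: Sg
1;Sg 3;Sg 4])]) (Br 1 6 (Lp 1 [:: (1, [:: Sg 4;Sg 5]); (1, [:: Sg 2;Sg 3]); (1, [:: Sg 0;Sg 7;Sg
4]); (1, [:: Sg 1;Sg 6;Sg 4])]) (Br 1 7 (Lp 1 [:: (1, [:: Sg 4;Sg 5]); (1, [:: Sg 2;Sg 6]); (1,
[:: Sg 0;Sg 3;Sg 4]); (1, [:: Sg 1;Sg 7;Sg 4])]) (Cl 6))))) (Br 3 5 (Lp 1 [:: (1, [:: Sg 0;Sg 1]);
(1, [:: Sg 6;Xg 0 4]); (1, [:: Kg 0 4;Sg 3;Sg 5]); (1, [:: Sg 2;Sg 7])]) (Br 1 5 (Lp 1 [:: (1, [::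
Sg 6;Sg 7]); (1, [:: Sg 1;Sg 2;Sg 5]); (1, [:: Sg 0;Xg 5 3]); (1, [:: Sg 4;Kg 5 3])]) (Br 5 6 (Lp
1 [:: (1, [:: Sg 0;Sg 1]); (1, [:: Sg 3;Xg 0 4]); (1, [:: Kg 0 4;Sg 6;Sg 5]); (1, [:: Sg 2;Sg
7])]) (Br 5 7 (Lp 1 [:: (1, [:: Sg 0;Sg 1]); (1, [:: Sg 2;Sg 6]); (1, [:: Sg 3;Xg 0 4]); (1, [::
Kg 0 4;Sg 7;Sg 5])]) (Cl 6))))));
([:: 0; 1; 2],
Br 3 5 (Lp 1 [:: (1, [:: Sg 0;Sg 1]); (1, [:: Sg 6;Sg 2;Sg 8]); (1, [:: Sg 6;Sg 7;Sg 4]); (1, [::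
Sg 0;Sg 3;Sg 5])]) (Br 1 3 (Lp 1 [:: (1, [:: Sg 4;Sg 5]); (1, [:: Sg 0;Sg 7;Sg 8]); (1, [:: Sg
6;Sg 2;Sg 8]); (1, [:: Sg 1;Sg 3;Sg 4])]) (Br 1 5 (Lp 1 [:: (1, [:: Sg 2;Sg 3]); (1, [:: Sg 0;Sg
7;Sg 8]); (1, [:: Sg 6;Sg 7;Sg 4]); (1, [:: Sg 1;Sg 2;Sg 5])]) (Br 0 4 (Br 5 7 (Lp 1 [:: (1, [::
Sg 0;Sg 1]); (1, [:: Sg 0;Sg 3;Sg 4]); (1, [:: Sg 6;Sg 2;Sg 8]); (1, [:: Sg 0;Sg 7;Sg 5])]) (Br 5
6 (Lp 1 [:: (1, [:: Sg 0;Sg 1]); (1, [:: Sg 0;Sg 3;Sg 4]); (1, [:: Sg 0;Sg 7;Sg 8]); (1, [:: Sg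
6;Sg 2;Sg 5])]) (Br 1 8 (Lp 1 [:: (1, [:: Sg 4;Sg 5]); (1, [:: Sg 0;Sg 3;Sg 4]); (1, [:: Sg 6;Sg
7;Sg 4]); (1, [:: Sg 1;Sg 2;Sg 8])]) (Cl 6)))) (Br 5 6 (Lp 1 [:: (1, [:: Sg 0;Sg 1]); (1, [:: Sg
2;Sg 3]); (1, [:: Sg 6;Xg 0 4;Sg 5]); (1, [:: Kg 0 4;Sg 7;Sg 8])]) (Br 1 8 (Lp 1 [:: (1, [:: Sg
4;Sg 5]); (1, [:: Sg 2;Sg 3]); (1, [:: Sg 1;Xg 4 0;Sg 8]); (1, [:: Sg 6;Sg 7;Kg 4 0])]) (Br 5 7
(Lp 1 [:: (1, [:: Sg 0;Sg 1]); (1, [:: Sg 6;Sg 2;Sg 8]); (1, [:: Kg 0 4;Sg 7;Sg 5]); (1, [:: Sg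
3;Xg 0 4])]) (Cl 6))))))));
([:: 0; 1; 3],
Br 3 7 (Br 5 8 (Lp 1 [:: (1, [:: Sg 0;Sg 1]); (1, [:: Sg 6;Sg 7;Sg 8]); (1, [:: Sg 4;Sg 3;Sg 7;Sg
8]); (1, [:: Sg 5;Sg 2;Sg 7;Sg 8])]) (Lp 1 [:: (1, [:: Sg 0;Sg 6]); (1, [:: Sg 4;Sg 3;Sg 7;Sg 8]);
(1, [:: Sg 1;Sg 2;Sg 5])])) (Lp 2 [:: (1, [:: Sg 0;Sg 6]); (2, [:: Sg 4;Sg 5]); (1, [:: Sg 2;Sg
3]); (1, [:: Sg 0;Sg 7;Sg 8]); (1, [:: Sg 6;Sg 2;Xg 3 7;Sg 8]); (1, [:: Sg 1;Sg 3;Sg 4]); (1, [::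
Sg 1;Kg 3 7;Sg 4])]));
([:: 0; 2; 3],
Br 3 7 (Br 1 8 (Lp 1 [:: (1, [:: Sg 4;Sg 5]); (1, [:: Sg 6;Sg 7;Sg 8]); (1, [:: Sg 0;Sg 3;Sg 7;Sg
8]); (1, [:: Sg 1;Sg 2;Sg 7;Sg 8])]) (Lp 1 [:: (1, [:: Sg 4;Sg 5]); (1, [:: Sg 0;Sg 3;Sg 7;Sg 8]);
(1, [:: Sg 1;Sg 2;Sg 6])])) (Lp 2 [:: (2, [:: Sg 0;Sg 1]); (1, [:: Sg 4;Sg 6]); (1, [:: Sg 2;Sg
3]); (1, [:: Sg 4;Sg 7;Sg 8]); (1, [:: Sg 6;Sg 2;Xg 3 7;Sg 8]); (1, [:: Sg 0;Sg 3;Sg 5]); (1, [::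
Sg 0;Kg 3 7;Sg 5])]));
([:: 1; 2; 3],
Br 5 7 (Br 0 4 (Lp 1 [:: (1, [:: Sg 0;Sg 1]); (1, [:: Sg 2;Sg 6]); (1, [:: Sg 0;Sg 8;Sg 7;Sg 5]);
(1, [:: Sg 0;Sg 3;Sg 4])]) (Lp 1 [:: (1, [:: Sg 2;Sg 6]); (1, [:: Sg 0;Sg 8;Sg 7;Sg 5]); (1, [::
Sg 3;Xg 0 4]); (1, [:: Sg 1;Kg 0 4])])) (Lp 2 [:: (2, [:: Sg 0;Sg 1]); (1, [:: Sg 4;Sg 5]); (1,
[:: Sg 2;Sg 6]); (1, [:: Sg 2;Sg 7;Sg 8]); (1, [:: Sg 4;Sg 6;Sg 8;Xg 5 7]); (1, [:: Sg 0;Sg 3;Sg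
5]); (1, [:: Sg 0;Sg 3;Kg 5 7])]));
([:: 0; 1; 2; 3],
Br 1 3 (Lp 1 [:: (1, [:: Sg 4;Sg 5]); (1, [:: Sg 0;Sg 7;Sg 8;Sg 9]); (1, [:: Sg 6;Sg 2;Sg 8;Sg
9]); (1, [:: Sg 1;Sg 3;Sg 4])]) (Lp 1 [:: (1, [:: Sg 4;Sg 5]); (1, [:: Sg 6;Sg 7;Sg 8;Sg 9]); (1,
[:: Sg 0;Sg 3;Sg 8;Sg 9]); (1, [:: Sg 1;Sg 2;Sg 8;Sg 9])]));
([:: 0; 1; 3; 2],
Br 1 5 (Lp 1 [:: (1, [:: Sg 2;Sg 3]); (1, [:: Sg 0;Sg 7;Sg 8;Sg 9]); (1, [:: Sg 6;Sg 7;Sg 8;Sg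
4]); (1, [:: Sg 1;Sg 2;Sg 5])]) (Lp 1 [:: (1, [:: Sg 2;Sg 3]); (1, [:: Sg 6;Sg 7;Sg 8;Sg 9]); (1,
[:: Sg 0;Sg 7;Sg 8;Sg 5]); (1, [:: Sg 1;Sg 7;Sg 8;Sg 4])]));
([:: 0; 2; 1; 3],
Br 3 5 (Lp 1 [:: (1, [:: Sg 0;Sg 1]); (1, [:: Sg 4;Sg 7;Sg 8;Sg 9]); (1, [:: Sg 6;Sg 2;Sg 8;Sg
9]); (1, [:: Sg 0;Sg 3;Sg 5])]) (Lp 1 [:: (1, [:: Sg 0;Sg 1]); (1, [:: Sg 6;Sg 7;Sg 8;Sg 9]); (1,
[:: Sg 4;Sg 3;Sg 8;Sg 9]); (1, [:: Sg 5;Sg 2;Sg 8;Sg 9])]))].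

(** Normal position: the avoided component contains 0, 2, 5, which join the labels 0, 1, 2 pairwise,
    and not 1. The further cycle starts at number 8. *)
Definition avoid_certs_01_123_023 : seq (seq nat * cert) := [::
([:: 0; 1],
Br 4 6 (Br 3 7 (Br 1 7 (Br 1 4 (Lp 1 [:: (1, [:: Sg 0;Sg 1]); (1, [:: Sg 8;Sg 9]); (1, [:: Sg 1;Sg
2;Sg 6;Sg 7]); (1, [:: Sg 1;Sg 4;Sg 3;Sg 5])]) (Lp 1 [:: (1, [:: Sg 8;Sg 9]); (1, [:: Sg 1;Sg 2;Sg
6;Sg 7]); (1, [:: Sg 5;Sg 3;Xg 1 4]); (1, [:: Sg 0;Kg 1 4])])) (Br 1 4 (Lp 1 [:: (1, [:: Sg 8;Sg
9]); (1, [:: Sg 1;Sg 4;Sg 6;Sg 5]); (1, [:: Sg 2;Sg 3;Xg 1 7]); (1, [:: Sg 0;Kg 1 7])]) (Br 4 7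
(Lp 1 [:: (1, [:: Sg 8;Sg 9]); (1, [:: Sg 2;Sg 6;Xg 7 1]); (1, [:: Sg 0;Sg 4;Sg 7]); (1, [:: Sg
5;Sg 3;Kg 7 1])]) (Br 4 8 (Br 7 8 (Lp 1 [:: (1, [:: Sg 0;Sg 1]); (1, [:: Sg 0;Sg 9]); (1, [:: Sg
8;Sg 4;Sg 6;Sg 5]); (1, [:: Sg 8;Sg 2;Sg 3;Sg 7])]) (Br 7 9 (Lp 1 [:: (1, [:: Sg 0;Sg 1]); (1, [::
Sg 8;Sg 4;Sg 6;Sg 5]); (1, [:: Sg 9;Sg 2;Sg 3;Sg 7])]) (Cl 8))) (Br 4 9 (Br 7 9 (Lp 1 [:: (1, [::
Sg 0;Sg 1]); (1, [:: Sg 0;Sg 8]); (1, [:: Sg 9;Sg 4;Sg 6;Sg 5]); (1, [:: Sg 9;Sg 2;Sg 3;Sg 7])])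
(Cl 8)) (Cl 8)))))) (Lp 1 [:: (1, [:: Sg 8;Sg 9]); (1, [:: Sg 5;Sg 6;Sg 7]); (1, [:: Sg 1;Sg 2;Xg
7 3]); (1, [:: Sg 0;Sg 4;Kg 7 3])])) (Lp 1 [:: (1, [:: Sg 8;Sg 9]); (1, [:: Sg 2;Sg 3;Sg 4]); (1,
[:: Sg 1;Xg 4 6;Sg 5]); (1, [:: Sg 0;Kg 4 6;Sg 7])]));
([:: 0; 2],
Br 4 6 (Br 3 8 (Br 1 8 (Lp 1 [:: (1, [:: Sg 5;Sg 9]); (1, [:: Sg 5;Sg 6;Sg 7]); (1, [:: Sg 0;Sg
4;Sg 3;Sg 8]); (1, [:: Sg 1;Sg 2;Sg 8])]) (Lp 1 [:: (1, [:: Sg 5;Sg 9]); (1, [:: Sg 0;Sg 4;Sg 3;Sg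
8]); (1, [:: Sg 1;Sg 2;Sg 6;Sg 7])])) (Lp 1 [:: (1, [:: Sg 8;Sg 9]); (1, [:: Sg 5;Sg 6;Sg 7]); (1,
[:: Sg 0;Sg 4;Xg 8 3]); (1, [:: Sg 1;Sg 2;Kg 8 3])])) (Lp 1 [:: (1, [:: Sg 8;Sg 9]); (1, [:: Sg
2;Xg 4 6]); (1, [:: Sg 0;Kg 4 6;Sg 7]); (1, [:: Sg 1;Sg 4;Sg 3;Sg 5])]));
([:: 0; 3],
Br 3 8 (Br 6 8 (Br 3 7 (Br 3 9 (Br 6 9 (Br 4 6 (Br 1 7 (Br 4 7 (Lp 1 [:: (1, [:: Sg 8;Sg 9]); (1,
[:: Sg 5;Sg 6;Sg 7]); (1, [:: Sg 1;Sg 2;Sg 3;Sg 7]); (1, [:: Sg 0;Sg 4;Sg 7])]) (Lp 1 [:: (1, [::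
Sg 8;Sg 9]); (1, [:: Sg 1;Sg 2;Sg 6;Sg 7]); (1, [:: Sg 0;Xg 7 4]); (1, [:: Sg 5;Sg 3;Kg 7 4])]))
(Br 4 7 (Lp 1 [:: (1, [:: Sg 8;Sg 9]); (1, [:: Sg 0;Sg 4;Sg 7]); (1, [:: Sg 2;Sg 6;Xg 7 1]); (1,
[:: Sg 5;Sg 3;Kg 7 1])]) (Br 1 4 (Lp 1 [:: (1, [:: Sg 8;Sg 9]); (1, [:: Sg 2;Sg 6;Xg 1 7]); (1,
[:: Sg 1;Sg 4;Sg 3;Sg 5]); (1, [:: Sg 0;Kg 1 7])]) (Br 1 8 (Br 0 5 (Lp 1 [:: (1, [:: Sg 5;Sg 3;Sg
9]); (1, [:: Sg 5;Sg 6;Sg 7]); (1, [:: Sg 1;Sg 2;Sg 3;Sg 8]); (1, [:: Sg 0;Sg 4;Sg 3;Sg 5])]) (Lp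
1 [:: (1, [:: Sg 5;Sg 6;Sg 9]); (1, [:: Sg 2;Sg 3;Sg 4]); (1, [:: Sg 1;Xg 5 0;Sg 3;Sg 8]); (1, [::
Kg 5 0;Sg 3;Sg 7])])) (Br 1 9 (Br 0 5 (Lp 1 [:: (1, [:: Sg 5;Sg 3;Sg 8]); (1, [:: Sg 5;Sg 6;Sg
7]); (1, [:: Sg 1;Sg 2;Sg 3;Sg 9]); (1, [:: Sg 0;Sg 4;Sg 3;Sg 5])]) (Lp 1 [:: (1, [:: Sg 5;Sg 6;Sg
8]); (1, [:: Sg 2;Sg 3;Sg 4]); (1, [:: Sg 1;Xg 5 0;Sg 3;Sg 9]); (1, [:: Kg 5 0;Sg 3;Sg 7])])) (Cl
8)))))) (Lp 1 [:: (1, [:: Sg 8;Sg 9]); (1, [:: Sg 2;Sg 3;Sg 4]); (1, [:: Sg 0;Kg 4 6;Sg 7]); (1,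
[:: Sg 1;Xg 4 6;Sg 5])])) (Lp 1 [:: (1, [:: Sg 5;Sg 3;Sg 8]); (1, [:: Sg 5;Sg 6;Sg 7]); (1, [:: Sg
0;Sg 4;Sg 9]); (1, [:: Sg 1;Sg 2;Sg 3;Sg 9])])) (Lp 2 [:: (1, [:: Sg 5;Sg 3;Sg 8]); (2, [:: Sg
5;Sg 6;Sg 7]); (1, [:: Sg 0;Sg 4;Sg 9]); (1, [:: Sg 1;Sg 2;Xg 3 9]); (1, [:: Sg 0;Sg 4;Kg 9 3]);
(1, [:: Sg 5;Kg 3 9;Sg 8]); (1, [:: Sg 1;Sg 2;Xg 9 3])])) (Lp 1 [:: (1, [:: Sg 8;Sg 9]); (1, [::
Sg 5;Sg 3;Sg 8]); (1, [:: Sg 0;Sg 4;Sg 7]); (1, [:: Sg 1;Sg 2;Sg 6;Sg 7])])) (Lp 1 [:: (1, [:: Sg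
8;Sg 9]); (1, [:: Sg 5;Sg 6;Sg 7]); (1, [:: Sg 0;Sg 4;Sg 8]); (1, [:: Sg 1;Sg 2;Sg 3;Sg 8])])) (Lp
1 [:: (1, [:: Sg 8;Sg 9]); (1, [:: Sg 5;Sg 6;Sg 7]); (1, [:: Sg 0;Sg 4;Kg 8 3]); (1, [:: Sg 1;Sg
2;Xg 8 3])]));
([:: 1; 2],
Br 3 7 (Br 6 8 (Br 1 8 (Lp 1 [:: (1, [:: Sg 2;Sg 9]); (1, [:: Sg 2;Sg 3;Sg 4]); (1, [:: Sg 0;Sg
8;Sg 6;Sg 7]); (1, [:: Sg 1;Sg 8;Sg 5])]) (Lp 1 [:: (1, [:: Sg 2;Sg 9]); (1, [:: Sg 0;Sg 8;Sg 6;Sg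
7]); (1, [:: Sg 1;Sg 4;Sg 3;Sg 5])])) (Lp 1 [:: (1, [:: Sg 8;Sg 9]); (1, [:: Sg 2;Sg 3;Sg 4]); (1,
[:: Sg 0;Xg 8 6;Sg 7]); (1, [:: Sg 1;Kg 8 6;Sg 5])])) (Lp 1 [:: (1, [:: Sg 8;Sg 9]); (1, [:: Sg
5;Sg 6;Sg 7]); (1, [:: Sg 0;Sg 4;Kg 7 3]); (1, [:: Sg 1;Sg 2;Xg 7 3])]));
([:: 1; 3],
Br 6 8 (Br 3 8 (Br 4 6 (Br 3 9 (Br 6 9 (Br 0 5 (Br 1 4 (Lp 1 [:: (1, [:: Sg 5;Sg 6;Sg 7]); (1, [::
Sg 2;Sg 6;Sg 8]); (1, [:: Sg 0;Sg 9;Sg 3;Sg 5]); (1, [:: Sg 1;Sg 4;Sg 3;Sg 5])]) (Br 1 8 (Lp 1 [::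
(1, [:: Sg 5;Sg 6;Sg 7]); (1, [:: Sg 2;Sg 3;Sg 4]); (1, [:: Sg 0;Sg 9;Sg 3;Sg 5]); (1, [:: Sg 1;Sg
8;Sg 3;Sg 5])]) (Br 1 9 (Lp 1 [:: (1, [:: Sg 5;Sg 6;Sg 7]); (1, [:: Sg 2;Sg 6;Sg 8]); (1, [:: Sg
0;Sg 4;Sg 3;Sg 5]); (1, [:: Sg 1;Sg 9;Sg 3;Sg 5])]) (Cl 8)))) (Br 1 4 (Lp 1 [:: (1, [:: Sg 5;Sg
6;Sg 7]); (1, [:: Xg 5 0;Sg 3;Sg 8]); (1, [:: Sg 1;Sg 4;Sg 3;Kg 5 0]); (1, [:: Sg 2;Sg 3;Sg 9])])
(Br 1 8 (Lp 1 [:: (1, [:: Sg 5;Sg 6;Sg 7]); (1, [:: Xg 5 0;Sg 3;Sg 4]); (1, [:: Sg 1;Sg 8;Sg 3;Kg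
5 0]); (1, [:: Sg 2;Sg 3;Sg 9])]) (Br 1 9 (Lp 1 [:: (1, [:: Sg 5;Sg 6;Sg 7]); (1, [:: Sg 2;Sg 6;Sg
8]); (1, [:: Xg 5 0;Sg 3;Sg 4]); (1, [:: Sg 1;Sg 9;Sg 3;Kg 5 0])]) (Cl 8))))) (Lp 1 [:: (1, [:: Sg
2;Sg 3;Sg 4]); (1, [:: Sg 2;Sg 6;Sg 8]); (1, [:: Sg 0;Sg 9;Sg 7]); (1, [:: Sg 1;Sg 9;Sg 3;Sg
5])])) (Lp 1 [:: (1, [:: Sg 2;Sg 3;Sg 4]); (1, [:: Sg 2;Sg 6;Sg 8]); (1, [:: Sg 0;Sg 9;Sg 7]); (1,
[:: Sg 1;Xg 3 9;Sg 5])])) (Lp 1 [:: (1, [:: Sg 8;Sg 9]); (1, [:: Sg 2;Sg 6;Sg 8]); (1, [:: Sg 0;Sg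
4;Sg 7]); (1, [:: Sg 1;Sg 4;Sg 3;Sg 5])])) (Lp 1 [:: (1, [:: Sg 8;Sg 9]); (1, [:: Sg 2;Sg 3;Sg
4]); (1, [:: Sg 0;Sg 8;Sg 7]); (1, [:: Sg 1;Sg 8;Sg 6;Sg 5])])) (Lp 1 [:: (1, [:: Sg 8;Sg 9]); (1,
[:: Sg 2;Sg 3;Sg 4]); (1, [:: Sg 0;Kg 8 6;Sg 7]); (1, [:: Sg 1;Xg 8 6;Sg 5])]));
([:: 0; 1; 2],
Br 6 9 (Br 1 7 (Lp 1 [:: (1, [:: Sg 0;Sg 9;Sg 10]); (1, [:: Sg 8;Sg 9;Sg 5]); (1, [:: Sg 2;Sg 3;Sg
4]); (1, [:: Sg 1;Sg 2;Sg 6;Sg 7])]) (Lp 1 [:: (1, [:: Sg 8;Sg 2;Sg 10]); (1, [:: Sg 2;Sg 3;Sg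
4]); (1, [:: Sg 0;Sg 9;Sg 6;Sg 7]); (1, [:: Sg 1;Sg 9;Sg 5])])) (Lp 1 [:: (1, [:: Sg 8;Sg 9;Sg
10]); (1, [:: Sg 2;Sg 3;Sg 4]); (1, [:: Sg 0;Xg 9 6;Sg 7]); (1, [:: Sg 1;Kg 9 6;Sg 5])]));
([:: 0; 1; 3],
Br 6 9 (Br 1 7 (Lp 1 [:: (1, [:: Sg 0;Sg 9;Sg 10]); (1, [:: Sg 2;Sg 3;Sg 4]); (1, [:: Sg 8;Sg 9;Sg
6;Sg 5]); (1, [:: Sg 1;Sg 2;Sg 6;Sg 7])]) (Br 1 4 (Lp 1 [:: (1, [:: Sg 8;Sg 9;Sg 10]); (1, [:: Sg
2;Sg 6;Xg 1 7]); (1, [:: Sg 1;Sg 4;Sg 3;Sg 5]); (1, [:: Sg 0;Kg 1 7])]) (Br 3 10 (Br 4 7 (Lp 1 [::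
(1, [:: Sg 0;Sg 1]); (1, [:: Sg 8;Sg 2;Sg 3;Sg 10]); (1, [:: Sg 8;Sg 9;Sg 6;Sg 5]); (1, [:: Sg
0;Sg 4;Sg 7])]) (Br 0 5 (Br 7 8 (Lp 1 [:: (1, [:: Sg 0;Sg 1]); (1, [:: Sg 0;Sg 9;Sg 10]); (1, [::
Sg 0;Sg 4;Sg 6;Sg 5]); (1, [:: Sg 8;Sg 2;Sg 3;Sg 7])]) (Br 1 9 (Lp 1 [:: (1, [:: Sg 5;Sg 3;Sg 7]);
(1, [:: Sg 8;Sg 2;Sg 3;Sg 10]); (1, [:: Sg 0;Sg 4;Sg 3;Sg 5]); (1, [:: Sg 1;Sg 9;Sg 6;Sg 5])]) (Br
1 10 (Lp 1 [:: (1, [:: Sg 5;Sg 3;Sg 7]); (1, [:: Sg 0;Sg 4;Sg 3;Sg 5]); (1, [:: Sg 8;Sg 9;Sg 6;Sg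
5]); (1, [:: Sg 1;Sg 2;Sg 3;Sg 10])]) (Cl 8)))) (Br 7 8 (Lp 1 [:: (1, [:: Sg 0;Sg 1]); (1, [:: Sg
2;Sg 3;Sg 4]); (1, [:: Sg 8;Xg 0 5;Sg 6;Sg 7]); (1, [:: Kg 0 5;Sg 9;Sg 10])]) (Br 1 9 (Lp 1 [::
(1, [:: Sg 5;Sg 3;Sg 7]); (1, [:: Sg 2;Sg 3;Sg 4]); (1, [:: Sg 8;Xg 5 0;Sg 3;Sg 10]); (1, [:: Sg
1;Sg 9;Sg 6;Kg 5 0])]) (Br 1 10 (Lp 1 [:: (1, [:: Kg 5 0;Sg 3;Sg 7]); (1, [:: Sg 2;Sg 3;Sg 4]);
(1, [:: Sg 8;Sg 9;Sg 6;Sg 5]); (1, [:: Sg 1;Xg 5 0;Sg 3;Sg 10])]) (Cl 8)))))) (Lp 2 [:: (1, [:: Sg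
5;Sg 3;Sg 7]); (2, [:: Sg 8;Sg 9;Sg 6;Sg 5]); (1, [:: Sg 0;Sg 4;Sg 10]); (1, [:: Sg 1;Sg 2;Xg 3
10]); (1, [:: Sg 0;Sg 4;Kg 10 3]); (1, [:: Sg 5;Kg 3 10;Sg 7]); (1, [:: Sg 1;Sg 2;Xg 10 3])]))))
(Lp 2 [:: (2, [:: Sg 2;Sg 3;Sg 4]); (1, [:: Sg 1;Xg 6 9;Sg 5]); (1, [:: Sg 8;Sg 2;Sg 6;Sg 10]);
(1, [:: Sg 8;Sg 2;Kg 6 9;Sg 10]); (1, [:: Sg 1;Xg 9 6;Sg 5]); (1, [:: Sg 0;Sg 9;Sg 7]); (1, [:: Sg
0;Kg 9 6;Sg 7])]));
([:: 0; 2; 3],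
Br 4 6 (Br 3 8 (Br 1 7 (Lp 1 [:: (1, [:: Sg 5;Sg 9;Sg 10]); (1, [:: Sg 0;Sg 4;Sg 3;Sg 8]); (1, [::
Sg 1;Sg 2;Sg 6;Sg 7])]) (Lp 1 [:: (1, [:: Sg 5;Sg 6;Sg 7]); (1, [:: Sg 5;Sg 9;Sg 10]); (1, [:: Sg
0;Sg 4;Sg 3;Sg 8]); (1, [:: Sg 1;Sg 2;Sg 8])])) (Lp 1 [:: (1, [:: Sg 5;Sg 6;Sg 7]); (1, [:: Sg
8;Sg 9;Sg 10]); (1, [:: Sg 0;Sg 4;Xg 8 3]); (1, [:: Sg 1;Sg 2;Kg 8 3])])) (Lp 1 [:: (1, [:: Sg
8;Sg 9;Sg 10]); (1, [:: Sg 2;Xg 4 6]); (1, [:: Sg 1;Sg 4;Sg 3;Sg 5]); (1, [:: Sg 0;Kg 4 6;Sg 7])]));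
([:: 1; 2; 3],
Br 3 7 (Br 4 9 (Br 6 8 (Br 1 4 (Lp 1 [:: (1, [:: Sg 2;Sg 9;Sg 10]); (1, [:: Sg 0;Sg 8;Sg 6;Sg 7]);
(1, [:: Sg 1;Sg 4;Sg 3;Sg 5])]) (Lp 1 [:: (1, [:: Sg 2;Sg 3;Sg 4]); (1, [:: Sg 2;Sg 9;Sg 10]); (1,
[:: Sg 0;Sg 8;Sg 6;Sg 7]); (1, [:: Sg 1;Sg 8;Sg 5])])) (Lp 1 [:: (1, [:: Sg 2;Sg 3;Sg 4]); (1, [::
Sg 8;Sg 9;Sg 10]); (1, [:: Sg 0;Xg 8 6;Sg 7]); (1, [:: Sg 1;Kg 8 6;Sg 5])])) (Lp 1 [:: (1, [:: Sg
5;Sg 6;Sg 7]); (1, [:: Sg 0;Sg 8;Sg 9;Sg 7]); (1, [:: Sg 1;Sg 4;Sg 3;Sg 5]); (1, [:: Sg 2;Sg 9;Sg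
10])])) (Lp 1 [:: (1, [:: Sg 5;Sg 6;Sg 7]); (1, [:: Sg 8;Sg 9;Sg 10]); (1, [:: Sg 0;Sg 4;Kg 7 3]);
(1, [:: Sg 1;Sg 2;Xg 7 3])]));
([:: 0; 1; 2; 3],
Br 6 9 (Br 1 4 (Lp 1 [:: (1, [:: Sg 0;Sg 9;Sg 6;Sg 7]); (1, [:: Sg 8;Sg 2;Sg 10;Sg 11]); (1, [::
Sg 1;Sg 4;Sg 3;Sg 5])]) (Lp 1 [:: (1, [:: Sg 2;Sg 3;Sg 4]); (1, [:: Sg 0;Sg 9;Sg 6;Sg 7]); (1, [::
Sg 8;Sg 2;Sg 10;Sg 11]); (1, [:: Sg 1;Sg 9;Sg 5])])) (Lp 1 [:: (1, [:: Sg 2;Sg 3;Sg 4]); (1, [::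
Sg 8;Sg 9;Sg 10;Sg 11]); (1, [:: Sg 0;Xg 9 6;Sg 7]); (1, [:: Sg 1;Kg 9 6;Sg 5])]));
([:: 0; 1; 3; 2],
Br 6 9 (Br 1 7 (Lp 1 [:: (1, [:: Sg 2;Sg 3;Sg 4]); (1, [:: Sg 0;Sg 9;Sg 10;Sg 11]); (1, [:: Sg
8;Sg 9;Sg 6;Sg 5]); (1, [:: Sg 1;Sg 2;Sg 6;Sg 7])]) (Br 4 7 (Lp 1 [:: (1, [:: Sg 0;Xg 7 1;Sg 10;Sg
11]); (1, [:: Sg 8;Sg 9;Sg 6;Sg 5]); (1, [:: Sg 11;Sg 2;Sg 4;Sg 7]); (1, [:: Sg 5;Sg 3;Kg 7 1])])
(Lp 1 [:: (1, [:: Sg 1;Sg 2;Sg 11]); (1, [:: Sg 5;Sg 3;Sg 7]); (1, [:: Sg 8;Sg 9;Sg 6;Sg 5]); (1,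
[:: Sg 0;Sg 4;Sg 10;Sg 11])]))) (Lp 1 [:: (1, [:: Sg 2;Sg 3;Sg 4]); (1, [:: Sg 8;Sg 9;Sg 10;Sg
11]); (1, [:: Sg 1;Xg 9 6;Sg 5]); (1, [:: Sg 0;Kg 9 6;Sg 7])]));
([:: 0; 2; 1; 3],
Br 1 8 (Br 3 8 (Lp 1 [:: (1, [:: Sg 1;Sg 2;Sg 8]); (1, [:: Sg 5;Sg 6;Sg 7]); (1, [:: Sg 5;Sg 9;Sg
10;Sg 11]); (1, [:: Sg 0;Sg 4;Sg 3;Sg 8])]) (Lp 1 [:: (1, [:: Sg 5;Sg 6;Sg 7]); (1, [:: Sg 8;Sg
9;Sg 10;Sg 11]); (1, [:: Sg 0;Sg 4;Xg 8 3]); (1, [:: Sg 1;Sg 2;Kg 8 3])])) (Lp 1 [:: (1, [:: Sg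
5;Sg 9;Sg 10;Sg 11]); (1, [:: Sg 1;Sg 2;Sg 6;Sg 7]); (1, [:: Sg 0;Sg 4;Sg 3;Sg 8])]))].

(** The other component of the same targets: the avoided one contains 0, 4, 7, which join the labels
    0, 1, 3 pairwise, and not 1. *)
Definition avoid_certs_01_123_023' : seq (seq nat * cert) := [::
([:: 0; 1],
Br 2 6 (Br 3 5 (Br 1 2 (Br 1 5 (Lp 1 [:: (1, [:: Sg 0;Sg 1]); (1, [:: Sg 8;Sg 9]); (1, [:: Sg 1;Sg
2;Sg 6;Sg 7]); (1, [:: Sg 1;Sg 4;Sg 3;Sg 5])]) (Lp 1 [:: (1, [:: Sg 8;Sg 9]); (1, [:: Sg 1;Sg 2;Sg
6;Sg 7]); (1, [:: Xg 1 5;Sg 3;Sg 4]); (1, [:: Sg 0;Kg 1 5])])) (Br 1 5 (Lp 1 [:: (1, [:: Sg 8;Sg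
9]); (1, [:: Sg 1;Sg 4;Sg 6;Sg 5]); (1, [:: Xg 1 2;Sg 3;Sg 7]); (1, [:: Sg 0;Kg 1 2])]) (Br 2 5
(Lp 1 [:: (1, [:: Sg 8;Sg 9]); (1, [:: Xg 2 1;Sg 6;Sg 7]); (1, [:: Sg 0;Sg 2;Sg 5]); (1, [:: Kg 2
1;Sg 3;Sg 4])]) (Br 5 8 (Br 0 7 (Lp 1 [:: (1, [:: Sg 0;Sg 1]); (1, [:: Sg 0;Sg 9]); (1, [:: Sg
8;Sg 4;Sg 6;Sg 5]); (1, [:: Sg 0;Sg 2;Sg 3;Sg 7])]) (Lp 1 [:: (1, [:: Sg 0;Sg 9]); (1, [:: Sg 8;Sg
4;Sg 6;Sg 5]); (1, [:: Sg 2;Sg 3;Xg 0 7]); (1, [:: Sg 1;Kg 0 7])])) (Br 5 9 (Br 0 7 (Lp 1 [:: (1,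
[:: Sg 0;Sg 1]); (1, [:: Sg 0;Sg 8]); (1, [:: Sg 9;Sg 4;Sg 6;Sg 5]); (1, [:: Sg 0;Sg 2;Sg 3;Sg
7])]) (Lp 1 [:: (1, [:: Sg 0;Sg 8]); (1, [:: Sg 9;Sg 4;Sg 6;Sg 5]); (1, [:: Sg 2;Sg 3;Xg 0 7]);
(1, [:: Sg 1;Kg 0 7])])) (Cl 8)))))) (Lp 1 [:: (1, [:: Sg 8;Sg 9]); (1, [:: Sg 5;Sg 6;Sg 7]); (1,
[:: Sg 1;Sg 4;Xg 5 3]); (1, [:: Sg 0;Sg 2;Kg 5 3])])) (Lp 1 [:: (1, [:: Sg 8;Sg 9]); (1, [:: Sg
2;Sg 3;Sg 4]); (1, [:: Sg 1;Xg 2 6;Sg 7]); (1, [:: Sg 0;Kg 2 6;Sg 5])]));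
([:: 0; 2],
Br 2 6 (Br 3 8 (Br 3 5 (Br 6 8 (Br 2 5 (Br 1 2 (Lp 1 [:: (1, [:: Sg 8;Sg 9]); (1, [:: Sg 0;Sg 2;Sg
5]); (1, [:: Sg 2;Sg 6;Sg 4]); (1, [:: Sg 1;Sg 2;Sg 3;Sg 7])]) (Lp 1 [:: (1, [:: Sg 8;Sg 9]); (1,
[:: Sg 0;Sg 2;Sg 5]); (1, [:: Xg 2 1;Sg 6;Sg 7]); (1, [:: Kg 2 1;Sg 3;Sg 4])])) (Br 1 2 (Lp 1 [::
(1, [:: Sg 0;Xg 2 5]); (1, [:: Sg 8;Sg 9]); (1, [:: Sg 1;Sg 2;Sg 6;Sg 7]); (1, [:: Kg 2 5;Sg 3;Sg
4])]) (Br 1 5 (Lp 1 [:: (1, [:: Sg 0;Xg 5 2]); (1, [:: Sg 8;Sg 9]); (1, [:: Sg 1;Sg 4;Sg 6;Sg 5]);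
(1, [:: Kg 5 2;Sg 3;Sg 7])]) (Br 3 9 (Br 6 9 (Br 1 8 (Br 0 7 (Lp 1 [:: (1, [:: Sg 5;Sg 6;Sg 7]);
(1, [:: Sg 9;Sg 3;Sg 7]); (1, [:: Sg 1;Sg 4;Sg 3;Sg 8]); (1, [:: Sg 0;Sg 2;Sg 3;Sg 7])]) (Lp 1 [::
(1, [:: Sg 9;Sg 6;Sg 7]); (1, [:: Sg 2;Sg 3;Sg 4]); (1, [:: Sg 1;Xg 7 0;Sg 3;Sg 8]); (1, [:: Sg
5;Sg 3;Kg 7 0])])) (Br 1 9 (Br 0 7 (Lp 1 [:: (1, [:: Sg 5;Sg 6;Sg 7]); (1, [:: Sg 8;Sg 3;Sg 7]);
(1, [:: Sg 1;Sg 4;Sg 3;Sg 9]); (1, [:: Sg 0;Sg 2;Sg 3;Sg 7])]) (Lp 1 [:: (1, [:: Sg 8;Sg 3;Sg 7]);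
(1, [:: Sg 1;Sg 4;Sg 6;Sg 9]); (1, [:: Sg 2;Sg 3;Xg 7 0]); (1, [:: Sg 5;Sg 3;Kg 7 0])])) (Cl 8)))
(Lp 1 [:: (1, [:: Sg 5;Sg 6;Sg 7]); (1, [:: Sg 8;Sg 3;Sg 7]); (1, [:: Sg 0;Sg 2;Sg 9]); (1, [:: Sg
1;Sg 4;Sg 3;Sg 9])])) (Lp 2 [:: (2, [:: Sg 5;Sg 6;Sg 7]); (1, [:: Sg 8;Sg 3;Sg 7]); (1, [:: Sg
0;Sg 2;Sg 9]); (1, [:: Sg 0;Sg 2;Kg 9 3]); (1, [:: Sg 1;Sg 4;Xg 3 9]); (1, [:: Sg 8;Kg 3 9;Sg 7]);
(1, [:: Sg 1;Sg 4;Xg 9 3])]))))) (Lp 1 [:: (1, [:: Sg 8;Sg 9]); (1, [:: Sg 5;Sg 6;Sg 7]); (1, [::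
Sg 0;Sg 2;Sg 8]); (1, [:: Sg 1;Sg 4;Sg 3;Sg 8])])) (Lp 1 [:: (1, [:: Sg 8;Sg 9]); (1, [:: Sg 8;Sg
3;Sg 7]); (1, [:: Sg 0;Sg 2;Sg 5]); (1, [:: Sg 1;Sg 4;Sg 6;Sg 5])])) (Lp 1 [:: (1, [:: Sg 8;Sg
9]); (1, [:: Sg 5;Sg 6;Sg 7]); (1, [:: Sg 0;Sg 2;Kg 8 3]); (1, [:: Sg 1;Sg 4;Xg 8 3])])) (Lp 1 [::
(1, [:: Sg 8;Sg 9]); (1, [:: Sg 2;Sg 3;Sg 4]); (1, [:: Sg 0;Kg 2 6;Sg 5]); (1, [:: Sg 1;Xg 2 6;Sg
7])]));
([:: 0; 3],
Br 3 8 (Br 1 5 (Lp 1 [:: (1, [:: Sg 8;Sg 9]); (1, [:: Sg 5;Sg 6;Sg 7]); (1, [:: Sg 0;Sg 2;Sg 3;Sg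
8]); (1, [:: Sg 1;Sg 4;Sg 6;Sg 5])]) (Lp 1 [:: (1, [:: Sg 5;Sg 6;Sg 7]); (1, [:: Sg 0;Sg 2;Sg 3;Sg
8]); (1, [:: Sg 1;Sg 4;Sg 9])])) (Lp 1 [:: (1, [:: Sg 8;Sg 9]); (1, [:: Sg 5;Sg 6;Sg 7]); (1, [::
Sg 0;Sg 2;Xg 8 3]); (1, [:: Sg 1;Sg 4;Kg 8 3])]));
([:: 1; 2],
Br 6 8 (Br 2 6 (Br 3 8 (Br 3 9 (Br 6 9 (Br 3 5 (Br 0 7 (Br 1 5 (Lp 1 [:: (1, [:: Sg 8;Sg 9]); (1,
[:: Sg 0;Sg 2;Sg 6;Sg 7]); (1, [:: Sg 1;Sg 4;Sg 3;Sg 5])]) (Br 1 2 (Lp 1 [:: (1, [:: Sg 5;Sg 6;Sg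
7]); (1, [:: Sg 8;Sg 6;Sg 4]); (1, [:: Sg 0;Sg 9;Sg 3;Sg 7]); (1, [:: Sg 1;Sg 2;Sg 3;Sg 7])]) (Br
1 8 (Lp 1 [:: (1, [:: Sg 5;Sg 6;Sg 7]); (1, [:: Sg 2;Sg 3;Sg 4]); (1, [:: Sg 0;Sg 9;Sg 3;Sg 7]);
(1, [:: Sg 1;Sg 8;Sg 3;Sg 7])]) (Br 1 9 (Lp 1 [:: (1, [:: Sg 5;Sg 6;Sg 7]); (1, [:: Sg 8;Sg 6;Sg
4]); (1, [:: Sg 0;Sg 2;Sg 3;Sg 7]); (1, [:: Sg 1;Sg 9;Sg 3;Sg 7])]) (Cl 8))))) (Br 1 2 (Lp 1 [::
(1, [:: Sg 5;Sg 6;Sg 7]); (1, [:: Sg 8;Sg 6;Sg 4]); (1, [:: Sg 9;Sg 3;Xg 7 0]); (1, [:: Sg 1;Sg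
2;Sg 3;Kg 7 0])]) (Br 1 5 (Lp 1 [:: (1, [:: Sg 8;Sg 9]); (1, [:: Sg 1;Sg 4;Sg 6;Sg 5]); (1, [:: Xg
1 2;Sg 3;Sg 7]); (1, [:: Sg 0;Kg 1 2])]) (Br 1 8 (Lp 1 [:: (1, [:: Sg 5;Sg 6;Sg 7]); (1, [:: Sg
2;Sg 3;Sg 4]); (1, [:: Sg 9;Sg 3;Xg 7 0]); (1, [:: Sg 1;Sg 8;Sg 3;Kg 7 0])]) (Br 1 9 (Lp 1 [:: (1,
[:: Sg 5;Sg 6;Sg 7]); (1, [:: Sg 2;Sg 3;Sg 4]); (1, [:: Sg 8;Sg 3;Xg 7 0]); (1, [:: Sg 1;Sg 9;Sg
3;Kg 7 0])]) (Cl 8)))))) (Lp 1 [:: (1, [:: Sg 8;Sg 9]); (1, [:: Sg 5;Sg 6;Sg 7]); (1, [:: Sg 0;Sg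
2;Kg 5 3]); (1, [:: Sg 1;Sg 4;Xg 5 3])])) (Lp 1 [:: (1, [:: Sg 2;Sg 3;Sg 4]); (1, [:: Sg 8;Sg 6;Sg
4]); (1, [:: Sg 0;Sg 9;Sg 5]); (1, [:: Sg 1;Sg 9;Sg 3;Sg 7])])) (Lp 2 [:: (1, [:: Sg 2;Sg 3;Sg
4]); (1, [:: Sg 8;Sg 6;Sg 4]); (1, [:: Sg 0;Sg 9;Sg 5]); (1, [:: Sg 0;Kg 9 3;Sg 5]); (1, [:: Sg
1;Xg 3 9;Sg 7]); (1, [:: Sg 1;Xg 9 3;Sg 7]); (1, [:: Sg 8;Kg 3 9;Sg 4]); (1, [:: Sg 2;Sg 6;Sg
4])])) (Lp 1 [:: (1, [:: Sg 8;Sg 9]); (1, [:: Sg 2;Sg 3;Sg 4]); (1, [:: Sg 0;Sg 8;Sg 5]); (1, [::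
Sg 1;Sg 8;Sg 6;Sg 7])])) (Lp 1 [:: (1, [:: Sg 8;Sg 9]); (1, [:: Sg 8;Sg 6;Sg 4]); (1, [:: Sg 0;Sg
2;Sg 5]); (1, [:: Sg 1;Sg 2;Sg 3;Sg 7])])) (Lp 1 [:: (1, [:: Sg 8;Sg 9]); (1, [:: Sg 2;Sg 3;Sg
4]); (1, [:: Sg 0;Kg 8 6;Sg 5]); (1, [:: Sg 1;Xg 8 6;Sg 7])]));
([:: 1; 3],
Br 6 8 (Br 1 2 (Lp 1 [:: (1, [:: Sg 8;Sg 9]); (1, [:: Sg 2;Sg 3;Sg 4]); (1, [:: Sg 0;Sg 8;Sg 6;Sg
5]); (1, [:: Sg 1;Sg 2;Sg 3;Sg 7])]) (Lp 1 [:: (1, [:: Sg 2;Sg 3;Sg 4]); (1, [:: Sg 0;Sg 8;Sg 6;Sg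
5]); (1, [:: Sg 1;Sg 9;Sg 7])])) (Lp 1 [:: (1, [:: Sg 8;Sg 9]); (1, [:: Sg 2;Sg 3;Sg 4]); (1, [::
Sg 0;Xg 8 6;Sg 5]); (1, [:: Sg 1;Kg 8 6;Sg 7])]));
([:: 0; 1; 2],
Br 2 6 (Br 3 5 (Br 2 5 (Br 1 5 (Lp 1 [:: (1, [:: Sg 0;Sg 2;Sg 5]); (1, [:: Sg 8;Sg 9;Sg 10]); (1,
[:: Sg 5;Sg 3;Sg 7]); (1, [:: Sg 1;Sg 4;Sg 6;Sg 5])]) (Lp 1 [:: (1, [:: Sg 0;Sg 2;Sg 5]); (1, [::
Sg 8;Sg 9;Sg 10]); (1, [:: Xg 5 1;Sg 6;Sg 4]); (1, [:: Kg 5 1;Sg 3;Sg 7])])) (Br 1 5 (Lp 1 [:: (1,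
[:: Sg 0;Xg 5 2]); (1, [:: Sg 8;Sg 9;Sg 10]); (1, [:: Sg 1;Sg 4;Sg 6;Sg 5]); (1, [:: Kg 5 2;Sg
3;Sg 7])]) (Br 1 2 (Lp 1 [:: (1, [:: Sg 0;Xg 2 5]); (1, [:: Sg 8;Sg 9;Sg 10]); (1, [:: Sg 1;Sg
2;Sg 6;Sg 7]); (1, [:: Kg 2 5;Sg 3;Sg 4])]) (Br 3 9 (Br 6 9 (Br 1 9 (Br 5 8 (Lp 1 [:: (1, [:: Sg
0;Sg 9;Sg 10]); (1, [:: Sg 2;Sg 3;Sg 4]); (1, [:: Sg 1;Sg 9;Sg 6;Sg 7]); (1, [:: Sg 8;Sg 4;Sg 3;Sg
5])]) (Br 3 10 (Br 0 7 (Lp 1 [:: (1, [:: Sg 5;Sg 6;Sg 7]); (1, [:: Sg 1;Sg 9;Sg 3;Sg 7]); (1, [::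
Sg 8;Sg 4;Sg 3;Sg 10]); (1, [:: Sg 0;Sg 2;Sg 3;Sg 7])]) (Lp 1 [:: (1, [:: Sg 5;Sg 6;Sg 7]); (1,
[:: Sg 2;Sg 3;Sg 4]); (1, [:: Sg 8;Xg 7 0;Sg 3;Sg 10]); (1, [:: Sg 1;Sg 9;Sg 3;Kg 7 0])])) (Lp 1
[:: (1, [:: Sg 8;Sg 9;Sg 10]); (1, [:: Sg 5;Sg 6;Sg 7]); (1, [:: Sg 0;Sg 2;Kg 10 3]); (1, [:: Sg
1;Sg 4;Xg 10 3])]))) (Br 3 10 (Br 6 10 (Br 5 9 (Br 0 7 (Lp 1 [:: (1, [:: Sg 0;Sg 1]); (1, [:: Sg
0;Sg 9;Sg 5]); (1, [:: Sg 8;Sg 4;Sg 6;Sg 10]); (1, [:: Sg 0;Sg 2;Sg 3;Sg 7])]) (Lp 1 [:: (1, [::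
Sg 0;Sg 9;Sg 5]); (1, [:: Sg 8;Sg 4;Sg 6;Sg 10]); (1, [:: Sg 2;Sg 3;Xg 0 7]); (1, [:: Sg 1;Kg 0
7])])) (Br 2 9 (Br 0 7 (Br 5 8 (Lp 1 [:: (1, [:: Sg 0;Sg 1]); (1, [:: Sg 0;Sg 9;Sg 10]); (1, [::
Sg 0;Sg 2;Sg 6;Sg 7]); (1, [:: Sg 8;Sg 4;Sg 3;Sg 5])]) (Br 1 10 (Lp 1 [:: (1, [:: Sg 5;Sg 6;Sg
7]); (1, [:: Sg 0;Sg 2;Sg 3;Sg 7]); (1, [:: Sg 8;Sg 9;Sg 3;Sg 7]); (1, [:: Sg 1;Sg 4;Sg 3;Sg
10])]) (Cl 8))) (Br 5 8 (Lp 1 [:: (1, [:: Sg 0;Sg 9;Sg 10]); (1, [:: Sg 2;Sg 3;Sg 4]); (1, [:: Sg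
8;Xg 0 7;Sg 6;Sg 5]); (1, [:: Sg 1;Kg 0 7])]) (Br 1 10 (Lp 1 [:: (1, [:: Sg 5;Sg 6;Kg 7 0]); (1,
[:: Sg 2;Sg 3;Sg 4]); (1, [:: Sg 8;Sg 9;Sg 3;Sg 7]); (1, [:: Sg 1;Xg 7 0;Sg 3;Sg 10])]) (Cl 8))))
(Br 0 7 (Br 5 8 (Lp 1 [:: (1, [:: Sg 0;Sg 1]); (1, [:: Sg 0;Sg 9;Sg 10]); (1, [:: Sg 0;Sg 2;Sg
6;Sg 7]); (1, [:: Sg 8;Sg 4;Sg 3;Sg 5])]) (Br 1 10 (Lp 1 [:: (1, [:: Sg 5;Sg 6;Sg 7]); (1, [:: Sg
0;Sg 2;Sg 3;Sg 7]); (1, [:: Sg 8;Sg 9;Sg 3;Sg 7]); (1, [:: Sg 1;Sg 4;Sg 3;Sg 10])]) (Cl 8))) (Br 5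
8 (Lp 1 [:: (1, [:: Sg 0;Sg 9;Sg 10]); (1, [:: Sg 2;Sg 3;Sg 4]); (1, [:: Sg 8;Xg 0 7;Sg 6;Sg 5]);
(1, [:: Sg 1;Kg 0 7])]) (Br 1 10 (Lp 1 [:: (1, [:: Sg 5;Sg 6;Kg 7 0]); (1, [:: Sg 2;Sg 3;Sg 4]);
(1, [:: Sg 8;Sg 9;Sg 3;Sg 7]); (1, [:: Sg 1;Xg 7 0;Sg 3;Sg 10])]) (Cl 8)))))) (Lp 1 [:: (1, [:: Sg
5;Sg 6;Sg 7]); (1, [:: Sg 8;Sg 9;Sg 3;Sg 7]); (1, [:: Sg 0;Sg 2;Sg 10]); (1, [:: Sg 1;Sg 4;Sg 3;Sg
10])])) (Lp 2 [:: (2, [:: Sg 5;Sg 6;Sg 7]); (1, [:: Sg 8;Sg 9;Sg 3;Sg 7]); (1, [:: Sg 0;Sg 2;Sg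
10]); (1, [:: Sg 0;Sg 2;Kg 10 3]); (1, [:: Sg 1;Sg 4;Xg 3 10]); (1, [:: Sg 8;Sg 9;Kg 3 10;Sg 7]);
(1, [:: Sg 1;Sg 4;Xg 10 3])]))) (Lp 1 [:: (1, [:: Sg 2;Sg 3;Sg 4]); (1, [:: Sg 0;Sg 9;Sg 5]); (1,
[:: Sg 1;Sg 9;Sg 3;Sg 7]); (1, [:: Sg 8;Sg 4;Sg 6;Sg 10])])) (Lp 2 [:: (1, [:: Sg 0;Sg 1]); (1,
[:: Sg 5;Sg 6;Sg 7]); (1, [:: Sg 2;Sg 3;Sg 4]); (1, [:: Sg 0;Sg 9;Sg 5]); (1, [:: Sg 1;Xg 3 9;Sg
7]); (1, [:: Sg 8;Sg 4;Sg 3;Sg 10]); (1, [:: Sg 8;Sg 4;Kg 3 9;Sg 10]); (1, [:: Sg 2;Sg 6;Sg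
4])]))))) (Lp 1 [:: (1, [:: Sg 0;Sg 9;Sg 10]); (1, [:: Sg 2;Sg 3;Sg 4]); (1, [:: Sg 1;Sg 4;Sg 6;Sg
5]); (1, [:: Sg 8;Sg 9;Sg 3;Sg 7])])) (Lp 1 [:: (1, [:: Sg 0;Sg 9;Sg 10]); (1, [:: Sg 0;Sg 2;Sg
5]); (1, [:: Sg 1;Sg 2;Sg 3;Sg 7]); (1, [:: Sg 8;Sg 4;Sg 6;Sg 10])]));
([:: 0; 1; 3],
Br 6 9 (Br 1 5 (Lp 1 [:: (1, [:: Sg 0;Sg 9;Sg 10]); (1, [:: Sg 8;Sg 9;Sg 7]); (1, [:: Sg 2;Sg 3;Sg
4]); (1, [:: Sg 1;Sg 4;Sg 6;Sg 5])]) (Lp 1 [:: (1, [:: Sg 8;Sg 9;Sg 7]); (1, [:: Sg 2;Sg 3;Sg 4]);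
(1, [:: Sg 0;Sg 9;Sg 6;Sg 5]); (1, [:: Sg 1;Sg 4;Sg 10])])) (Lp 1 [:: (1, [:: Sg 8;Sg 9;Sg 10]);
(1, [:: Sg 2;Sg 3;Sg 4]); (1, [:: Sg 0;Xg 9 6;Sg 5]); (1, [:: Sg 1;Kg 9 6;Sg 7])]));
([:: 0; 2; 3],
Br 2 9 (Br 1 8 (Lp 1 [:: (1, [:: Sg 5;Sg 6;Sg 7]); (1, [:: Sg 2;Sg 3;Sg 4]); (1, [:: Sg 0;Sg 2;Sg
9;Sg 10]); (1, [:: Sg 1;Sg 4;Sg 9;Sg 8])]) (Lp 1 [:: (1, [:: Sg 5;Sg 6;Sg 7]); (1, [:: Sg 0;Sg
2;Sg 9;Sg 10]); (1, [:: Sg 1;Sg 4;Sg 10]); (1, [:: Sg 8;Sg 3;Sg 7])])) (Lp 1 [:: (1, [:: Sg 5;Sg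
6;Sg 7]); (1, [:: Sg 0;Xg 2 9;Sg 10]); (1, [:: Sg 1;Sg 2;Sg 3;Sg 7]); (1, [:: Sg 8;Kg 2 9;Sg 4;Sg
10])]));
([:: 1; 2; 3],
Br 5 9 (Br 1 8 (Lp 1 [:: (1, [:: Sg 5;Sg 6;Sg 7]); (1, [:: Sg 2;Sg 3;Sg 4]); (1, [:: Sg 0;Sg 10;Sg
9;Sg 5]); (1, [:: Sg 1;Sg 8;Sg 9;Sg 7])]) (Lp 1 [:: (1, [:: Sg 2;Sg 3;Sg 4]); (1, [:: Sg 0;Sg
10;Sg 9;Sg 5]); (1, [:: Sg 1;Sg 10;Sg 7]); (1, [:: Sg 8;Sg 6;Sg 4])])) (Lp 1 [:: (1, [:: Sg 2;Sg
3;Sg 4]); (1, [:: Sg 0;Sg 10;Xg 5 9]); (1, [:: Sg 1;Sg 4;Sg 6;Sg 5]); (1, [:: Kg 5 9;Sg 8;Sg 10;Sg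
7])]));
([:: 0; 1; 2; 3],
Br 2 10 (Br 1 2 (Lp 1 [:: (1, [:: Sg 5;Sg 6;Sg 7]); (1, [:: Sg 0;Sg 9;Sg 10;Sg 11]); (1, [:: Sg
1;Sg 2;Sg 3;Sg 7]); (1, [:: Sg 8;Sg 4;Sg 11])]) (Br 3 11 (Lp 1 [:: (1, [:: Sg 1;Sg 4;Sg 11]); (1,
[:: Sg 5;Sg 6;Sg 7]); (1, [:: Sg 8;Sg 9;Sg 10;Sg 11]); (1, [:: Sg 0;Sg 2;Sg 3;Sg 11])]) (Lp 1 [::
(1, [:: Sg 1;Sg 4;Sg 11]); (1, [:: Sg 5;Sg 6;Sg 7]); (1, [:: Sg 0;Sg 2;Sg 10;Sg 11]); (1, [:: Sg
8;Sg 9;Sg 3;Sg 7])]))) (Lp 1 [:: (1, [:: Sg 5;Sg 6;Sg 7]); (1, [:: Sg 0;Sg 9;Sg 10;Sg 11]); (1,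
[:: Sg 1;Sg 2;Sg 3;Sg 7]); (1, [:: Sg 8;Sg 4;Sg 11])]));
([:: 0; 1; 3; 2],
Br 5 10 (Br 1 5 (Lp 1 [:: (1, [:: Sg 2;Sg 3;Sg 4]); (1, [:: Sg 0;Sg 9;Sg 10;Sg 11]); (1, [:: Sg
1;Sg 4;Sg 6;Sg 5]); (1, [:: Sg 8;Sg 9;Sg 7])]) (Br 6 9 (Lp 1 [:: (1, [:: Sg 1;Sg 9;Sg 7]); (1, [::
Sg 2;Sg 3;Sg 4]); (1, [:: Sg 8;Sg 9;Sg 10;Sg 11]); (1, [:: Sg 0;Sg 9;Sg 6;Sg 5])]) (Lp 1 [:: (1,
[:: Sg 1;Sg 9;Sg 7]); (1, [:: Sg 2;Sg 3;Sg 4]); (1, [:: Sg 0;Sg 9;Sg 10;Sg 5]); (1, [:: Sg 8;Sg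
4;Sg 6;Sg 11])]))) (Lp 1 [:: (1, [:: Sg 2;Sg 3;Sg 4]); (1, [:: Sg 0;Sg 9;Sg 10;Sg 11]); (1, [:: Sg
1;Sg 4;Sg 6;Sg 5]); (1, [:: Sg 8;Sg 9;Sg 7])]));
([:: 0; 2; 1; 3],
Br 1 2 (Lp 1 [:: (1, [:: Sg 0;Sg 10;Sg 11]); (1, [:: Sg 5;Sg 6;Sg 7]); (1, [:: Sg 1;Sg 2;Sg 3;Sg
7]); (1, [:: Sg 8;Sg 9;Sg 4;Sg 11])]) (Br 6 10 (Lp 1 [:: (1, [:: Sg 2;Sg 3;Sg 4]); (1, [:: Sg 0;Sg
10;Sg 6;Sg 5]); (1, [:: Sg 1;Sg 4;Sg 11]); (1, [:: Sg 8;Sg 9;Sg 10;Sg 7])]) (Lp 1 [:: (1, [:: Sg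
2;Sg 3;Sg 4]); (1, [:: Sg 8;Sg 9;Sg 10;Sg 11]); (1, [:: Sg 0;Xg 10 6;Sg 5]); (1, [:: Sg 1;Kg 10
6;Sg 7])])))].

(** Normal position: the avoided component contains 4, 7, 10, and the segments 1, 8, 11 lie together
    in one component. The further cycle starts at number 12. Traces of length two do not occur in
    this situation. *)
Definition avoid_certs_trios : seq (seq nat * cert) := [::
([:: 0; 1; 2],
Br 5 6 (Br 2 5 (Br 0 4 (Br 5 9 (Br 0 7 (Br 5 12 (Br 2 6 (Br 2 9 (Br 2 12 (Br 2 13 (Br 0 12 (Br 1 5
(Br 6 14 (Br 2 10 (Lp 1 [:: (1, [:: Sg 9;Sg 10;Sg 11]); (1, [:: Sg 12;Sg 13;Sg 4;Sg 8]); (1, [::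
Sg 3;Sg 10;Sg 2;Sg 5]); (1, [:: Sg 0;Sg 1;Sg 7]); (1, [:: Sg 6;Sg 10;Sg 14])]) (Lp 1 [:: (1, [::
Sg 9;Sg 10;Sg 11]); (1, [:: Sg 12;Sg 13;Sg 4;Sg 8]); (1, [:: Sg 3;Xg 10 2;Sg 5]); (1, [:: Sg 0;Sg
1;Sg 7]); (1, [:: Sg 6;Kg 10 2;Sg 14])])) (Lp 1 [:: (1, [:: Sg 9;Sg 10;Sg 11]); (1, [:: Sg 6;Sg
7;Sg 8]); (1, [:: Sg 3;Sg 4;Sg 5]); (1, [:: Sg 12;Sg 0;Sg 1;Sg 5]); (1, [:: Sg 14;Sg 13;Sg 2;Sg
5])])) (Br 6 14 (Br 2 4 (Lp 1 [:: (1, [:: Sg 9;Sg 10;Sg 11]); (1, [:: Sg 3;Sg 4;Sg 5]); (1, [:: Sg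
12;Sg 13;Sg 4;Sg 8]); (1, [:: Sg 6;Sg 2;Sg 4;Sg 14]); (1, [:: Sg 0;Sg 1;Sg 7])]) (Lp 1 [:: (1, [::
Sg 9;Sg 10;Sg 11]); (1, [:: Sg 12;Sg 13;Sg 4;Sg 8]); (1, [:: Sg 6;Xg 4 2;Sg 14]); (1, [:: Sg 0;Sg
1;Sg 7]); (1, [:: Sg 3;Kg 4 2;Sg 5])])) (Lp 1 [:: (1, [:: Sg 9;Sg 10;Xg 5 1]); (1, [:: Sg 12;Sg
0;Sg 11]); (1, [:: Sg 6;Sg 7;Sg 8]); (1, [:: Sg 3;Sg 4;Sg 5]); (1, [:: Sg 14;Sg 13;Sg 2;Kg 5
1])]))) (Br 0 6 (Br 2 4 (Lp 1 [:: (1, [:: Sg 12;Sg 10;Sg 14]); (1, [:: Sg 3;Sg 4;Sg 5]); (1, [::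
Sg 13;Sg 1;Sg 7]); (1, [:: Sg 6;Sg 0;Sg 4;Sg 8]); (1, [:: Sg 9;Sg 2;Sg 4;Sg 11])]) (Lp 1 [:: (1,
[:: Sg 12;Sg 10;Sg 14]); (1, [:: Sg 13;Sg 1;Sg 7]); (1, [:: Sg 6;Sg 0;Sg 4;Sg 8]); (1, [:: Sg 9;Xg
4 2;Sg 11]); (1, [:: Sg 3;Kg 4 2;Sg 5])])) (Br 0 3 (Lp 1 [:: (1, [:: Sg 9;Sg 10;Sg 11]); (1, [::
Sg 12;Sg 13;Sg 14]); (1, [:: Sg 3;Sg 0;Sg 7;Sg 5]); (1, [:: Xg 0 6;Sg 4;Sg 8]); (1, [:: Kg 0 6;Sg
1;Sg 2])]) (Br 0 9 (Lp 1 [:: (1, [:: Sg 12;Sg 13;Sg 14]); (1, [:: Sg 6;Sg 7;Sg 8]); (1, [:: Sg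
9;Sg 0;Sg 4;Sg 5]); (1, [:: Xg 0 3;Sg 10;Sg 11]); (1, [:: Kg 0 3;Sg 1;Sg 2])]) (Br 3 6 (Lp 1 [::
(1, [:: Sg 12;Sg 13;Sg 14]); (1, [:: Sg 6;Sg 7;Sg 1;Sg 3]); (1, [:: Xg 6 0;Sg 4;Sg 5]); (1, [:: Sg
9;Sg 2;Sg 8]); (1, [:: Kg 6 0;Sg 10;Sg 11])]) (Br 3 9 (Lp 1 [:: (1, [:: Sg 12;Sg 13;Sg 14]); (1,
[:: Sg 6;Sg 7;Sg 8]); (1, [:: Sg 9;Sg 2;Sg 1;Sg 3]); (1, [:: Xg 6 0;Sg 4;Sg 5]); (1, [:: Kg 6 0;Sg
10;Sg 11])]) (Br 3 12 (Br 0 13 (Br 0 14 (Lp 1 [:: (1, [:: Sg 9;Sg 10;Sg 11]); (1, [:: Sg 6;Sg 7;Sg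
8]); (1, [:: Xg 12 0;Sg 4;Sg 5]); (1, [:: Sg 12;Sg 2;Sg 1;Sg 3]); (1, [:: Kg 12 0;Sg 13;Sg 14])])
(Br 2 4 (Lp 1 [:: (1, [:: Sg 9;Sg 10;Sg 11]); (1, [:: Sg 6;Sg 7;Sg 8]); (1, [:: Sg 12;Sg 2;Sg 1;Sg
3]); (1, [:: Sg 14;Sg 13;Sg 2;Sg 5]); (1, [:: Sg 0;Sg 4;Sg 2])]) (Lp 1 [:: (1, [:: Sg 9;Sg 10;Sg
11]); (1, [:: Sg 12;Sg 7;Sg 1;Sg 3]); (1, [:: Sg 14;Sg 13;Sg 2;Sg 8]); (1, [:: Sg 0;Xg 2 4]); (1,
[:: Sg 6;Kg 2 4;Sg 5])]))) (Br 6 14 (Br 2 10 (Lp 1 [:: (1, [:: Sg 6;Sg 10;Sg 14]); (1, [:: Sg 9;Sg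
10;Sg 11]); (1, [:: Sg 12;Sg 13;Sg 4;Sg 8]); (1, [:: Sg 3;Sg 10;Sg 2;Sg 5]); (1, [:: Sg 0;Sg 1;Sg
7])]) (Lp 1 [:: (1, [:: Sg 9;Sg 10;Sg 11]); (1, [:: Sg 12;Sg 13;Sg 4;Sg 8]); (1, [:: Sg 3;Xg 10
2;Sg 5]); (1, [:: Sg 6;Kg 10 2;Sg 14]); (1, [:: Sg 0;Sg 1;Sg 7])])) (Cl 12))) (Br 6 9 (Br 3 14 (Br
5 11 (Lp 1 [:: (1, [:: Sg 6;Sg 9]); (1, [:: Sg 12;Sg 13;Sg 4;Sg 8]); (1, [:: Sg 11;Sg 0;Sg 7;Sg
5]); (1, [:: Xg 12 3;Sg 1;Sg 2]); (1, [:: Kg 12 3;Sg 10;Sg 14])]) (Br 5 14 (Lp 1 [:: (1, [:: Sg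
6;Sg 9]); (1, [:: Sg 0;Sg 1;Sg 7]); (1, [:: Sg 12;Sg 13;Sg 4;Sg 8]); (1, [:: Sg 14;Xg 12 3;Sg 2;Sg
5]); (1, [:: Kg 12 3;Sg 10;Sg 11])]) (Br 2 10 (Lp 1 [:: (1, [:: Sg 6;Sg 10;Sg 14]); (1, [:: Sg
9;Sg 10;Sg 11]); (1, [:: Sg 0;Sg 1;Sg 7]); (1, [:: Sg 12;Sg 13;Sg 4;Sg 8]); (1, [:: Sg 3;Sg 10;Sg
2;Sg 5])]) (Lp 1 [:: (1, [:: Sg 9;Sg 10;Sg 14]); (1, [:: Sg 0;Sg 1;Sg 7]); (1, [:: Sg 12;Sg 13;Sg
4;Sg 8]); (1, [:: Sg 3;Xg 10 2;Sg 5]); (1, [:: Sg 6;Kg 10 2;Sg 11])])))) (Lp 2 [:: (1, [:: Sg 6;Sg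
9]); (1, [:: Sg 9;Sg 10;Sg 11]); (2, [:: Sg 3;Sg 4;Sg 5]); (2, [:: Sg 0;Sg 1;Sg 7]); (1, [:: Sg
12;Sg 13;Sg 4;Sg 8]); (1, [:: Sg 12;Sg 2;Sg 1;Sg 14]); (1, [:: Sg 14;Sg 13;Sg 2;Sg 8]); (1, [:: Sg
6;Sg 10;Sg 11])])) (Br 6 12 (Br 2 4 (Br 2 10 (Lp 1 [:: (1, [:: Sg 12;Sg 13;Sg 14]); (1, [:: Sg
6;Sg 7;Sg 8]); (1, [:: Sg 0;Sg 1;Sg 2]); (1, [:: Sg 9;Sg 2;Sg 4;Sg 11]); (1, [:: Sg 3;Sg 10;Sg
2;Sg 5])]) (Lp 1 [:: (1, [:: Sg 12;Sg 13;Sg 14]); (1, [:: Sg 0;Sg 1;Sg 7]); (1, [:: Sg 9;Sg 2;Sg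
4;Sg 11]); (1, [:: Sg 3;Xg 2 10;Sg 8]); (1, [:: Sg 6;Kg 2 10;Sg 5])])) (Br 2 10 (Lp 1 [:: (1, [::
Sg 12;Sg 13;Sg 14]); (1, [:: Sg 9;Sg 7;Sg 5]); (1, [:: Sg 3;Sg 10;Sg 2;Sg 8]); (1, [:: Sg 6;Xg 2
4;Sg 11]); (1, [:: Sg 0;Sg 1;Kg 2 4])]) (Br 6 13 (Lp 1 [:: (1, [:: Sg 12;Sg 10;Sg 14]); (1, [:: Sg
3;Sg 4;Sg 5]); (1, [:: Sg 0;Sg 1;Sg 7]); (1, [:: Sg 6;Sg 13;Kg 4 2;Sg 8]); (1, [:: Sg 9;Xg 4 2;Sg
11])]) (Br 9 14 (Lp 1 [:: (1, [:: Sg 0;Sg 1;Sg 7]); (1, [:: Sg 12;Sg 13;Sg 4;Sg 8]); (1, [:: Sg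
3;Xg 10 2;Sg 5]); (1, [:: Sg 6;Sg 10;Sg 11]); (1, [:: Sg 9;Kg 10 2;Sg 14])]) (Cl 12))))) (Br 9 12
(Br 2 4 (Br 2 10 (Lp 1 [:: (1, [:: Sg 12;Sg 13;Sg 14]); (1, [:: Sg 6;Sg 7;Sg 8]); (1, [:: Sg 0;Sg
1;Sg 2]); (1, [:: Sg 9;Sg 2;Sg 4;Sg 11]); (1, [:: Sg 3;Sg 10;Sg 2;Sg 5])]) (Lp 1 [:: (1, [:: Sg
12;Sg 13;Sg 14]); (1, [:: Sg 0;Sg 1;Sg 7]); (1, [:: Sg 9;Sg 2;Sg 4;Sg 11]); (1, [:: Sg 3;Xg 2
10;Sg 8]); (1, [:: Sg 6;Kg 2 10;Sg 5])])) (Br 2 10 (Lp 1 [:: (1, [:: Sg 12;Sg 13;Sg 14]); (1, [::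
Sg 0;Sg 1;Sg 7]); (1, [:: Sg 3;Sg 10;Sg 2;Sg 8]); (1, [:: Sg 9;Xg 2 4;Sg 11]); (1, [:: Sg 6;Kg 2
4;Sg 5])]) (Br 6 13 (Lp 1 [:: (1, [:: Sg 12;Sg 10;Sg 14]); (1, [:: Sg 3;Sg 4;Sg 5]); (1, [:: Sg
0;Sg 1;Sg 7]); (1, [:: Sg 6;Sg 13;Kg 4 2;Sg 8]); (1, [:: Sg 9;Xg 4 2;Sg 11])]) (Br 9 14 (Lp 2 [::
(2, [:: Sg 6;Sg 10;Sg 11]); (1, [:: Sg 3;Sg 4;Sg 5]); (2, [:: Sg 0;Sg 1;Sg 7]); (1, [:: Sg 12;Sg
13;Sg 4;Sg 8]); (1, [:: Sg 9;Xg 4 2;Sg 14]); (1, [:: Sg 9;Kg 10 2;Sg 14]); (1, [:: Sg 12;Sg 13;Xg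
10 2;Sg 5]); (1, [:: Sg 3;Kg 4 2;Sg 8])]) (Cl 12))))) (Br 2 10 (Br 2 4 (Lp 1 [:: (1, [:: Sg 12;Sg
13;Sg 14]); (1, [:: Sg 6;Sg 7;Sg 8]); (1, [:: Sg 0;Sg 1;Sg 2]); (1, [:: Sg 3;Sg 10;Sg 2;Sg 5]);
(1, [:: Sg 9;Sg 2;Sg 4;Sg 11])]) (Lp 1 [:: (1, [:: Sg 12;Sg 13;Sg 14]); (1, [:: Sg 6;Sg 7;Sg 8]);
(1, [:: Sg 3;Sg 10;Sg 2;Sg 5]); (1, [:: Sg 9;Xg 2 4;Sg 11]); (1, [:: Sg 0;Sg 1;Kg 2 4])])) (Br 4
10 (Lp 1 [:: (1, [:: Sg 12;Sg 13;Sg 14]); (1, [:: Sg 9;Sg 10;Sg 4;Sg 8]); (1, [:: Sg 0;Sg 1;Sg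
7]); (1, [:: Sg 3;Xg 10 2;Sg 5]); (1, [:: Sg 6;Kg 10 2;Sg 11])]) (Br 3 13 (Lp 1 [:: (1, [:: Sg
9;Sg 10;Sg 11]); (1, [:: Sg 0;Sg 1;Sg 2]); (1, [:: Sg 3;Sg 13;Sg 7;Sg 8]); (1, [:: Sg 6;Xg 10 4;Sg
5]); (1, [:: Sg 12;Kg 10 4;Sg 14])]) (Br 6 14 (Lp 2 [:: (2, [:: Sg 9;Sg 10;Sg 11]); (1, [:: Sg
3;Sg 4;Sg 5]); (1, [:: Sg 12;Sg 13;Sg 4;Sg 8]); (2, [:: Sg 6;Kg 10 2;Sg 14]); (2, [:: Sg 0;Sg 1;Sg
7]); (1, [:: Sg 12;Sg 13;Xg 10 2;Sg 5]); (1, [:: Sg 3;Xg 10 2;Sg 8])]) (Cl 12))))))))))))))) (Lp 1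
[:: (1, [:: Sg 9;Sg 10;Sg 11]); (1, [:: Sg 12;Sg 13;Sg 14]); (1, [:: Sg 0;Sg 1;Sg 2]); (1, [:: Sg
6;Sg 13;Sg 4;Sg 8]); (1, [:: Sg 3;Sg 13;Sg 7;Sg 5])])) (Lp 1 [:: (1, [:: Sg 12;Sg 13;Sg 14]); (1,
[:: Sg 6;Sg 7;Sg 8]); (1, [:: Sg 0;Sg 1;Sg 2]); (1, [:: Sg 9;Sg 2;Sg 4;Sg 11]); (1, [:: Sg 3;Sg
10;Sg 2;Sg 5])])) (Lp 1 [:: (1, [:: Sg 0;Sg 1;Sg 2]); (1, [:: Sg 12;Sg 13;Sg 4;Sg 8]); (1, [:: Sg
14;Sg 13;Sg 7;Xg 2 9]); (1, [:: Sg 6;Sg 2;Sg 4;Sg 11]); (1, [:: Sg 3;Sg 10;Kg 2 9;Sg 5])])) (Lp 1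
[:: (1, [:: Sg 9;Sg 10;Sg 11]); (1, [:: Sg 0;Sg 1;Sg 2]); (1, [:: Sg 12;Sg 13;Sg 4;Sg 8]); (1, [::
Sg 14;Sg 13;Sg 7;Xg 2 6]); (1, [:: Sg 3;Sg 10;Kg 2 6;Sg 5])])) (Lp 1 [:: (1, [:: Sg 12;Sg 13;Sg
14]); (1, [:: Sg 6;Sg 7;Sg 8]); (1, [:: Sg 3;Sg 4;Sg 5]); (1, [:: Sg 9;Sg 10;Sg 1;Sg 5]); (1, [::
Sg 11;Sg 0;Sg 2;Sg 5])])) (Lp 1 [:: (1, [:: Sg 9;Sg 10;Sg 11]); (1, [:: Sg 6;Sg 0;Sg 4;Sg 8]); (1,
[:: Sg 3;Sg 0;Sg 2;Sg 5]); (1, [:: Sg 12;Sg 10;Sg 14]); (1, [:: Sg 13;Sg 1;Sg 7])])) (Lp 1 [:: (1,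
[:: Sg 12;Sg 13;Sg 4;Sg 8]); (1, [:: Sg 9;Sg 10;Sg 3]); (1, [:: Sg 6;Sg 10;Sg 1;Sg 5]); (1, [:: Sg
11;Sg 0;Sg 2;Sg 5]); (1, [:: Sg 14;Sg 13;Sg 7;Kg 5 9])])) (Lp 1 [:: (1, [:: Sg 3;Sg 0;Sg 2;Sg 5]);
(1, [:: Sg 9;Xg 0 4;Sg 8]); (1, [:: Sg 12;Sg 10;Sg 14]); (1, [:: Sg 13;Sg 1;Sg 7]); (1, [:: Sg
6;Kg 0 4;Sg 11])])) (Lp 1 [:: (1, [:: Sg 12;Sg 13;Sg 14]); (1, [:: Sg 6;Sg 10;Sg 1;Sg 5]); (1, [::
Sg 9;Sg 7;Sg 8]); (1, [:: Xg 5 2;Sg 0;Sg 11]); (1, [:: Sg 3;Sg 4;Kg 5 2])])) (Lp 1 [:: (1, [:: Sg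
9;Sg 10;Sg 11]); (1, [:: Sg 0;Sg 1;Sg 2]); (1, [:: Sg 12;Sg 13;Sg 4;Sg 8]); (1, [:: Sg 6;Sg 10;Sg
3]); (1, [:: Sg 14;Sg 13;Sg 7;Sg 5])]));
([:: 0; 1; 3],
Br 3 6 (Br 0 3 (Br 0 6 (Br 3 12 (Br 0 12 (Br 3 9 (Br 0 9 (Br 2 4 (Br 0 13 (Br 2 10 (Br 1 3 (Br 3 8
(Lp 1 [:: (1, [:: Sg 9;Sg 10;Sg 11]); (1, [:: Sg 12;Sg 13;Sg 14]); (1, [:: Sg 3;Sg 4;Sg 5]); (1,
[:: Sg 6;Sg 7;Sg 1;Sg 3]); (1, [:: Sg 3;Sg 0;Sg 2;Sg 8])]) (Br 5 8 (Lp 1 [:: (1, [:: Sg 9;Sg 10;Sg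
11]); (1, [:: Sg 12;Sg 13;Sg 14]); (1, [:: Sg 0;Xg 3 8;Sg 2]); (1, [:: Sg 6;Sg 7;Sg 1;Sg 3]); (1,
[:: Kg 3 8;Sg 4;Sg 5])]) (Br 0 4 (Lp 1 [:: (1, [:: Sg 9;Sg 7;Sg 1;Sg 3]); (1, [:: Sg 12;Sg 13;Sg
4;Sg 11]); (1, [:: Sg 3;Sg 10;Sg 2;Sg 5]); (1, [:: Sg 6;Sg 0;Sg 4;Sg 8]); (1, [:: Sg 12;Sg 0;Sg
4;Sg 14])]) (Lp 1 [:: (1, [:: Sg 6;Sg 7;Sg 8]); (1, [:: Sg 0;Sg 1;Sg 2]); (1, [:: Sg 3;Sg 10;Sg
13;Sg 5]); (1, [:: Sg 12;Xg 0 4;Sg 14]); (1, [:: Sg 9;Kg 0 4;Sg 11])])))) (Br 0 4 (Br 0 7 (Lp 1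
[:: (1, [:: Sg 6;Sg 0;Sg 11]); (1, [:: Sg 12;Sg 13;Sg 14]); (1, [:: Sg 10;Sg 1;Sg 2]); (1, [:: Sg
9;Sg 0;Sg 4;Sg 8]); (1, [:: Sg 3;Sg 0;Sg 7;Sg 5])]) (Lp 1 [:: (1, [:: Sg 12;Sg 13;Sg 14]); (1, [::
Sg 10;Sg 1;Sg 2]); (1, [:: Sg 9;Sg 0;Sg 4;Sg 8]); (1, [:: Sg 3;Xg 0 7;Sg 5]); (1, [:: Sg 6;Kg 0
7;Sg 11])])) (Br 2 6 (Lp 1 [:: (1, [:: Sg 12;Xg 4 0;Sg 14]); (1, [:: Sg 3;Sg 4;Sg 5]); (1, [:: Sg
6;Sg 2;Kg 4 0;Sg 11]); (1, [:: Sg 10;Sg 1;Sg 13]); (1, [:: Sg 9;Sg 7;Sg 8])]) (Br 2 9 (Lp 1 [::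
(1, [:: Sg 6;Sg 7;Sg 8]); (1, [:: Sg 12;Xg 4 0;Sg 14]); (1, [:: Sg 3;Sg 4;Sg 5]); (1, [:: Sg 9;Sg
2;Kg 4 0;Sg 11]); (1, [:: Sg 10;Sg 1;Sg 13])]) (Br 1 5 (Br 5 6 (Lp 1 [:: (1, [:: Sg 12;Sg 13;Sg
14]); (1, [:: Sg 6;Sg 10;Sg 1;Sg 5]); (1, [:: Sg 11;Sg 4;Xg 6 2]); (1, [:: Sg 9;Sg 7;Sg 8]); (1,
[:: Kg 6 2;Sg 0;Sg 3])]) (Br 5 9 (Lp 1 [:: (1, [:: Sg 6;Sg 7;Sg 8]); (1, [:: Sg 12;Sg 13;Sg 14]);
(1, [:: Sg 9;Sg 10;Sg 1;Sg 5]); (1, [:: Sg 11;Sg 4;Xg 6 2]); (1, [:: Kg 6 2;Sg 0;Sg 3])]) (Br 2 5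
(Lp 1 [:: (1, [:: Sg 6;Sg 7;Sg 8]); (1, [:: Sg 12;Sg 13;Sg 14]); (1, [:: Sg 11;Sg 10;Sg 2;Sg 5]);
(1, [:: Sg 0;Sg 1;Xg 5 9]); (1, [:: Sg 3;Sg 4;Kg 5 9])]) (Br 5 13 (Lp 1 [:: (1, [:: Sg 9;Sg 10;Sg
11]); (1, [:: Sg 6;Xg 0 4;Sg 8]); (1, [:: Sg 0;Sg 1;Sg 2]); (1, [:: Sg 3;Kg 0 4;Sg 13;Sg 5]); (1,
[:: Sg 12;Sg 7;Sg 14])]) (Br 6 13 (Lp 1 [:: (1, [:: Sg 9;Xg 4 0;Sg 8]); (1, [:: Sg 3;Sg 4;Sg 5]);
(1, [:: Sg 6;Sg 13;Kg 4 0;Sg 11]); (1, [:: Sg 12;Sg 7;Sg 14]); (1, [:: Sg 10;Sg 1;Sg 2])]) (Br 9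
13 (Lp 1 [:: (1, [:: Sg 6;Sg 7;Sg 8]); (1, [:: Sg 12;Xg 4 0;Sg 14]); (1, [:: Sg 3;Sg 4;Sg 5]); (1,
[:: Sg 9;Sg 13;Kg 4 0;Sg 11]); (1, [:: Sg 10;Sg 1;Sg 2])]) (Br 0 7 (Lp 1 [:: (1, [:: Sg 9;Sg 10;Sg
11]); (1, [:: Sg 6;Xg 0 4;Sg 8]); (1, [:: Sg 12;Sg 13;Sg 14]); (1, [:: Sg 3;Sg 0;Sg 7;Sg 5]); (1,
[:: Kg 0 4;Sg 1;Sg 2])]) (Br 4 10 (Lp 1 [:: (1, [:: Sg 12;Sg 13;Sg 14]); (1, [:: Sg 0;Sg 1;Sg 2]);
(1, [:: Sg 6;Sg 10;Sg 4;Sg 8]); (1, [:: Sg 9;Kg 0 7;Sg 11]); (1, [:: Sg 3;Xg 0 7;Sg 5])]) (Br 1 14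
(Br 6 14 (Lp 1 [:: (1, [:: Sg 3;Sg 4;Sg 5]); (1, [:: Sg 0;Sg 1;Sg 2]); (1, [:: Sg 12;Sg 13;Sg 4;Sg
11]); (1, [:: Sg 6;Sg 10;Sg 1;Sg 14]); (1, [:: Sg 9;Sg 7;Sg 8])]) (Br 5 12 (Lp 1 [:: (1, [:: Sg
6;Xg 0 4;Sg 8]); (1, [:: Sg 0;Sg 1;Sg 2]); (1, [:: Sg 12;Kg 0 4;Kg 1 3;Sg 5]); (1, [:: Sg 11;Sg
10;Sg 13;Sg 14]); (1, [:: Sg 9;Sg 7;Xg 1 3])]) (Cl 12))) (Lp 2 [:: (1, [:: Sg 6;Sg 7;Sg 8]); (1,
[:: Sg 3;Sg 4;Sg 5]); (2, [:: Sg 0;Sg 1;Sg 2]); (1, [:: Sg 12;Sg 13;Sg 4;Sg 11]); (1, [:: Sg 6;Xg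
4 10;Sg 14]); (1, [:: Sg 9;Sg 7;Sg 14]); (1, [:: Sg 12;Sg 13;Kg 4 10;Sg 3]); (1, [:: Sg 11;Kg 4
10;Sg 5]); (1, [:: Sg 9;Xg 4 10;Sg 8])])))))))))) (Lp 1 [:: (1, [:: Sg 9;Sg 10;Sg 11]); (1, [:: Sg
6;Xg 0 4;Sg 8]); (1, [:: Sg 3;Kg 0 4;Sg 2;Sg 5]); (1, [:: Sg 0;Sg 1;Sg 13]); (1, [:: Sg 12;Sg 7;Sg
14])])))))) (Lp 1 [:: (1, [:: Sg 6;Sg 7;Sg 8]); (1, [:: Sg 9;Sg 2;Sg 4;Sg 11]); (1, [:: Sg 3;Sg
0;Sg 2;Sg 5]); (1, [:: Sg 12;Sg 7;Sg 14]); (1, [:: Sg 10;Sg 1;Sg 13])])) (Lp 1 [:: (1, [:: Sg 6;Sg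
7;Sg 8]); (1, [:: Sg 12;Sg 13;Sg 14]); (1, [:: Sg 0;Sg 1;Sg 2]); (1, [:: Sg 9;Sg 13;Sg 4;Sg 11]);
(1, [:: Sg 3;Sg 10;Sg 13;Sg 5])])) (Lp 1 [:: (1, [:: Sg 3;Sg 0;Sg 2;Sg 5]); (1, [:: Sg 9;Xg 2 4;Sg
11]); (1, [:: Sg 12;Sg 7;Sg 14]); (1, [:: Sg 10;Sg 1;Sg 13]); (1, [:: Sg 6;Kg 2 4;Sg 8])])) (Lp 1
[:: (1, [:: Sg 0;Sg 1;Sg 2]); (1, [:: Sg 12;Sg 13;Sg 4;Sg 11]); (1, [:: Xg 0 9;Sg 10;Sg 13;Sg
14]); (1, [:: Sg 6;Sg 0;Sg 4;Sg 8]); (1, [:: Sg 3;Kg 0 9;Sg 7;Sg 5])])) (Lp 1 [:: (1, [:: Sg 12;Sg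
13;Sg 4;Sg 11]); (1, [:: Sg 6;Sg 7;Sg 1;Sg 3]); (1, [:: Sg 9;Sg 7;Sg 5]); (1, [:: Kg 3 9;Sg 10;Sg
13;Sg 14]); (1, [:: Sg 3;Sg 0;Sg 2;Sg 8])])) (Lp 1 [:: (1, [:: Sg 9;Sg 10;Sg 11]); (1, [:: Sg 0;Sg
1;Sg 2]); (1, [:: Sg 6;Sg 0;Sg 4;Sg 8]); (1, [:: Sg 3;Kg 0 12;Sg 7;Sg 5]); (1, [:: Xg 0 12;Sg
10;Sg 13;Sg 14])])) (Lp 1 [:: (1, [:: Sg 9;Sg 10;Sg 11]); (1, [:: Sg 12;Sg 13;Sg 14]); (1, [:: Sg
3;Sg 4;Sg 5]); (1, [:: Sg 6;Sg 7;Sg 1;Sg 3]); (1, [:: Sg 3;Sg 0;Sg 2;Sg 8])])) (Lp 1 [:: (1, [::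
Sg 12;Sg 13;Sg 4;Sg 11]); (1, [:: Sg 3;Sg 0;Sg 7;Sg 5]); (1, [:: Xg 0 6;Sg 10;Sg 13;Sg 14]); (1,
[:: Sg 9;Sg 7;Sg 8]); (1, [:: Kg 0 6;Sg 1;Sg 2])])) (Lp 1 [:: (1, [:: Sg 9;Sg 10;Sg 11]); (1, [::
Sg 12;Sg 13;Sg 14]); (1, [:: Sg 6;Sg 7;Sg 1;Sg 3]); (1, [:: Xg 3 0;Sg 2;Sg 8]); (1, [:: Kg 3 0;Sg
4;Sg 5])])) (Lp 1 [:: (1, [:: Sg 0;Sg 1;Sg 2]); (1, [:: Sg 12;Sg 13;Sg 4;Sg 11]); (1, [:: Sg 3;Sg
10;Sg 13;Sg 14]); (1, [:: Sg 6;Sg 7;Sg 5]); (1, [:: Sg 9;Sg 7;Sg 8])]));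
([:: 0; 2; 3],
Br 0 13 (Br 2 13 (Br 6 12 (Br 0 12 (Br 9 12 (Br 8 12 (Br 1 12 (Lp 1 [:: (1, [:: Sg 9;Sg 10;Sg
11]); (1, [:: Sg 3;Sg 4;Sg 5]); (1, [:: Sg 12;Sg 13;Sg 14]); (1, [:: Sg 12;Sg 0;Sg 2;Sg 8]); (1,
[:: Sg 6;Sg 7;Sg 1;Sg 12])]) (Br 3 6 (Br 1 11 (Lp 1 [:: (1, [:: Sg 6;Sg 10;Sg 3]); (1, [:: Sg 3;Sg
4;Sg 5]); (1, [:: Sg 12;Sg 13;Sg 14]); (1, [:: Sg 12;Sg 0;Sg 2;Sg 8]); (1, [:: Sg 9;Sg 7;Sg 1;Sg
11])]) (Br 1 3 (Lp 1 [:: (1, [:: Sg 9;Sg 10;Sg 11]); (1, [:: Sg 3;Sg 4;Sg 5]); (1, [:: Sg 12;Sg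
13;Sg 14]); (1, [:: Sg 12;Sg 0;Sg 2;Sg 8]); (1, [:: Sg 6;Sg 7;Sg 1;Sg 3])]) (Br 0 6 (Br 0 9 (Br 1
13 (Br 1 14 (Lp 1 [:: (1, [:: Sg 9;Sg 10;Sg 11]); (1, [:: Sg 6;Sg 7;Xg 12 1]); (1, [:: Sg 3;Sg
4;Sg 5]); (1, [:: Sg 12;Sg 0;Sg 2;Sg 8]); (1, [:: Kg 12 1;Sg 13;Sg 14])]) (Br 0 7 (Lp 1 [:: (1,
[:: Sg 9;Sg 10;Sg 11]); (1, [:: Sg 12;Sg 4;Sg 8]); (1, [:: Sg 0;Sg 1;Sg 2]); (1, [:: Sg 6;Sg 10;Sg
13;Sg 14]); (1, [:: Sg 3;Sg 0;Sg 7;Sg 5])]) (Lp 1 [:: (1, [:: Sg 12;Sg 4;Sg 8]); (1, [:: Sg 0;Sg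
1;Sg 2]); (1, [:: Sg 9;Sg 10;Sg 13;Sg 14]); (1, [:: Sg 3;Xg 0 7;Sg 5]); (1, [:: Sg 6;Kg 0 7;Sg
11])]))) (Br 1 14 (Br 11 13 (Lp 1 [:: (1, [:: Sg 9;Sg 10;Kg 12 1]); (1, [:: Sg 3;Sg 4;Sg 5]); (1,
[:: Sg 12;Sg 0;Sg 2;Sg 8]); (1, [:: Sg 6;Sg 7;Sg 13;Sg 11]); (1, [:: Sg 14;Xg 12 1])]) (Br 6 14
(Lp 1 [:: (1, [:: Sg 9;Sg 10;Sg 11]); (1, [:: Sg 3;Sg 4;Sg 5]); (1, [:: Sg 6;Sg 7;Sg 13;Sg 12]);
(1, [:: Sg 12;Sg 0;Sg 2;Sg 8]); (1, [:: Sg 6;Sg 0;Sg 1;Sg 14])]) (Br 4 10 (Lp 1 [:: (1, [:: Sg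
3;Sg 4;Sg 5]); (1, [:: Sg 11;Sg 4;Sg 14]); (1, [:: Sg 0;Sg 1;Sg 2]); (1, [:: Sg 6;Sg 7;Sg 13;Sg
12]); (1, [:: Sg 9;Sg 10;Sg 4;Sg 8])]) (Lp 1 [:: (1, [:: Sg 11;Sg 4;Sg 14]); (1, [:: Sg 0;Sg 1;Sg
2]); (1, [:: Sg 6;Sg 7;Sg 13;Sg 12]); (1, [:: Sg 9;Xg 4 10;Sg 8]); (1, [:: Sg 3;Kg 4 10;Sg
5])])))) (Cl 12))) (Lp 1 [:: (1, [:: Sg 9;Sg 10;Sg 11]); (1, [:: Sg 12;Sg 13;Sg 14]); (1, [:: Sg
0;Sg 1;Sg 2]); (1, [:: Sg 6;Sg 0;Sg 4;Sg 8]); (1, [:: Sg 3;Sg 0;Sg 7;Sg 5])])) (Lp 1 [:: (1, [::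
Sg 9;Sg 10;Sg 11]); (1, [:: Sg 12;Sg 4;Sg 8]); (1, [:: Sg 0;Sg 1;Sg 2]); (1, [:: Sg 6;Sg 10;Sg
13;Sg 14]); (1, [:: Sg 3;Sg 0;Sg 7;Sg 5])])))) (Lp 2 [:: (2, [:: Sg 9;Sg 10;Sg 11]); (1, [:: Sg
3;Sg 4;Sg 5]); (2, [:: Sg 12;Sg 0;Sg 2;Sg 8]); (1, [:: Xg 6 3;Sg 1;Sg 7]); (1, [:: Sg 6;Sg 10;Sg
13;Sg 14]); (1, [:: Xg 3 6;Sg 1;Sg 7]); (1, [:: Kg 6 3;Sg 10;Sg 13;Sg 14]); (1, [:: Kg 3 6;Sg 4;Sg
5])]))) (Br 1 11 (Lp 1 [:: (1, [:: Sg 3;Sg 4;Sg 5]); (1, [:: Sg 12;Sg 13;Sg 14]); (1, [:: Sg 0;Xg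
12 8;Sg 2]); (1, [:: Sg 9;Sg 7;Sg 1;Sg 11]); (1, [:: Sg 6;Sg 10;Kg 12 8])]) (Br 1 12 (Br 0 3 (Br 3
8 (Lp 1 [:: (1, [:: Sg 9;Sg 10;Sg 11]); (1, [:: Sg 3;Sg 4;Sg 5]); (1, [:: Sg 12;Sg 13;Sg 14]); (1,
[:: Sg 6;Sg 7;Sg 1;Sg 12]); (1, [:: Sg 3;Sg 0;Sg 2;Sg 8])]) (Br 0 6 (Br 0 9 (Br 11 13 (Br 4 10 (Lp
1 [:: (1, [:: Sg 3;Sg 4;Sg 5]); (1, [:: Sg 12;Sg 13;Sg 14]); (1, [:: Sg 0;Sg 1;Sg 2]); (1, [:: Sg
9;Sg 7;Sg 13;Sg 11]); (1, [:: Sg 6;Sg 10;Sg 4;Sg 8])]) (Lp 1 [:: (1, [:: Sg 12;Sg 4;Sg 14]); (1,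
[:: Sg 0;Sg 1;Sg 2]); (1, [:: Sg 9;Sg 7;Sg 13;Sg 11]); (1, [:: Sg 6;Xg 4 10;Sg 8]); (1, [:: Sg
3;Kg 4 10;Sg 5])])) (Br 3 14 (Br 1 14 (Br 8 13 (Lp 1 [:: (1, [:: Sg 9;Sg 10;Sg 11]); (1, [:: Sg
3;Sg 4;Sg 5]); (1, [:: Sg 0;Xg 12 8;Sg 2]); (1, [:: Sg 6;Sg 7;Sg 13;Kg 12 8]); (1, [:: Sg 12;Sg
1;Sg 14])]) (Br 8 14 (Br 11 14 (Br 4 10 (Lp 1 [:: (1, [:: Sg 3;Sg 4;Sg 5]); (1, [:: Sg 0;Sg 1;Sg
2]); (1, [:: Sg 6;Sg 7;Sg 13;Sg 12]); (1, [:: Sg 9;Sg 10;Sg 4;Sg 8]); (1, [:: Sg 11;Sg 4;Sg 14])])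
(Lp 1 [:: (1, [:: Sg 3;Sg 4;Sg 5]); (1, [:: Sg 0;Sg 1;Sg 2]); (1, [:: Sg 6;Sg 7;Sg 13;Sg 12]); (1,
[:: Sg 9;Xg 4 10;Sg 8]); (1, [:: Sg 11;Kg 4 10;Sg 14])])) (Cl 12)) (Cl 12))) (Cl 12)) (Cl 12)))
(Lp 1 [:: (1, [:: Sg 6;Sg 0;Sg 4;Sg 8]); (1, [:: Sg 9;Sg 10;Sg 13;Sg 14]); (1, [:: Sg 9;Sg 2;Sg
1;Sg 12]); (1, [:: Sg 3;Sg 0;Sg 7;Sg 5]); (1, [:: Sg 6;Sg 0;Sg 11])])) (Lp 1 [:: (1, [:: Sg 9;Sg
10;Sg 11]); (1, [:: Xg 6 0;Sg 4;Sg 8]); (1, [:: Kg 6 0;Sg 10;Sg 13;Sg 14]); (1, [:: Sg 3;Sg 0;Sg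
7;Sg 5]); (1, [:: Sg 6;Sg 2;Sg 1;Sg 12])]))) (Lp 1 [:: (1, [:: Sg 9;Sg 10;Sg 11]); (1, [:: Sg 6;Sg
7;Sg 8]); (1, [:: Sg 3;Sg 13;Sg 14]); (1, [:: Kg 3 0;Sg 4;Sg 5]); (1, [:: Xg 3 0;Sg 2;Sg 1;Sg
12])])) (Br 1 3 (Br 5 6 (Br 2 5 (Br 2 6 (Br 2 9 (Br 6 14 (Br 9 14 (Br 2 14 (Br 5 9 (Br 3 12 (Br 5
11 (Lp 1 [:: (1, [:: Sg 9;Sg 7;Sg 8]); (1, [:: Sg 3;Sg 4;Xg 12 1]); (1, [:: Sg 12;Sg 13;Sg 14]);
(1, [:: Sg 11;Sg 0;Sg 2;Sg 5]); (1, [:: Sg 6;Sg 10;Kg 12 1])]) (Br 5 12 (Br 3 6 (Br 0 6 (Lp 1 [::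
(1, [:: Sg 9;Sg 10;Sg 11]); (1, [:: Sg 6;Sg 7;Sg 8]); (1, [:: Sg 12;Sg 4;Sg 5]); (1, [:: Sg 6;Sg
2;Sg 1;Sg 3]); (1, [:: Sg 6;Sg 0;Sg 13;Sg 14])]) (Lp 1 [:: (1, [:: Sg 9;Sg 10;Sg 13;Sg 14]); (1,
[:: Sg 6;Sg 7;Sg 1;Sg 3]); (1, [:: Sg 12;Sg 0;Sg 2;Sg 5]); (1, [:: Xg 6 0;Sg 4;Sg 8]); (1, [:: Kg
6 0;Sg 10;Sg 11])])) (Lp 2 [:: (1, [:: Sg 9;Sg 10;Sg 11]); (1, [:: Sg 9;Sg 7;Sg 8]); (1, [:: Sg
12;Sg 4;Sg 5]); (1, [:: Sg 0;Sg 1;Sg 2]); (2, [:: Sg 6;Sg 10;Sg 13;Sg 14]); (1, [:: Sg 12;Sg 0;Sg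
2;Sg 5]); (1, [:: Sg 3;Sg 4;Sg 8]); (1, [:: Xg 6 3;Sg 1;Sg 7]); (1, [:: Kg 6 3;Sg 10;Sg 11])]))
(Br 1 5 (Br 0 6 (Lp 2 [:: (1, [:: Sg 1;Sg 4]); (1, [:: Sg 9;Sg 10;Sg 11]); (1, [:: Sg 6;Sg 7;Sg
8]); (1, [:: Sg 9;Sg 7;Sg 8]); (1, [:: Sg 3;Sg 1;Sg 5]); (1, [:: Sg 3;Sg 4;Sg 5]); (1, [:: Sg 6;Sg
10;Sg 13;Sg 14]); (1, [:: Sg 12;Sg 0;Sg 2;Sg 14]); (1, [:: Sg 6;Sg 0;Sg 11]); (1, [:: Sg 6;Sg 2;Sg
13;Sg 12])]) (Lp 4 [:: (1, [:: Sg 1;Sg 4]); (3, [:: Sg 9;Sg 10;Sg 11]); (1, [:: Sg 9;Sg 7;Sg 8]);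
(3, [:: Sg 3;Sg 1;Sg 5]); (1, [:: Sg 3;Sg 4;Sg 5]); (1, [:: Sg 6;Sg 10;Sg 13;Sg 14]); (3, [:: Sg
6;Sg 7;Sg 13;Sg 12]); (3, [:: Sg 12;Sg 0;Sg 2;Sg 14]); (2, [:: Xg 6 0;Sg 4;Sg 8]); (1, [:: Kg 6
0;Sg 2;Sg 8]); (1, [:: Kg 6 0;Sg 10;Sg 11])])) (Br 5 8 (Br 11 13 (Lp 1 [:: (1, [:: Sg 5;Sg 8]);
(1, [:: Sg 3;Sg 4;Xg 12 1]); (1, [:: Sg 12;Sg 0;Sg 2;Sg 14]); (1, [:: Sg 9;Sg 7;Sg 13;Sg 11]); (1,
[:: Sg 6;Sg 10;Kg 12 1])]) (Br 1 14 (Lp 1 [:: (1, [:: Sg 5;Sg 8]); (1, [:: Sg 9;Sg 10;Sg 11]); (1,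
[:: Sg 3;Sg 4;Xg 12 1]); (1, [:: Sg 6;Sg 7;Sg 13;Sg 12]); (1, [:: Kg 12 1;Sg 0;Sg 2;Sg 14])]) (Cl
12))) (Br 11 12 (Br 0 6 (Br 1 14 (Lp 1 [:: (1, [:: Sg 9;Sg 10;Sg 11]); (1, [:: Sg 6;Sg 2;Sg 8]);
(1, [:: Sg 3;Sg 4;Sg 5]); (1, [:: Sg 6;Sg 7;Sg 13;Sg 12]); (1, [:: Sg 6;Sg 0;Sg 1;Sg 14])]) (Br 1
13 (Br 11 13 (Br 8 13 (Lp 1 [:: (1, [:: Sg 3;Sg 4;Sg 5]); (1, [:: Sg 0;Sg 1;Sg 2]); (1, [:: Sg
6;Sg 7;Sg 13;Sg 11]); (1, [:: Sg 12;Sg 0;Sg 2;Sg 14]); (1, [:: Sg 9;Sg 10;Sg 13;Sg 8])]) (Cl 12))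
(Cl 12)) (Cl 12))) (Br 1 14 (Lp 1 [:: (1, [:: Sg 9;Sg 10;Sg 11]); (1, [:: Sg 3;Sg 4;Sg 5]); (1,
[:: Sg 6;Sg 7;Sg 13;Sg 12]); (1, [:: Xg 6 0;Sg 1;Sg 14]); (1, [:: Kg 6 0;Sg 2;Sg 8])]) (Br 8 13
(Lp 1 [:: (1, [:: Sg 9;Sg 10;Sg 11]); (1, [:: Sg 3;Sg 4;Sg 5]); (1, [:: Sg 12;Sg 0;Sg 2;Sg 14]);
(1, [:: Sg 6;Sg 10;Sg 13;Sg 8]); (1, [:: Sg 0;Sg 1;Sg 7])]) (Cl 12)))) (Br 1 13 (Br 11 13 (Br 2 10
(Lp 1 [:: (1, [:: Sg 9;Sg 7;Sg 8]); (1, [:: Sg 3;Sg 4;Sg 5]); (1, [:: Sg 6;Sg 7;Sg 13;Sg 11]); (1,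
[:: Sg 12;Sg 0;Sg 2;Sg 14]); (1, [:: Sg 10;Sg 1;Sg 2])]) (Lp 1 [:: (1, [:: Sg 3;Sg 4;Sg 5]); (1,
[:: Sg 9;Sg 7;Sg 13;Sg 11]); (1, [:: Sg 12;Sg 0;Sg 2;Sg 14]); (1, [:: Sg 1;Xg 2 10]); (1, [:: Sg
6;Kg 2 10;Sg 8])])) (Br 1 14 (Br 0 6 (Lp 1 [:: (1, [:: Sg 9;Sg 10;Sg 11]); (1, [:: Sg 6;Sg 7;Sg
8]); (1, [:: Sg 3;Sg 4;Sg 5]); (1, [:: Sg 6;Sg 0;Sg 1;Sg 14]); (1, [:: Sg 6;Sg 2;Sg 13;Sg 12])])
(Lp 1 [:: (1, [:: Sg 3;Sg 4;Sg 5]); (1, [:: Sg 9;Sg 10;Sg 1;Sg 14]); (1, [:: Sg 6;Sg 7;Sg 13;Sg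
12]); (1, [:: Sg 11;Xg 6 0]); (1, [:: Kg 6 0;Sg 2;Sg 8])])) (Cl 12))) (Br 5 14 (Br 11 14 (Br 4 10
(Lp 1 [:: (1, [:: Sg 3;Sg 4;Sg 5]); (1, [:: Sg 0;Sg 1;Sg 2]); (1, [:: Sg 6;Sg 7;Sg 13;Sg 12]); (1,
[:: Sg 11;Sg 0;Sg 2;Sg 14]); (1, [:: Sg 9;Sg 10;Sg 4;Sg 8])]) (Lp 1 [:: (1, [:: Sg 11;Sg 4;Sg
14]); (1, [:: Sg 0;Sg 1;Sg 2]); (1, [:: Sg 6;Sg 7;Sg 13;Sg 12]); (1, [:: Sg 9;Xg 4 10;Sg 8]); (1,
[:: Sg 3;Kg 4 10;Sg 5])])) (Cl 12)) (Cl 12)))))))) (Br 5 11 (Lp 1 [:: (1, [:: Sg 6;Sg 7;Sg 8]);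
(1, [:: Sg 9;Sg 2;Sg 1;Sg 3]); (1, [:: Sg 12;Sg 0;Sg 2;Sg 14]); (1, [:: Sg 6;Sg 10;Sg 13;Sg 14]);
(1, [:: Sg 11;Sg 4;Sg 5])]) (Br 4 10 (Lp 1 [:: (1, [:: Sg 9;Sg 10;Sg 11]); (1, [:: Sg 12;Sg 13;Sg
14]); (1, [:: Sg 6;Sg 7;Sg 1;Sg 3]); (1, [:: Sg 3;Sg 0;Sg 2;Sg 5]); (1, [:: Sg 6;Sg 10;Sg 4;Sg
8])]) (Br 5 12 (Lp 1 [:: (1, [:: Sg 6;Kg 10 4;Sg 11]); (1, [:: Sg 9;Sg 7;Sg 8]); (1, [:: Sg 6;Sg
10;Sg 13;Sg 14]); (1, [:: Sg 6;Xg 10 4;Sg 1;Sg 3]); (1, [:: Sg 12;Sg 0;Sg 2;Sg 5])]) (Br 1 5 (Lp 2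
[:: (1, [:: Sg 6;Kg 10 4;Sg 11]); (1, [:: Sg 9;Kg 10 4;Sg 11]); (1, [:: Sg 6;Xg 10 4;Sg 8]); (1,
[:: Sg 9;Sg 7;Sg 8]); (1, [:: Sg 6;Sg 10;Sg 13;Sg 14]); (1, [:: Sg 6;Sg 7;Sg 13;Sg 12]); (1, [::
Sg 6;Xg 10 4;Sg 1;Sg 3]); (1, [:: Sg 3;Sg 0;Sg 2;Sg 5]); (1, [:: Sg 12;Sg 0;Sg 2;Sg 14]); (1, [::
Sg 6;Sg 10;Sg 1;Sg 5])]) (Br 5 8 (Lp 2 [:: (1, [:: Sg 6;Kg 10 4;Sg 11]); (1, [:: Sg 9;Sg 10;Sg
11]); (1, [:: Sg 9;Sg 7;Sg 8]); (1, [:: Sg 3;Sg 4;Sg 5]); (1, [:: Sg 0;Sg 1;Sg 2]); (1, [:: Sg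
6;Sg 10;Sg 13;Sg 14]); (1, [:: Sg 6;Sg 7;Sg 13;Sg 12]); (1, [:: Sg 6;Xg 10 4;Sg 1;Sg 3]); (1, [::
Sg 12;Sg 0;Sg 2;Sg 14]); (1, [:: Sg 5;Sg 8])]) (Br 11 13 (Lp 1 [:: (1, [:: Sg 9;Xg 4 10;Sg 8]);
(1, [:: Sg 3;Sg 4;Sg 5]); (1, [:: Sg 12;Sg 0;Sg 2;Sg 14]); (1, [:: Sg 6;Sg 7;Sg 13;Sg 11]); (1,
[:: Sg 1;Kg 4 10])]) (Br 1 14 (Lp 1 [:: (1, [:: Sg 9;Kg 10 4;Sg 11]); (1, [:: Sg 6;Xg 10 4;Sg 8]);
(1, [:: Sg 6;Sg 7;Sg 13;Sg 12]); (1, [:: Sg 3;Sg 0;Sg 2;Sg 5]); (1, [:: Sg 6;Sg 10;Sg 1;Sg 14])])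
(Cl 12))))))))) (Lp 2 [:: (1, [:: Sg 6;Sg 7;Sg 8]); (1, [:: Sg 6;Sg 7;Sg 13;Sg 12]); (1, [:: Sg
12;Sg 0;Sg 2;Sg 14]); (2, [:: Sg 9;Sg 2;Sg 1;Sg 3]); (1, [:: Sg 6;Sg 10;Xg 12 8;Sg 5]); (1, [:: Sg
6;Sg 10;Sg 13;Sg 14]); (1, [:: Kg 12 8;Sg 0;Sg 2;Sg 5]); (2, [:: Sg 11;Sg 4;Sg 5])])) (Lp 1 [::
(1, [:: Sg 0;Sg 1;Sg 2]); (1, [:: Sg 6;Sg 7;Sg 13;Sg 12]); (1, [:: Sg 9;Kg 2 14;Sg 4;Sg 11]); (1,
[:: Sg 3;Sg 10;Sg 2;Sg 5]); (1, [:: Xg 2 14;Sg 7;Sg 8])])) (Lp 1 [:: (1, [:: Sg 3;Sg 4;Sg 5]); (1,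
[:: Sg 6;Sg 7;Sg 13;Sg 12]); (1, [:: Sg 6;Sg 10;Sg 1;Sg 14]); (1, [:: Sg 9;Sg 0;Sg 11]); (1, [::
Sg 6;Sg 2;Sg 8])])) (Lp 1 [:: (1, [:: Sg 6;Sg 7;Sg 8]); (1, [:: Sg 3;Sg 4;Sg 5]); (1, [:: Sg 10;Sg
1;Xg 6 14]); (1, [:: Kg 6 14;Sg 0;Sg 11]); (1, [:: Sg 9;Sg 2;Sg 13;Sg 12])])) (Lp 1 [:: (1, [:: Sg
9;Sg 7;Sg 8]); (1, [:: Sg 12;Sg 13;Sg 14]); (1, [:: Sg 0;Sg 1;Sg 2]); (1, [:: Sg 3;Sg 10;Sg 2;Sg
5]); (1, [:: Sg 6;Sg 2;Sg 4;Sg 11])])) (Lp 1 [:: (1, [:: Sg 9;Sg 7;Sg 8]); (1, [:: Sg 12;Sg 13;Sg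
14]); (1, [:: Sg 0;Sg 1;Sg 2]); (1, [:: Sg 3;Sg 10;Kg 2 6;Sg 5]); (1, [:: Sg 11;Sg 4;Xg 2 6])]))
(Lp 1 [:: (1, [:: Sg 9;Sg 7;Sg 8]); (1, [:: Sg 12;Sg 13;Sg 14]); (1, [:: Sg 6;Sg 10;Sg 1;Sg 5]);
(1, [:: Xg 5 2;Sg 0;Sg 11]); (1, [:: Sg 3;Sg 4;Kg 5 2])])) (Lp 1 [:: (1, [:: Sg 12;Sg 13;Sg 14]);
(1, [:: Sg 0;Xg 12 8;Sg 2]); (1, [:: Sg 6;Sg 7;Sg 1;Sg 3]); (1, [:: Sg 11;Sg 4;Sg 5]); (1, [:: Sg
9;Sg 10;Kg 12 8])])) (Br 0 6 (Br 0 9 (Br 3 8 (Br 1 5 (Lp 1 [:: (1, [:: Sg 9;Sg 10;Sg 11]); (1, [::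
Sg 6;Sg 7;Xg 3 1]); (1, [:: Sg 12;Sg 13;Sg 14]); (1, [:: Sg 3;Sg 0;Sg 2;Sg 8]); (1, [:: Kg 3 1;Sg
4;Sg 5])]) (Br 5 11 (Lp 1 [:: (1, [:: Sg 9;Sg 10;Kg 3 1]); (1, [:: Sg 6;Sg 7;Xg 3 1]); (1, [:: Sg
3;Sg 4;Sg 8]); (1, [:: Sg 12;Sg 13;Sg 14]); (1, [:: Sg 11;Sg 0;Sg 2;Sg 5])]) (Br 2 6 (Br 2 9 (Br 6
14 (Br 1 14 (Lp 1 [:: (1, [:: Sg 9;Sg 10;Sg 11]); (1, [:: Sg 3;Sg 4;Sg 8]); (1, [:: Sg 6;Sg 7;Sg
13;Sg 12]); (1, [:: Sg 3;Sg 0;Sg 2;Sg 5]); (1, [:: Sg 6;Sg 0;Sg 1;Sg 14])]) (Br 5 13 (Br 0 7 (Lp 1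
[:: (1, [:: Sg 9;Sg 10;Sg 11]); (1, [:: Sg 12;Sg 4;Sg 14]); (1, [:: Sg 6;Sg 0;Sg 13;Sg 5]); (1,
[:: Sg 3;Sg 0;Sg 2;Sg 8]); (1, [:: Sg 0;Sg 1;Sg 7])]) (Lp 1 [:: (1, [:: Sg 12;Sg 4;Sg 14]); (1,
[:: Sg 9;Sg 10;Sg 13;Sg 5]); (1, [:: Sg 3;Sg 0;Sg 2;Sg 8]); (1, [:: Sg 1;Xg 0 7]); (1, [:: Sg 6;Kg
0 7;Sg 11])])) (Cl 12))) (Lp 2 [:: (1, [:: Sg 9;Sg 10;Sg 11]); (1, [:: Sg 6;Sg 7;Sg 5]); (1, [::
Sg 9;Sg 7;Sg 5]); (1, [:: Sg 3;Sg 4;Sg 8]); (1, [:: Sg 0;Sg 1;Sg 2]); (1, [:: Sg 6;Sg 7;Sg 13;Sg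
12]); (1, [:: Sg 3;Sg 0;Sg 2;Sg 8]); (1, [:: Sg 11;Sg 4;Sg 14]); (1, [:: Sg 10;Sg 1;Xg 6 14]); (1,
[:: Kg 6 14;Sg 7;Sg 13;Sg 12])])) (Lp 1 [:: (1, [:: Sg 9;Sg 7;Sg 5]); (1, [:: Sg 12;Sg 13;Sg 14]);
(1, [:: Sg 3;Sg 0;Sg 2;Sg 8]); (1, [:: Sg 6;Sg 2;Sg 4;Sg 11]); (1, [:: Sg 10;Sg 1;Sg 2])])) (Lp 1
[:: (1, [:: Sg 9;Sg 7;Sg 5]); (1, [:: Sg 12;Sg 13;Sg 14]); (1, [:: Sg 3;Sg 0;Sg 2;Sg 8]); (1, [::
Sg 11;Sg 4;Xg 2 6]); (1, [:: Sg 10;Sg 1;Kg 2 6])])))) (Br 3 11 (Br 1 13 (Br 2 6 (Br 6 14 (Br 1 14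
(Lp 1 [:: (1, [:: Sg 9;Sg 10;Sg 11]); (1, [:: Sg 6;Sg 7;Sg 8]); (1, [:: Sg 3;Sg 4;Sg 5]); (1, [::
Sg 6;Sg 2;Sg 13;Sg 12]); (1, [:: Sg 6;Sg 0;Sg 1;Sg 14])]) (Br 3 13 (Br 11 13 (Br 8 13 (Lp 1 [::
(1, [:: Sg 3;Sg 4;Sg 5]); (1, [:: Sg 0;Sg 1;Sg 2]); (1, [:: Sg 9;Sg 7;Sg 13;Sg 11]); (1, [:: Sg
12;Sg 0;Sg 2;Sg 14]); (1, [:: Sg 6;Sg 10;Sg 13;Sg 8])]) (Cl 12)) (Cl 12)) (Cl 12))) (Lp 1 [:: (1,
[:: Sg 9;Sg 7;Sg 8]); (1, [:: Sg 3;Sg 4;Sg 5]); (1, [:: Sg 6;Sg 2;Sg 13;Sg 12]); (1, [:: Sg 10;Sg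
1;Xg 6 14]); (1, [:: Kg 6 14;Sg 0;Sg 11])])) (Br 2 5 (Lp 1 [:: (1, [:: Sg 9;Sg 7;Sg 8]); (1, [::
Sg 12;Sg 13;Sg 14]); (1, [:: Sg 3;Sg 10;Sg 2;Sg 5]); (1, [:: Sg 11;Sg 4;Xg 2 6]); (1, [:: Sg 0;Sg
1;Kg 2 6])]) (Br 2 9 (Lp 1 [:: (1, [:: Sg 6;Sg 10;Sg 3]); (1, [:: Xg 2 5;Sg 7;Sg 8]); (1, [:: Sg
12;Sg 13;Sg 14]); (1, [:: Sg 9;Sg 2;Sg 4;Sg 11]); (1, [:: Sg 0;Sg 1;Kg 2 5])]) (Br 5 6 (Lp 1 [::
(1, [:: Sg 9;Sg 10;Sg 3]); (1, [:: Sg 12;Sg 13;Sg 14]); (1, [:: Sg 6;Sg 0;Sg 1;Sg 5]); (1, [:: Xg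
5 2;Sg 7;Sg 8]); (1, [:: Sg 11;Sg 4;Kg 5 2])]) (Br 5 9 (Lp 1 [:: (1, [:: Sg 6;Sg 10;Sg 3]); (1,
[:: Sg 12;Sg 13;Sg 14]); (1, [:: Sg 9;Sg 0;Sg 1;Sg 5]); (1, [:: Xg 5 2;Sg 7;Sg 8]); (1, [:: Sg
11;Sg 4;Kg 5 2])]) (Br 2 14 (Lp 2 [:: (1, [:: Sg 3;Sg 11]); (2, [:: Sg 9;Sg 7;Sg 8]); (1, [:: Sg
3;Sg 4;Sg 5]); (1, [:: Sg 0;Sg 1;Sg 2]); (1, [:: Sg 6;Sg 10;Sg 13;Xg 12 1]); (1, [:: Sg 12;Sg 0;Sg
2;Sg 14]); (1, [:: Sg 12;Sg 10;Sg 2;Sg 14]); (1, [:: Sg 6;Sg 7;Sg 13;Kg 12 1]); (1, [:: Sg 11;Sg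
4;Sg 5])]) (Br 0 4 (Lp 1 [:: (1, [:: Sg 3;Sg 4;Sg 5]); (1, [:: Sg 11;Sg 4;Sg 14]); (1, [:: Sg 6;Sg
7;Sg 13;Sg 12]); (1, [:: Sg 9;Sg 0;Sg 4;Sg 8]); (1, [:: Sg 10;Sg 1;Sg 2])]) (Lp 1 [:: (1, [:: Sg
11;Sg 4;Sg 14]); (1, [:: Sg 6;Sg 7;Sg 13;Sg 12]); (1, [:: Sg 9;Xg 4 0;Sg 8]); (1, [:: Sg 3;Kg 4
0;Sg 5]); (1, [:: Sg 10;Sg 1;Sg 2])])))))))) (Br 8 14 (Br 3 14 (Br 1 14 (Br 11 14 (Br 4 10 (Lp 1
[:: (1, [:: Sg 3;Sg 4;Sg 5]); (1, [:: Sg 0;Sg 1;Sg 2]); (1, [:: Sg 6;Sg 7;Sg 13;Sg 12]); (1, [::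
Sg 9;Sg 10;Sg 4;Sg 8]); (1, [:: Sg 11;Sg 4;Sg 14])]) (Lp 1 [:: (1, [:: Sg 3;Sg 4;Sg 5]); (1, [::
Sg 0;Sg 1;Sg 2]); (1, [:: Sg 6;Sg 7;Sg 13;Sg 12]); (1, [:: Sg 9;Xg 4 10;Sg 8]); (1, [:: Sg 11;Kg 4
10;Sg 14])])) (Cl 12)) (Cl 12)) (Cl 12)) (Cl 12))) (Br 3 12 (Br 1 13 (Br 11 13 (Br 4 10 (Lp 1 [::
(1, [:: Sg 3;Sg 4;Sg 5]); (1, [:: Sg 12;Sg 4;Sg 14]); (1, [:: Sg 0;Sg 1;Sg 2]); (1, [:: Sg 9;Sg
7;Sg 13;Sg 11]); (1, [:: Sg 6;Sg 10;Sg 4;Sg 8])]) (Lp 1 [:: (1, [:: Sg 12;Sg 4;Sg 14]); (1, [:: Sg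
0;Sg 1;Sg 2]); (1, [:: Sg 9;Sg 7;Sg 13;Sg 11]); (1, [:: Sg 6;Xg 4 10;Sg 8]); (1, [:: Sg 3;Kg 4
10;Sg 5])])) (Br 3 14 (Br 8 14 (Br 11 12 (Lp 2 [:: (1, [:: Sg 9;Sg 10;Sg 11]); (2, [:: Sg 3;Sg
4;Sg 5]); (1, [:: Sg 0;Sg 1;Sg 2]); (1, [:: Sg 9;Sg 10;Sg 13;Xg 12 1]); (1, [:: Sg 12;Sg 0;Sg 2;Xg
13 11]); (1, [:: Sg 6;Sg 7;Kg 13 11;Sg 12]); (1, [:: Sg 6;Sg 7;Sg 13;Kg 12 1]); (2, [:: Sg 8;Sg
14])]) (Br 1 14 (Br 11 14 (Br 4 10 (Lp 1 [:: (1, [:: Sg 3;Sg 4;Sg 5]); (1, [:: Sg 11;Sg 4;Sg 14]);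
(1, [:: Sg 0;Sg 1;Sg 2]); (1, [:: Sg 6;Sg 7;Sg 13;Sg 12]); (1, [:: Sg 9;Sg 10;Sg 4;Sg 8])]) (Lp 1
[:: (1, [:: Sg 11;Sg 4;Sg 14]); (1, [:: Sg 0;Sg 1;Sg 2]); (1, [:: Sg 6;Sg 7;Sg 13;Sg 12]); (1, [::
Sg 9;Xg 4 10;Sg 8]); (1, [:: Sg 3;Kg 4 10;Sg 5])])) (Cl 12)) (Cl 12))) (Cl 12)) (Cl 12))) (Br 3 14
(Br 8 14 (Br 1 14 (Br 11 14 (Br 4 10 (Lp 1 [:: (1, [:: Sg 3;Sg 4;Sg 5]); (1, [:: Sg 0;Sg 1;Sg 2]);
(1, [:: Sg 6;Sg 7;Sg 13;Sg 12]); (1, [:: Sg 9;Sg 10;Sg 4;Sg 8]); (1, [:: Sg 11;Sg 4;Sg 14])]) (Lp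
1 [:: (1, [:: Sg 3;Sg 4;Sg 5]); (1, [:: Sg 0;Sg 1;Sg 2]); (1, [:: Sg 6;Sg 7;Sg 13;Sg 12]); (1, [::
Sg 9;Xg 4 10;Sg 8]); (1, [:: Sg 11;Kg 4 10;Sg 14])])) (Cl 12)) (Cl 12)) (Cl 12)) (Cl 12))) (Br 11
12 (Br 1 13 (Br 2 6 (Br 6 14 (Br 1 14 (Lp 1 [:: (1, [:: Sg 6;Sg 0;Sg 11]); (1, [:: Sg 9;Sg 7;Sg
8]); (1, [:: Sg 3;Sg 4;Sg 5]); (1, [:: Sg 6;Sg 10;Sg 1;Sg 14]); (1, [:: Sg 6;Sg 2;Sg 13;Sg 12])])
(Br 8 14 (Lp 2 [:: (1, [:: Sg 11;Sg 12]); (1, [:: Sg 9;Sg 10;Sg 11]); (1, [:: Sg 9;Sg 7;Sg 8]);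
(2, [:: Sg 3;Sg 4;Sg 5]); (1, [:: Sg 0;Sg 1;Sg 2]); (1, [:: Sg 6;Sg 7;Sg 13;Xg 14 1]); (1, [:: Sg
12;Sg 0;Sg 2;Sg 14]); (1, [:: Sg 8;Sg 14]); (1, [:: Sg 6;Sg 10;Sg 13;Kg 14 1])]) (Br 3 13 (Br 11
13 (Br 2 10 (Lp 1 [:: (1, [:: Sg 9;Sg 7;Sg 8]); (1, [:: Sg 3;Sg 4;Sg 5]); (1, [:: Sg 6;Sg 2;Sg
13;Sg 11]); (1, [:: Sg 12;Sg 0;Sg 2;Sg 14]); (1, [:: Sg 10;Sg 1;Sg 2])]) (Lp 1 [:: (1, [:: Sg 3;Sg
4;Sg 5]); (1, [:: Sg 9;Sg 7;Sg 13;Sg 11]); (1, [:: Sg 12;Sg 0;Sg 2;Sg 14]); (1, [:: Sg 1;Xg 2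
10]); (1, [:: Sg 6;Kg 2 10;Sg 8])])) (Cl 12)) (Cl 12)))) (Lp 1 [:: (1, [:: Sg 9;Sg 7;Sg 8]); (1,
[:: Sg 3;Sg 4;Sg 5]); (1, [:: Sg 10;Sg 1;Xg 6 14]); (1, [:: Sg 6;Sg 2;Sg 13;Sg 12]); (1, [:: Kg 6
14;Sg 0;Sg 11])])) (Br 5 11 (Br 2 5 (Lp 1 [:: (1, [:: Sg 9;Sg 7;Sg 8]); (1, [:: Sg 12;Sg 13;Sg
14]); (1, [:: Sg 11;Sg 10;Sg 2;Sg 5]); (1, [:: Sg 3;Sg 4;Xg 2 6]); (1, [:: Sg 0;Sg 1;Kg 2 6])])
(Br 2 9 (Lp 1 [:: (1, [:: Sg 6;Sg 10;Sg 3]); (1, [:: Sg 12;Sg 13;Sg 14]); (1, [:: Sg 9;Sg 2;Sg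
4;Sg 11]); (1, [:: Xg 2 5;Sg 7;Sg 8]); (1, [:: Sg 0;Sg 1;Kg 2 5])]) (Br 5 6 (Lp 1 [:: (1, [:: Sg
9;Sg 10;Sg 3]); (1, [:: Sg 12;Sg 13;Sg 14]); (1, [:: Sg 6;Sg 0;Sg 1;Sg 5]); (1, [:: Sg 11;Sg 4;Xg
6 2]); (1, [:: Kg 6 2;Sg 7;Sg 8])]) (Br 5 9 (Lp 1 [:: (1, [:: Sg 6;Sg 10;Sg 3]); (1, [:: Sg 12;Sg
13;Sg 14]); (1, [:: Sg 9;Sg 0;Sg 1;Sg 5]); (1, [:: Sg 11;Sg 4;Xg 6 2]); (1, [:: Kg 6 2;Sg 7;Sg
8])]) (Br 3 13 (Br 0 4 (Lp 1 [:: (1, [:: Sg 11;Sg 4;Sg 5]); (1, [:: Sg 12;Sg 4;Sg 14]); (1, [:: Sg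
9;Sg 7;Sg 13;Sg 3]); (1, [:: Sg 6;Sg 0;Sg 4;Sg 8]); (1, [:: Sg 10;Sg 1;Sg 2])]) (Lp 1 [:: (1, [::
Sg 12;Sg 4;Sg 14]); (1, [:: Sg 9;Sg 7;Sg 13;Sg 3]); (1, [:: Sg 6;Xg 4 0;Sg 8]); (1, [:: Sg 10;Sg
1;Sg 2]); (1, [:: Sg 11;Kg 4 0;Sg 5])])) (Br 3 14 (Br 0 4 (Lp 1 [:: (1, [:: Sg 3;Sg 4;Sg 14]); (1,
[:: Sg 11;Sg 4;Sg 5]); (1, [:: Sg 6;Sg 7;Sg 13;Sg 12]); (1, [:: Sg 9;Sg 0;Sg 4;Sg 8]); (1, [:: Sg
10;Sg 1;Sg 2])]) (Lp 1 [:: (1, [:: Sg 11;Sg 4;Sg 5]); (1, [:: Sg 6;Sg 7;Sg 13;Sg 12]); (1, [:: Sg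
9;Xg 4 0;Sg 8]); (1, [:: Sg 3;Kg 4 0;Sg 14]); (1, [:: Sg 10;Sg 1;Sg 2])])) (Cl 12))))))) (Lp 1 [::
(1, [:: Sg 9;Sg 7;Sg 8]); (1, [:: Sg 12;Sg 13;Sg 14]); (1, [:: Sg 0;Sg 1;Sg 2]); (1, [:: Sg 3;Sg
10;Kg 2 6;Sg 5]); (1, [:: Sg 11;Sg 4;Xg 2 6])]))) (Br 3 14 (Br 8 14 (Br 1 14 (Br 11 14 (Br 4 10
(Lp 1 [:: (1, [:: Sg 3;Sg 4;Sg 5]); (1, [:: Sg 0;Sg 1;Sg 2]); (1, [:: Sg 6;Sg 7;Sg 13;Sg 12]); (1,
[:: Sg 9;Sg 10;Sg 4;Sg 8]); (1, [:: Sg 11;Sg 4;Sg 14])]) (Lp 1 [:: (1, [:: Sg 3;Sg 4;Sg 5]); (1,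
[:: Sg 0;Sg 1;Sg 2]); (1, [:: Sg 6;Sg 7;Sg 13;Sg 12]); (1, [:: Sg 9;Xg 4 10;Sg 8]); (1, [:: Sg
11;Kg 4 10;Sg 14])])) (Cl 12)) (Cl 12)) (Cl 12)) (Cl 12))) (Br 4 10 (Br 0 7 (Lp 1 [:: (1, [:: Sg
6;Sg 0;Sg 11]); (1, [:: Sg 12;Sg 13;Sg 14]); (1, [:: Sg 0;Sg 1;Sg 2]); (1, [:: Sg 9;Sg 10;Sg 4;Sg
8]); (1, [:: Sg 3;Sg 0;Sg 7;Sg 5])]) (Lp 1 [:: (1, [:: Sg 12;Sg 13;Sg 14]); (1, [:: Sg 0;Sg 1;Sg
2]); (1, [:: Sg 9;Sg 10;Sg 4;Sg 8]); (1, [:: Sg 3;Xg 0 7;Sg 5]); (1, [:: Sg 6;Kg 0 7;Sg 11])]))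
(Br 11 13 (Lp 1 [:: (1, [:: Sg 9;Xg 4 10;Sg 8]); (1, [:: Sg 12;Sg 4;Sg 14]); (1, [:: Sg 0;Sg 1;Sg
2]); (1, [:: Sg 6;Sg 7;Sg 13;Sg 11]); (1, [:: Sg 3;Kg 4 10;Sg 5])]) (Br 11 14 (Lp 1 [:: (1, [:: Sg
9;Xg 4 10;Sg 8]); (1, [:: Sg 3;Sg 4;Sg 5]); (1, [:: Sg 0;Sg 1;Sg 2]); (1, [:: Sg 6;Sg 7;Sg 13;Sg
12]); (1, [:: Sg 11;Kg 4 10;Sg 14])]) (Cl 12)))))))) (Lp 1 [:: (1, [:: Sg 9;Sg 10;Sg 11]); (1, [::
Sg 12;Sg 13;Sg 14]); (1, [:: Sg 0;Sg 1;Sg 2]); (1, [:: Sg 6;Sg 0;Sg 4;Sg 8]); (1, [:: Sg 3;Sg 0;Sg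
7;Sg 5])])) (Lp 1 [:: (1, [:: Sg 9;Sg 10;Sg 11]); (1, [:: Sg 12;Sg 13;Sg 14]); (1, [:: Sg 0;Sg
1;Sg 2]); (1, [:: Sg 3;Kg 0 6;Sg 7;Sg 5]); (1, [:: Xg 0 6;Sg 4;Sg 8])])))))) (Lp 1 [:: (1, [:: Sg
9;Sg 10;Sg 11]); (1, [:: Sg 3;Sg 4;Sg 5]); (1, [:: Sg 12;Sg 0;Sg 2;Sg 8]); (1, [:: Sg 6;Sg 7;Sg
1;Sg 12]); (1, [:: Sg 9;Sg 10;Sg 13;Sg 14])])) (Lp 1 [:: (1, [:: Sg 9;Sg 10;Sg 11]); (1, [:: Sg
3;Sg 4;Sg 5]); (1, [:: Xg 12 0;Sg 2;Sg 8]); (1, [:: Sg 6;Sg 7;Sg 1;Sg 12]); (1, [:: Kg 12 0;Sg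
13;Sg 14])])) (Br 0 6 (Lp 1 [:: (1, [:: Sg 9;Sg 10;Sg 11]); (1, [:: Sg 3;Sg 4;Sg 5]); (1, [:: Xg 6
12;Sg 1;Sg 7]); (1, [:: Sg 6;Sg 0;Sg 13;Sg 14]); (1, [:: Kg 6 12;Sg 2;Sg 8])]) (Br 2 4 (Lp 2 [::
(1, [:: Sg 9;Sg 10;Sg 11]); (1, [:: Sg 9;Sg 7;Sg 8]); (2, [:: Sg 3;Sg 4;Sg 5]); (1, [:: Sg 12;Sg
4;Sg 8]); (1, [:: Sg 12;Sg 13;Sg 14]); (1, [:: Sg 0;Sg 1;Sg 2]); (1, [:: Sg 0;Sg 1;Sg 7]); (1, [::
Sg 6;Sg 10;Sg 13;Sg 14]); (1, [:: Sg 6;Sg 2;Sg 4;Sg 11])]) (Lp 1 [:: (1, [:: Sg 9;Sg 10;Sg 11]);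
(1, [:: Sg 12;Sg 4;Sg 8]); (1, [:: Sg 0;Sg 1;Sg 7]); (1, [:: Sg 6;Xg 4 2;Sg 13;Sg 14]); (1, [:: Sg
3;Kg 4 2;Sg 5])])))) (Lp 1 [:: (1, [:: Sg 3;Sg 4;Sg 5]); (1, [:: Sg 12;Sg 13;Sg 14]); (1, [:: Sg
0;Sg 1;Sg 2]); (1, [:: Sg 9;Sg 10;Sg 13;Sg 8]); (1, [:: Sg 6;Sg 7;Sg 13;Sg 11])])) (Lp 1 [:: (1,
[:: Sg 3;Sg 4;Sg 5]); (1, [:: Sg 12;Sg 13;Sg 14]); (1, [:: Sg 0;Sg 1;Sg 2]); (1, [:: Sg 9;Sg 10;Sg
13;Sg 8]); (1, [:: Sg 6;Sg 7;Sg 13;Sg 11])]));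
([:: 1; 2; 3],
Br 3 6 (Br 5 6 (Br 3 12 (Br 6 12 (Lp 1 [:: (1, [:: Sg 9;Sg 10;Sg 11]); (1, [:: Sg 0;Sg 1;Sg 2]);
(1, [:: Sg 12;Sg 13;Sg 14]); (1, [:: Sg 3;Sg 12;Sg 7;Sg 5]); (1, [:: Sg 6;Sg 12;Sg 4;Sg 8])]) (Lp
1 [:: (1, [:: Sg 9;Sg 7;Sg 8]); (1, [:: Sg 0;Sg 1;Sg 2]); (1, [:: Sg 3;Sg 12;Sg 7;Sg 5]); (1, [::
Sg 6;Sg 14;Sg 4;Sg 11]); (1, [:: Sg 10;Sg 13;Sg 14])])) (Lp 2 [:: (1, [:: Sg 9;Sg 10;Sg 11]); (1,
[:: Sg 9;Sg 7;Sg 8]); (2, [:: Sg 0;Sg 1;Sg 2]); (1, [:: Xg 3 12;Sg 14;Sg 4;Sg 11]); (1, [:: Xg 3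
12;Sg 7;Sg 5]); (2, [:: Sg 6;Sg 7;Sg 13;Sg 3]); (1, [:: Kg 3 12;Sg 10;Sg 14;Sg 8]); (1, [:: Kg 3
12;Sg 4;Sg 5])])) (Lp 2 [:: (1, [:: Sg 6;Sg 10;Sg 3]); (1, [:: Sg 9;Sg 10;Sg 11]); (1, [:: Sg 9;Sg
7;Sg 8]); (1, [:: Sg 3;Sg 4;Sg 5]); (2, [:: Sg 0;Sg 1;Sg 2]); (2, [:: Sg 12;Sg 13;Sg 14]); (1, [::
Sg 6;Sg 12;Sg 4;Sg 8]); (1, [:: Sg 11;Sg 12;Sg 7;Sg 5])])) (Lp 2 [:: (1, [:: Sg 9;Sg 10;Sg 11]);
(1, [:: Sg 3;Sg 4;Sg 5]); (2, [:: Sg 0;Sg 1;Sg 2]); (2, [:: Sg 12;Sg 13;Sg 14]); (1, [:: Sg 6;Sg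
14;Sg 4;Sg 11]); (1, [:: Sg 3;Sg 10;Sg 14;Sg 8]); (1, [:: Sg 6;Sg 7;Sg 5]); (1, [:: Sg 9;Sg 7;Sg
8])]));
([:: 0; 1; 2; 3],
Br 0 14 (Br 5 6 (Br 5 9 (Br 2 5 (Br 0 4 (Br 0 7 (Br 5 12 (Br 3 15 (Br 2 6 (Br 6 15 (Br 2 4 (Lp 2
[:: (1, [:: Sg 9;Sg 10;Sg 11]); (1, [:: Sg 9;Sg 7;Sg 8]); (2, [:: Sg 3;Sg 4;Sg 5]); (1, [:: Sg
0;Sg 1;Sg 2]); (1, [:: Sg 0;Sg 1;Sg 7]); (1, [:: Sg 6;Sg 10;Sg 14;Sg 15]); (1, [:: Sg 12;Sg 13;Sg
14;Sg 15]); (1, [:: Sg 6;Sg 2;Sg 4;Sg 11]); (1, [:: Sg 12;Sg 13;Sg 4;Sg 8])]) (Lp 1 [:: (1, [:: Sg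
0;Sg 1;Sg 7]); (1, [:: Sg 6;Sg 10;Sg 14;Sg 15]); (1, [:: Sg 9;Xg 4 2;Sg 11]); (1, [:: Sg 12;Sg
13;Sg 4;Sg 8]); (1, [:: Sg 3;Kg 4 2;Sg 5])])) (Lp 2 [:: (1, [:: Sg 9;Sg 10;Sg 11]); (2, [:: Sg
3;Sg 4;Sg 5]); (1, [:: Sg 0;Sg 1;Sg 2]); (1, [:: Sg 12;Sg 13;Sg 14;Sg 15]); (1, [:: Sg 0;Sg 14;Xg
15 6]); (1, [:: Sg 9;Sg 7;Sg 8]); (1, [:: Sg 12;Sg 10;Sg 1;Sg 15]); (1, [:: Sg 11;Sg 13;Sg 7;Kg 15
6]); (1, [:: Sg 6;Sg 2;Sg 8])])) (Lp 1 [:: (1, [:: Sg 9;Sg 10;Sg 11]); (1, [:: Sg 12;Sg 13;Sg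
14;Sg 15]); (1, [:: Sg 6;Sg 0;Sg 4;Sg 8]); (1, [:: Sg 0;Sg 1;Sg 7]); (1, [:: Sg 3;Sg 10;Sg 2;Sg
5])])) (Lp 1 [:: (1, [:: Sg 9;Sg 10;Sg 11]); (1, [:: Sg 0;Sg 1;Sg 2]); (1, [:: Sg 3;Sg 0;Sg 7;Sg
5]); (1, [:: Sg 12;Sg 13;Sg 4;Sg 8]); (1, [:: Sg 6;Sg 10;Sg 14;Sg 15])])) (Lp 1 [:: (1, [:: Sg
6;Sg 7;Sg 8]); (1, [:: Sg 3;Sg 4;Sg 5]); (1, [:: Sg 12;Sg 13;Sg 14;Sg 15]); (1, [:: Sg 9;Sg 10;Sg
1;Sg 5]); (1, [:: Sg 11;Sg 0;Sg 2;Sg 5])])) (Lp 1 [:: (1, [:: Sg 9;Sg 10;Sg 11]); (1, [:: Sg 6;Sg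
0;Sg 4;Sg 8]); (1, [:: Sg 3;Sg 0;Sg 2;Sg 5]); (1, [:: Sg 13;Sg 1;Sg 7]); (1, [:: Sg 12;Sg 10;Sg
14;Sg 15])])) (Lp 1 [:: (1, [:: Sg 3;Sg 0;Sg 2;Sg 5]); (1, [:: Sg 9;Xg 0 4;Sg 8]); (1, [:: Sg
13;Sg 1;Sg 7]); (1, [:: Sg 12;Sg 10;Sg 14;Sg 15]); (1, [:: Sg 6;Kg 0 4;Sg 11])])) (Lp 1 [:: (1,
[:: Sg 6;Sg 7;Sg 8]); (1, [:: Sg 12;Sg 13;Sg 14;Sg 15]); (1, [:: Sg 9;Sg 10;Sg 1;Sg 5]); (1, [::
Xg 5 2;Sg 0;Sg 11]); (1, [:: Sg 3;Sg 4;Kg 5 2])])) (Lp 2 [:: (1, [:: Sg 6;Sg 7;Sg 8]); (1, [:: Sg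
3;Sg 4;Sg 5]); (2, [:: Sg 0;Sg 1;Sg 2]); (2, [:: Sg 12;Sg 13;Sg 14;Sg 15]); (1, [:: Sg 9;Sg 10;Sg
3]); (1, [:: Sg 9;Sg 13;Sg 4;Sg 8]); (1, [:: Sg 11;Sg 13;Sg 7;Sg 5]); (1, [:: Sg 6;Sg 10;Sg
11])])) (Lp 2 [:: (1, [:: Sg 9;Sg 10;Sg 11]); (1, [:: Sg 3;Sg 4;Sg 5]); (2, [:: Sg 0;Sg 1;Sg 2]);
(2, [:: Sg 12;Sg 13;Sg 14;Sg 15]); (1, [:: Sg 6;Sg 10;Sg 3]); (1, [:: Sg 6;Sg 13;Sg 4;Sg 8]); (1,
[:: Sg 9;Sg 7;Sg 8]); (1, [:: Sg 11;Sg 13;Sg 7;Sg 5])])) (Lp 1 [:: (1, [:: Sg 3;Sg 4;Sg 5]); (1,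
[:: Sg 0;Sg 1;Sg 2]); (1, [:: Sg 12;Sg 13;Sg 14;Sg 15]); (1, [:: Sg 6;Sg 10;Sg 14;Sg 8]); (1, [::
Sg 9;Sg 7;Sg 14;Sg 11])]));
([:: 0; 1; 3; 2],
Br 3 6 (Br 0 3 (Br 0 6 (Br 3 12 (Br 6 15 (Br 4 10 (Lp 1 [:: (1, [:: Sg 3;Sg 4;Sg 5]); (1, [:: Sg
0;Sg 1;Sg 2]); (1, [:: Sg 6;Sg 7;Sg 14;Sg 15]); (1, [:: Sg 12;Sg 13;Sg 4;Sg 11]); (1, [:: Sg 9;Sg
10;Sg 4;Sg 8])]) (Lp 1 [:: (1, [:: Sg 0;Sg 1;Sg 2]); (1, [:: Sg 6;Sg 7;Sg 14;Sg 15]); (1, [:: Sg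
12;Sg 13;Sg 4;Sg 11]); (1, [:: Sg 9;Xg 4 10;Sg 8]); (1, [:: Sg 3;Kg 4 10;Sg 5])])) (Lp 2 [:: (1,
[:: Sg 6;Sg 0;Sg 11]); (1, [:: Sg 9;Sg 10;Sg 11]); (2, [:: Sg 3;Sg 4;Sg 5]); (1, [:: Sg 0;Sg 1;Sg
2]); (1, [:: Sg 12;Sg 13;Sg 14;Sg 15]); (1, [:: Xg 15 6;Sg 1;Sg 2]); (1, [:: Sg 9;Sg 7;Sg 8]); (1,
[:: Kg 15 6;Sg 10;Sg 13;Sg 8]); (1, [:: Sg 12;Sg 7;Sg 14;Sg 15])])) (Lp 1 [:: (1, [:: Sg 9;Sg
10;Sg 11]); (1, [:: Sg 3;Sg 4;Sg 5]); (1, [:: Sg 12;Sg 13;Sg 14;Sg 15]); (1, [:: Sg 6;Sg 7;Sg 1;Sg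
3]); (1, [:: Sg 3;Sg 0;Sg 2;Sg 8])])) (Lp 2 [:: (1, [:: Sg 9;Sg 10;Sg 11]); (1, [:: Sg 3;Sg 4;Sg
5]); (2, [:: Sg 0;Sg 1;Sg 2]); (2, [:: Sg 12;Sg 13;Sg 14;Sg 15]); (1, [:: Sg 6;Sg 13;Sg 4;Sg 11]);
(1, [:: Sg 3;Kg 0 6;Sg 7;Sg 5]); (1, [:: Xg 0 6;Sg 10;Sg 13;Sg 8]); (1, [:: Sg 9;Sg 7;Sg 8])]))
(Lp 1 [:: (1, [:: Sg 9;Sg 10;Sg 11]); (1, [:: Sg 12;Sg 13;Sg 14;Sg 15]); (1, [:: Sg 6;Sg 7;Sg 1;Sg
3]); (1, [:: Xg 3 0;Sg 2;Sg 8]); (1, [:: Kg 3 0;Sg 4;Sg 5])])) (Lp 2 [:: (1, [:: Sg 9;Sg 10;Sg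
11]); (1, [:: Sg 3;Sg 4;Sg 5]); (2, [:: Sg 0;Sg 1;Sg 2]); (1, [:: Sg 6;Sg 13;Sg 4;Sg 11]); (1, [::
Sg 3;Sg 10;Sg 13;Sg 8]); (1, [:: Sg 6;Sg 7;Sg 5]); (1, [:: Sg 9;Sg 7;Sg 8]); (2, [:: Sg 12;Sg 7;Sg
14;Sg 15])]));
([:: 0; 2; 1; 3],
Br 3 6 (Br 5 6 (Br 0 3 (Br 0 6 (Br 6 12 (Br 5 9 (Br 2 4 (Br 3 9 (Br 9 12 (Br 6 13 (Br 3 8 (Lp 1
[:: (1, [:: Sg 9;Sg 10;Sg 11]); (1, [:: Sg 10;Sg 1;Sg 14]); (1, [:: Sg 6;Sg 13;Sg 4;Sg 5]); (1,
[:: Sg 12;Sg 13;Sg 7;Sg 15]); (1, [:: Sg 3;Sg 0;Sg 2;Sg 8])]) (Lp 1 [:: (1, [:: Sg 9;Sg 10;Sg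
11]); (1, [:: Sg 0;Sg 1;Sg 2]); (1, [:: Sg 6;Sg 13;Sg 4;Sg 8]); (1, [:: Sg 12;Sg 13;Sg 14;Sg 15]);
(1, [:: Sg 3;Sg 13;Sg 7;Sg 5])])) (Lp 2 [:: (1, [:: Sg 6;Sg 0;Sg 11]); (1, [:: Sg 9;Sg 10;Sg 11]);
(1, [:: Sg 9;Sg 7;Sg 8]); (2, [:: Sg 3;Sg 4;Sg 5]); (1, [:: Sg 0;Sg 1;Sg 2]); (1, [:: Sg 12;Sg
13;Sg 7;Sg 15]); (1, [:: Sg 12;Sg 13;Sg 14;Sg 15]); (1, [:: Xg 13 6;Sg 10;Sg 14;Sg 8]); (1, [:: Kg
13 6;Sg 1;Sg 2])])) (Lp 2 [:: (1, [:: Sg 6;Sg 0;Sg 11]); (1, [:: Sg 9;Sg 10;Sg 11]); (2, [:: Sg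
3;Sg 4;Sg 5]); (1, [:: Sg 0;Sg 1;Sg 2]); (1, [:: Sg 12;Sg 13;Sg 7;Sg 15]); (1, [:: Sg 12;Sg 13;Sg
14;Sg 15]); (1, [:: Sg 6;Sg 7;Sg 1;Sg 12]); (1, [:: Sg 12;Sg 10;Sg 14;Sg 8]); (1, [:: Sg 9;Sg 2;Sg
8])])) (Lp 1 [:: (1, [:: Sg 6;Sg 7;Sg 5]); (1, [:: Sg 10;Sg 1;Sg 14]); (1, [:: Sg 12;Sg 13;Sg 7;Sg
15]); (1, [:: Sg 9;Sg 2;Sg 4;Sg 11]); (1, [:: Sg 3;Sg 0;Sg 2;Sg 8])])) (Lp 1 [:: (1, [:: Sg 10;Sg
1;Sg 14]); (1, [:: Sg 12;Sg 13;Sg 7;Sg 15]); (1, [:: Sg 9;Xg 2 4;Sg 11]); (1, [:: Sg 3;Sg 0;Sg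
2;Sg 5]); (1, [:: Sg 6;Kg 2 4;Sg 8])])) (Lp 1 [:: (1, [:: Sg 6;Sg 10;Sg 3]); (1, [:: Sg 0;Sg 1;Sg
2]); (1, [:: Sg 12;Sg 13;Sg 14;Sg 15]); (1, [:: Sg 11;Sg 13;Sg 7;Sg 5]); (1, [:: Sg 9;Sg 13;Sg
4;Sg 8])])) (Lp 2 [:: (1, [:: Sg 6;Sg 0;Sg 11]); (1, [:: Sg 9;Sg 10;Sg 11]); (1, [:: Sg 9;Sg 7;Sg
8]); (2, [:: Sg 3;Sg 4;Sg 5]); (1, [:: Sg 0;Sg 1;Sg 2]); (1, [:: Sg 12;Sg 13;Sg 7;Sg 15]); (1, [::
Sg 12;Sg 13;Sg 14;Sg 15]); (1, [:: Xg 12 6;Sg 1;Sg 2]); (1, [:: Kg 12 6;Sg 10;Sg 14;Sg 8])])) (Lp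
2 [:: (1, [:: Sg 9;Sg 10;Sg 11]); (1, [:: Sg 9;Sg 7;Sg 8]); (1, [:: Sg 3;Sg 4;Sg 5]); (1, [:: Sg
0;Sg 1;Sg 2]); (2, [:: Sg 12;Sg 13;Sg 7;Sg 15]); (1, [:: Sg 3;Sg 0;Sg 7;Sg 5]); (1, [:: Sg 6;Sg
14;Sg 4;Sg 11]); (1, [:: Xg 0 6;Sg 10;Sg 14;Sg 8]); (1, [:: Kg 0 6;Sg 1;Sg 2])])) (Lp 1 [:: (1,
[:: Sg 9;Sg 10;Sg 11]); (1, [:: Sg 12;Sg 13;Sg 14;Sg 15]); (1, [:: Xg 3 0;Sg 2;Sg 8]); (1, [:: Sg
6;Sg 7;Sg 1;Sg 3]); (1, [:: Kg 3 0;Sg 4;Sg 5])])) (Lp 2 [:: (1, [:: Sg 6;Sg 10;Sg 3]); (1, [:: Sg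
9;Sg 10;Sg 11]); (1, [:: Sg 9;Sg 7;Sg 8]); (1, [:: Sg 3;Sg 4;Sg 5]); (2, [:: Sg 0;Sg 1;Sg 2]); (2,
[:: Sg 12;Sg 13;Sg 14;Sg 15]); (1, [:: Sg 6;Sg 13;Sg 4;Sg 8]); (1, [:: Sg 11;Sg 13;Sg 7;Sg 5])]))
(Lp 2 [:: (1, [:: Sg 9;Sg 10;Sg 11]); (1, [:: Sg 3;Sg 4;Sg 5]); (2, [:: Sg 0;Sg 1;Sg 2]); (1, [::
Sg 6;Sg 14;Sg 4;Sg 11]); (1, [:: Sg 3;Sg 10;Sg 14;Sg 8]); (1, [:: Sg 6;Sg 7;Sg 5]); (1, [:: Sg
9;Sg 7;Sg 8]); (2, [:: Sg 12;Sg 13;Sg 7;Sg 15])]))].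

Lemma half_le a b l : l = (a + b).+2 -> a <= b -> l <= 2 * b.+1.
Proof. lia. Qed.

(** * At most three vertices do not separate two longest cycles *)

Section Separation.
Variables (U : eqType) (e : rel U) (L : nat).
Hypothesis e_sym : symmetric e.
Hypothesis L_gt2 : 2 < L.
Hypothesis L_max : forall c, ucycle e c -> 2 < size c -> size c <= L.
Definition longest c := ucycle e c /\ size c = L.
Hypothesis meet2 : forall c d, longest c -> longest d ->
  exists x y, [/\ x != y, x \in c, y \in c, x \in d & y \in d].
Hypothesis no_common : forall v, exists2 c, longest c & v \notin c.

(** Putting the longer arc second gives a path with at least half of the [L] edges, the source of
    all lower bounds in this part. *)
Lemma arcs c x y : longest c -> x \in c -> y \in c -> x != y ->
  exists m1 m2, [/\ conn e x m1 y, conn e x m2 y, uniq (x :: y :: m1 ++ m2),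
    perm_eq c (x :: y :: m1 ++ m2) & size m1 <= size m2].
Proof.
case=> /andP[cc uc] sc xc yc xy.
have [k c' Ec] := rot_to xc.
have cy : cycle e (x :: c') by rewrite -Ec rot_cycle.
have un : uniq (x :: c') by rewrite -Ec rot_uniq.
have pe : perm_eq c (x :: c') by rewrite -Ec perm_sym perm_rot.
have yc' : y \in c' by move: yc; rewrite (perm_mem pe) inE eq_sym (negbTE xy).
have [m1 [m2 E]] : exists m1 m2, c' = m1 ++ y :: m2.
  by case/splitPr: yc' => a b; exists a, b.
have /andP[h1 h2] : conn e x m1 y && conn e y m2 x by rewrite -conn_cat -E.
have h3 := conn_rev e_sym h2.
have pp : perm_eq (x :: c') (x :: y :: m1 ++ rev m2).
  by rewrite E perm_cons -cat1s perm_catCA perm_cons perm_cat2l perm_sym perm_rev.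
have pq : perm_eq (x :: y :: m1 ++ rev m2) (x :: y :: rev m2 ++ m1).
  by rewrite !perm_cons perm_catC.
case: (leqP (size m1) (size (rev m2))) => [le|/ltnW le].
  exists m1, (rev m2); split=> //; last exact: perm_trans pe pp.
  by rewrite -(perm_uniq pp).
exists (rev m2), m1; split=> //; last exact: perm_trans pe (perm_trans pp pq).
by rewrite -(perm_uniq pq) -(perm_uniq pp).
Qed.

Lemma two_paths x y m1 m2 : conn e x m1 y -> conn e x m2 y ->
  uniq (x :: y :: m1 ++ m2) -> size m1 + size m2 + 2 <= L.
Proof.
move=> h1 h2 un; have h3 := conn_rev e_sym h2.
have pe : perm_eq (x :: m1 ++ y :: rev m2) (x :: y :: m1 ++ m2).
  by rewrite perm_cons -[y :: rev m2]cat1s perm_catCA perm_cons perm_cat2l perm_rev.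
have sz := perm_size pe; rewrite /= !size_cat /= in sz.
(* Two empty interiors close up to a single edge, not to a cycle; a closed walk of more than [L]
   vertices has more than two, so this case drops out. *)
rewrite leqNgt; apply/negP => lt.
have := L_max (c := x :: m1 ++ y :: rev m2).
rewrite /ucycle (perm_uniq pe) un andbT.
have -> : cycle e (x :: m1 ++ y :: rev m2).
  by change (conn e x (m1 ++ y :: rev m2) x); rewrite conn_cat h1.
move/(_ isT); rewrite /= !size_cat /= size_rev => h.
suff : (size m1 + (size m2).+1).+1 <= L by lia.
by apply: h; rewrite addnS; rewrite addn2 in lt; apply: ltn_trans L_gt2 lt.
Qed.

Lemma two_paths_sep x y m1 m2 : conn e x m1 y -> conn e x m2 y ->
  x != y -> uniq m1 -> uniq m2 -> x \notin m1 -> x \notin m2 ->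
  y \notin m1 -> y \notin m2 -> {in m1, forall z, z \notin m2} ->
  (size m1).+1 + (size m2).+1 <= L.
Proof.
move=> h1 h2 xy u1 u2 x1 x2 y1 y2 d.
have d' : ~~ has (mem m1) m2.
  by apply/hasPn => z z2; apply/negP => /d; rewrite z2.
have : size m1 + size m2 + 2 <= L.
  apply: two_paths h1 h2 _; rewrite !cons_uniq inE !mem_cat !negb_or xy x1 x2 y1 y2.
  by rewrite cat_uniq u1 u2 d'.
by rewrite addn2 addSn addnS.
Qed.

(* From [y] follow a path to its first vertex on [c], then the longer arc of
   [c] to [x]: this gains at least one edge over half of [c]. *)
Lemma detour c x y m : longest c -> x \in c -> conn e y m x -> uniq (y :: m) ->
  y \notin c -> has (mem c) m -> x \notin m ->
  exists m', [/\ conn e y m' x, uniq (y :: m'), x \notin m',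
    forall z, z \in m' -> z \in m \/ z \in c & L < 2 * (size m').+1].
Proof.
move=> lc xc cm um yc hm xm.
have [s1 [x1 [s2 [Em x1c ns]]]] : exists s1 x1 s2,
    [/\ m = s1 ++ x1 :: s2, x1 \in c & ~~ has (mem c) s1].
  by case/split_find: hm => x1 s1 s2 h1 h2; exists s1, x1, s2; rewrite cat_rcons.
rewrite Em in cm um xm.
have x1x : x1 != x by apply: contraNneq xm => <-; rewrite mem_cat inE eqxx orbT.
have [m1 [m2 [h1 h2 un pe le]]] := arcs lc x1c xc x1x.
have sc := perm_size pe; rewrite (proj2 lc) /= size_cat in sc.
have inc z : z \in m2 -> z \in c.
  by move=> zm; rewrite (perm_mem pe) !inE mem_cat zm !orbT.
exists (s1 ++ x1 :: m2); split.
- by move: cm; rewrite !conn_cat h2 => /andP[->].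
- move: um; rewrite cons_uniq mem_cat inE !negb_or cat_uniq.
  case/andP=> /and3P[y1 y2 _] /and3P[u1 _ _].
  move: un; rewrite !cons_uniq inE mem_cat !negb_or cat_uniq.
  case/and3P=> /and3P[_ _ xm2] _ /and3P[_ _ u2].
  rewrite mem_cat inE !negb_or y1 y2 (contra (inc y) yc) cat_uniq u1 /= negb_or.
  rewrite xm2 u2 !andbT; apply/andP; split.
    by apply: contra ns => x1s; apply/hasP; exists x1.
  by apply: contra ns => /hasP[z zm zs]; apply/hasP; exists z => //; apply: inc.
- rewrite mem_cat inE !negb_or eq_sym x1x; apply/and3P; split=> //.
    by apply: contra xm => xs; rewrite mem_cat xs.
  by move: un; rewrite !cons_uniq mem_cat !negb_or => /and3P[_ /andP[_ ->] _].
- move=> z; rewrite mem_cat inE => /or3P[zs|/eqP->|/inc]; [left|left|by right].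
    by rewrite Em mem_cat zs.
  by rewrite Em mem_cat inE eqxx orbT.
- by rewrite size_cat /=; move: sc le; clear; lia.
Qed.

Lemma arcs3 c x y z : longest c -> x \in c -> y \in c -> z \in c ->
  uniq [:: x; y; z] -> exists m1 m2 m3,
  [/\ conn e x m1 y, conn e y m2 z, conn e z m3 x &
      perm_eq c ([:: x; y; z] ++ m1 ++ m2 ++ m3)].
Proof.
move=> lc xc yc zc; rewrite /= !inE negb_or andbT => /andP[/andP[xy xz] yz].
have [m1 [m2 [h1 h2 un pe _]]] := arcs lc xc yc xy.
have : z \in m1 ++ m2.
  by move: zc; rewrite (perm_mem pe) !inE eq_sym (negbTE xz) eq_sym (negbTE yz).
rewrite mem_cat => /orP[zm|zm].
  case/splitPr: zm h1 pe un => s1 s2; rewrite conn_cat => /andP[k1 k2] pe un.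
  exists m2, (rev s2), (rev s1); split=> //; [exact: conn_rev|exact: conn_rev|].
  apply: perm_trans pe _; apply/permP => p.
  by rewrite /= ?count_cat /= ?count_cat /= ?count_rev; clear; lia.
case/splitPr: zm h2 pe un => s1 s2; rewrite conn_cat => /andP[k1 k2] pe un.
exists m1, (rev s2), (rev s1); split=> //; [exact: conn_rev|exact: conn_rev|].
apply: perm_trans pe _; apply/permP => p.
by rewrite /= ?count_cat /= ?count_cat /= ?count_rev; clear; lia.
Qed.

Section Sides.
Variables (A : {pred U}) (S : seq U).
Hypothesis S_size : size S <= 3.
Hypothesis A_closed : forall u v, u \in A -> e u v -> (v \in A) || (v \in S).

Lemma one_side x m y : conn e x m y -> {in m, forall z, z \notin S} ->
  {subset m <= A} \/ {in m, forall z, z \notin A}.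
Proof.
elim: m x => [|z m IH] x; first by left.
case/andP=> _ zm off.
have off' : {in m, forall z, z \notin S} by move=> u um; apply: off; rewrite inE um orbT.
have zS : z \notin S by apply: off; rewrite mem_head.
case: (IH z zm off') => h; case: (boolP (z \in A)) => zA.
- by left=> u; rewrite inE => /predU1P[->//|/h].
- case: m zm off' h {IH off} => [|w m] zm off' h.
    by right=> u; rewrite inE => /eqP->.
  have wA : w \in A by apply: h; rewrite mem_head.
  have /andP[zw _] := zm; rewrite e_sym in zw.
  by have := A_closed wA zw; rewrite (negbTE zA) (negbTE zS).
- case: m zm off' h {IH off} => [|w m] zm off' h.
    by left=> u; rewrite inE => /eqP->.
  have wA : w \notin A by apply: h; rewrite mem_head.
  have /andP[zw _] := zm.
  have := A_closed zA zw; rewrite (negbTE wA) /= => wS.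
  by have := off' w (mem_head _ _); rewrite wS.
- by right=> u; rewrite inE => /predU1P[->//|/h].
Qed.

Definition inner x := (x \in A) || (x \in S).
Variables X Y : seq U.
Hypothesis X_long : longest X.
Hypothesis Y_long : longest Y.
Hypothesis X_in : {in X, forall x, inner x}.
Hypothesis Y_out : {in Y, forall x, x \notin A}.

Lemma meet_in_S x : x \in X -> x \in Y -> x \in S.
Proof. by move=> /X_in/orP[xA /Y_out|//]; rewrite xA. Qed.

(** With at most one vertex [x] in [S], the rest of [c] stays on one side. Then [c] meets [Y], if
    this side is [A], or [X] otherwise, at most in [x], against [meet2]. *)
Lemma two_in_S c : longest c -> exists x y, [/\ x != y, x \in c, y \in c, x \in S & y \in S].
Proof.
move=> lc; have [cc uc] : cycle e c /\ uniq c by case: lc => /andP[].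
have one x m : perm_eq c (x :: m) -> conn e x m x -> {in m, forall z, z \notin S} -> False.
  move=> pe xm off; case: (one_side xm off) => h.
    have [u [v [uv uc' vc uY vY]]] := meet2 lc Y_long.
    have ux w : w \in c -> w \in Y -> w = x.
      rewrite (perm_mem pe) inE => /predU1P[//|/h wA /Y_out]; by rewrite wA.
    by move: uv; rewrite (ux u) // (ux v) // eqxx.
  have [u [v [uv uc' vc uX vX]]] := meet2 lc X_long.
  have ux w : w \in c -> w \in X -> w = x.
    rewrite (perm_mem pe) inE => /predU1P[//|wm /X_in].
    by rewrite /inner (negbTE (h w wm)) (negbTE (off w wm)).
  by move: uv; rewrite (ux u) // (ux v) // eqxx.
case: (boolP (has (mem S) c)) => [/hasP[x xc xS]|/hasPn nS]; last first.
  exfalso; case: c lc cc uc one nS => [[_ /=]|x m] lc cc uc one nS; first by move: L_gt2; rewrite -lc.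
  by apply: (one x m) => // z zm; apply: nS; rewrite inE zm orbT.
have [k m Em] := rot_to xc.
have pe : perm_eq c (x :: m) by rewrite -Em perm_sym perm_rot.
have cm : cycle e (x :: m) by rewrite -Em rot_cycle.
have um : uniq (x :: m) by rewrite -Em rot_uniq.
case: (boolP (has (mem S) m)) => [/hasP[y ym yS]|/hasPn nS]; last first.
  by case: (one x m pe cm).
exists x, y; split=> //; last by rewrite (perm_mem pe) inE ym orbT.
by apply: contraTneq um => ->; rewrite /= ym.
Qed.

(** The common vertices of [X] and [Y] lie in [S]; let [a], [b] be two of them. A longest cycle that
    misses [a] has two further vertices in [S], so these and [a] exhaust [S], and [b] is one of
    them. *)
Lemma third : exists a b c, [/\ uniq [:: a; b; c], {subset S <= [:: a; b; c]},
  a \in X /\ b \in X & a \in Y /\ b \in Y].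
Proof.
have [a [b [ab aX bX aY bY]]] := meet2 X_long Y_long.
have [E lE aE] := no_common a.
have [p [q [pq pE qE pS qS]]] := two_in_S lE.
have aS := meet_in_S aX aY; have bS := meet_in_S bX bY.
have pa : a != p by apply: contraNneq aE => ->.
have qa : a != q by apply: contraNneq aE => ->.
have un : uniq [:: a; p; q] by rewrite /= !inE negb_or pa qa pq.
have sub : {subset [:: a; p; q] <= S} by move=> z; rewrite !inE => /or3P[] /eqP->.
have [_ eqS] := uniq_min_size un sub S_size.
have := bS; rewrite -eqS !inE eq_sym (negbTE ab) => /= /orP[] /eqP bE.
  by exists a, p, q; split=> //; [move=> z; rewrite -eqS|rewrite -bE|rewrite -bE].
exists a, q, p; split=> //; [|move=> z; rewrite -eqS|by rewrite -bE|by rewrite -bE].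
  by rewrite /= !inE negb_or pa qa eq_sym pq.
by rewrite !inE; case: (z == a); case: (z == p); case: (z == q).
Qed.

(** Two vertices of [S] lie on [E], and [a] does not; they are [b] and [c]. Both arcs between them
    therefore avoid [S], and each stays on one side. *)
Lemma avoid_arcs a b c E : uniq [:: a; b; c] -> {subset S <= [:: a; b; c]} ->
  longest E -> a \notin E -> exists m1 m2,
  [/\ conn e c m1 b, conn e c m2 b, uniq (c :: b :: m1 ++ m2),
      perm_eq E (c :: b :: m1 ++ m2) & L <= 2 * (size m2).+1 /\
      {in m1 ++ m2, forall z, z \notin S}].
Proof.
rewrite /= !inE negb_or andbT => /andP[/andP[ab ac] bc] Ssub lE aE.
have [p [q [pq pE qE pS qS]]] := two_in_S lE.
have pa : p != a by apply: contraNneq aE => <-.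
have qa : q != a by apply: contraNneq aE => <-.
have [bE cE] : b \in E /\ c \in E.
  have := Ssub p pS; have := Ssub q qS; rewrite !inE (negbTE pa) (negbTE qa) /=.
  by move=> /orP[] /eqP Eq /orP[] /eqP Ep; subst; rewrite ?eqxx // in pq *.
have cb : c != b by rewrite eq_sym.
have [m1 [m2 [h1 h2 un pe le]]] := arcs lE cE bE cb.
exists m1, m2; split=> //; split.
  by have := perm_size pe; rewrite (proj2 lE) /= size_cat => /half_le; apply.
move=> z zm; apply: contraL zm => /Ssub; rewrite !inE => /or3P[] /eqP->.
- apply: contra aE => am; by rewrite (perm_mem pe) !inE am !orbT.
- by have := un; rewrite !cons_uniq => /and3P[].
- by have := un; rewrite !cons_uniq inE negb_or => /and3P[/andP[_ ->]].
Qed.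

(** Since [m] hits [X] off [S], it lies in [A]. By [detour] there is a path from [c] to [b] within
    [m] and [X] with more than [L / 2] edges. It is disjoint from [m'], which is outside [A] and [S]
    and has at least [L / 2] edges, so the two form a cycle that is too long. *)
Lemma hit_cross b c m m' : b \in X -> c \notin X -> conn e c m b -> conn e c m' b ->
  uniq (c :: b :: m ++ m') -> {in m ++ m', forall z, z \notin S} ->
  {in m', forall z, z \notin A} -> L <= 2 * (size m').+1 -> has (mem X) m -> False.
Proof.
move=> bX cX cm cm' un off out le hm.
have mA : {subset m <= A}.
  have offm : {in m, forall z, z \notin S} by move=> z zm; apply: off; rewrite mem_cat zm.
  case: (one_side cm offm) => // h; case/hasP: hm => u um uX.
  by have := X_in uX; rewrite /inner (negbTE (h u um)) (negbTE (offm u um)).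
move: un; rewrite !cons_uniq inE !mem_cat !negb_or cat_uniq.
case/and3P=> /and3P[cb cM cM'] /andP[bM bM'] /and3P[uM _ uM'].
have ucm : uniq (c :: m) by rewrite /= cM.
have [t [ct ut bt tin lt]] := detour X_long bX cm ucm cX hm bM.
suff : (size t).+1 + (size m').+1 <= L by move: lt le; clear; lia.
move: ut; rewrite cons_uniq => /andP[ct' ut].
apply: (@two_paths_sep c b) => // z /tin zin; apply/negP => zm'.
case: zin => [/mA zA|/X_in]; first by have := out z zm'; rewrite zA.
by rewrite /inner (negbTE (out z zm')) (negbTE (off z _)) // mem_cat zm' orbT.
Qed.

(** [E] and [X] share a vertex other than [b]; it is not [c], and not on [m2], which is off both [A]
    and [S]. *)
Lemma hit_X b c E m1 m2 : longest E -> b \in X -> c \notin X ->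
  perm_eq E (c :: b :: m1 ++ m2) -> {in m2, forall z, z \notin A} ->
  {in m1 ++ m2, forall z, z \notin S} -> has (mem X) m1.
Proof.
move=> lE bX cX pe out off.
have [u [v [uv uE vE uX vX]]] := meet2 lE X_long.
have key w : w \in E -> w \in X -> w != b -> w \in m1.
  rewrite (perm_mem pe) !inE mem_cat => + wX wb; rewrite (negbTE wb) /=.
  case/or3P=> [/eqP wc|//|wm]; first by rewrite -wc wX in cX.
  have := X_in wX; rewrite /inner (negbTE (out w wm)) (negbTE (off w _)) //.
  by rewrite mem_cat wm orbT.
case: (eqVneq u b) => ub; apply/hasP.
  by exists v => //; apply: key => //; rewrite -ub eq_sym.
by exists u => //; apply: key.
Qed.

Lemma case2_arith n1 n2 n3 x1 x2 m l : l <= 2 * m.+1 -> x1 <= x2 ->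
  l = n1 + (n2 + n3) + 3 -> l = (x1 + x2).+2 -> (n1 + n2.+1).+1 + m.+1 <= l ->
  x2.+1 + n2.+1 <= l -> x2.+1 + (n1 + n3.+1).+1 <= l -> False.
Proof. clear; lia. Qed.

Lemma case3_arith y1 y2 y3 x1 x2 x3 m l : l <= 2 * m.+1 ->
  l = x1 + (x2 + x3) + 3 -> l = y1 + (y2 + y3) + 3 ->
  x2.+1 + (y3 + y1.+1).+1 <= l -> y2.+1 + (x3 + x1.+1).+1 <= l ->
  m.+1 + (y3 + y1.+1).+1 <= l \/ m.+1 + (x3 + x1.+1).+1 <= l -> l <= 2 * x2.+1.
Proof. clear; lia. Qed.

Lemma off_three a b c (m : seq U) : {subset S <= [:: a; b; c]} -> a \notin m -> b \notin m ->
  c \notin m -> {in m, forall z, z \notin S}.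
Proof.
move=> sub am bm cm z zm; apply: contraL zm => /sub.
by rewrite !inE => /or3P[] /eqP->.
Qed.

Lemma uniq3 (a b c : U) m1 m2 m3 : uniq ([:: a; b; c] ++ m1 ++ m2 ++ m3) ->
  [/\ [/\ uniq m1, uniq m2 & uniq m3], [/\ a != b, b != c & c != a],
     [/\ a \notin m1, a \notin m2 & a \notin m3],
     [/\ b \notin m1, b \notin m2 & b \notin m3]
   & [/\ c \notin m1, c \notin m2 & c \notin m3] /\
     [/\ {in m1, forall z, z \notin m2}, {in m2, forall z, z \notin m3}
       & {in m3, forall z, z \notin m1}]].
Proof.
rewrite cat_uniq => /and3P[abc hs]; rewrite cat_uniq => /and3P[u1 h1].
rewrite cat_uniq => /and3P[u2 h2 u3].
move: abc; rewrite /= !inE negb_or andbT => /andP[/andP[ab ac] bc].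
have nin z : z \in m1 ++ m2 ++ m3 -> [/\ z != a, z != b & z != c].
  by move/hasPn: hs => h /h; rewrite /= !inE !negb_or => /and3P[].
have out z : z \in [:: a; b; c] -> [/\ z \notin m1, z \notin m2 & z \notin m3].
  move=> zabc; have : z \notin m1 ++ m2 ++ m3.
    by apply/negP => /nin[]; move: zabc; rewrite !inE => /or3P[] /eqP->; rewrite eqxx.
  by rewrite !mem_cat !negb_or => /and3P[].
have [a1 a2 a3] := out a ltac:(by rewrite !inE eqxx).
have [b1 b2 b3] := out b ltac:(by rewrite !inE eqxx orbT).
have [c1 c2 c3] := out c ltac:(by rewrite !inE eqxx !orbT).
split; rewrite 1?(eq_sym c a) //; split=> //; split=> z.
- by move=> z1; apply/negP => z2; case/hasP: h1; exists z; rewrite ?mem_cat ?z2.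
- by move=> z2; apply/negP => z3; case/hasP: h2; exists z.
- by move=> z3; apply/negP => z1; case/hasP: h1; exists z; rewrite ?mem_cat ?z3 ?orbT.
Qed.

Lemma uniq2 (c b : U) m1 m2 : uniq (c :: b :: m1 ++ m2) ->
  [/\ c != b, [/\ uniq m1, uniq m2 & {in m1, forall z, z \notin m2}],
      c \notin m1 /\ c \notin m2 & b \notin m1 /\ b \notin m2].
Proof.
rewrite !cons_uniq inE !mem_cat !negb_or cat_uniq.
case/and3P=> /and3P[-> -> ->] /andP[-> ->] /and3P[-> h ->]; split=> //; split=> //.
by move=> z z1; apply/negP => z2; case/hasP: h; exists z.
Qed.

Lemma uniq_join (m1 m2 : seq U) a : uniq m1 -> uniq m2 -> a \notin m1 -> a \notin m2 ->
  {in m1, forall z, z \notin m2} -> uniq (m1 ++ a :: m2).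
Proof.
move=> u1 u2 a1 a2 d; rewrite cat_uniq u1 /= a2 u2 negb_or a1 /= andbT.
by apply/hasPn => z z2; apply/negP => /d; rewrite z2.
Qed.

(** Take a longest cycle [E] missing [a]. If its long arc is outside [A], [hit_cross] applies.
    Otherwise that arc closes up with the part [c], [a], [b] of [Y], so the arc of [Y] from [b] to
    [c] has at least [L / 2] edges. The long arc of [X] closes up with the part [a], [c], [b] of
    [Y], which thus has at most [L / 2] edges, and no edge is left between [c] and [a]. *)
Lemma case_cY a b c : uniq [:: a; b; c] -> {subset S <= [:: a; b; c]} ->
  a \in X -> b \in X -> c \notin X -> a \in Y -> b \in Y -> c \in Y -> False.
Proof.
move=> un Ssub aX bX cX aY bY cY.
have [E lE aE] := no_common a.
have [m1 [m2 [c1 c2 um pe [le off]]]] := avoid_arcs un Ssub lE aE.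
have off2 : {in m2, forall z, z \notin S}.
  by move=> z zm; apply: off; rewrite mem_cat zm orbT.
case: (one_side c2 off2) => h; last first.
  exact: hit_cross bX cX c1 c2 um off h le (hit_X lE bX cX pe h off).
have un' : uniq [:: c; a; b] by rewrite -(rot_uniq 1).
have [n1 [n2 [n3 [k1 k2 k3 pY]]]] := arcs3 Y_long cY aY bY un'.
have /andP[_ uY] : ucycle e Y by case: Y_long.
rewrite (perm_uniq pY) in uY.
have [[u1 u2 u3] [ca ab bc] [cn1 cn2 cn3] [an1 an2 an3] [[bn1 bn2 bn3] [d12 d23 d31]]] := uniq3 uY.
have sY := perm_size pY; rewrite (proj2 Y_long) !size_cat in sY.
have Yout z : z \in n1 ++ n2 ++ n3 -> z \notin A.
  by move=> zn; apply: Y_out; rewrite (perm_mem pY) mem_cat zn orbT.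
have [x1 [x2 [j1 j2 ux pX lx]]] := arcs X_long aX bX ab.
have sX := perm_size pX; rewrite (proj2 X_long) /= size_cat in sX.
have [_ [ux1 ux2 _] [_ ax2] [_ bx2]] := uniq2 ux.
have cx2 : c \notin x2 by apply: contra cX => cx; rewrite (perm_mem pX) !inE mem_cat cx !orbT.
have Xin z : z \in x2 -> z \in A.
  move=> zx; have zX : z \in X by rewrite (perm_mem pX) !inE mem_cat zx !orbT.
  by have := X_in zX; rewrite /inner (negbTE (off_three Ssub ax2 bx2 cx2 zx)) orbF.
have [cb [um1 um2 _] [_ cm2] [_ bm2]] := uniq2 um.
have aM2 : a \notin m2 by apply: contra aE => am; rewrite (perm_mem pe) !inE mem_cat am !orbT.
apply: (case2_arith le lx _ sX (n1 := size n1) (n2 := size n2) (n3 := size n3)).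
- by rewrite sY /= addnC.
- have -> : (size n1 + (size n2).+1) = size (n1 ++ a :: n2) by rewrite size_cat.
  apply: (@two_paths_sep c b) => //.
  + by rewrite conn_cat k1.
  + exact: uniq_join.
  + by rewrite mem_cat inE !negb_or cn1 cn2 ca.
  + by rewrite mem_cat inE !negb_or bn1 bn2 eq_sym ab.
  + move=> z; rewrite mem_cat inE => zn; apply/negP => /h zA.
    case/or3P: zn => [zn|/eqP za|zn].
    * by move: (Yout z); rewrite !mem_cat zn zA => /(_ isT).
    * by move: (Y_out aY); rewrite -za zA.
    * by move: (Yout z); rewrite !mem_cat zn zA orbT => /(_ isT).
- apply: (@two_paths_sep a b) => //.
  by move=> z /Xin zA; apply/negP => zn; move: (Yout z); rewrite !mem_cat zn zA orbT => /(_ isT).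
- have -> : (size n1 + (size n3).+1) = size (rev n1 ++ c :: rev n3).
    by rewrite size_cat /= !size_rev.
  apply: (@two_paths_sep a b) => //.
  + by rewrite conn_cat !conn_rev.
  + apply: uniq_join; rewrite ?rev_uniq ?mem_rev // => z; rewrite !mem_rev => z1.
    by apply/negP => /d31; rewrite z1.
  + by rewrite mem_cat inE !negb_or !mem_rev an1 an3 eq_sym ca.
  + by rewrite mem_cat inE !negb_or !mem_rev bn1 bn3 bc.
  + move=> z /Xin zA; apply/negP; rewrite mem_cat inE !mem_rev.
    case/or3P=> [zn|/eqP zc|zn].
    * by move: (Yout z); rewrite !mem_cat zn zA => /(_ isT).
    * by move: (Y_out cY); rewrite -zc zA.
    * by move: (Yout z); rewrite !mem_cat zn zA !orbT => /(_ isT).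
Qed.

(** Exchanging the arcs from [b] to [c] between [X] and [Y] gives two cycles, and the bound [L] for
    both forces these arcs to be equally long. The long arc of a cycle missing [a] also runs between
    [b] and [c], on one side, and can replace the arc of [X] or of [Y] on that side; so the arcs
    have at least [L / 2] edges. *)
Lemma case_both a b c x1 x2 x3 y1 y2 y3 :
  uniq [:: a; b; c] -> {subset S <= [:: a; b; c]} ->
  conn e a x1 b -> conn e b x2 c -> conn e c x3 a ->
  perm_eq X ([:: a; b; c] ++ x1 ++ x2 ++ x3) ->
  conn e a y1 b -> conn e b y2 c -> conn e c y3 a ->
  perm_eq Y ([:: a; b; c] ++ y1 ++ y2 ++ y3) -> L <= 2 * (size x2).+1.
Proof.
move=> un Ssub kx1 kx2 kx3 pX ky1 ky2 ky3 pY.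
have [E lE aE] := no_common a.
have [m1 [m2 [c1 c2 um pe [le off]]]] := avoid_arcs un Ssub lE aE.
have off2 : {in m2, forall z, z \notin S}.
  by move=> z zm; apply: off; rewrite mem_cat zm orbT.
have [cb [um1 um2 _] [_ cm2] [_ bm2]] := uniq2 um.
have aM2 : a \notin m2 by apply: contra aE => am; rewrite (perm_mem pe) !inE mem_cat am !orbT.
have /andP[_ uX] : ucycle e X by case: X_long.
have /andP[_ uY] : ucycle e Y by case: Y_long.
rewrite (perm_uniq pX) in uX; rewrite (perm_uniq pY) in uY.
have [[ux1 ux2 ux3] [ab bc ca] [ax1 ax2 ax3] [bx1 bx2 bx3] [[cx1 cx2 cx3] [dx12 dx23 dx31]]] := uniq3 uX.
have [[uy1 uy2 uy3] _ [ay1 ay2 ay3] [by1 by2 by3] [[cy1 cy2 cy3] [dy12 dy23 dy31]]] := uniq3 uY.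
have sX := perm_size pX; rewrite (proj2 X_long) !size_cat in sX.
have sY := perm_size pY; rewrite (proj2 Y_long) !size_cat in sY.
have Yo z : z \in [:: a; b; c] ++ y1 ++ y2 ++ y3 -> z \notin A.
  by rewrite -(perm_mem pY); apply: Y_out.
have Xi z : z \in x1 ++ x2 ++ x3 -> z \in A.
  move=> zx; have zX : z \in X by rewrite (perm_mem pX) mem_cat zx orbT.
  have /off_three : {subset S <= [:: a; b; c]} := Ssub.
  move=> /(_ (x1 ++ x2 ++ x3)); rewrite !mem_cat !negb_or ax1 ax2 ax3 bx1 bx2 bx3 cx1 cx2 cx3.
  move=> /(_ isT isT isT z zx) zS.
  by have := X_in zX; rewrite /inner (negbTE zS) orbF.
have Yarc m : conn e c m b -> uniq m -> c \notin m -> b \notin m -> {subset m <= A} ->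
    (size m).+1 + (size y3 + (size y1).+1).+1 <= L.
  move=> cm mu mc mb mA; have -> : (size y3 + (size y1).+1) = size (y3 ++ a :: y1) by rewrite size_cat.
  apply: (@two_paths_sep c b) => //.
  - by rewrite conn_cat ky3.
  - exact: uniq_join.
  - by rewrite mem_cat inE !negb_or cy3 cy1 ca.
  - by rewrite mem_cat inE !negb_or by3 by1 eq_sym ab.
  - move=> z /mA zA; apply/negP => zn; have := Yo z; rewrite zA !mem_cat !inE.
    by move: zn; rewrite mem_cat inE => /or3P[->|->|->]; rewrite ?orbT => /(_ isT).
have Xarc m : conn e c m b -> uniq m -> c \notin m -> b \notin m -> {in m, forall z, z \notin A} ->
    a \notin m -> (size m).+1 + (size x3 + (size x1).+1).+1 <= L.
  move=> cm mu mc mb mA ma; have -> : (size x3 + (size x1).+1) = size (x3 ++ a :: x1) by rewrite size_cat.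
  apply: (@two_paths_sep c b) => //.
  - by rewrite conn_cat kx3.
  - exact: uniq_join.
  - by rewrite mem_cat inE !negb_or cx3 cx1 ca.
  - by rewrite mem_cat inE !negb_or bx3 bx1 eq_sym ab.
  - move=> z zm; have zA := mA z zm; rewrite mem_cat inE !negb_or.
    apply/and3P; split; last by apply: contra zA => zx; apply: Xi; rewrite mem_cat zx.
      by apply: contra zA => zx; apply: Xi; rewrite !mem_cat zx !orbT.
    by apply: contraNneq ma => <-.
apply: (case3_arith (m := size m2) le).
- by rewrite sX /= addnC.
- by rewrite sY /= addnC.
- rewrite -(size_rev x2); apply: Yarc; rewrite ?rev_uniq ?mem_rev //; first exact: conn_rev.
  by move=> z; rewrite mem_rev => zx; apply: Xi; rewrite !mem_cat zx orbT.
- rewrite -(size_rev y2); apply: Xarc; rewrite ?rev_uniq ?mem_rev //; first exact: conn_rev.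
  by move=> z; rewrite mem_rev => zy; apply: Yo; rewrite !mem_cat zy !orbT.
- by case: (one_side c2 off2) => h; [left; apply: Yarc|right; apply: Xarc].
Qed.

(** By [case_both] and its cyclic shift two of the three arcs of [X] have [L / 2] edges each, which
    leaves none for the third. *)
Lemma not_all_shared a b c : uniq [:: a; b; c] -> {subset S <= [:: a; b; c]} ->
  a \in X -> b \in X -> c \in X -> a \in Y -> b \in Y -> c \in Y -> False.
Proof.
move=> un Ssub aX bX cX aY bY cY.
have [x1 [x2 [x3 [k1 k2 k3 pX]]]] := arcs3 X_long aX bX cX un.
have [y1 [y2 [y3 [l1 l2 l3 pY]]]] := arcs3 Y_long aY bY cY un.
have h2 := case_both un Ssub k1 k2 k3 pX l1 l2 l3 pY.
have un' : uniq [:: b; c; a] by rewrite -[[:: b; c; a]]/(rot 1 [:: a; b; c]) rot_uniq.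
have Ssub' : {subset S <= [:: b; c; a]}.
  by move=> z /Ssub; rewrite !inE; case: (z == a); case: (z == b); case: (z == c).
have rotp z1 z2 z3 : perm_eq ([:: a; b; c] ++ z1 ++ z2 ++ z3) ([:: b; c; a] ++ z2 ++ z3 ++ z1).
  by apply/permP => p; rewrite /= ?count_cat /=; clear; lia.
have h3 := case_both un' Ssub' k2 k3 k1 (perm_trans pX (rotp _ _ _)) l2 l3 l1 (perm_trans pY (rotp _ _ _)).
have := perm_size pX; rewrite (proj2 X_long) !size_cat /=.
by move: h2 h3; clear; lia.
Qed.

End Sides.

(** The vertices off [A] and [S] form a side [A'] with the same closure property, so the two cycles
    can be exchanged. The cases are whether the third vertex [c] of the separator lies on [X] and on
    [Y]. If on neither, the long arc of a cycle missing [a] lies on one side, and [hit_cross] is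
    used with the cycle of the opposite side. *)
Lemma no_fence (A : {pred U}) (S X Y : seq U) : size S <= 3 ->
  (forall u v, u \in A -> e u v -> (v \in A) || (v \in S)) ->
  longest X -> longest Y -> {in X, forall x, (x \in A) || (x \in S)} ->
  {in Y, forall x, x \notin A} -> False.
Proof.
move=> S3 Acl lX lY Xin Yout.
have [a [b [c [un Ssub [aX bX] [aY bY]]]]] := third S3 Acl lX lY Xin Yout.
pose A' : {pred U} := [pred z | (z \notin A) && (z \notin S)].
have A'cl u v : u \in A' -> e u v -> (v \in A') || (v \in S).
  rewrite !inE => /andP[uA uS] uv; case: (boolP (v \in S)) => vS; rewrite ?orbT //.
  rewrite orbF andbT; apply/negP => vA; rewrite e_sym in uv.
  by have := Acl _ _ vA uv; rewrite (negbTE uA) (negbTE uS).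
have Yin' : {in Y, forall x, (x \in A') || (x \in S)}.
  by move=> x xY; rewrite inE Yout //=; case: (x \in S).
have Xout' : {in X, forall x, x \notin A'}.
  by move=> x /Xin /orP[xA|xS]; rewrite inE ?xA ?xS ?andbF.
case: (boolP (c \in X)) => cX; case: (boolP (c \in Y)) => cY.
- exact: (not_all_shared Acl lX lY Xin Yout un Ssub).
- exact: (case_cY A'cl lY lX Yin' Xout' un Ssub).
- exact: (case_cY Acl lX lY Xin Yout un Ssub).
have [E lE aE] := no_common a.
have [m1 [m2 [c1 c2 um pe [le off]]]] := avoid_arcs Acl lX lY Xin Yout un Ssub lE aE.
have off2 : {in m2, forall z, z \notin S}.
  by move=> z zm; apply: off; rewrite mem_cat zm orbT.
case: (one_side Acl c2 off2) => h.
  have h' : {in m2, forall z, z \notin A'} by move=> z /h zA; rewrite inE zA.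
  apply: (hit_cross A'cl lY Yin' bY cY c1 c2 um off h' le).
  exact: (hit_X lY Yin' lE bY cY pe h' off).
apply: (hit_cross Acl lX Xin bX cX c1 c2 um off h le).
exact: (hit_X lX Xin lE bX cX pe h off).
Qed.

End Separation.

(** * The choice of the bag *)

Section Peeling.
Variables (U : finType) (e r : rel U) (L : nat).
Hypothesis e_sym : symmetric e.
Hypothesis e_r : forall x y, e x y -> r x y.
Hypothesis L_gt2 : 2 < L.
Hypothesis L_max : forall c, ucycle e c -> 2 < size c -> size c <= L.
Hypothesis meet2 : forall c d, longest e L c -> longest e L d ->
  exists x y, [/\ x != y, x \in c, y \in c, x \in d & y \in d].
Hypothesis no_common : forall v, exists2 c, longest e L c & v \notin c.

Definition big (P : seq U) x :=
  forall c, longest e L c -> exists2 y, y \in c & connect (off_bag e P) x y.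

(* [v] is the first removed vertex whose component meets every longest cycle. If there
   is none, the bag is the initial K_4 and [sink_small] holds vacuously. *)
Record sink (bs : seq U) (v : U) : Prop := Sink {
  sink_uniq : uniq bs;
  sink_size : size bs = 4;
  sink_v : v \in bs;
  sink_side : forall x, x \notin bs -> exists2 w, w \in bs &
    forall y, connect (off_bag e bs) x y -> ~~ e y w;
  sink_unfenced : forall x c, x \notin bs -> ucycle e c -> size c = L ->
    exists2 y, y \in c & ~~ connect (off_bag e bs) x y /\
      (y \in bs -> forall z, connect (off_bag e bs) x z -> ~~ e z y);
  sink_small : forall x, x \notin bs -> big bs x ->
    (forall y, connect (off_bag e bs) x y -> ~~ e y v) /\
    forall c, longest e L c -> exists2 y, y \in c & y = v \/
      (y \notin bs /\ exists2 z, connect (off_bag e bs) y z & e z v) }.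

(** Compares components for two vertex sets: an invariant [C] kept by every step off [P] carries the
    whole path over to [Q]. *)
Lemma connect_transfer (P Q : seq U) (C : pred U) x y :
  (forall u w, C u -> off_bag e P u w -> C w && off_bag e Q u w) ->
  C x -> connect (off_bag e P) x y -> C y /\ connect (off_bag e Q) x y.
Proof.
move=> H Cx /connectP[p pp ->]; elim: p x Cx pp => [|z p IH] x Cx /=.
  by split=> //; apply: connect0.
case/andP=> /(H _ _ Cx)/andP[Cz xz] /(IH z Cz)[h1 h2].
by split=> //; apply: connect_trans h2; apply: connect1.
Qed.

Lemma last_step (P : seq U) y v : connect (off_bag e P) y v -> y != v ->
  exists2 z, connect (off_bag e (v :: P)) y z & e z v.
Proof.
case/connectP=> p; elim: p y => [|z p IH] y /= ; first by move=> _ -> ; rewrite eqxx.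
case/andP=> /and3P[yP zP yz] pp vl yv.
case: (eqVneq z v) => zv; first by exists y; rewrite -?zv.
have [t ct tv] := IH z pp vl zv; exists t => //.
by apply: connect_trans ct; apply: connect1; rewrite /off_bag /= !inE !negb_or yv zv yP zP.
Qed.

Lemma connect_off (P : seq U) x y : x \notin P -> connect (off_bag e P) x y -> y \notin P.
Proof.
move=> xP; move/(@connect_transfer P P (fun z => z \notin P)) => /(_ _ xP)[] //.
by move=> u w _ h; rewrite h andbT; case/and3P: h.
Qed.

Definition attached (P : seq U) x (S : {set U}) :=
  [/\ triangle r S, {subset S <= P} &
      forall y w, connect (off_bag e P) x y -> e y w -> w \in P -> w \in S].

(** The invariant of the removal, [P] being what is left: each part cut off so far hangs on a
    triangle and is avoided by some longest cycle. It holds trivially before the first removal. *)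
Definition peelable (P : seq U) := forall x, x \notin P ->
  (exists S, attached P x S) /\ ~ big P x.

Lemma avoiding_cycle P x : ~ big P x ->
  exists2 c, longest e L c & {in c, forall y, ~~ connect (off_bag e P) x y}.
Proof.
move=> nb; apply: contrapT => h; apply: nb => c lc; apply: contrapT => h'.
apply: h; exists c => // y yc; apply/negP => xy; apply: h'; by exists y.
Qed.

Lemma inner_side (P bs : seq U) x S : uniq bs -> size bs = 4 -> {subset bs <= P} ->
  attached P x S -> exists2 w, w \in bs &
    forall y, connect (off_bag e P) x y -> ~~ e y w.
Proof.
move=> ub sb bP [[S3 _] SP att].
have /allPn[w wb wS] : ~~ all (mem S) bs.
  apply/negP => /allP h; have : size bs <= size (enum S).
    by apply: uniq_leq_size => // z /h; rewrite mem_enum.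
  by rewrite sb -cardE S3.
exists w => // y xy; apply: contra wS => yw; exact: att xy yw (bP _ wb).
Qed.

Lemma inner_unfenced (P bs : seq U) x S c : x \notin P -> {subset bs <= P} ->
  attached P x S -> ~ big P x -> longest e L c -> exists2 y, y \in c &
    ~~ connect (off_bag e P) x y /\
    (y \in bs -> forall z, connect (off_bag e P) x z -> ~~ e z y).
Proof.
move=> xP bP [[S3 _] SP att] nb lc; apply: contrapT => H.
have [d ld dout] := avoiding_cycle nb.
apply: (@no_fence _ e L e_sym L_gt2 L_max meet2 no_common
  [pred y | connect (off_bag e P) x y] (enum S) c d) => //.
- by rewrite -cardE S3.
- move=> u v; rewrite !inE => xu uv; have uP := connect_off xP xu.
  case: (boolP (v \in P)) => vP; last first.
    by rewrite (connect_trans xu) //; apply: connect1; rewrite /off_bag /= uP vP.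
  by rewrite mem_enum (att u v xu uv vP) orbT.
- move=> y yc; rewrite inE mem_enum; apply/negPn/negP; rewrite negb_or => /andP[nxy yS].
  apply: H; exists y => //; split=> // yb z xz.
  by apply: contra yS => zy; apply: att xz zy (bP _ yb).
Qed.

(** The induction follows the construction, but [peelable] travels against it: it is assumed for the
    larger set and passed on to the smaller one, until this fails at some [v] or only four vertices
    are left. *)
Theorem peel (A : {set U}) : three_tree_on r A -> peelable (enum A) -> 3 < #|A| ->
  exists bs v, sink bs v.
Proof.
elim=> {A} [A [-> _] //|A B v tA IH vA BA trB Bnb pA cA].
have in_vA : forall z, (z \in enum (v |: A)) = (z == v) || (z \in A).
  by move=> z; rewrite mem_enum !inE.
case: (leqP #|A| 3) => A3.
  have sz : size (enum (v |: A)) = 4.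
    by rewrite -cardE; move: cA A3; rewrite cardsU1 vA; lia.
  exists (enum (v |: A)), v; split=> //.
  - exact: enum_uniq.
  - by rewrite in_vA eqxx.
  - by move=> x /pA[[S aS] _]; apply: inner_side aS => //; apply: enum_uniq.
  - by move=> x c xb uc sc; have [[S aS] nb] := pA x xb; apply: inner_unfenced aS nb _.
  - by move=> x /pA[_ nb] /nb.
set P := enum A; set Q := enum (v |: A).
have inP z : (z \in P) = (z \in A) by rewrite mem_enum.
(* Removing [v] merges it with all earlier components adjacent to it; the result is [J], and the
   other components are unchanged. *)
pose J := connect (off_bag e P) v.
have vP : v \notin P by rewrite inP.
have Joff y : J y -> y \notin A by move/(connect_off vP); rewrite inP.
have Jcl y z : J y -> e y z -> z \notin A -> J z.
  move=> Jy yz zA; have yA := Joff _ Jy; apply: connect_trans Jy _; apply: connect1.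
  by rewrite /off_bag /= !inP zA yA.
have vB w : e v w -> w \in A -> w \in B.
  by move=> /e_r vw wA; rewrite -Bnb inE wA.
have Jlast y : J y -> y != v -> exists2 z, connect (off_bag e Q) y z & e z v.
  move=> Jy yv; have yv' : connect (off_bag e P) y v.
    by rewrite (off_bag_sym P e_sym).
  have [z yz zv] := last_step yv' yv; exists z => //.
  apply: (@connect_transfer _ _ xpredT _ _ _ _ yz).2 => // u w _.
  by rewrite /off_bag /= !inE !in_vA !inP.
have QJ y : y \notin Q -> J y -> y != v.
  by move=> yQ _; apply: contraNneq yQ => ->; rewrite in_vA eqxx.
(* An earlier component merged into [J] is adjacent to [v], so its triangle contains [v]. The other
   vertices of the triangle are neighbours of [v] in the 3-tree and, if in [A], belong to [B]. *)
have Jatt y w : J y -> e y w -> w \in A -> w \in B.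
  move=> Jy yw wA; case: (eqVneq y v) => [yv|yv]; first by apply: vB; rewrite -?yv.
  have yQ : y \notin Q by rewrite in_vA negb_or yv Joff.
  have [[S [[S3 trS] SQ att]] _] := pA y yQ.
  have [z yz zv] := Jlast y Jy yv.
  have vS : v \in S by apply: att yz zv _; rewrite in_vA eqxx.
  have wS : w \in S by apply: att (connect0 _ _) yw _; rewrite in_vA wA orbT.
  rewrite -Bnb inE wA /=; apply: trS => //.
  by apply: contraNneq vA => ->.
(* When some longest cycle avoids [J], the smaller set is peelable again and the induction
   continues. *)
have [bJ|nbJ] := pselect (big P v); last first.
  apply: IH => // x; rewrite inP => xA.
  case: (boolP (connect (off_bag e P) v x)) => vx.
    split; last first.
      move=> bx; apply: nbJ => c lc; have [y yc xy] := bx c lc.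
      by exists y => //; apply: connect_trans xy.
    exists B; split=> //; first by move=> z zB; rewrite inP (subsetP BA).
    move=> y w xy yw; rewrite inP; apply: Jatt yw.
    exact: connect_trans xy.
  have xv : x != v by apply: contraNneq vx => ->; apply: connect0.
  have xQ : x \notin Q by rewrite in_vA negb_or xv.
  have PQ y : connect (off_bag e P) x y -> ~~ J y /\ connect (off_bag e Q) x y.
    apply: (@connect_transfer _ _ (fun z => ~~ J z)) => // u w Ju uw.
    have Jw : ~~ J w.
      apply: contra Ju => Jw; case/and3P: uw => uP _ uw; rewrite inP in uP.
      by apply: Jcl Jw _ uP; rewrite e_sym.
    rewrite Jw /=; case/and3P: uw => uP wP uw; rewrite !inP in uP wP.
    rewrite /off_bag /= !in_vA !negb_or uP wP uw !andbT.
    by apply/andP; split; [apply: contraNneq Ju|apply: contraNneq Jw] => ->; apply: connect0.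
  have [[S [[S3 trS] SQ att]] nb] := pA x xQ; split; last first.
    move=> bx; apply: nb => c lc; have [y yc /PQ[_ xy]] := bx c lc; by exists y.
  have noV y : connect (off_bag e P) x y -> ~~ e y v.
    move=> xy; have [Jy _] := PQ y xy; apply: contra Jy => yv.
    apply: (@Jcl v) => //; first exact: connect0; first by rewrite e_sym.
    by have := connect_off _ xy; rewrite !inP => ->.
  (* A component outside [J] is not adjacent to [v], yet its triangle may contain [v]. Its remaining
     vertices are then in [B], which serves instead. *)
  case: (boolP (v \in S)) => vS.
    exists B; split=> //; first by move=> z zB; rewrite inP (subsetP BA).
    move=> y w xy yw; rewrite inP => wA; have [_ xy'] := PQ y xy.
    have wS : w \in S by apply: att xy' yw _; rewrite in_vA wA orbT.
    by rewrite -Bnb inE wA /=; apply: trS => //; apply: contraNneq vA => ->.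
  exists S; split=> //.
    move=> z zS; have := SQ z zS; rewrite in_vA inP => /predU1P[zv|//].
    by rewrite -zv zS in vS.
  move=> y w xy yw; rewrite inP => wA; have [_ xy'] := PQ y xy.
  by apply: att xy' yw _; rewrite in_vA wA orbT.
have vB' : v \notin B by apply: contra vA => /(subsetP BA).
(* Now [J] meets every longest cycle, and the bag is [v] with the triangle to which [v] was
   attached. Outside [J] no component for this bag is adjacent to [v]; this is what [offJ] and
   [nadj] prepare. *)
pose bs := v :: enum B.
have inb z : (z \in bs) = (z == v) || (z \in B) by rewrite inE mem_enum.
have szb : size bs = 4 by rewrite /= -cardE (proj1 trB).
have unb : uniq bs by rewrite /= mem_enum vB' enum_uniq.
have bQ : {subset bs <= Q}.
  by move=> z; rewrite inb in_vA => /orP[->//|/(subsetP BA)->]; rewrite orbT.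
have offJ x y : x \notin bs -> ~~ J x -> connect (off_bag e bs) x y -> ~~ J y.
  move=> xb nx xy.
  suff [] : ~~ J y /\ connect (off_bag e bs) x y by [].
  apply: (@connect_transfer _ _ (fun z => ~~ J z)) xy => // u w Ju uw.
  rewrite uw andbT; apply: contra Ju => Jw; case/and3P: uw => ub wb uw.
  rewrite e_sym in uw; case: (boolP (u \in A)) => uA; last exact: Jcl Jw uw uA.
  by have := Jatt w u Jw uw uA; move: ub; rewrite inb => /norP[_ /negbTE->].
have nadj x y : x \notin bs -> ~~ J x -> connect (off_bag e bs) x y -> ~~ e y v.
  move=> xb nx xy; apply: contra (offJ x y xb nx xy) => yv; rewrite e_sym in yv.
  have yb := connect_off xb xy.
  case: (boolP (y \in A)) => yA; last by apply: Jcl yv yA; apply: connect0.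
  by move: yb; rewrite inb (vB y yv yA) orbT.
(* Within [J] without [v], all neighbours in the 3-tree's earlier part lie in the bag, so the
   components for the bag and for [Q] coincide and inherit what is known from [pA]. *)
pose C z := J z && (z != v).
have bsQ x y : C x -> connect (off_bag e bs) x y -> connect (off_bag e Q) x y.
  move=> Cx xy; apply: (@connect_transfer _ _ C _ _ _ Cx xy).2.
  move=> u w /andP[Ju uv] /and3P[ub wb uw]; rewrite inb negb_or in wb.
  case/andP: wb => wv wB.
  have wA : w \notin A by apply: contra wB; apply: Jatt uw.
  by rewrite /C (Jcl u w) //= wv /off_bag /= !in_vA !negb_or uv wv wA (Joff u Ju).
have Qbs x y : C x -> connect (off_bag e Q) x y -> C y /\ connect (off_bag e bs) x y.
  apply: connect_transfer => u w /andP[Ju uv] /and3P[uQ wQ uw].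
  rewrite /off_bag /= uw (contra (bQ u) uQ) (contra (bQ w) wQ) !andbT.
  move: wQ; rewrite in_vA negb_or => /andP[wv wA].
  by rewrite /C (Jcl u w).
have Cx x : x \notin bs -> J x -> C x /\ x \notin Q.
  rewrite inb negb_or => /andP[xv _] Jx.
  by rewrite /C Jx in_vA negb_or xv (Joff x Jx).
have eqc x y : x \notin bs -> J x -> connect (off_bag e bs) x y = connect (off_bag e Q) x y.
  move=> xb Jx; have [cx _] := Cx x xb Jx.
  by apply/idP/idP => [/(bsQ _ _ cx)|/(Qbs _ _ cx)[]].
exists bs, v; split=> //.
- by rewrite inb eqxx.
- move=> x xb; case: (boolP (J x)) => Jx; last first.
    by exists v; [rewrite inb eqxx|move=> y; apply: nadj].
  have [_ xQ] := Cx x xb Jx; have [[S aS] _] := pA x xQ.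
  have [w wb Hw] := inner_side unb szb bQ aS.
  by exists w => // y; rewrite eqc //; apply: Hw.
- move=> x c xb uc sc; case: (boolP (J x)) => Jx; last first.
    (* The vertex of [c] in [J] is the required one: the component of [x] stays outside [J], and the
       only bag vertex in [J] is [v], to which that component is not adjacent. *)
    have [y yc Jy] := bJ c (conj uc sc).
    exists y => //; split; first by apply: contraL Jy => /(offJ _ _ xb Jx).
    rewrite inb => /predU1P[-> z|yB]; first exact: nadj.
    by have := Joff y Jy; rewrite (subsetP BA).
  have [_ xQ] := Cx x xb Jx; have [[S aS] nb] := pA x xQ.
  have [y yc [ny ay]] := inner_unfenced xQ bQ aS nb (conj uc sc).
  by exists y => //; rewrite eqc //; split=> // yb z; rewrite eqc //; apply: ay.
(* A component inside [J] is one for [Q] and hence avoided by a longest cycle, so a big component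
   lies outside [J]. The second claim holds because [J] itself meets all longest cycles, at [v] or
   in a component next to [v]. *)
- move=> x xb bx; case: (boolP (J x)) => Jx.
    have [_ xQ] := Cx x xb Jx; have [_ []] := pA x xQ.
    by move=> c lc; have [y yc] := bx c lc; rewrite eqc //; exists y.
  split=> [y|c lc]; first exact: nadj.
  have [y yc Jy] := bJ c lc; exists y => //; case: (eqVneq y v) => yv; [by left|right].
  have yb : y \notin bs.
    by rewrite inb negb_or yv; apply: contra (Joff y Jy) => /(subsetP BA).
  split=> //; have [z yz zv] := Jlast y Jy yv; exists z => //.
  by rewrite eqc.
Qed.

End Peeling.

(** * Two longest cycles of a 2-connected graph share two vertices *)

Section Lists.
Variable U : eqType.

Lemma last_hit (C : {pred U}) s : has [in C] s -> exists s1 x s2,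
  [/\ s = s1 ++ x :: s2, x \in C & {in s2, forall z, z \notin C}].
Proof.
elim: s => //= y s IH; case: (boolP (has [in C] s)) => hs.
  by have [s1 [x [s2 [-> xC h]]]] := IH hs; exists (y :: s1), x, s2.
rewrite orbF => yC; exists [::], y, s; split=> // z zs.
by apply: contra hs => zC; apply/hasP; exists z.
Qed.

Lemma first_hit (C : {pred U}) s : has [in C] s -> exists s1 x s2,
  [/\ s = s1 ++ x :: s2, x \in C & {in s1, forall z, z \notin C}].
Proof.
elim: s => //= y s IH; case: (boolP (y \in C)) => yC /=.
  by exists [::], y, s.
move=> hs; have [s1 [x [s2 [-> xC h]]]] := IH hs; exists (y :: s1), x, s2.
by split=> // z; rewrite inE => /predU1P[->|/h].
Qed.

Lemma cross_arith (a b c d l : nat) : l <= 2 * a.+1 -> l <= 2 * b.+1 ->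
  a.+1 + (c + (b + d.+1).+1).+1 <= l -> False.
Proof. lia. Qed.

Lemma touch_arith (a b c l : nat) : l <= 2 * a.+1 -> l <= 2 * b.+1 ->
  a.+1 + (c + b.+1).+1 <= l -> False.
Proof. lia. Qed.
End Lists.

Section TwoConnected.
Variables (T : finType) (e : rel T) (L : nat).
Hypothesis e_sym : symmetric e.
Hypothesis conn0 : forall X : {set T}, #|X| < 2 -> connected_off e X.
Hypothesis L_gt2 : 2 < L.
Hypothesis L_max : forall c, ucycle e c -> 2 < size c -> size c <= L.

(** A simple path from [a] to [d] off [X] is cut at its first vertex in [D] and then at the last
    vertex in [C] before that. *)
Lemma bridge (X : {set T}) (C D : {pred T}) a d : #|X| < 2 ->
  a \in C -> d \in D -> a \notin X -> d \notin X ->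
  {in C, forall z, z \notin D} ->
  exists a' d' m, [/\ [/\ a' \in C, d' \in D, a' \notin X & d' \notin X],
    conn e a' m d', uniq (a' :: rcons m d')
    & {in m, forall z, [/\ z \notin X, z \notin C & z \notin D]}].
Proof.
move=> X2 aC dD aX dX CD; have /connectP[p pp dl] := conn0 X2 aX dX.
case/shortenP: pp dl => q qp uq _ dl.
have qX : {in q, forall z, z \notin X}.
  elim: q a qp {aC aX uq dl} => //= y q IH a /andP[/and3P[_ yX _] qp] z.
  by rewrite inE => /predU1P[->|/(IH y qp)].
have qe : path e a q by apply: sub_path qp => u v /and3P[].
have hq : has [in D] q.
  apply/hasP; exists d => //; move: dl; case: (lastP q) => [|s z] /= dl.
    by have := CD a aC; rewrite -[a]dl dD.
  by rewrite dl last_rcons mem_rcons mem_head.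
have [q1 [d' [q2 [Eq d'D h1]]]] := first_hit hq.
have hc : has [in C] (a :: q1) by rewrite /= aC.
have [s1 [a' [s2 [Es a'C h2]]]] := last_hit hc.
have cp : conn e a' s2 d'.
  have : path e a (rcons q1 d') by move: qe; rewrite Eq -cat_rcons cat_path => /andP[].
  case: s1 Es => [[-> ->] //|y s1 [-> ->]]; rewrite rcons_cat cat_path /=.
  by case/and3P.
have uu : uniq (a' :: rcons s2 d').
  have E : a :: q = s1 ++ ((a' :: rcons s2 d') ++ q2).
    by rewrite Eq -cat_cons Es -catA !cat_cons cat_rcons.
  by move: uq; rewrite E cat_uniq => /and3P[_ _]; rewrite cat_uniq => /and3P[].
have aq : {in a :: q, forall z, z \notin X}.
  by move=> z; rewrite inE => /predU1P[->|/qX].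
exists a', d', s2; split=> //.
  split=> //; first by apply: aq; rewrite Eq -cat_cons Es !mem_cat inE eqxx !orbT.
  by apply: qX; rewrite Eq mem_cat inE eqxx orbT.
move=> z zs; have zq : z \in a :: q by rewrite Eq -cat_cons Es !mem_cat inE zs !orbT.
split; [exact: aq|exact: h2|].
have : z \in a :: q1 by rewrite Es mem_cat inE zs !orbT.
by rewrite inE => /predU1P[->|/h1 //]; apply: CD.
Qed.

Section Fan.
Variable c : seq T.

(** A fan in the sense of Menger's theorem, of size two: two paths from [u] to [c] that share only
    [u]. *)
Definition fan u := exists f g N M, [/\ conn e u N f, conn e u M g, f != g, f \in c /\ g \in c
  & [/\ {in N ++ M, forall z, z \notin c}, uniq (N ++ M) & u \notin N ++ M]].

(** Menger's theorem for two paths, by augmentation. Cut both paths of the fan after their last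
    vertex in [D0] or at [u]. If both cuts are at [u], a bridge from [D0] avoiding [u] reaches the
    fan or [c], and frees one of the two paths from starting at [u]. *)
Lemma two_starts u (D0 : {pred T}) v : fan u -> u \notin c -> u \notin D0 -> v \in D0 ->
  {in D0, forall z, z \notin c} ->
  exists s t f g N M, [/\ [/\ s != t, f != g, f \in c & g \in c],
    s \in [predU1 u & D0], t \in [predU1 u & D0], conn e s N f /\ conn e t M g
    & [/\ {in N ++ M, forall z, z \notin c /\ z \notin [predU1 u & D0]} & uniq (N ++ M)]].
Proof.
move=> [f [g [N [M [cN cM fg [fc gc] [off un uN]]]]]] uc uD vD Dc.
have tail w K k : conn e u K k -> w = u -> exists s1 s K1, [/\ u :: K = s1 ++ s :: K1,
    s \in [predU1 u & D0], {in K1, forall z, z \notin [predU1 u & D0]} & conn e s K1 k].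
  move=> ck _; have hk : has [in [predU1 u & D0]] (u :: K) by rewrite /= inE eqxx.
  have [s1 [s [K1 [E sD h]]]] := last_hit hk; exists s1, s, K1; split=> //.
  case: s1 E ck => [[-> ->] //|y s1 [-> ->]].
  by rewrite conn_cat => /andP[].
have [s1 [s [N1 [EN sD hN cN1]]]] := tail u N f cN erefl.
have [t1 [t [M1 [EM tD hM cM1]]]] := tail u M g cM erefl.
have subN : {subset N1 <= N}.
  by case: (s1) EN => [[_ ->]|y s1' [_ ->]] z zN //; rewrite mem_cat inE zN !orbT.
have subM : {subset M1 <= M}.
  by case: (t1) EM => [[_ ->]|y t1' [_ ->]] z zN //; rewrite mem_cat inE zN !orbT.
move: un; rewrite cat_uniq => /and3P[unN dNM unM].
have dis z : z \in N -> z \in M -> False.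
  by move=> zN zM; case/hasP: dNM; exists z.
move: uN; rewrite mem_cat negb_or => /andP[uN uM].
have uN1 : uniq N1.
  have : uniq (u :: N) by rewrite /= uN.
  by rewrite EN cat_uniq /= => /and4P[].
have uM1 : uniq M1.
  have : uniq (u :: M) by rewrite /= uM.
  by rewrite EM cat_uniq /= => /and4P[].
case: (eqVneq s t) => st; last first.
  exists s, t, f, g, N1, M1; split=> //; split.
    move=> z; rewrite mem_cat => /orP[] zz; split; [|exact: hN| |exact: hM];
      by apply: off; rewrite mem_cat ?(subN _ zz) ?(subM _ zz) ?orbT.
  rewrite cat_uniq uN1 uM1 andbT /=; apply/hasPn => z zM; apply/negP => zN.
  exact: dis (subN _ zN) (subM _ zM).
have su : s = u.
  have sN : s \in u :: N by rewrite EN mem_cat inE eqxx orbT.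
  have sM : s \in u :: M by rewrite EM mem_cat inE -st eqxx orbT.
  move: sN sM; rewrite !inE => /predU1P[//|sN] /predU1P[//|sM].
  by case: (dis s).
have nils (K s1' K1 : seq T) : u \notin K -> u :: K = s1' ++ u :: K1 -> K1 = K.
  case: s1' => [|y s1'] uK [] // _ E.
  by move: uK; rewrite E mem_cat inE eqxx orbT.
have E1 : N1 = N by apply: (nils N s1) => //; rewrite EN su.
have E2 : M1 = M by apply: (nils M t1) => //; rewrite EM -st su.
rewrite {}E1 in hN *; rewrite {}E2 in hM *.
pose C : {pred T} := [pred z | [|| z \in c, z \in N | z \in M]].
have DC : {in D0, forall z, z \notin C}.
  move=> z zD; rewrite inE !negb_or Dc //=; apply/andP; split.
    by apply/negP => /hN; rewrite inE zD orbT.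
  by apply/negP => /hM; rewrite inE zD orbT.
have vu : v \notin [set u] by rewrite inE; apply: contraNneq uD => <-.
have fu : f \notin [set u] by rewrite inE; apply: contraNneq uc => <-.
have X2 : #|[set u]| < 2 by rewrite cards1.
have fC : f \in C by rewrite inE fc.
have [w [k [m [[wD kC wu ku] cm um hm]]]] := bridge X2 vD fC vu fu DC.
have wu' : w != u by rewrite inE in wu.
have mN z : z \in m -> [/\ z \notin c, z \notin N, z \notin M & z \notin [predU1 u & D0]].
  case/hm; rewrite !inE !negb_or => zu zD /and3P[z1 z2 z3]; by rewrite zu zD.
have um' : uniq m by move: um; rewrite /= rcons_uniq => /and3P[].
have disj2 (r1 r2 : seq T) : uniq r1 -> uniq r2 -> (forall z, z \in r1 -> z \in r2 -> False) -> uniq (r1 ++ r2).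
  move=> u1 u2 h; rewrite cat_uniq u1 u2 andbT /=.
  by apply/hasPn => z z2; apply/negP => z1; apply: (h z).
have wD' : w \in [predU1 u & D0] by rewrite inE wD orbT.
have uD' : u \in [predU1 u & D0] by rewrite inE eqxx.
(* The bridge lands on the path [K]: continue along [K] to [c], and keep the other path [K'] from
   [u]. *)
have via (K K' : seq T) p q : conn e u K p -> conn e u K' q -> p \in c -> q \in c -> p != q ->
    uniq K -> uniq K' -> (forall z, z \in K -> z \in K' -> False) ->
    {in K, forall z, z \notin c /\ z \notin [predU1 u & D0]} ->
    {in K', forall z, z \notin c /\ z \notin [predU1 u & D0]} ->
    (forall z, z \in m -> z \in K -> False) -> (forall z, z \in m -> z \in K' -> False) ->
    k \in K ->
  exists s t f g N M, [/\ [/\ s != t, f != g, f \in c & g \in c],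
    s \in [predU1 u & D0], t \in [predU1 u & D0], conn e s N f /\ conn e t M g
    & [/\ {in N ++ M, forall z, z \notin c /\ z \notin [predU1 u & D0]} & uniq (N ++ M)]].
  move=> cK cK' pc qc pq uK uK' dK hK hK' mK mK' kK.
  have [K1 [K2 EK]] : exists K1 K2, K = K1 ++ k :: K2 by case/splitPr: kK => x y; exists x, y.
  have cK2 : conn e k K2 p by move: cK; rewrite EK conn_cat => /andP[].
  exists w, u, p, q, (m ++ k :: K2), K'; split=> //; first by rewrite conn_cat cm.
  have inK z : z \in k :: K2 -> z \in K by rewrite EK mem_cat => ->; rewrite orbT.
  split.
    move=> z; rewrite !mem_cat => /orP[/orP[zm|/inK/hK//]|/hK'//].
    by have [] := mN z zm.
  apply: (disj2) => //; last first.
    by move=> z; rewrite mem_cat => /orP[/mK' h /h|/inK /dK h /h].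
  apply: (disj2) => //; last by move=> z /mK h /inK /h.
  by move: uK; rewrite EK cat_uniq => /and3P[].
have dis' z : z \in M -> z \in N -> False by move=> zM zN; apply: dis zN zM.
have oN z : z \in N -> z \notin c /\ z \notin [predU1 u & D0].
  by move=> zN; split; [apply: off; rewrite mem_cat zN|apply: hN].
have oM z : z \in M -> z \notin c /\ z \notin [predU1 u & D0].
  by move=> zM; split; [apply: off; rewrite mem_cat zM orbT|apply: hM].
have gf : g != f by rewrite eq_sym.
have mN1 z : z \in m -> z \in N -> False by case/mN=> _ /negP h _ _ /h.
have mM1 z : z \in m -> z \in M -> False by case/mN=> _ _ /negP h _ /h.
case/or3P: kC => [kc|kN|kM]; first last.
- exact: (via M N g f).
- exact: (via N M f g).
(* The bridge lands on [c] itself, at [k]: keep a path of the fan that ends elsewhere, which exists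
   since the two ends differ. *)
have [K [p [cK [pc pk] uK hK mK]]] : exists K p, [/\ conn e u K p, p \in c /\ p != k, uniq K,
    {in K, forall z, z \notin c /\ z \notin [predU1 u & D0]} & forall z, z \in m -> z \in K -> False].
  case: (eqVneq f k) => fk; last by exists N, f.
  by exists M, g; split=> //; rewrite -fk.
exists w, u, k, p, m, K; split=> //; first by split=> //; rewrite eq_sym.
split; last exact: disj2.
by move=> z; rewrite mem_cat => /orP[/mN[]|/hK].
Qed.

(** Induction along a path from [q] to [c] with next vertex [u]. If [u] is on [c], the edge to [u]
    and a bridge avoiding [u] form the fan. If not, [two_starts] with [D0] reduced to [q] gives
    disjoint paths from [q] and from [u], and the latter is prolonged by the edge from [q]. *)
Lemma fan_all q : 1 < size c -> uniq c -> q \notin c -> fan q.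
Proof.
move=> c2 uc qc.
have [x xc] : exists x, x \in c by case: (c) c2 => // x s _; exists x; rewrite mem_head.
have X0 : #|(set0 : {set T})| < 2 by rewrite cards0.
have /connectP[p] := conn0 X0 (x := q) (y := x) ltac:(by rewrite inE) ltac:(by rewrite inE).
elim: p q qc => [|u p IH] q qc /= ; first by move=> _ xq; rewrite -xq xc in qc.
rewrite !inE /= => /andP[qu pp] xl.
case: (eqVneq u q) => [uq|uq]; first by apply: IH; rewrite ?uq // -uq.
case: (boolP (u \in c)) => uC.
  have X1 : #|[set u]| < 2 by rewrite cards1.
  have [y yc yu] : exists2 y, y \in c & y != u.
    case: (c) c2 uc => [|y [|z s]] //= _ /andP[yz _].
    case: (eqVneq y u) => yu; last by exists y; rewrite ?mem_head.
    exists z; rewrite ?inE ?eqxx ?orbT //; apply: contraNneq yz => zu.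
    by rewrite yu -zu mem_head.
  have [||||a [d [m [[aq dc au du] cm um hm]]]] := @bridge [set u] (pred1 q) (mem c) q y X1 _ yc.
  - by rewrite inE.
  - by rewrite inE eq_sym.
  - by rewrite inE.
  - by move=> z; rewrite inE => /eqP->.
  move: aq; rewrite inE => /eqP aq; rewrite {}aq in cm um.
  exists u, d, [::], m; split=> //.
  - by rewrite /conn /= qu.
  - by rewrite inE in du; rewrite eq_sym.
  - split=> /=; first by move=> z /hm[].
      by move: um; rewrite /= rcons_uniq => /and3P[].
    by move: um; rewrite /= mem_rcons inE negb_or => /andP[/andP[]].
have fu := IH u uC pp xl.
have [|||s [t [f [g [N [M [[st fg fc gc] sD tD [cN cM] [hh un]]]]]]]] :=
  @two_starts u (pred1 q) q fu uC _ _.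
- by rewrite inE.
- by rewrite inE.
- by move=> z; rewrite inE => /eqP->.
have build N' M' f' g' : conn e q N' f' -> conn e u M' g' -> f' != g' -> f' \in c -> g' \in c ->
    {in N' ++ M', forall z, z \notin c /\ z \notin [predU1 u & pred1 q]} -> uniq (N' ++ M') -> fan q.
  move=> k1 k2 fg' fc' gc' h' un'.
  have nu z : z \in N' ++ M' -> [/\ z \notin c, z != u & z != q].
    by case/h' => zc; rewrite !inE negb_or => /andP[].
  exists f', g', N', (u :: M'); split=> //; first by rewrite /conn /= qu.
  split.
  - move=> z; rewrite mem_cat inE => /or3P[zN|/eqP->//|zM].
      by have [] := nu z ltac:(by rewrite mem_cat zN).
    by have [] := nu z ltac:(by rewrite mem_cat zM orbT).
  - rewrite uniq_catC cat_cons cons_uniq uniq_catC un' andbT mem_cat orbC -mem_cat.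
    by apply/negP => /nu[]; rewrite eqxx.
  - rewrite mem_cat inE !negb_or eq_sym uq /=.
    by rewrite -negb_or -mem_cat; apply/negP => /nu[]; rewrite eqxx.
move: sD tD; rewrite !inE => /orP[] /eqP sE /orP[] /eqP tE; rewrite sE tE ?eqxx // in st cN cM.
- by apply: (build M N g f) => //; [rewrite eq_sym|move=> z; rewrite mem_cat orbC -mem_cat; apply: hh|rewrite uniq_catC].
- exact: (build N M f g).
Qed.

End Fan.

(** Cycles with no common vertex are joined by two disjoint paths, and cycles with exactly one by a
    path avoiding it. In both cases the longer arcs, with at least [L / 2] edges each, close up with
    the connecting paths to a cycle of more than [L] edges. *)
Theorem longest_meet2 c d : longest e L c -> longest e L d ->
  exists x y, [/\ x != y, x \in c, y \in c, x \in d & y \in d].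
Proof.
move=> lc ld; have [/andP[_ uc] sc] := lc; have [/andP[_ ud] sd] := ld.
have arcs' := @arcs _ e L e_sym.
have sep := @two_paths_sep _ e L e_sym L_gt2 L_max.
have long (b : seq T) k1 (x y : T) m1 m2 : longest e L b -> perm_eq b (x :: y :: m1 ++ m2) ->
    size m1 <= size m2 -> k1 = size m2 -> L <= 2 * k1.+1.
  by move=> lb pe le ->; have := perm_size pe; rewrite (proj2 lb) /= size_cat => /half_le; apply.
case: (boolP (has [in d] c)) => [/hasP[x xc xd]|/hasPn cd]; last first.
  exfalso.
  have [q qd] : exists q, q \in d.
    by case: (d) sd => [sd|q s]; [move: L_gt2; rewrite -sd|exists q; rewrite mem_head].
  have dc z : z \in d -> z \notin c by move=> zd; apply: contraL zd => /cd.
  have fq : fan c q by apply: fan_all => //; [rewrite sc; apply: ltnW|apply: dc].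
  have [v vd vq] : exists2 v, v \in d & v != q.
    have : ~~ all (pred1 q) d.
      apply/negP => /allP h; have : size d <= size [:: q].
        by apply: uniq_leq_size => // z /h; rewrite inE.
      by rewrite sd leqNgt (ltnW L_gt2).
    by case/allPn => v vd vq; exists v.
  (* Together with the apex [q] of the fan this is all of [d], so [two_starts] yields two disjoint
     paths from [d] to [c]. *)
  pose D0 : {pred T} := [pred z | (z \in d) && (z != q)].
  have D0E z : (z \in [predU1 q & D0]) = (z \in d).
    by rewrite !inE; case: eqVneq => [->|]; rewrite ?qd ?andbT.
  have [|||s [t [f [g [N [M [[st fg fc gc] sD tD [cN cM] [hh un]]]]]]]] :=
    @two_starts c q D0 v fq (dc q qd) _ _ _.
  - by rewrite inE eqxx andbF.
  - by rewrite inE vd vq.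
  - by move=> z; rewrite inE => /andP[/dc].
  rewrite !D0E in sD tD.
  have off z : z \in N ++ M -> z \notin c /\ z \notin d by case/hh; rewrite D0E.
  have [m1 [m2 [_ h2 um pm lm]]] := arcs' c f g lc fc gc fg.
  have ts : t != s by rewrite eq_sym.
  have [n1 [n2 [_ k2 un' pn ln]]] := arcs' d t s ld tD sD ts.
  have lm2 := long c _ f g m1 m2 lc pm lm erefl.
  have ln2 := long d _ t s n1 n2 ld pn ln erefl.
  have [_ [_ um2 _] [_ fm2] [_ gm2]] := uniq2 um.
  have [_ [_ un2 _] [_ tn2] [_ sn2]] := uniq2 un'.
  have inc z : z \in m2 -> z \in c by move=> zm; rewrite (perm_mem pm) !inE mem_cat zm !orbT.
  have ind z : z \in n2 -> z \in d by move=> zm; rewrite (perm_mem pn) !inE mem_cat zm !orbT.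
  have offN z : z \in N -> z \notin c /\ z \notin d by move=> zN; apply: off; rewrite mem_cat zN.
  have offM z : z \in M -> z \notin c /\ z \notin d by move=> zN; apply: off; rewrite mem_cat zN orbT.
  move: un; rewrite cat_uniq => /and3P[uN /hasPn NM uM].
  (* from f back along N to s, the arc of d to t, along M to g *)
  pose W := rev N ++ s :: (rev n2 ++ t :: M).
  have cW : conn e f W g by rewrite !conn_cat !conn_rev.
  have WE z : z \in W -> [\/ z \in N, z \in d | z \in M].
    rewrite mem_cat inE mem_cat inE !mem_rev.
    case/orP=> [zN|/orP[/eqP->|/orP[/ind zd|/orP[/eqP->|zM]]]];
      by [constructor 1|constructor 2|constructor 3].
  have Wc z : z \in W -> z \notin c by case/WE=> [/offN[]|/dc|/offM[]].
  have uW : uniq W.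
    apply: uniq_join; rewrite ?rev_uniq //.
    + apply: uniq_join; rewrite ?rev_uniq ?mem_rev //.
      * by apply/negP => /offM[_]; rewrite tD.
      * by move=> z; rewrite mem_rev => /ind zd; apply/negP => /offM[_]; rewrite zd.
    + by rewrite mem_rev; apply/negP => /offN[_]; rewrite sD.
    + rewrite mem_cat inE !negb_or mem_rev sn2 st /=.
      by apply/negP => /offM[_]; rewrite sD.
    + move=> z; rewrite mem_rev => zN; rewrite mem_cat inE !negb_or mem_rev.
      have [_ zd] := offN z zN; apply/and3P; split.
      * by apply: contra zd; apply: ind.
      * by apply: contraNneq zd => ->.
      * by apply/negP => /NM; rewrite /= zN.
  have := sep f g m2 W h2 cW fg um2 uW fm2 _ gm2 _ _.
  rewrite /W size_cat /= size_cat /= !size_rev.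
  have -> : f \notin rev N ++ s :: rev n2 ++ t :: M by apply/negP => /Wc; rewrite fc.
  have -> : g \notin rev N ++ s :: rev n2 ++ t :: M by apply/negP => /Wc; rewrite gc.
  move=> /(_ isT isT) H; apply: (cross_arith lm2 ln2 (H _)).
  by move=> z /inc zc; apply/negP => /Wc; rewrite zc.
case: (boolP (has (fun z => (z \in d) && (z != x)) c)) => [/hasP[y yc /andP[yd yx]]|/hasPn one].
  by exists x, y; split=> //; rewrite eq_sym.
exfalso.
have other b : longest e L b -> exists2 y, y \in b & y != x.
  move=> [/andP[_ ub] sb]; have : ~~ all (pred1 x) b.
    apply/negP => /allP h; have : size b <= size [:: x].
      by apply: uniq_leq_size => // z /h; rewrite inE.
    by rewrite sb leqNgt (ltnW L_gt2).
  by case/allPn => y yb yx; exists y.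
have [y yc yx] := other c lc; have [w wd wx] := other d ld.
have cdx z : z \in c -> z \in d -> z = x.
  by move=> zc zd; have := one z zc; rewrite zd /= negbK => /eqP.
have X1 : #|[set x]| < 2 by rewrite cards1.
pose C : {pred T} := [pred z | (z \in c) && (z != x)].
pose D : {pred T} := [pred z | (z \in d) && (z != x)].
have [|||||a [b [m [[aC bD _ _] cm um hm]]]] := @bridge [set x] C D y w X1.
- by rewrite inE yc.
- by rewrite inE wd.
- by rewrite inE.
- by rewrite inE.
- move=> z; rewrite !inE => /andP[zc zx]; rewrite negb_and.
  by apply/orP; left; apply: contra zx => /(cdx z zc)->.
move: aC bD; rewrite !inE => /andP[ac ax] /andP[bd bx].
have hm' z : z \in m -> [/\ z != x, z \notin c & z \notin d].
  by case/hm; rewrite !inE => zx; rewrite zx !andbT.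
have [m1 [m2 [_ h2 u2 pm lm]]] := arcs' c a x lc ac xc ax.
have [n1 [n2 [_ k2 v2 pn ln]]] := arcs' d b x ld bd xd bx.
have lm2 := long c _ a x m1 m2 lc pm lm erefl.
have ln2 := long d _ b x n1 n2 ld pn ln erefl.
have [_ [_ um2 _] [_ am2] [_ xm2]] := uniq2 u2.
have [_ [_ un2 _] [_ bn2] [_ xn2]] := uniq2 v2.
have inc z : z \in m2 -> z \in c by move=> zm; rewrite (perm_mem pm) !inE mem_cat zm !orbT.
have ind z : z \in n2 -> z \in d by move=> zm; rewrite (perm_mem pn) !inE mem_cat zm !orbT.
have um' : uniq m by move: um; rewrite /= rcons_uniq => /and3P[].
pose W := m ++ b :: n2.
have cW : conn e a W x by rewrite conn_cat cm.
have uW : uniq W.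
  apply: uniq_join => //; first by apply/negP => /hm'[_ _]; rewrite bd.
  by move=> z zm; apply/negP => /ind zd; have [_ _] := hm' z zm; rewrite zd.
have aW : a \notin W.
  rewrite mem_cat inE !negb_or; apply/and3P; split.
  - by apply/negP => /hm'[_]; rewrite ac.
  - by apply: contraNneq ax => ab; apply/eqP/cdx => //; rewrite ab.
  - by apply/negP => /ind ad; move: ax; rewrite (cdx a ac ad) eqxx.
have xW : x \notin W.
  rewrite mem_cat inE !negb_or eq_sym bx xn2 andbT; apply/andP; split=> //.
  by apply/negP => /hm'[]; rewrite eqxx.
have := sep a x m2 W h2 cW ax um2 uW am2 aW xm2 xW.
rewrite size_cat /= => H.
suff : {in m2, forall z, z \notin W} by move/H; apply: touch_arith lm2 ln2.
move=> z zm2; have zc := inc z zm2; rewrite mem_cat inE !negb_or; apply/and3P; split.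
- by apply/negP => /hm'[_]; rewrite zc.
- by apply: contraNneq xm2 => zb; rewrite -(cdx z zc) // zb.
- by apply/negP => /ind zd; rewrite (cdx z zc zd) (negbTE xm2) in zm2.
Qed.

End TwoConnected.

(** * Running the certificates *)

Fixpoint map_cert (f : nat -> nat) (t : cert) :=
  let g p := match p with
    | Sg a => Sg (f a) | Xg a b => Xg (f a) (f b) | Kg a b => Kg (f a) (f b) end in
  match t with
  | Br a b t1 t2 => Br (f a) (f b) (map_cert f t1) (map_cert f t2)
  | Cl a => Cl (f a)
  | Tg i => Tg i
  | Lp k rows => Lp k [seq (r.1, map g r.2) | r <- rows]
  end.

(* The component of the segments [J] is avoided by the last cycle, so that the
   segments of [J] are disjoint from those of this cycle. *)
Definition avoid_facts (trs : seq (seq nat)) (tr J J2 dz : seq nat) :=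
  let sgs := segments (rcons trs tr) in
  Facts [seq ab <- [seq (a, b) | a <- J, b <- iota 0 (size sgs)] |
           (so sgs ab.2 == size trs) || (ab.2 \in dz)]
        [::] (zip J (behead J) ++ zip J2 (behead J2)).

(** The last cycle runs through all traces except those in [excl], which are excluded by other
    means. [J2] lies in one component, and the segments of [dz] are outside the component of [J].
    [ok] selects a certificate and [f] renames its segments; since the renamed certificate is
    checked anew, a wrong choice could only make the check fail. *)
Definition avoid_check trs J J2 dz (excl : seq (seq nat)) (certs : seq (seq nat * cert))
    (ok : seq nat -> seq nat -> bool) (f : seq nat -> seq nat -> seq nat) :=
  all (fun tr => if tr \in excl then true else
    let sgs := segments (rcons trs tr) in let st := avoid_facts trs tr J J2 dz in
    has (fun p => if ok p.1 tr then
      let l := f p.1 tr in check sgs (size trs).+1 [::] st (map_cert (nth 0 l) p.2)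
      else false) certs) all_traces.

(* Longest cycles C, D, E with C meeting the bag in {0, 1}, D missing 0 and E missing
   1, up to symmetry. *)
Definition traces_01_12_02 := [:: [:: 0; 1]; [:: 1; 2]; [:: 0; 2]].
Definition traces_01_12_023 := [:: [:: 0; 1]; [:: 1; 2]; [:: 0; 2; 3]].
Definition traces_01_123_023 := [:: [:: 0; 1]; [:: 1; 2; 3]; [:: 0; 2; 3]].
Definition traces_trios := [:: [:: 1; 2; 3]; [:: 0; 2; 3]; [:: 0; 1; 3]; [:: 0; 1; 2]].

(* The configurations which the length inequalities leave open: two distinct
   components, each meeting all the cycles, and the segments they contain. *)
Definition targets_01_12_02 := [:: [:: [:: 0; 2; 4]; [:: 1; 3; 5]]; [:: [:: 0; 2; 5]; [:: 1; 3; 4]];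
      [:: [:: 0; 3; 4]; [:: 1; 2; 5]]; [:: [:: 0; 3; 5]; [:: 1; 2; 4]]].
Definition targets_01_123_023 := [:: [:: [:: 0; 2; 5]; [:: 1; 4; 7]]; [:: [:: 1; 2; 5]; [:: 0; 4; 7]]].
(* The segments of [traces_trios] none of whose ends is [l]. *)
Definition trio l := nth [::] [:: [:: 4; 7; 10]; [:: 1; 8; 11]; [:: 2; 5; 9]; [:: 0; 3; 6]] l.
Definition targets_trios := [:: [:: trio 0; trio 1]; [:: trio 0; trio 2]; [:: trio 0; trio 3];
   [:: trio 1; trio 2]; [:: trio 1; trio 3]; [:: trio 2; trio 3]].

Lemma check_01_12_02 : check (segments traces_01_12_02) 3 targets_01_12_02 (Facts [::] [::] [::]) cert_01_12_02.
Proof. by vm_cast_no_check (erefl true). Qed.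
Lemma check_01_12_023 : check (segments traces_01_12_023) 3 [::] (Facts [::] [::] [::]) cert_01_12_023.
Proof. by vm_cast_no_check (erefl true). Qed.
Lemma check_01_123_023 : check (segments traces_01_123_023) 3 targets_01_123_023 (Facts [::] [::] [::]) cert_01_123_023.
Proof. by vm_cast_no_check (erefl true). Qed.
Lemma check_trios : check (segments traces_trios) 4 targets_trios (Facts [::] [::] [::]) cert_trios.
Proof. by vm_cast_no_check (erefl true). Qed.

(** The tail fixes all further numbers; with length 30 it reaches beyond every segment number that
    occurs. *)
Definition by_list (s : seq nat) := s ++ iota (size s) 30.

Definition mix (J J' : seq nat) := [:: nth 0 J 0; nth 0 J' 0; nth 0 J 1; nth 0 J' 1; nth 0 J 2; nth 0 J' 2].

(** Each of the two components can be the avoided one. The excluded traces are complementary to the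
    traces of the three cycles, see [disjoint_traces]. *)
Lemma avoid_01_12_02 : all (fun tg => let: J := nth [::] tg 0 in let: J' := nth [::] tg 1 in
  avoid_check traces_01_12_02 J [::] J' [:: [:: 0; 3]; [:: 1; 3]; [:: 2; 3]] avoid_certs_01_12_02 eq_op (fun _ _ => by_list (mix J J')) &&
  avoid_check traces_01_12_02 J' [::] J [:: [:: 0; 3]; [:: 1; 3]; [:: 2; 3]] avoid_certs_01_12_02 eq_op (fun _ _ => by_list (mix J' J))) targets_01_12_02.
Proof. by vm_cast_no_check (erefl true). Qed.

(** The two targets differ by the exchange of the segments 0 and 1 of the first cycle; [i] is the
    one in the avoided component. *)
Lemma avoid_01_123_023 : all (fun i =>
  avoid_check traces_01_123_023 [:: i; 2; 5] [::] [:: 1 - i] [:: [:: 2; 3]] avoid_certs_01_123_023 eq_op (fun _ _ => by_list [:: i; 1 - i]) &&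
  avoid_check traces_01_123_023 [:: i; 4; 7] [::] [:: 1 - i] [:: [:: 2; 3]] avoid_certs_01_123_023' eq_op (fun _ _ => by_list [:: i; 1 - i]))
  [:: 0; 1].
Proof. by vm_cast_no_check (erefl true). Qed.

(* The certificates are for the components of the trios 0 and 1; the other pairs
   follow by permuting the bag. *)
Definition relabel (l m : nat) := [:: l; m] ++ [seq i <- iota 0 4 | (i != l) && (i != m)].

(** Cycle [i] of [traces_trios] is the one missing label [i], so permuting the bag by [sigma]
    permutes these cycles by [sigma] too. The default 4 in [nth 4 sigma] sends the fifth cycle to
    itself. Ends are compared without regard to direction. *)
Definition seg_index (sigma tr0 tr : seq nat) :=
  let sgs := segments (rcons traces_trios tr) in
  let g := nth 0 sigma in
  [seq find (fun s' : nat * nat * nat => if s'.2 == nth 4 sigma s.2 then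
    perm_eq [:: s'.1.1; s'.1.2] [:: g s.1.1; g s.1.2] else false) sgs
   | s <- segments (rcons traces_trios tr0)].

Lemma avoid_trios : all (fun l => all (fun m => if l == m then true else
   avoid_check traces_trios (trio l) (trio m) [::] (take 6 all_traces) avoid_certs_trios
     (fun tr0 tr => perm_eq (map (nth 0 (relabel l m)) tr0) tr) (seg_index (relabel l m)))
   (iota 0 4)) (iota 0 4).
Proof. by vm_cast_no_check (erefl true). Qed.

Lemma zip_behead (T : eqType) (s : seq T) a b :
  (a, b) \in zip s (behead s) -> a \in s /\ b \in s.
Proof.
case: s => [//|x s] /= h.
have := map_f fst h; have := map_f snd h; rewrite /=.
move=> h2 h1; split.
  suff : {subset unzip1 (zip (x :: s) s) <= x :: s} by apply.
  elim: (s) (x) => [//|y s' IH] z u; rewrite /= !inE => /predU1P[->|/IH]; rewrite ?eqxx //.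
  by rewrite inE => ->; rewrite orbT.
rewrite inE; apply/orP; right.
suff : {subset unzip2 (zip (x :: s) s) <= s} by apply.
elim: (s) (x) => [//|y s' IH] z u; rewrite /= !inE => /predU1P[->|/IH->]; rewrite ?eqxx ?orbT //.
Qed.

Lemma has_witness (T : Type) (a : pred T) s : has a s -> exists x, a x.
Proof. by elim: s => //= x s IH /orP[ax|/IH //]; exists x. Qed.

Lemma positions_rcons trs tr :
  positions (rcons trs tr) = positions trs ++ [seq (size trs, i) | i <- iota 0 (size tr)].
Proof.
rewrite /positions size_rcons -addn1 iotaD map_cat flatten_cat.
congr (_ ++ _); last by rewrite /= cats0 nth_rcons ltnn eqxx.
congr flatten; apply/eq_in_map => o; rewrite mem_iota /= add0n => ot.
by rewrite nth_rcons ot.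
Qed.

(** * Configurations of longest cycles at the chosen bag *)

Section Bag.
Variables (U : finType) (e : rel U) (L : nat) (bs : seq U) (v : U).
Hypothesis e_sym : symmetric e.
Hypothesis L_gt2 : 2 < L.
Hypothesis L_max : forall c, ucycle e c -> 2 < size c -> size c <= L.
Hypothesis sk : sink e L bs v.
Hypothesis meet2 : forall c d, longest e L c -> longest e L d ->
  exists x y, [/\ x != y, x \in c, y \in c, x \in d & y \in d].

Let vb := bag_label bs v.
Let conn_off := off_bag_sym bs e_sym.

Record family trs cs mss := Family {
  fam_cs : size cs = size trs;
  fam_ms : size mss = size trs;
  fam_dec : forall o, o < size trs ->
  [/\ nth [::] trs o \in all_traces, ucycle e (nth [::] cs o),
      size (nth [::] cs o) = L
    & dec e vb (nth [::] cs o) (nth [::] trs o) (nth [::] mss o)] }.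

Lemma family0 : family [::] [::] [::].
Proof. by []. Qed.

Lemma family_rcons trs cs mss tr c ms : family trs cs mss -> tr \in all_traces ->
  longest e L c -> dec e vb c tr ms -> family (rcons trs tr) (rcons cs c) (rcons mss ms).
Proof.
case=> h1 h2 h ta [uc sc] d; split; rewrite ?size_rcons ?h1 ?h2 //.
move=> o; rewrite ltnS => ot; rewrite !nth_rcons h1 h2.
by case: ltngtP ot => [/h //|//|_ _]; split.
Qed.

Lemma bag_inj : {in gtn 4 &, injective vb}.
Proof. by apply: bag_label_inj; [apply: sink_uniq sk|apply: sink_size sk]. Qed.

Lemma longest_dec c : longest e L c ->
  exists tr ms, tr \in all_traces /\ dec e vb c tr ms.
Proof.
case; apply: (decomposition v e_sym (sink_uniq sk) (sink_size sk) L_gt2 (sink_unfenced sk)).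
Qed.

Lemma traces_lt4 tr : tr \in all_traces -> all (gtn 4) tr.
Proof. by move: tr; apply/allP. Qed.

Lemma trace_mem c tr ms i : tr \in all_traces -> dec e vb c tr ms -> i < 4 ->
  (vb i \in c) = (i \in tr).
Proof. by move=> ta d i4; apply: dec_mem bag_inj (traces_lt4 ta) i4 d. Qed.

Section Family.
Variables (trs : seq (seq nat)) (cs : seq (seq U)) (mss : seq (seq (seq U))).
Hypothesis fam : family trs cs mss.
Let sgs := segments trs.
Let n := size sgs.
Let mi := interior trs mss.
Let lab := seg_label e bs trs mss.

Lemma cycle_in_seg o y : o < size trs -> y \in nth [::] cs o -> y \notin bs ->
  exists a, [/\ a < n, so sgs a = o & y \in mi a].
Proof.
move=> ot + yb; have [ta _ _ [sz _ pe _]] := fam_dec fam ot.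
rewrite -(perm_mem pe) mem_glue unzip1_zip ?unzip2_zip ?size_map ?sz // => /orP[|].
  case/mapP=> i it yi; case/negP: yb; rewrite yi bag_label_in ?(sink_size sk) //.
  exact: (allP (traces_lt4 ta)).
case/flattenP=> m /(nthP [::])[i im <-] ym; rewrite -sz in im.
have [a an Ea] := seg_of ot im; exists a.
have [o' [i' [_ _ Ea' [_ _ ->] Em]]] := seg_at mss an.
by move: Ea'; rewrite Ea => -[E1 E2]; split=> //; rewrite /mi Em -E1 -E2.
Qed.

Lemma class_root a b : a < n -> b < n -> a != b -> lab a = lab b ->
  exists2 x, x \in mi a & lab a = inr (root (off_bag e bs) x).
Proof.
move=> an bn ab; rewrite {1}/lab /seg_label /comp_label -/(mi a).
case Ea : (mi a) => [|x m] /=; last first.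
  by move=> _; exists x; [exact: mem_head|rewrite /lab /seg_label -/(mi a) Ea].
rewrite /lab /seg_label /comp_label; case: (interior _ _ _) => [|//] [E].
by rewrite E eqxx in ab.
Qed.

Lemma lab_connect a x y : a < n -> y \in mi a ->
  lab a = inr (root (off_bag e bs) x) -> connect (off_bag e bs) x y.
Proof.
move=> an ya; rewrite /lab (seg_label_root e_sym (sink_size sk) (fam_dec fam) an ya).
by case=> E; rewrite -root_connect // E.
Qed.

Lemma lab_adj a x i : a < n -> lab a = inr (root (off_bag e bs) x) -> i \in ends sgs a ->
  exists2 z, connect (off_bag e bs) x z & e z (vb i).
Proof.
move=> an la ie; case Em : (mi a) => [|y m].
  by move: la; rewrite /lab /seg_label -/(mi a) Em.
have ya : y \in mi a by rewrite Em mem_head.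
have xy := lab_connect an ya la.
have [z1 [z2 [c1 e1 c2 e2]]] := seg_ends_adj e_sym (sink_size sk) (fam_dec fam) an ya.
by move: ie; rewrite !inE => /orP[] /eqP->;
  [exists z1|exists z2] => //; apply: connect_trans xy _.
Qed.

(** The avoiding cycle [N] is appended to the family, which changes neither numbers nor labels of
    the earlier segments, and the certificate for its trace refutes the enlarged family. *)
Lemma avoid_refute J J2 dz excl certs ok f x N :
  avoid_check trs J J2 dz excl certs ok f ->
  all (gtn n) J -> all (gtn n) J2 -> all (gtn n) dz ->
  (forall a, a \in J -> lab a = inr (root (off_bag e bs) x)) ->
  {in J2 &, forall a b, lab a = lab b} ->
  (forall a, a \in dz -> lab a <> inr (root (off_bag e bs) x)) ->
  longest e L N -> {in N, forall y, ~~ connect (off_bag e bs) x y} ->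
  (forall tr ms, tr \in excl -> dec e vb N tr ms -> False) -> False.
Proof.
move=> ac /allP Jn /allP J2n /allP dn JL J2L dL lN avo ex.
have [tr [ms [ta d]]] := longest_dec lN.
have := allP ac tr ta; case: ifP => [trx _|_]; first exact: ex trx d.
cbv zeta; case/has_witness => p; case: ifP => // _; set t := map_cert _ _ => ck.
have fam' := family_rcons fam ta lN d.
have En a : a < n -> a < size (segments (rcons trs tr)).
  by rewrite /n /sgs !size_map positions_rcons size_cat => /leq_trans; apply; exact: leq_addr.
have Em a : a < n -> interior (rcons trs tr) (rcons mss ms) a = mi a.
  move=> an; rewrite /mi /interior positions_rcons nth_cat.
  have an' : a < size (positions trs) by move: an; rewrite /n /sgs size_map.
  rewrite an'; have := mem_nth (0, 0) an'.
  by case: (nth _ _ a) => o i; rewrite positionsP nth_rcons (fam_ms fam) => /andP[-> _].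
have El a : a < n -> seg_label e bs (rcons trs tr) (rcons mss ms) a = lab a.
  by move=> an; rewrite /seg_label Em.
have [||tg //] := problem e_sym (sink_uniq sk) (sink_size sk) L_gt2 L_max (sink_side sk)
  (sink_unfenced sk) (fam_dec fam') (st := avoid_facts trs tr J J2 dz) (targets := [::]) (t := t).
2: by rewrite size_rcons.
(* A segment of [J] has its inner vertices in the component of [x]. It is disjoint from [N], which
   avoids this component, and from a segment of [dz], which would otherwise have the same label. *)
have main a b : (a, b) \in apart (avoid_facts trs tr J J2 dz) ->
    ~~ has (mem (interior (rcons trs tr) (rcons mss ms) a))
           (interior (rcons trs tr) (rcons mss ms) b).
  rewrite mem_filter => /andP[/= ob /allpairsP[[a' b'] [/= aJ bn [? ?]]]]; subst a' b'.
  rewrite mem_iota /= add0n in bn; have an := Jn a aJ.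
  apply/hasPn => y yb; rewrite /= Em //; apply/negP => ya.
  have xy := lab_connect an ya (JL a aJ).
  case/orP: ob => [/eqP ob|bd].
    have [o [i [ot it _ [_ _ so1] Ei]]] := seg_at (rcons mss ms) bn.
    suff yN : y \in N by case/negP: (avo y yN).
    move: yb; rewrite Ei -so1 ob.
    rewrite nth_rcons (fam_ms fam) ltnn eqxx => yi.
    have [sz _ pe _] := d; rewrite -(perm_mem pe) mem_glue.
    rewrite unzip2_zip ?size_map ?sz //; apply/orP; right; apply/flattenP.
    exists (nth [::] ms i) => //; apply: mem_nth; rewrite ltnNge.
    by apply/negP => h; rewrite nth_default in yi.
  apply: (dL b bd); have bn' := dn b bd.
  rewrite Em // in yb.
  rewrite /lab (seg_label_root e_sym (sink_size sk) (fam_dec fam) bn' yb).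
  by congr inr; apply/eqP; rewrite root_connect // conn_off.
split=> [a b|a b //|a b].
- by rewrite /listed => /orP[/main //|/main]; rewrite has_sym.
- have tog c c' : (c, c') \in zip J (behead J) ++ zip J2 (behead J2) ->
    [/\ c < n, c' < n & lab c = lab c'].
    rewrite mem_cat => /orP[/zip_behead[h1 h2]|/zip_behead[h1 h2]].
      by split; [exact: Jn|exact: Jn|rewrite !JL].
    by split; [exact: J2n|exact: J2n|exact: J2L].
  by rewrite /listed => /orP[] /tog[h1 h2 h3]; rewrite !El //; split=> //; exact: En.
Qed.

End Family.

(** A common vertex of the cycles is not in the bag, since the traces are complementary. So segments
    of both cycles pass through its component. In a trace of length two every segment ends at both
    labels, hence the component is adjacent to the whole bag, against [sink_side]. *)
Lemma disjoint_traces c d tr tr' ms ms' : longest e L c -> longest e L d ->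
  tr \in all_traces -> tr' \in all_traces -> dec e vb c tr ms -> dec e vb d tr' ms' ->
  size tr = 2 -> size tr' = 2 -> all (fun i => (i \in tr) (+) (i \in tr')) (iota 0 4) -> False.
Proof.
move=> lc ld ta ta' dc dd s2 s2' /allP ex.
have [y [_ [_ yc _ yd _]]] := meet2 lc ld.
have f := family_rcons family0 ta lc dc; have f' := family_rcons family0 ta' ld dd.
case: (boolP (y \in bs)) => yb.
  have [i i4 yi] := bag_labelP v (sink_size sk) yb.
  have := ex i; rewrite mem_iota /= => /(_ i4).
  by rewrite -(trace_mem ta dc i4) -(trace_mem ta' dd i4) /vb -yi yc yd.
have [w wb Hw] := sink_side sk yb; have [i i4 wi] := bag_labelP v (sink_size sk) wb.
have key c' t m : family [:: t] [:: c'] [:: m] -> t \in all_traces -> size t = 2 ->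
    y \in c' -> i \in t -> False.
  move=> g tat st yc' it; have [a [an _ ya]] := cycle_in_seg g (o := 0) isT yc' yb.
  have [z1 [z2 [c1 e1 c2 e2]]] := seg_ends_adj e_sym (sink_size sk) (fam_dec g) an ya.
  have [o [j [ot jt _ [E1 E2 _] _]]] := seg_at [:: m] an.
  case: o ot jt E1 E2 => // _ /= jt E1 E2; rewrite E1 in e1; rewrite E2 in e2.
  have : (i == nth 0 t j) || (i == nth 0 (rot 1 t) j).
    case: t st it jt {g E1 E2 e1 e2 tat an ya} => [|p [|q []]] //= _.
    by rewrite !inE orbC; case: j => [|[|j]] // + _; rewrite orbC.
  case/orP=> /eqP ij; first by case/negP: (Hw z1 c1); rewrite wi ij.
  by case/negP: (Hw z2 c2); rewrite wi ij.
have := ex i; rewrite mem_iota /= => /(_ i4); case: (boolP (i \in tr)) => [it _|_ /= it'].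
  exact: key f ta s2 yc it.
exact: key f' ta' s2' yd it'.
Qed.

Lemma family_problem trs cs mss targets t : family trs cs mss ->
  check (segments trs) (size trs) targets (Facts [::] [::] [::]) t ->
  exists2 tg, tg \in targets & forall s, s \in tg ->
    {in s &, forall a b, seg_label e bs trs mss a = seg_label e bs trs mss b}.
Proof.
move=> fam; apply: (problem e_sym (sink_uniq sk) (sink_size sk) L_gt2 L_max
  (sink_side sk) (sink_unfenced sk) (fam_dec fam)); by split.
Qed.

Lemma class_of trs cs mss J : family trs cs mss ->
  [&& 1 < size J, uniq J & all (gtn (size (segments trs))) J] ->
  {in J &, forall a b, seg_label e bs trs mss a = seg_label e bs trs mss b} ->
  exists2 x, x \notin bs &
    forall a, a \in J -> seg_label e bs trs mss a = inr (root (off_bag e bs) x).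
Proof.
move=> fam; case: J => [|a [|b J]] // /and3P[_ /= /andP[ab _] /and3P[an bn _]] H.
have ne : a != b by apply: contraNneq ab => ->; rewrite mem_head.
have Hab : seg_label e bs trs mss a = seg_label e bs trs mss b.
  by apply: H; rewrite !inE eqxx ?orbT.
have [x xa E] := class_root an bn ne Hab.
exists x; first exact: (mi_off (sink_size sk) (fam_dec fam) an xa).
by move=> c cJ; rewrite -E; apply: H; rewrite ?mem_head.
Qed.

(** [v] is a bag vertex, so one of the two components is adjacent to it, and [sink_small] says that
    this one is not big. *)
Lemma small_side x x' :
  (forall i, i < 4 -> exists z, (connect (off_bag e bs) x z \/ connect (off_bag e bs) x' z)
     /\ e z (vb i)) -> x \notin bs -> x' \notin bs ->
  ~ (big e L bs x /\ big e L bs x').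
Proof.
move=> adj xb xb' [/(sink_small sk xb)[h _] /(sink_small sk xb')[h' _]].
have [i i4 vi] := bag_labelP v (sink_size sk) (sink_v sk).
have [z [[c|c] ez]] := adj i i4; first by case/negP: (h z c); rewrite vi.
by case/negP: (h' z c); rewrite vi.
Qed.

Lemma class_adj trs cs mss J x i : family trs cs mss ->
  all (gtn (size (segments trs))) J ->
  (forall a, a \in J -> seg_label e bs trs mss a = inr (root (off_bag e bs) x)) ->
  has (fun a => i \in ends (segments trs) a) J ->
  exists2 z, connect (off_bag e bs) x z & e z (vb i).
Proof.
move=> fam /allP Jn JL /hasP[a aJ ia].
exact: (lab_adj fam (Jn a aJ) (JL a aJ) ia).
Qed.

Lemma bag_trace c : longest e L c -> exists tr ms,
  [/\ tr \in all_traces, dec e vb c tr ms & forall i, i < 4 -> (vb i \in c) = (i \in tr)].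
Proof.
move=> lc; have [tr [ms [ta d]]] := longest_dec lc; exists tr, ms; split=> // i i4.
exact: trace_mem ta d i4.
Qed.

Lemma trace_in (P : pred (seq nat)) tr (s : seq (seq nat)) :
  tr \in all_traces -> P tr -> all (fun t => P t ==> (t \in s)) all_traces -> tr \in s.
Proof. by move=> ta Pt /allP/(_ _ ta)/implyP; apply. Qed.

Lemma family3 tr1 tr2 tr3 ms1 ms2 ms3 C D E : longest e L C -> longest e L D ->
  longest e L E -> tr1 \in all_traces -> tr2 \in all_traces -> tr3 \in all_traces ->
  dec e vb C tr1 ms1 -> dec e vb D tr2 ms2 -> dec e vb E tr3 ms3 ->
  family [:: tr1; tr2; tr3] [:: C; D; E] [:: ms1; ms2; ms3].
Proof.
move=> lC lD lE t1 t2 t3 d1 d2 d3.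
exact: (family_rcons (family_rcons (family_rcons family0 t1 lC d1) t2 lD d2) t3 lE d3).
Qed.

(** The certificate leaves two components with one segment of each cycle in either. If one of them
    is avoided by a longest cycle, [avoid_refute] applies. If both are big, neither is adjacent to
    [v], so [v] has label 3; then [C] would have to contain [v] or meet a component next to [v], but
    all its segments lie in these two. *)
Lemma no_traces_01_12_02 C D E m1 m2 m3 : longest e L C -> longest e L D -> longest e L E ->
  dec e vb C [:: 0; 1] m1 -> dec e vb D [:: 1; 2] m2 -> dec e vb E [:: 0; 2] m3 -> False.
Proof.
move=> lC lD lE dC dD dE.
have fam := family3 lC lD lE (tr1 := [:: 0; 1]) (tr2 := [:: 1; 2]) (tr3 := [:: 0; 2])
  isT isT isT dC dD dE; rewrite -/traces_01_12_02 in fam; set cs := [:: C; D; E] in fam *.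
set mss := [:: m1; m2; m3] in fam *.
have [tg tin H] := family_problem fam check_01_12_02.
have /allP/(_ tg tin) : all (fun tg : seq (seq nat) =>
  [&& tg == [:: nth [::] tg 0; nth [::] tg 1], 0 \in nth [::] tg 0, 1 \in nth [::] tg 1,
   all (fun J => [&& [&& 1 < size J, uniq J & all (gtn 6) J] &
     all (fun i => has (fun a => i \in ends (segments traces_01_12_02) a) J) (iota 0 3)]) tg &
   all (fun a => (a \in nth [::] tg 0) || (a \in nth [::] tg 1)) (iota 0 6)]) targets_01_12_02.
  by vm_compute.
case/and5P=> /eqP; set J := nth [::] tg 0; set J' := nth [::] tg 1 => Etg J0 J1.
have av := allP avoid_01_12_02 tg tin; move: av; cbv zeta; rewrite -/J -/J' => /andP[av av'].
move=> /allP W /allP cover.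
have /andP[wJ /allP cJ] : [&& 1 < size J, uniq J & all (gtn 6) J] &&
    all (fun i => has (fun a => i \in ends (segments traces_01_12_02) a) J) (iota 0 3).
  by apply: W; rewrite Etg mem_head.
have wJ' : [&& 1 < size J', uniq J' & all (gtn 6) J'].
  by have /W/andP[] : J' \in tg by rewrite Etg inE mem_head orbT.
have HJ : {in J &, forall a b, seg_label e bs traces_01_12_02 mss a = seg_label e bs traces_01_12_02 mss b}.
  by apply: H; rewrite Etg mem_head.
have HJ' : {in J' &, forall a b, seg_label e bs traces_01_12_02 mss a = seg_label e bs traces_01_12_02 mss b}.
  by apply: H; rewrite Etg inE mem_head orbT.
have [x xb xJ] := class_of fam wJ HJ; have [x' xb' xJ'] := class_of fam wJ' HJ'.
have /and3P[_ _ Jn] := wJ; have /and3P[_ _ Jn'] := wJ'.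
(* The two segments of [C] cannot share a label, so the two components of the target are
   distinct. *)
have [c [cn oc lc]] := seg_label_own e_sym (sink_size sk) (sink_unfenced sk)
  (fam_dec fam) (a := 0) isT.
have ne : seg_label e bs traces_01_12_02 mss 1 <> seg_label e bs traces_01_12_02 mss 0.
  by move: cn oc lc; case: c => [|[|[|[|[|[|c]]]]]].
have excl N : longest e L N -> forall tr ms,
    tr \in [:: [:: 0; 3]; [:: 1; 3]; [:: 2; 3]] -> dec e vb N tr ms -> False.
  move=> lN tr ms; rewrite !inE => /or3P[] /eqP-> dN.
  - exact: (disjoint_traces lN lD _ _ dN dD).
  - exact: (disjoint_traces lN lE _ _ dN dE).
  - exact: (disjoint_traces lN lC _ _ dN dC).
have [bx|/avoiding_cycle[N lN avo]] := pselect (big e L bs x); last first.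
  apply: (avoid_refute fam av Jn _ Jn' xJ _ _ lN avo (excl N lN)) => // a aJ' E'.
  by apply: ne; rewrite (HJ' 1 a J1 aJ') E' xJ.
have [bx'|/avoiding_cycle[N lN avo]] := pselect (big e L bs x'); last first.
  apply: (avoid_refute fam av' Jn' _ Jn xJ' _ _ lN avo (excl N lN)) => // a aJ E'.
  by apply: ne; rewrite -(HJ a 0 aJ J0) E' xJ'.
have [h hC] := sink_small sk xb bx; have [h' _] := sink_small sk xb' bx'.
have [i i4 vi] := bag_labelP v (sink_size sk) (sink_v sk).
(* The segments in [J] have ends at all of the labels 0, 1, 2, so a bag vertex with such a label is
   adjacent to this component. *)
case: (ltnP i 3) => i3.
  have [|z cz ez] := class_adj fam Jn xJ (i := i).
    by apply: cJ; rewrite mem_iota.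
  by case/negP: (h z cz); rewrite vi.
have [y yC [yv|[yb [z yz zv]]]] := hC C lC.
  have := trace_mem (tr := [:: 0; 1]) isT dC i4.
  by rewrite /vb -vi -yv yC; move: i3 i4; case: (i) => [|[|[|[|]]]].
have [a [an _ ya]] := cycle_in_seg fam (o := 0) isT yC yb.
have := cover a; rewrite mem_iota => /(_ an)/orP[aJ|aJ].
  have cxy := lab_connect fam an ya (xJ a aJ).
  by case/negP: (h z (connect_trans cxy yz)).
have cxy := lab_connect fam an ya (xJ' a aJ).
by case/negP: (h' z (connect_trans cxy yz)).
Qed.

(** As before, except that the two components together touch the entire bag: one has ends at 0, 1, 2
    and the other at 3. So [small_side] already shows that one of them is avoided. *)
Lemma no_traces_01_123_023 C D E m1 m2 m3 : longest e L C -> longest e L D -> longest e L E ->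
  dec e vb C [:: 0; 1] m1 -> dec e vb D [:: 1; 2; 3] m2 -> dec e vb E [:: 0; 2; 3] m3 ->
  False.
Proof.
move=> lC lD lE dC dD dE.
have fam := family3 lC lD lE (tr1 := [:: 0; 1]) (tr2 := [:: 1; 2; 3]) (tr3 := [:: 0; 2; 3])
  isT isT isT dC dD dE; rewrite -/traces_01_123_023 in fam; set cs := [:: C; D; E] in fam *.
set mss := [:: m1; m2; m3] in fam *.
have [tg tin H] := family_problem fam check_01_123_023.
have [i [i01 [HJ HJ']]] : exists i, i \in [:: 0; 1] /\
   ({in [:: i; 2; 5] &, forall a b, seg_label e bs traces_01_123_023 mss a = seg_label e bs traces_01_123_023 mss b} /\
   {in [:: 1 - i; 4; 7] &, forall a b, seg_label e bs traces_01_123_023 mss a = seg_label e bs traces_01_123_023 mss b}).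
  move: tin; rewrite !inE => /orP[] /eqP Etg;
    [exists 0|exists 1]; by split; [rewrite !inE|split; apply: H; rewrite Etg].
have wf J : J \in [:: [:: 0; 2; 5]; [:: 1; 2; 5]; [:: 0; 4; 7]; [:: 1; 4; 7]] ->
   [&& 1 < size J, uniq J & all (gtn (size (segments traces_01_123_023))) J].
  by move: J; apply/allP.
have wJ : [:: i; 2; 5] \in [:: [:: 0; 2; 5]; [:: 1; 2; 5]; [:: 0; 4; 7]; [:: 1; 4; 7]].
  by move: i01; rewrite !inE => /orP[] /eqP->.
have wJ' : [:: 1 - i; 4; 7] \in [:: [:: 0; 2; 5]; [:: 1; 2; 5]; [:: 0; 4; 7]; [:: 1; 4; 7]].
  by move: i01; rewrite !inE => /orP[] /eqP->.
have [x xb xJ] := class_of fam (wf _ wJ) HJ.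
have [x' xb' xJ'] := class_of fam (wf _ wJ') HJ'.
have /and3P[_ _ Jn] := wf _ wJ; have /and3P[_ _ Jn'] := wf _ wJ'.
have i8 : i < 8 by move: i01; rewrite !inE => /orP[] /eqP->.
have [c [cn oc lc]] := seg_label_own e_sym (sink_size sk) (sink_unfenced sk)
  (fam_dec fam) (a := i) i8.
have ne : seg_label e bs traces_01_123_023 mss (1 - i) <> seg_label e bs traces_01_123_023 mss i.
  by move: i01 cn oc lc; rewrite !inE => /orP[] /eqP->; case: c => [|[|[|[|[|[|[|[|c]]]]]]]].
have excl N : longest e L N -> forall tr ms,
    tr \in [:: [:: 2; 3]] -> dec e vb N tr ms -> False.
  move=> lN tr ms; rewrite !inE => /eqP-> dN.
  exact: (disjoint_traces lN lC _ _ dN dC).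
have i1n : all (gtn (size (segments traces_01_123_023))) [:: 1 - i].
  by move: i01; rewrite !inE => /orP[] /eqP->.
have i0n : all (gtn (size (segments traces_01_123_023))) [:: i].
  by move: i01; rewrite !inE => /orP[] /eqP->.
have [bx|/avoiding_cycle[N lN avo]] := pselect (big e L bs x); last first.
  have /andP[av _] := allP avoid_01_123_023 i i01.
  apply: (avoid_refute fam av Jn _ i1n xJ _ _ lN avo (excl N lN)) => // a.
  by rewrite inE => /eqP-> E'; apply: ne; rewrite E' xJ ?mem_head.
have [bx'|/avoiding_cycle[N lN avo]] := pselect (big e L bs x'); last first.
  have i01' : 1 - i \in [:: 0; 1] by move: i01; rewrite !inE => /orP[] /eqP->.
  have /andP[_ av] := allP avoid_01_123_023 (1 - i) i01'.
  have E1 : 1 - (1 - i) = i by move: i01; rewrite !inE => /orP[] /eqP->.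
  rewrite E1 in av.
  apply: (avoid_refute fam av Jn' _ i0n xJ' _ _ lN avo (excl N lN)) => // a.
  by rewrite inE => /eqP-> E'; apply: ne; rewrite E' xJ' ?mem_head.
apply: (small_side _ xb xb' (conj bx bx')) => j j4; case: (ltnP j 3) => j3.
  have [|z cz ez] := class_adj fam Jn xJ (i := j); last by exists z; split; [left|].
  by move: i01 j3 {j4}; rewrite !inE => /orP[] /eqP->; case: j => [|[|[|]]].
have [|z cz ez] := class_adj fam Jn' xJ' (i := j); last by exists z; split; [right|].
by move: i01 j3 j4; rewrite !inE => /orP[] /eqP->; case: j => [|[|[|[|]]]].
Qed.

(** The last hypothesis removes the traces 1, 2, 3 for [D] with 0, 2 for [E]. They become the traces
    1, 2 with 0, 2, 3 when the labels 0 and 1 and the roles of [D] and [E] are exchanged. *)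
Lemma no_two_trace C D E : longest e L C -> longest e L D -> longest e L E ->
  vb 2 \notin C -> vb 3 \notin C -> vb 0 \notin D -> vb 2 \in D ->
  vb 1 \notin E -> vb 2 \in E -> vb 1 \in D -> vb 0 \in E -> (vb 3 \in D -> vb 3 \in E) -> False.
Proof.
move=> lC lD lE.
have [t1 [m1 [ta1 d1 h1]]] := bag_trace lC; have [t2 [m2 [ta2 d2 h2]]] := bag_trace lD.
have [t3 [m3 [ta3 d3 h3]]] := bag_trace lE.
rewrite !h1 // !h2 // !h3 // => C2 C3 D0 D2 E1 E2 D1 E0 DE.
have := trace_in (P := fun t => (2 \notin t) && (3 \notin t)) (s := [:: [:: 0; 1]]) ta1.
rewrite C2 C3 inE => /(_ isT isT)/eqP Et1; rewrite Et1 in d1.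
have := trace_in (P := fun t => [&& 0 \notin t, 1 \in t & 2 \in t])
  (s := [:: [:: 1; 2]; [:: 1; 2; 3]]) ta2.
rewrite D0 D1 D2 => /(_ isT isT) t2s.
have := trace_in (P := fun t => [&& 1 \notin t, 0 \in t & 2 \in t])
  (s := [:: [:: 0; 2]; [:: 0; 2; 3]]) ta3.
rewrite E0 E1 E2 => /(_ isT isT) t3s.
move: t2s t3s; rewrite !inE => /orP[] /eqP Et2 /orP[] /eqP Et3; rewrite Et2 in d2; rewrite Et3 in d3.
- exact: no_traces_01_12_02 lC lD lE d1 d2 d3.
- have fam := family3 lC lD lE (tr1 := [:: 0; 1]) (tr2 := [:: 1; 2]) (tr3 := [:: 0; 2; 3])
    isT isT isT d1 d2 d3.
  by have [] := family_problem fam check_01_12_023.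
- by move: DE; rewrite Et2 Et3 => /(_ isT).
- exact: no_traces_01_123_023 lC lD lE d1 d2 d3.
Qed.

Lemma cross c d : longest e L c -> longest e L d -> vb 2 \notin c -> vb 3 \notin c ->
  vb 0 \notin d -> vb 1 \notin d -> False.
Proof.
move=> lc ld; have [t1 [m1 [ta1 d1 h1]]] := bag_trace lc.
have [t2 [m2 [ta2 d2 h2]]] := bag_trace ld; rewrite !h1 // !h2 // => C2 C3 D0 D1.
have := trace_in (P := fun t => (2 \notin t) && (3 \notin t)) (s := [:: [:: 0; 1]]) ta1.
rewrite C2 C3 inE => /(_ isT isT)/eqP E1; rewrite E1 in d1.
have := trace_in (P := fun t => (0 \notin t) && (1 \notin t)) (s := [:: [:: 2; 3]]) ta2.
rewrite D0 D1 inE => /(_ isT isT)/eqP E2; rewrite E2 in d2.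
exact: (disjoint_traces lc ld _ _ d1 d2).
Qed.

Lemma two_in_bag c : longest e L c ->
  1 < (vb 0 \in c) + (vb 1 \in c) + (vb 2 \in c) + (vb 3 \in c).
Proof.
move=> lc; have [tr [ms [ta _ h]]] := bag_trace lc; rewrite !h //.
by move: tr ta {h}; apply/allP.
Qed.

Hypothesis no_common : forall v, exists2 c, longest e L c & v \notin c.

(** Were there no such cycle, a longest cycle missing one bag vertex would contain the other three.
    The four cycles obtained by missing each bag vertex in turn form the family [traces_trios]. *)
Lemma some_cycle_meeting_bag_twice : (forall c tr ms, longest e L c -> tr \in take 6 all_traces ->
  dec e vb c tr ms -> False) -> False.
Proof.
move=> no2.
have M i : i < 4 -> exists c ms, longest e L c /\ dec e vb c (nth [::] traces_trios i) ms.
  move=> i4; have [c lc ic] := no_common (vb i).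
  have [tr [ms [ta d h]]] := bag_trace lc; exists c, ms; split=> //.
  rewrite h // in ic.
  have t2 : tr \notin take 6 all_traces by apply/negP => t6; apply: no2 lc t6 d.
  (* Three labels have a single cyclic order up to reversal, so the missing label determines the
     trace. *)
  have := trace_in (P := fun t => (i \notin t) && (t \notin take 6 all_traces))
    (s := [:: nth [::] traces_trios i]) ta.
  rewrite ic t2 => /(_ isT) h'; have : tr \in [:: nth [::] traces_trios i].
    by apply: h'; move: i4; case: (i) => [|[|[|[|]]]].
  by rewrite inE => /eqP <-.
have [c0 [m0 [l0 d0]]] := M 0 isT; have [c1 [m1 [l1 d1]]] := M 1 isT.
have [c2 [m2 [l2 d2]]] := M 2 isT; have [c3 [m3 [l3 d3]]] := M 3 isT.
have fam : family traces_trios [:: c0; c1; c2; c3] [:: m0; m1; m2; m3].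
  by apply: (family_rcons (family3 l0 l1 l2 _ _ _ d0 d1 d2) _ l3 d3).
have [tg tin H] := family_problem fam check_trios.
have [l [m [l4 m4 lm Etg]]] : exists l m, [/\ l \in iota 0 4, m \in iota 0 4, l != m &
    tg = [:: trio l; trio m]].
  move: tin; rewrite !inE => /or4P[|||/or3P[]] /eqP->;
  [exists 0, 1|exists 0, 2|exists 0, 3|exists 1, 2|exists 1, 3|exists 2, 3]; by split.
have wf k : k \in iota 0 4 ->
   [&& 1 < size (trio k), uniq (trio k) & all (gtn (size (segments traces_trios))) (trio k)].
  by move: k; apply/allP.
have HJ := H (trio l); rewrite Etg mem_head in HJ; have {}HJ := HJ isT.
have HJ' := H (trio m); rewrite Etg !inE eqxx orbT in HJ'; have {}HJ' := HJ' isT.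
have [x xb xJ] := class_of fam (wf l l4) HJ; have [x' xb' xJ'] := class_of fam (wf m m4) HJ'.
have /and3P[_ _ Jn] := wf l l4; have /and3P[_ _ Jn'] := wf m m4.
have av a b : a \in iota 0 4 -> b \in iota 0 4 -> a != b ->
    avoid_check traces_trios (trio a) (trio b) [::] (take 6 all_traces) avoid_certs_trios
     (fun tr0 tr => perm_eq (map (nth 0 (relabel a b)) tr0) tr) (seg_index (relabel a b)).
  by move=> a4 b4 /negbTE ab; have := allP (allP avoid_trios a a4) b b4; rewrite ab.
have [bx|/avoiding_cycle[N lN avo]] := pselect (big e L bs x); last first.
  by apply: (avoid_refute fam (av l m l4 m4 lm) Jn Jn' _ xJ HJ' _ lN avo) => // tr ms; apply: no2.
have [bx'|/avoiding_cycle[N lN avo]] := pselect (big e L bs x'); last first.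
  rewrite eq_sym in lm.
  by apply: (avoid_refute fam (av m l m4 l4 lm) Jn' Jn _ xJ' HJ _ lN avo) => // tr ms; apply: no2.
apply: (small_side _ xb xb' (conj bx bx')) => j j4.
(* A trio touches every label but its own, so two different trios touch the whole bag. *)
have cov : all (fun l => all (fun j => (j == l) ||
   has (fun a => j \in ends (segments traces_trios) a) (trio l)) (iota 0 4)) (iota 0 4) by [].
have jin : j \in iota 0 4 by rewrite mem_iota.
case/orP: (allP (allP cov l l4) j jin) => [/eqP jl|hj].
  case/orP: (allP (allP cov m m4) j jin) => [/eqP jm|hj].
    by move: lm; rewrite -jl jm eqxx.
  by have [z cz ez] := class_adj fam Jn' xJ' hj; exists z; split; [right|].
by have [z cz ez] := class_adj fam Jn xJ hj; exists z; split; [left|].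
Qed.

End Bag.

Lemma sink_perm (U : finType) (e : rel U) L bs bs' v : perm_eq bs bs' ->
  sink e L bs v -> sink e L bs' v.
Proof.
move=> pe [h1 h2 h3 h4 h5 h6].
have E : off_bag e bs' = off_bag e bs.
  by apply/funext => x; apply/funext => y; rewrite /off_bag /= !(perm_mem pe).
have Em x : (x \in bs') = (x \in bs) by rewrite (perm_mem pe).
split; rewrite -?(perm_uniq pe) -?(perm_size pe) ?Em //.
- move=> x; rewrite Em E => /h4[w wb Hw]; by exists w; rewrite ?Em.
- by move=> x c; rewrite Em E => xb uc sc; have [y yc Hy] := h5 x c xb uc sc; exists y; rewrite ?Em.
- move=> x; rewrite Em /big E => xb bx; have [k1 k2] := h6 x xb bx; split=> // c lc.
  by have [y yc Hy] := k2 c lc; exists y; rewrite ?Em.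
Qed.

(** * Symmetries of the bag and the final contradiction *)

Section BagContra.
Variables (U : finType) (e : rel U) (L : nat) (v : U).
Hypothesis e_sym : symmetric e.
Hypothesis L_gt2 : 2 < L.
Hypothesis L_max : forall c, ucycle e c -> 2 < size c -> size c <= L.
Hypothesis meet2 : forall c d, longest e L c -> longest e L d ->
  exists x y, [/\ x != y, x \in c, y \in c, x \in d & y \in d].
Hypothesis no_common : forall v, exists2 c, longest e L c & v \notin c.

(** Let [D] miss [p] and [E] miss [q]. By [cross] and the cycle [C], [q] is on [D] and [p] on [E];
    each of [D] and [E] also contains [s] or [t]. If they share one of these, [no_two_trace] applies
    after reordering the bag; if not, [D] and [E] have complementary traces and [cross] applies to
    them. *)
Lemma no_cycle_meeting_bag_twice p q s t C : sink e L [:: p; q; s; t] v -> longest e L C ->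
  s \notin C -> t \notin C -> False.
Proof.
move=> sk lC sC tC; set bs := [:: p; q; s; t] in sk.
have perm b : perm_eq bs b -> sink e L b v by move=> pe; apply: sink_perm pe sk.
have sk1 : sink e L [:: q; p; s; t] v.
  by apply: perm; apply/permP => P /=; lia.
have sk2 : sink e L [:: p; q; t; s] v.
  by apply: perm; apply/permP => P /=; lia.
have sk3 : sink e L [:: q; p; t; s] v.
  by apply: perm; apply/permP => P /=; lia.
have sk4 : sink e L [:: q; s; p; t] v.
  by apply: perm; apply/permP => P /=; lia.
have sk5 : sink e L [:: q; t; p; s] v.
  by apply: perm; apply/permP => P /=; lia.
have [D lD pD] := no_common p; have [E lE qE] := no_common q.
have qD : q \in D.
  by apply: contraT => qD; case: (cross e_sym L_gt2 sk meet2 lC lD sC tC pD qD).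
have pE : p \in E.
  by apply: contraT => pE; case: (cross e_sym L_gt2 sk meet2 lC lE sC tC pE qE).
have cD := two_in_bag e_sym L_gt2 sk lD; have cE := two_in_bag e_sym L_gt2 sk lE.
rewrite /bag_label /= (negbTE pD) qD in cD; rewrite /bag_label /= (negbTE qE) pE in cE.
have c0 := no_two_trace e_sym L_gt2 L_max sk meet2 lC lD lE sC tC pD _ qE _ qD pE.
have c1 := no_two_trace e_sym L_gt2 L_max sk1 meet2 lC lE lD sC tC qE _ pD _ pE qD.
have c2 := no_two_trace e_sym L_gt2 L_max sk2 meet2 lC lD lE tC sC pD _ qE _ qD pE.
have c3 := no_two_trace e_sym L_gt2 L_max sk3 meet2 lC lE lD tC sC qE _ pD _ pE qD.
have c4 := cross e_sym L_gt2 sk4 meet2 lD lE pD _ qE.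
have c5 := cross e_sym L_gt2 sk5 meet2 lD lE pD _ qE.
rewrite /bag_label /= in c0 c1 c2 c3 c4 c5.
(* In [c0] to [c3] the shared vertex is [s] or [t], with the roles of [D] and [E] in both orders so
   that one of them meets the last hypothesis of [no_two_trace]; [c4] and [c5] are the complementary
   cases. *)
case: (boolP (s \in D)) cD c0 c1 c2 c3 c4 c5 => sD; case: (boolP (t \in D)) => tD;
  case: (boolP (s \in E)) cE => sE; case: (boolP (t \in E)) => tE //= _ _;
  move=> c0 c1 c2 c3 c4 c5; try by [apply: c0|apply: c1|apply: c2|apply: c3|apply: c4|apply: c5].
Qed.

Theorem no_sink_bag bs : sink e L bs v -> False.
Proof.
move=> sk; have H := some_cycle_meeting_bag_twice e_sym L_gt2 L_max sk no_common; apply: H => C tr ms lC t6 d.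
have ta : tr \in all_traces by apply: mem_take t6.
have h i : i < 4 -> (bag_label bs v i \in C) = (i \in tr) by move=> i4; exact: (trace_mem sk ta d i4).
set b := bag_label bs v in h.
have Eb : bs = map b (iota 0 4).
  by apply: (@eq_from_nth _ v); rewrite ?(sink_size sk) // => i i4; rewrite (nth_map 0) ?size_iota // nth_iota.
have key i j k l : perm_eq (iota 0 4) [:: i; j; k; l] -> k < 4 -> l < 4 ->
    k \notin tr -> l \notin tr -> False.
  move=> pe k4 l4; rewrite -!h //; apply: (no_cycle_meeting_bag_twice (p := b i) (q := b j)) lC.
  by apply: sink_perm sk; rewrite Eb -/(map b [:: i; j; k; l]) perm_map.
move: t6; rewrite !inE => /or4P[|||/or3P[]] /eqP E; rewrite E in key.
- exact: (key 0 1 2 3).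
- exact: (key 0 2 1 3).
- exact: (key 0 3 1 2).
- exact: (key 1 2 0 3).
- exact: (key 1 3 0 2).
- exact: (key 2 3 0 1).
Qed.

End BagContra.

(** * From the given graph to the 3-tree, and the theorem *)

Lemma connect_step (T : finType) (g : rel T) x y : connect g x y -> x != y ->
  exists z, g x z.
Proof.
by case/connectP=> [[|z p]] /= => [_ ->|/andP[xz _] _ _]; rewrite ?eqxx //; exists z.
Qed.

(** Take an edge from [x] to [y]. Deleting [x] leaves [y] a further neighbour [w], since there is a
    third vertex; deleting [y] leaves a path from [w] to [x], which [y] closes to a cycle. *)
Lemma has_cycle (T : finType) (e : rel T) : simple_graph e -> k_connected 2 e ->
  exists c, graph_cycle e c.
Proof.
case=> e_sym e_irr [T2 co].
have [x [y xy]] : exists x y, e x y.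
  have /card_gt1P[x [z [_ _ xz]]] : 1 < #|T| by apply: ltnW.
  have /connect_step/(_ xz)[y /and3P[_ _ xy]] :
      connect [rel u v | [&& u \notin set0, v \notin set0 & e u v]] x z.
    by apply: co; rewrite ?cards0 ?inE.
  by exists x, y.
have yx : y != x by apply: contraTneq xy => ->; rewrite e_irr.
have [z zx zy] : exists2 z, z != x & z != y.
  have /card_gt0P[z] : 0 < #|~: [set x; y]|.
    by have := cardsC [set x; y]; rewrite cards2; move: T2; case: (x != y) => /=; lia.
  by rewrite !inE negb_or => /andP[h1 h2]; exists z.
have yz : y != z by rewrite eq_sym.
have /connect_step/(_ yz)[w /and3P[_]] :
    connect [rel u v | [&& u \notin [set x], v \notin [set x] & e u v]] y z.
  by apply: co; rewrite ?cards1 ?inE.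
rewrite inE => wx yw.
have wy : w != y by apply: contraTneq yw => ->; rewrite e_irr.
have /connectP[p pp lx] : connect [rel u v | [&& u \notin [set y], v \notin [set y] & e u v]] w x.
  by apply: co; rewrite ?cards1 ?inE // eq_sym.
case: (shortenP pp) lx => q qp uq _ lx.
have py : path e w q /\ y \notin q.
  elim: q w qp {uq lx wx yw wy pp} => //= u q IH w /andP[/and3P[_ uy wu] /IH[h1 h2]].
  by rewrite wu h1 inE negb_or h2; split; rewrite ?andbT //; move: uy; rewrite inE eq_sym.
case: py => pq yq; exists [:: y, w & q]; split.
  by case: (q) lx => [/= E|//]; rewrite E eqxx in wx.
rewrite /ucycle /= rcons_path pq -lx yw xy inE negb_or yq eq_sym wy /=.
by move: uq; rewrite /= => ->.
Qed.

Lemma common_vertex (T : finType) (e : rel T) (L : nat) :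
  simple_graph e -> k_connected 2 e -> partial_three_tree e -> 2 < L ->
  (forall c, ucycle e c -> 2 < size c -> size c <= L) ->
  exists v, forall c, longest e L c -> v \in c.
Proof.
move=> [e_sym e_irr] [T2 co] [U [r [f [[[r_sym _] tree] f_inj e_r]]]] L2 Lmax.
apply: contrapT => nc.
have no_common v : exists2 c, longest e L c & v \notin c.
  apply: contrapT => h; apply: nc; exists v => c lc; apply: contraT => vc.
  by case: h; exists c.
(* The graph is copied onto the vertex set of the 3-tree, where vertices outside the image of [f]
   are isolated. The copy need not be 2-connected; only its longest cycles, which are images, and
   the facts [meet2'] and [no_common'] are carried over. *)
pose e' : rel U := [rel u w | [exists x, exists y, [&& f x == u, f y == w & e x y]]].
have e'P u w : reflect (exists x y, [/\ u = f x, w = f y & e x y]) (e' u w).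
  apply: (iffP existsP) => [[x /existsP[y /and3P[/eqP <- /eqP <- xy]]]|[x [y [-> -> xy]]]].
    by exists x, y.
  by exists x; apply/existsP; exists y; rewrite !eqxx.
have e'E x y : e' (f x) (f y) = e x y.
  by apply/e'P/idP => [[x' [y' [/f_inj-> /f_inj->]]]|xy] //; exists x, y.
have e'_sym : symmetric e'.
  by move=> u w; apply/e'P/e'P => -[x [y [-> -> xy]]]; exists y, x; rewrite e_sym.
have e'_r u w : e' u w -> r u w by case/e'P => x [y [-> -> /e_r]].
have map_c c : ucycle e' (map f c) = ucycle e c.
  rewrite /ucycle (map_inj_uniq f_inj); congr andb.
  by case: c => //= x c; rewrite -map_rcons path_map; apply: eq_path => u w; apply: e'E.
have unmap c' : ucycle e' c' -> exists c, c' = map f c.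
  case/andP=> cy _.
  have im u : u \in c' -> exists x, u = f x.
    by move=> uc; have /e'P[x [y [-> _ _]]] := next_cycle cy uc; exists x.
  elim: c' im {cy} => [|u c' IH] im; first by exists [::].
  have [|c ->] := IH; first by move=> w wc; apply: im; rewrite inE wc orbT.
  by have [x ->] := im u (mem_head _ _); exists (x :: c).
have L'max c' : ucycle e' c' -> 2 < size c' -> size c' <= L.
  by move=> uc; have [c E] := unmap c' uc; move: uc; rewrite E map_c size_map; apply: Lmax.
have lmap c : longest e L c -> longest e' L (map f c).
  by case=> uc sc; split; rewrite ?map_c ?size_map.
have lunmap c' : longest e' L c' -> exists2 c, longest e L c & c' = map f c.
  case=> uc; have [c E] := unmap c' uc; move: uc; rewrite E map_c size_map => uc sc.
  by exists c.
have conn0 (X : {set T}) : #|X| < 2 -> connected_off e X by apply: co.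
have meet2' c d : longest e' L c -> longest e' L d ->
    exists x y, [/\ x != y, x \in c, y \in c, x \in d & y \in d].
  case/lunmap=> c0 lc -> /lunmap[d0 ld ->].
  have [x [y [xy xc yc xd yd]]] := longest_meet2 e_sym conn0 L2 Lmax lc ld.
  by exists (f x), (f y); rewrite (inj_eq f_inj) !mem_map.
have [x0 _] : exists x0 : T, x0 \in T by apply/card_gt0P; exact: (@leq_ltn_trans 2 0 _ isT T2).
have no_common' u : exists2 c, longest e' L c & u \notin c.
  case: (boolP (u \in codom f)) => [/codomP[x ->]|uf].
    by have [c lc xc] := no_common x; exists (map f c); [exact: lmap|rewrite mem_map].
  have [c lc _] := no_common x0; exists (map f c); first exact: lmap.
  by apply: contra uf => /mapP[x _ ->]; apply: codom_f.
(* A longest cycle, of at least three vertices, together with a vertex that it misses. *)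
have U3 : 3 < #|[set: U]|.
  have [c [uc sc] xc] := no_common x0; rewrite cardsT.
  have : size (map f (x0 :: c)) <= size (enum U).
    apply: uniq_leq_size => [|u _]; last by rewrite mem_enum.
    by rewrite map_inj_uniq //= xc; case/andP: uc.
  by rewrite size_map /= sc -cardE; apply: leq_trans.
have peelT : peelable e' r L (enum [set: U]) by move=> x; rewrite mem_enum inE.
have [bs [v sk]] := peel e'_sym e'_r L2 L'max meet2' no_common' tree peelT U3.
by have := no_sink_bag e'_sym L2 L'max meet2' no_common' sk.
Qed.

Theorem theorem1 (T : finType) (e : rel T) :
  simple_graph e -> k_connected 2 e -> partial_three_tree e ->
  lct e = 1 /\ exists v : T, forall c : seq T, longest_cycle e c -> v \in c.
Proof.
move=> sg kc pt; have [c0 gc0] := has_cycle sg kc.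
pose P n := `[< exists2 c, graph_cycle e c & size c = n >].
have exP : exists n, P n by exists (size c0); apply/asboolP; exists c0.
have boundP n : P n -> n <= #|T|.
  by case/asboolP=> c [_ /andP[_ uc]] <-; rewrite -(card_uniqP uc) max_card.
case: (ex_maxnP exP boundP) => L /asboolP[c1 gc1 sc1] Lmax.
have L_max c : ucycle e c -> 2 < size c -> size c <= L.
  by move=> uc sc; apply: Lmax; apply/asboolP; exists c.
have lc1 : longest_cycle e c1.
  by split=> // d [sd ud]; rewrite sc1; apply: L_max.
have L2 : 2 < L by rewrite -sc1; case: gc1.
have [v Hv] := common_vertex sg kc pt L2 L_max.
have Hc c : longest_cycle e c -> v \in c.
  case=> [[sc uc] mx]; apply: Hv; split=> //; apply/eqP; rewrite eqn_leq L_max //=.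
  by rewrite -sc1 mx.
split; last by exists v.
rewrite /lct; case: arg_minnP => [|S /asboolP trS minS].
  apply/asboolP => c /Hc vc; by exists v; rewrite ?inE.
apply/eqP; rewrite eqn_leq; apply/andP; split.
  rewrite -(cards1 v); apply: minS; apply/asboolP => c /Hc vc.
  by exists v; rewrite ?inE.
(* Since a longest cycle exists, the empty set is no transversal; this gives the lower bound 1. *)
by have [x xS _] := trS c1 lc1; apply/card_gt0P; exists x.
Qed.
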